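(* Let $x$ be a badly approximable number and $W_1,W_2,\dots$ an infinite sequence of even words such that $x=[W_1W_2\cdots]$ and the set $\{W_1,W_2,\dots\}$ is finite. Take any points $x'\in\mathbb{P}^1(\mathbb{R})\setminus\{x\}$ and $z_0\in\mathbb{H}$. Then the following statements hold. (1) The limit values $\mathrm{val}(x),\widehat{\mathrm{val}}(x),\widehat{1}(x)$ and $\widehat{\varepsilon}_x$, defined from these data as in the context, are bounded. Moreover, if they converge, then they are independent of $x'$, $z_0$ and $W_1,W_2,\dots$. Further, they are $\mathrm{SL}_2(\mathbb{Z})$-invariant. (2) If $x$ is a real quadratic number, then $\mathrm{val}(x),\widehat{\mathrm{val}}(x),\widehat{1}(x)$ and $\widehat{\varepsilon}_x$ converge and coincide with the values $\mathrm{val}^{\mathrm{quad}}(x),\widehat{\mathrm{val}}^{\mathrm{quad}}(x),\widehat{1}^{\mathrm{quad}}(x),\widehat{\varepsilon}^{\,\mathrm{quad}}_x$ defined for real quadratic numbers in the context. (3) If $\widehat{\mathrm{val}}(x)$ and $\widehat{1}(x)$ converge, then for any point $x'\in\mathbb{P}^1(\mathbb{R})\setminus\{x\}$ and any sequence $\{x_n\}_{n=1}^\infty$ of real numbers with $z_n:=\gamma_{W_1\cdots W_n}(x_n+\sqrt{-1})\in S_{\infty,x}$ and $z_n\to x$, we have $$\widehat{\mathrm{val}}(x)=\lim_{n\to\infty}\frac{1}{|W_1|+\dots+|W_n|}\int_{z_0}^{z_n}j\,\eta_{x',x},\qquad \widehat{1}(x)=\lim_{n\to\infty}\frac{1}{|W_1|+\dots+|W_n|}\int_{z_0}^{z_n}\eta_{x',x},$$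 where $1/(z-\infty):=0$ if $x'=\infty$. (4) The limit $\widehat{\varepsilon}_x$ converges if and only if $\widehat{1}(x)$ converges. Moreover, $\widehat{1}(x)=2\log\widehat{\varepsilon}_x$. (5) It holds that $\widehat{\varepsilon}_x\ge(3+\sqrt5)/2$. In particular, $\widehat{1}(x)>0$. (6) If $\widehat{\mathrm{val}}(x)$ and $\widehat{1}(x)$ converge, then $\mathrm{val}(x)$ converges and $\mathrm{val}(x)=\widehat{\mathrm{val}}(x)/\widehat{1}(x)$.
   Context: Let $\mathbb{H}$ be the upper half-plane, $\mathbb{P}^1(\mathbb{R})=\mathbb{R}\cup\{\infty\}$, $j$ the elliptic modular $j$-function on $\mathbb{H}$, and $ds=y^{-1}\sqrt{dx^2+dy^2}$. $\mathrm{SL}_2(\mathbb{R})$ acts by Möbius transformations. $S_{a,b}$ denotes the hyperbolic geodesic in $\mathbb{H}$ from $a$ to $b$, for $a,b\in\mathbb{H}\cup\mathbb{P}^1(\mathbb{R})$, and $d_{\mathrm{hyp}}(z,z')=\int_{S_{z,z'}}ds$. For $x',x\in\mathbb{P}^1(\mathbb{R})$, $$\eta_{x',x}:=\Big(\frac{1}{z-x'}-\frac{1}{z-x}\Big)dz,\qquad \frac{1}{z-\infty}:=0.$$ Continued fractions: $[k_1,k_2,k_3,\dots]=k_1+\cfrac{1}{k_2+\cfrac{1}{k_3+\cdots}}$ with $k_1\in\mathbb{Z}$ and $k_2,k_3,\dots\in\mathbb{Z}_{>0}$. An irrational number is badly approximable if the coefficients of its continued fraction expansion are bounded. An even word is a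 tuple $W=(k_1,\dots,k_{2r})$ of positive integers of even length $2r\ge 0$ (here, for $x=[W_1W_2\cdots]$ with $x<1$, the first entry of $W_1$ is not positive). Put $|W|:=r$ and $\gamma_W:=\begin{pmatrix}k_1&1\\1&0\end{pmatrix}\cdots\begin{pmatrix}k_{2r}&1\\1&0\end{pmatrix}\in\mathrm{SL}_2(\mathbb{Z})$. Products of even words are concatenations, and $[W_1W_2\cdots]$ is the continued fraction whose coefficients are the entries of the concatenation; $[V\overline{W}]:=[VWWW\cdots]$. For non-empty $W$, $N(W):=\max\{n\in\mathbb{Z}_{>0}\mid W=U^n\text{ for some even word }U\}$. Limits. For $x=[W_1W_2\cdots]$ badly approximable with $\{W_1,W_2,\dots\}$ finite, let $c_n\in\mathbb{Z}_{>0}$ be the denominator of the rational number $[W_1\cdots W_n]$ and put $L:=\lim_{n\to\infty}\frac{|W_1|+\dots+|W_n|}{n}$. Define $$\mathrm{val}(x):=\lim_{z\in S_{z_0,x},\,z\to x}\frac{1}{d_{\mathrm{hyp}}(z_0,z)}\int_{S_{z_0,z}}j\,ds,\qquad \widehat{\mathrm{val}}(x):=\lim_{n\to\infty}\frac{1}{|W_1|+\dots+|W_n|}\int_{z_0}^{\gamma_{W_1\cdots W_n}z_0}j\,\eta_{x',x},$$ $$\widehat{1}(x):=\lim_{n\to\infty}\frac{1}{|W_1|+\dots+|W_n|}\int_{z_0}^{\gamma_{W_1\cdots W_n}z_0}\eta_{x',x},\qquad \widehat{\varepsilon}_x:=\lim_{n\to\infty}c_n^{1/(Ln)}.$$ ''Converges''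 means that the limit exists; that a limit value ''is bounded'' means that the quantities whose limit is taken are bounded. Real quadratic numbers. For a real quadratic number $w$ with nontrivial Galois conjugate $w'$, let $\gamma_w=\begin{pmatrix}*&*\\c&d\end{pmatrix}$ be the unique element of the stabilizer $\mathrm{SL}_2(\mathbb{Z})_w$ with $\mathrm{SL}_2(\mathbb{Z})_w=\{\pm\gamma_w^n\mid n\in\mathbb{Z}\}$ and $\varepsilon_w:=cw+d>1$. Put $\widetilde{\mathrm{val}}(w):=\int_{z_0}^{\gamma_wz_0}j\,\eta_{w',w}$ and $\widetilde{1}(w):=\int_{z_0}^{\gamma_wz_0}\eta_{w',w}=2\log\varepsilon_w$ (independent of $z_0\in\mathbb{H}$). Writing $w=[V\overline{W}]$ with even words $V$ and $W\ne\emptyset$, put $$\mathrm{val}^{\mathrm{quad}}(w):=\frac{\widetilde{\mathrm{val}}(w)}{\widetilde{1}(w)},\quad \widehat{\mathrm{val}}^{\mathrm{quad}}(w):=\frac{N(W)}{|W|}\widetilde{\mathrm{val}}(w),\quad \widehat{1}^{\mathrm{quad}}(w):=\frac{N(W)}{|W|}\widetilde{1}(w),\quad \widehat{\varepsilon}^{\,\mathrm{quad}}_w:=\varepsilon_w^{N(W)/|W|},$$ which do not depend on the choice of $W$.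
   Formalization: The limit L of (|W_1|+…+|W_n|)/n may fail to exist or be 0 (e.g. x=[1,1,1,…] cut into words (1,1) and (1,1,1,1) in doubling blocks), leaving ε̂_x undefined; the clauses on ε̂_x are therefore stated for sequences for which L exists and L>0. *)

(* Defs.v *)
From Stdlib Require Import Reals ZArith QArith Qreals List.
From Coquelicot Require Import Coquelicot.
Import ListNotations.

Open Scope R_scope.

Definition Cexp (z : C) : C := (exp (Re z) * cos (Im z), exp (Re z) * sin (Im z)).

Definition CSeries (a : nat -> C) : C :=
  (Series (fun n => Re (a n)), Series (fun n => Im (a n))).

Definition is_Clim_seq (u : nat -> C) (l : C) : Prop :=
  filterlim u eventually (locally (T := C_UniformSpace) l).

Definition Cbounded_seq (u : nat -> C) : Prop :=
  exists M : R, forall n, Cmod (u n) <= M.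

Definition upper_half (z : C) : Prop := 0 < Im z.

Definition nome (z : C) : C := Cexp (2 * PI * Ci * z)%C.

(* sum_{n>=1} n^k q^n / (1 - q^n) = sum_{n>=1} sigma_k(n) q^n *)
Definition lambert (k : nat) (q : C) : C :=
  CSeries (fun n => (RtoC (INR (S n) ^ k) * q ^ (S n) / (1 - q ^ (S n)))%C).

Definition E4 (z : C) : C := (1 + 240 * lambert 3 (nome z))%C.
Definition E6 (z : C) : C := (1 - 504 * lambert 5 (nome z))%C.

(* j = 1/q + 744 + 196884 q + ..., so that j(i) = 1728 *)
Definition jfun (z : C) : C := (1728 * E4 z ^ 3 / (E4 z ^ 3 - E6 z ^ 2))%C.

(* Path from a to b in the closed upper half-plane (a and b finite).  On a
   half-circle centred on the real axis, x^2 + y^2 is an affine function of x;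
   hence interpolating both x and x^2 + y^2 affinely in t parametrizes the
   geodesic, vertical lines included.  Solving for y gives
     y^2 = (1-t) (Im a)^2 + t (Im b)^2 + t (1-t) (Re a - Re b)^2. *)
Definition geod_path (a b : C) (t : R) : C :=
  ((1 - t) * Re a + t * Re b,
   sqrt ((1 - t) * Im a ^ 2 + t * Im b ^ 2 + t * (1 - t) * (Re a - Re b) ^ 2)).

(* S_{a,b} as a subset of the open upper half-plane; an endpoint lies in the
   upper half-plane, or in R (as a complex number), or is infinity (None). *)
Definition geodesic (a b : option C) (z : C) : Prop :=
  upper_half z /\
  match a, b with
  | Some a, Some b => exists t : R, 0 <= t <= 1 /\ z = geod_path a b t
  | Some c, None | None, Some c => Re z = Re c /\ Im c <= Im z
  | None, None => False
  end.

(* ds along a path p, i.e. |p'(t)| / Im p(t) *)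
Definition hyp_speed (p : R -> C) (t : R) : R :=
  sqrt (Derive (fun s => Re (p s)) t ^ 2 + Derive (fun s => Im (p s)) t ^ 2)
  / Im (p t).

Definition ds_integral (f : C -> C) (a b : C) : C :=
  RInt (V := C_R_CompleteNormedModule)
    (fun t => (f (geod_path a b t) * RtoC (hyp_speed (geod_path a b) t))%C) 0 1.

Definition d_hyp (a b : C) : R := RInt (hyp_speed (geod_path a b)) 0 1.

(* Integral of f(z) dz along the straight segment from a to b.  It is only used
   for f holomorphic on the upper half-plane, which is convex: the segment stays
   there, and any other path would give the same value. *)
Definition path_integral (f : C -> C) (a b : C) : C :=
  RInt (V := C_R_CompleteNormedModule)
    (fun t => (f (a + RtoC t * (b - a)) * (b - a))%C) 0 1.

(* None is infinity. *)
Definition P1R : Type := option R.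

Definition simple_pole (p : P1R) (z : C) : C :=
  match p with
  | Some r => (/ (z - RtoC r))%C
  | None => 0
  end.

Definition eta (x' x : P1R) (z : C) : C := (simple_pole x' z - simple_pole x z)%C.

Definition j_eta (x' x : P1R) (z : C) : C := (jfun z * eta x' x z)%C.

Record mat2 : Set := Mat2 { m11 : Z; m12 : Z; m21 : Z; m22 : Z }.

Definition mat_one : mat2 := Mat2 1 0 0 1.

Definition mat_mul (A B : mat2) : mat2 :=
  Mat2 (m11 A * m11 B + m12 A * m21 B) (m11 A * m12 B + m12 A * m22 B)
       (m21 A * m11 B + m22 A * m21 B) (m21 A * m12 B + m22 A * m22 B).

Definition mat_opp (A : mat2) : mat2 :=
  Mat2 (- m11 A) (- m12 A) (- m21 A) (- m22 A).

Definition mat_adj (A : mat2) : mat2 :=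
  Mat2 (m22 A) (- m12 A) (- m21 A) (m11 A).

Definition SL2Z (A : mat2) : Prop := (m11 A * m22 A - m12 A * m21 A = 1)%Z.

(* Integer powers of a matrix of determinant 1, whose inverse is its adjugate. *)
Definition mat_pow (A : mat2) (n : Z) : mat2 :=
  match n with
  | Z0 => mat_one
  | Zpos p => Pos.iter (mat_mul A) mat_one p
  | Zneg p => Pos.iter (mat_mul (mat_adj A)) mat_one p
  end.

Definition moebius (A : mat2) (z : C) : C :=
  ((RtoC (IZR (m11 A)) * z + RtoC (IZR (m12 A)))
   / (RtoC (IZR (m21 A)) * z + RtoC (IZR (m22 A))))%C.

(* Action on the reals; only used at irrational numbers, where the denominator
   does not vanish. *)
Definition moebiusR (A : mat2) (x : R) : R :=
  (IZR (m11 A) * x + IZR (m12 A)) / (IZR (m21 A) * x + IZR (m22 A)).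

(* [k_1, ..., k_m]; since / 0 = 0 in Q, the last step k + / 0 is k. *)
Fixpoint cfQ (l : list Z) : Q :=
  match l with
  | [] => 0%Q
  | k :: l' => (inject_Z k + / cfQ l')%Q
  end.

(* Denominator in lowest terms. *)
Definition cf_den (l : list Z) : positive := Qden (Qred (cfQ l)).

(* x = [k 0, k 1, ...] *)
Definition is_cf (k : nat -> Z) (x : R) : Prop :=
  (forall n, (1 <= n)%nat -> (0 < k n)%Z) /\
  is_lim_seq (fun n => Q2R (cfQ (map k (seq 0 n)))) x.

Definition irrational (x : R) : Prop :=
  forall p q : Z, q <> 0%Z -> x <> IZR p / IZR q.

Definition badly_approximable (x : R) : Prop :=
  irrational x /\
  exists k : nat -> Z,
    is_cf k x /\ exists M : Z, forall n, (Z.abs (k n) <= M)%Z.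

(* Positivity of the entries (apart from the very first entry of the
   concatenation) is not recorded here: it is imposed by is_cf through
   is_word_expansion. *)
Definition word : Type := list Z.

Definition even_word (W : word) : Prop := Nat.Even (length W).

(* |W|, half the length *)
Definition wnorm (W : word) : nat := Nat.div2 (length W).

Definition gamma (W : word) : mat2 :=
  fold_right (fun k A => mat_mul (Mat2 k 1 1 0) A) mat_one W.

Definition wpow (U : word) (n : nat) : word := concat (repeat U n).

(* W_1 W_2 ... W_n, where W_i is stored as W (i - 1) *)
Definition wprefix (W : nat -> word) (n : nat) : word :=
  concat (map W (seq 0 n)).

(* k is the infinite concatenation of W 0, W 1, ... *)
Definition is_concat (W : nat -> word) (k : nat -> Z) : Prop :=
  (forall n, wprefix W n = map k (seq 0 (length (wprefix W n)))) /\
  (forall m : nat, exists n, (m <= length (wprefix W n))%nat).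

(* x = [W_1 W_2 ...] *)
Definition is_word_expansion (x : R) (W : nat -> word) : Prop :=
  (forall n, even_word (W n)) /\
  exists k : nat -> Z, is_concat W k /\ is_cf k x.

Definition finitely_many_words (W : nat -> word) : Prop :=
  exists ws : list word, forall n, In (W n) ws.

(* |W_1| + ... + |W_n| *)
Definition total_norm (W : nat -> word) (n : nat) : R :=
  INR (wnorm (wprefix W n)).

Definition gamma_prefix (W : nat -> word) (n : nat) : mat2 :=
  gamma (wprefix W n).

Definition mean_norm (W : nat -> word) (L : R) : Prop :=
  is_lim_seq (fun n => total_norm W n / INR n) L.

Definition val_fun (z0 z : C) : C :=
  (ds_integral jfun z0 z / RtoC (d_hyp z0 z))%C.

Definition val_lim (x : R) (z0 v : C) : Prop :=
  filterlim (val_fun z0)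
    (within (geodesic (Some z0) (Some (RtoC x)))
            (locally (T := C_UniformSpace) (RtoC x)))
    (locally (T := C_UniformSpace) v).

Definition val_bounded (x : R) (z0 : C) : Prop :=
  exists M : R, forall z,
    geodesic (Some z0) (Some (RtoC x)) z -> Cmod (val_fun z0 z) <= M.

Definition hval_seq (x : R) (W : nat -> word) (x' : P1R) (z0 : C) (n : nat) : C :=
  (path_integral (j_eta x' (Some x)) z0 (moebius (gamma_prefix W n) z0)
   / RtoC (total_norm W n))%C.

Definition hone_seq (x : R) (W : nat -> word) (x' : P1R) (z0 : C) (n : nat) : C :=
  (path_integral (eta x' (Some x)) z0 (moebius (gamma_prefix W n) z0)
   / RtoC (total_norm W n))%C.

Definition hval_lim x W x' z0 (v : C) : Prop := is_Clim_seq (hval_seq x W x' z0) v.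
Definition hone_lim x W x' z0 (v : C) : Prop := is_Clim_seq (hone_seq x W x' z0) v.

(* c_n^{1/(L n)}; L is meant to satisfy mean_norm W L and 0 < L *)
Definition heps_seq (W : nat -> word) (L : R) (n : nat) : R :=
  Rpower (IZR (Zpos (cf_den (wprefix W n)))) (1 / (L * INR n)).

Definition heps_lim (W : nat -> word) (L e : R) : Prop :=
  is_lim_seq (heps_seq W L) e.

Definition quad_root (a b c : Z) (w : R) : Prop :=
  IZR a * w ^ 2 + IZR b * w + IZR c = 0.

Definition real_quadratic (w : R) : Prop :=
  irrational w /\ exists a b c : Z, a <> 0%Z /\ quad_root a b c w.

Definition galois_conjugate (w w' : R) : Prop :=
  w' <> w /\
  exists a b c : Z, a <> 0%Z /\ quad_root a b c w /\ quad_root a b c w'.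

(* epsilon_w, for A = gamma_w *)
Definition eps_of (A : mat2) (w : R) : R := IZR (m21 A) * w + IZR (m22 A).

(* A = gamma_w *)
Definition is_stab_generator (w : R) (A : mat2) : Prop :=
  (forall B : mat2,
     (SL2Z B /\ moebiusR B w = w) <->
     exists n : Z, B = mat_pow A n \/ B = mat_opp (mat_pow A n)) /\
  SL2Z A /\ 1 < eps_of A w.

Definition tval (w w' : R) (A : mat2) (z : C) : C :=
  path_integral (j_eta (Some w') (Some w)) z (moebius A z).

Definition tone (w w' : R) (A : mat2) (z : C) : C :=
  path_integral (eta (Some w') (Some w)) z (moebius A z).

(* V W W W ... *)
Definition periodic_words (V W : word) (n : nat) : word :=
  match n with O => V | S _ => W end.

(* N = N(W) *)
Definition is_exponent (W : word) (N : nat) : Prop :=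
  let is_power n := (0 < n)%nat /\ exists U, even_word U /\ W = wpow U n in
  is_power N /\ forall n, is_power n -> (n <= N)%nat.

Definition quad_expansion (w : R) (V W : word) : Prop :=
  W <> [] /\ is_word_expansion w (periodic_words V W).

Definition is_val_quad (w : R) (v : C) : Prop :=
  exists (w' : R) (A : mat2) (z : C),
    galois_conjugate w w' /\ is_stab_generator w A /\ upper_half z /\
    v = (tval w w' A z / tone w w' A z)%C.

Definition is_hval_quad (w : R) (v : C) : Prop :=
  exists (w' : R) (A : mat2) (z : C) (V W : word) (N : nat),
    galois_conjugate w w' /\ is_stab_generator w A /\ upper_half z /\
    quad_expansion w V W /\ is_exponent W N /\
    v = (RtoC (INR N / INR (wnorm W)) * tval w w' A z)%C.

Definition is_hone_quad (w : R) (v : C) : Prop :=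
  exists (w' : R) (A : mat2) (z : C) (V W : word) (N : nat),
    galois_conjugate w w' /\ is_stab_generator w A /\ upper_half z /\
    quad_expansion w V W /\ is_exponent W N /\
    v = (RtoC (INR N / INR (wnorm W)) * tone w w' A z)%C.

Definition is_heps_quad (w e : R) : Prop :=
  exists (A : mat2) (V W : word) (N : nat),
    is_stab_generator w A /\ quad_expansion w V W /\ is_exponent W N /\
    e = Rpower (eps_of A w) (INR N / INR (wnorm W)).

(* Main.v *)
(** For a function [g] on the upper half-plane that is holomorphic and invariant under SL2(Z) (here [g = j] or
    [g = 1]), every integral in the theorem is compared, up to a bounded error, with the integral of
    [- g(z) dz / (z - x)] down the vertical line from [x + i] to [x + i/D^2], where [D = D_n = c xi_n + d] is the
    product of the first [n] complete quotients of [x] and [xi_n] the [n]-th one.  The reason is that [x] is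
    badly approximable: a point of a cone at [x] of height about [D_n^-2] is the image under the convergent
    matrix of a point of a fixed compact set.  Hence [g] is bounded on cones at [x], and changing [x'], the
    path or the end point within a bounded hyperbolic distance costs [O(1)].  Writing [a_g(n)] for these vertical
    integrals, [a_1(n) = 2 log D_n], and the existence and the values of all limits depend only on whether
    [a_g(n) / n] converges: val is the limit of [a_j / a_1], and [D_n] and the denominator [c_n] differ by a bounded
    factor.  An element of SL2(Z) changes [a_g] by a shift of the index and [O(1)], and [D_n] is bounded below by
    a constant times a power of the golden ratio.

    For a quadratic [x], Lagrange's theorem gives an even period, and the integral over one period of
    [j eta_{x',x}], with [x'] the conjugate, is exactly additive.  The stabilizer of a purely periodic [xi] is
    generated by the matrix of its least even period: a stabilizing matrix with [c xi + d > 1] has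
    [a > c >= d >= 1] since [xi > 1] and its conjugate lies in [(-1, 0)], so the Euclidean algorithm writes it as a
    product of matrices [(k 1; 1 0)], and by uniqueness of continued fractions these [k] form a period.

    The invariance of [j] is obtained from the Lipschitz formula
    [sum_n (z + n)^-k = const * A(e^(2 pi i z))], where the rational function [A] satisfies the duplication formula
    [A(v) + A(-v) = 2^k A(v^2)]: iterating it writes [A] as a finite sum over [2^N]-th roots and the limit
    [N -> oo] is taken termwise.  The discriminant does not vanish because it is invariant, every orbit meets
    [(Im z)^2 >= 3/4], and there [Delta] is dominated by its first [q]-coefficient. *)

Require Import Defs.
From Stdlib Require Import QArith Qreals Qcanon Znumtheory.
From Stdlib Require Import Reals ZArith List Lra Lia Psatz Classical.
From Coquelicot Require Import Coquelicot.
Import ListNotations.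
Open Scope R_scope.

(** * Complex differentiability and path integrals *)

(** Everything rests on path independence, which is obtained from a primitive instead of Cauchy's
    theorem: the half-plane is convex, so the integral over segments starting at [Ci] can be
    differentiated under the integral sign. This is why [holo] asks for a continuous derivative. Arc
    length fits into the same framework because on the geodesic from [x'] to [x] the form [eta x' x]
    restricts exactly to [ds]; the integral of [g ds] from [z0] towards [x] is therefore a path
    integral of [ge g x' x], with [x'] the other end of that geodesic. Only the convergent matrices
    of even index have determinant 1 and act on the half-plane, so renormalization uses the indices
    [2 * r]; the remaining indices are reached because consecutive values of [aseq] differ by a
    bounded amount. The index of [aseq] counts single partial quotients whereas [|W|] counts pairs,
    which produces the factor 1/2 in the characterizations of the limits. *)

Definition Ccont (f : C -> C) (z : C) : Prop :=
  forall eps, 0 < eps -> exists d, 0 < d /\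
    forall w, Cmod (w - z)%C < d -> Cmod (f w - f z)%C < eps.

Lemma Ccont_const (c z : C) : Ccont (fun _ => c) z.
Proof.
  intros eps He; exists 1; split; [lra|]; intros w _.
  replace (c - c)%C with (RtoC 0) by ring. rewrite Cmod_0; lra.
Qed.

Lemma Ccont_id (z : C) : Ccont (fun w => w) z.
Proof. intros eps He; exists eps; split; auto. Qed.

Lemma Ccont_plus f g z : Ccont f z -> Ccont g z -> Ccont (fun w => (f w + g w)%C) z.
Proof.
  intros Hf Hg eps He.
  destruct (Hf (eps/2)) as [d [Hd H1]]; [lra|].
  destruct (Hg (eps/2)) as [d' [Hd' H2]]; [lra|].
  exists (Rmin d d'); split; [apply Rmin_pos; auto|]; intros w Hw.
  specialize (H1 w (Rlt_le_trans _ _ _ Hw (Rmin_l _ _))).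
  specialize (H2 w (Rlt_le_trans _ _ _ Hw (Rmin_r _ _))).
  replace (f w + g w - (f z + g z))%C with ((f w - f z) + (g w - g z))%C by ring.
  eapply Rle_lt_trans; [apply Cmod_triangle|]; lra.
Qed.

Lemma Ccont_mult f g z : Ccont f z -> Ccont g z -> Ccont (fun w => (f w * g w)%C) z.
Proof.
  intros Hf Hg eps He.
  set (A := Cmod (f z)); set (B := Cmod (g z)).
  assert (HA : 0 <= A) by apply Cmod_ge_0.
  assert (HB : 0 <= B) by apply Cmod_ge_0.
  set (e := Rmin 1 (eps / (A + B + 1 + 1))).
  assert (He' : 0 < e) by (apply Rmin_pos; [lra| apply Rdiv_lt_0_compat; lra]).
  assert (e1 : e <= 1) by apply Rmin_l.
  assert (e2 : e * (A + B + 1 + 1) <= eps).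
  { apply Rle_trans with (eps / (A+B+1+1) * (A + B + 1 + 1)).
    - apply Rmult_le_compat_r; [lra|apply Rmin_r].
    - right; field; lra. }
  destruct (Hf e He') as [d [Hd H1]].
  destruct (Hg e He') as [d' [Hd' H2]].
  exists (Rmin d d'); split; [apply Rmin_pos; auto|]; intros w Hw.
  specialize (H1 w (Rlt_le_trans _ _ _ Hw (Rmin_l _ _))).
  specialize (H2 w (Rlt_le_trans _ _ _ Hw (Rmin_r _ _))).
  replace (f w * g w - f z * g z)%C with
    ((f w - f z) * (g w - g z) + (f w - f z) * g z + f z * (g w - g z))%C by ring.
  eapply Rle_lt_trans; [apply Cmod_triangle|].
  eapply Rle_lt_trans; [apply Rplus_le_compat_r, Cmod_triangle|].
  rewrite !Cmod_mult. fold A B.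
  set (u := Cmod (f w - f z)) in *. set (v := Cmod (g w - g z)) in *.
  assert (0 <= u) by apply Cmod_ge_0.
  assert (0 <= v) by apply Cmod_ge_0.
  assert (u * v <= e) by nra. nra.
Qed.

Lemma Ccont_opp f z : Ccont f z -> Ccont (fun w => (- f w)%C) z.
Proof.
  intros Hf eps He; destruct (Hf eps He) as [d [Hd H]]; exists d; split; auto.
  intros w Hw; specialize (H w Hw).
  replace (- f w - - f z)%C with (- (f w - f z))%C by ring. now rewrite Cmod_opp.
Qed.

Lemma Ccont_comp f g z : Ccont g z -> Ccont f (g z) -> Ccont (fun w => f (g w)) z.
Proof.
  intros Hg Hf eps He. destruct (Hf eps He) as [d [Hd H]].
  destruct (Hg d Hd) as [d' [Hd' H']]. exists d'; split; auto.
Qed.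

Lemma Ccont_nonzero f z : Ccont f z -> f z <> 0 ->
  exists d, 0 < d /\ forall w, Cmod (w - z)%C < d -> Cmod (f z) / 2 <= Cmod (f w).
Proof.
  intros Hf Hz. apply Cmod_gt_0 in Hz.
  destruct (Hf (Cmod (f z) / 2)) as [d [Hd H]]; [lra|].
  exists d; split; auto. intros w Hw; specialize (H w Hw).
  assert (Cmod (f z) <= Cmod (f w) + Cmod (f w - f z)); [|lra].
  replace (f z) with (f w + - (f w - f z))%C at 1 by ring.
  eapply Rle_trans; [apply Cmod_triangle|]. rewrite Cmod_opp; lra.
Qed.

Lemma Cmod_pos_neq z : 0 < Cmod z -> z <> 0.
Proof. intros H E; rewrite E, Cmod_0 in H; lra. Qed.

Lemma Ccont_inv f z : Ccont f z -> f z <> 0 -> Ccont (fun w => (/ f w)%C) z.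
Proof.
  intros Hf Hz eps He.
  destruct (Ccont_nonzero f z Hf Hz) as [d [Hd H]].
  pose proof (proj1 (Cmod_gt_0 _) Hz) as Hm. set (m := Cmod (f z)) in *.
  destruct (Hf (eps * (m * m) / 2)) as [d' [Hd' H']].
  { apply Rdiv_lt_0_compat; [|lra]. apply Rmult_lt_0_compat; nra. }
  exists (Rmin d d'); split; [apply Rmin_pos; auto|]; intros w Hw.
  specialize (H w (Rlt_le_trans _ _ _ Hw (Rmin_l _ _))).
  specialize (H' w (Rlt_le_trans _ _ _ Hw (Rmin_r _ _))).
  assert (Hw0 : f w <> 0) by (apply Cmod_pos_neq; lra).
  replace (/ f w - / f z)%C with (- (f w - f z) / (f w * f z))%C by (field; auto).
  rewrite Cmod_div by (apply Cmult_neq_0; auto).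
  rewrite Cmod_opp, Cmod_mult. fold m.
  apply Rmult_lt_reg_r with (Cmod (f w) * m); [nra|].
  unfold Rdiv; rewrite Rmult_assoc, Rinv_l by nra.
  rewrite Rmult_1_r. eapply Rlt_le_trans; [exact H'|].
  assert (m * m / 2 <= Cmod (f w) * m) by nra. nra.
Qed.

Lemma Ccont_pow f z n : Ccont f z -> Ccont (fun w => (f w ^ n)%C) z.
Proof.
  intros Hf; induction n as [|n IH]; simpl.
  - apply Ccont_const.
  - now apply (Ccont_mult f (fun w => (f w ^ n)%C)).
Qed.

(** Differentiability in Caratheodory's form, [l] being the derivative. *)
Definition Cdiff (f : C -> C) (z l : C) : Prop :=
  exists phi, Ccont phi z /\ phi z = l /\
    exists d, 0 < d /\ forall w, Cmod (w - z)%C < d -> (f w - f z = phi w * (w - z))%C.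

Lemma Ccont_ext_loc f g z d : 0 < d -> (forall w, Cmod (w - z)%C < d -> f w = g w) ->
  Ccont f z -> Ccont g z.
Proof.
  intros Hd E Hf eps He. destruct (Hf eps He) as [d' [Hd' H']].
  exists (Rmin d d'); split; [apply Rmin_pos; auto|]; intros w Hw.
  rewrite <- (E z).
  2: { replace (z - z)%C with (RtoC 0) by ring. now rewrite Cmod_0. }
  rewrite <- E.
  - apply H', (Rlt_le_trans _ _ _ Hw (Rmin_r _ _)).
  - apply (Rlt_le_trans _ _ _ Hw (Rmin_l _ _)).
Qed.

Lemma Cdiff_cont f z l : Cdiff f z l -> Ccont f z.
Proof.
  intros (phi & Hc & _ & d & Hd & E).
  apply Ccont_ext_loc with (fun w => (f z + phi w * (w - z))%C) d; auto.
  - intros w Hw. rewrite <- E by auto. ring.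
  - apply Ccont_plus; [apply Ccont_const|]. apply Ccont_mult; auto.
    apply (Ccont_plus (fun w => w) (fun _ => (- z)%C)); [apply Ccont_id|apply Ccont_const].
Qed.

Lemma Cdiff_const c z : Cdiff (fun _ => c) z 0.
Proof.
  exists (fun _ => RtoC 0); repeat split; [apply Ccont_const|]. exists 1; split; [lra|].
  intros; ring.
Qed.

Lemma Cdiff_id z : Cdiff (fun w => w) z 1.
Proof.
  exists (fun _ => RtoC 1); repeat split; [apply Ccont_const|]. exists 1; split; [lra|].
  intros; ring.
Qed.

Lemma Cdiff_plus f g z l m : Cdiff f z l -> Cdiff g z m ->
  Cdiff (fun w => (f w + g w)%C) z (l + m).
Proof.
  intros (p & Hp & <- & d & Hd & E) (q & Hq & <- & d' & Hd' & E').
  exists (fun w => (p w + q w)%C); repeat split; [now apply Ccont_plus|].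
  exists (Rmin d d'); split; [apply Rmin_pos; auto|]; intros w Hw.
  rewrite Cmult_plus_distr_r, <- E, <- E'; [ring| |].
  - apply (Rlt_le_trans _ _ _ Hw (Rmin_r _ _)).
  - apply (Rlt_le_trans _ _ _ Hw (Rmin_l _ _)).
Qed.

Lemma Cdiff_mult f g z l m : Cdiff f z l -> Cdiff g z m ->
  Cdiff (fun w => (f w * g w)%C) z (l * g z + f z * m).
Proof.
  intros Hf Hg. pose proof (Cdiff_cont _ _ _ Hg) as Cg. revert Hf Hg.
  intros (p & Hp & <- & d & Hd & E) (q & Hq & <- & d' & Hd' & E').
  exists (fun w => (p w * g w + f z * q w)%C); repeat split.
  - apply Ccont_plus; apply Ccont_mult; auto. apply Ccont_const.
  - exists (Rmin d d'); split; [apply Rmin_pos; auto|]; intros w Hw.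
    transitivity ((f w - f z) * g w + f z * (g w - g z))%C; [ring|].
    rewrite E, E'; [ring| |].
    + apply (Rlt_le_trans _ _ _ Hw (Rmin_r _ _)).
    + apply (Rlt_le_trans _ _ _ Hw (Rmin_l _ _)).
Qed.

Lemma Cdiff_inv f z l : Cdiff f z l -> f z <> 0 ->
  Cdiff (fun w => (/ f w)%C) z (- l / (f z * f z)).
Proof.
  intros Hf Hz. pose proof (Cdiff_cont _ _ _ Hf) as Cf. revert Hf.
  intros (p & Hp & <- & d & Hd & E).
  destruct (Ccont_nonzero f z Cf Hz) as [d' [Hd' H']].
  exists (fun w => (- p w * / (f w * f z))%C); repeat split.
  - apply Ccont_mult; [now apply Ccont_opp|].
    apply Ccont_inv; [|now apply Cmult_neq_0].
    apply Ccont_mult; auto. apply Ccont_const.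
  - exists (Rmin d d'); split; [apply Rmin_pos; auto|]; intros w Hw.
    specialize (H' w (Rlt_le_trans _ _ _ Hw (Rmin_r _ _))).
    specialize (E w (Rlt_le_trans _ _ _ Hw (Rmin_l _ _))).
    pose proof (proj1 (Cmod_gt_0 _) Hz) as Hm.
    assert (Hw0 : f w <> 0) by (apply Cmod_pos_neq; lra).
    transitivity (- (f w - f z) / (f w * f z))%C; [now field|].
    rewrite E. now field.
Qed.

Lemma Cdiff_comp f g z l m : Cdiff g z m -> Cdiff f (g z) l ->
  Cdiff (fun w => f (g w)) z (l * m).
Proof.
  intros Hg. pose proof (Cdiff_cont _ _ _ Hg) as Cg. revert Hg.
  intros (q & Hq & <- & d' & Hd' & E') (p & Hp & <- & d & Hd & E).
  destruct (Cg d Hd) as [d2 [Hd2 H2]].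
  exists (fun w => (p (g w) * q w)%C); repeat split.
  - apply Ccont_mult; auto. now apply Ccont_comp.
  - exists (Rmin d2 d'); split; [apply Rmin_pos; auto|]; intros w Hw.
    rewrite E, E'; [ring| |].
    + apply (Rlt_le_trans _ _ _ Hw (Rmin_r _ _)).
    + apply H2, (Rlt_le_trans _ _ _ Hw (Rmin_l _ _)).
Qed.

Lemma Cdiff_ext_loc f g z l d : 0 < d -> (forall w, Cmod (w - z)%C < d -> f w = g w) ->
  Cdiff f z l -> Cdiff g z l.
Proof.
  intros Hd E (p & Hp & <- & d' & Hd' & E').
  exists p; repeat split; auto.
  exists (Rmin d d'); split; [apply Rmin_pos; auto|]; intros w Hw.
  rewrite <- (E z).
  2: { replace (z - z)%C with (RtoC 0) by ring. now rewrite Cmod_0. }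
  rewrite <- E, E'; auto.
  - apply (Rlt_le_trans _ _ _ Hw (Rmin_r _ _)).
  - apply (Rlt_le_trans _ _ _ Hw (Rmin_l _ _)).
Qed.

(** * Differentiable paths in the complex plane *)

Definition Rcont (p : R -> C) (t : R) : Prop :=
  forall eps, 0 < eps -> exists d, 0 < d /\
    forall s, Rabs (s - t) < d -> Cmod (p s - p t)%C < eps.

Definition Pdiff (p : R -> C) (t : R) (v : C) : Prop :=
  exists phi, Rcont phi t /\ phi t = v /\
    exists d, 0 < d /\
      forall s, Rabs (s - t) < d -> (p s - p t = phi s * RtoC (s - t))%C.

Lemma Rcont_const c t : Rcont (fun _ => c) t.
Proof.
  intros eps He; exists 1; split; [lra|]; intros w _.
  replace (c - c)%C with (RtoC 0) by ring. rewrite Cmod_0; lra.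
Qed.

Lemma Rcont_comp f p t : Rcont p t -> Ccont f (p t) -> Rcont (fun s => f (p s)) t.
Proof.
  intros Hg Hf eps He. destruct (Hf eps He) as [d [Hd H]].
  destruct (Hg d Hd) as [d' [Hd' H']]. exists d'; split; auto.
Qed.

Lemma Rcont_bi (k : C -> C -> C) p q t :
  (forall eps, 0 < eps -> exists d, 0 < d /\ forall u v, Cmod (u - p t)%C < d ->
     Cmod (v - q t)%C < d -> Cmod (k u v - k (p t) (q t))%C < eps) ->
  Rcont p t -> Rcont q t -> Rcont (fun s => k (p s) (q s)) t.
Proof.
  intros Hk Hp Hq eps He. destruct (Hk eps He) as [d [Hd H]].
  destruct (Hp d Hd) as [d1 [Hd1 H1]]. destruct (Hq d Hd) as [d2 [Hd2 H2]].
  exists (Rmin d1 d2); split; [apply Rmin_pos; auto|]; intros s Hs.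
  apply H; [apply H1, (Rlt_le_trans _ _ _ Hs (Rmin_l _ _))
           |apply H2, (Rlt_le_trans _ _ _ Hs (Rmin_r _ _))].
Qed.

Lemma Rcont_plus p q t : Rcont p t -> Rcont q t -> Rcont (fun s => (p s + q s)%C) t.
Proof.
  apply (Rcont_bi Cplus). intros eps He. exists (eps/2); split; [lra|]; intros u v Hu Hv.
  replace (u + v - (p t + q t))%C with ((u - p t) + (v - q t))%C by ring.
  eapply Rle_lt_trans; [apply Cmod_triangle|]; lra.
Qed.

Lemma Rcont_mult p q t : Rcont p t -> Rcont q t -> Rcont (fun s => (p s * q s)%C) t.
Proof.
  apply (Rcont_bi Cmult). intros eps He.
  set (A := Cmod (p t)); set (B := Cmod (q t)).
  assert (HA : 0 <= A) by apply Cmod_ge_0.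
  assert (HB : 0 <= B) by apply Cmod_ge_0.
  set (e := Rmin 1 (eps / (A + B + 1 + 1))).
  assert (He' : 0 < e) by (apply Rmin_pos; [lra| apply Rdiv_lt_0_compat; lra]).
  assert (e1 : e <= 1) by apply Rmin_l.
  assert (e2 : e * (A + B + 1 + 1) <= eps).
  { apply Rle_trans with (eps / (A+B+1+1) * (A + B + 1 + 1)).
    - apply Rmult_le_compat_r; [lra|apply Rmin_r].
    - right; field; lra. }
  exists e; split; auto; intros u v Hu Hv.
  replace (u * v - p t * q t)%C with
    ((u - p t) * (v - q t) + (u - p t) * q t + p t * (v - q t))%C by ring.
  eapply Rle_lt_trans; [apply Cmod_triangle|].
  eapply Rle_lt_trans; [apply Rplus_le_compat_r, Cmod_triangle|].
  rewrite !Cmod_mult. fold A B.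
  set (x := Cmod (u - p t)) in *. set (y := Cmod (v - q t)) in *.
  assert (0 <= x) by apply Cmod_ge_0.
  assert (0 <= y) by apply Cmod_ge_0.
  assert (x * y <= e) by nra. nra.
Qed.

Lemma Pdiff_cont p t v : Pdiff p t v -> Rcont p t.
Proof.
  intros (phi & Hc & _ & d & Hd & E) eps He.
  assert (H : Rcont (fun s => (p t + phi s * RtoC (s - t))%C) t).
  { apply Rcont_plus; [apply Rcont_const|]. apply Rcont_mult; auto.
    intros e H; exists e; split; auto. intros s Hs.
    rewrite <- RtoC_minus, Cmod_R. now replace (s - t - (t - t)) with (s - t) by ring. }
  destruct (H eps He) as [d' [Hd' H']].
  exists (Rmin d d'); split; [apply Rmin_pos; auto|]; intros s Hs.
  specialize (H' s (Rlt_le_trans _ _ _ Hs (Rmin_r _ _))). cbv beta in H'.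
  rewrite <- (E s) in H' by apply (Rlt_le_trans _ _ _ Hs (Rmin_l _ _)).
  replace (p t + (p s - p t) - (p t + phi t * RtoC (t - t)))%C with (p s - p t)%C in H'; auto.
  replace (t - t) with 0 by ring. ring.
Qed.

Lemma Pdiff_comp F p t v l : Pdiff p t v -> Cdiff F (p t) l ->
  Pdiff (fun s => F (p s)) t (l * v).
Proof.
  intros Hp. pose proof (Pdiff_cont _ _ _ Hp) as Cp. revert Hp.
  intros (q & Hq & <- & d' & Hd' & E') (f & Hf & <- & d & Hd & E).
  destruct (Cp d Hd) as [d2 [Hd2 H2]].
  exists (fun w => (f (p w) * q w)%C); repeat split.
  - apply Rcont_mult; auto. now apply Rcont_comp.
  - exists (Rmin d2 d'); split; [apply Rmin_pos; auto|]; intros w Hw.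
    rewrite E, E'; [ring| |].
    + apply (Rlt_le_trans _ _ _ Hw (Rmin_r _ _)).
    + apply H2, (Rlt_le_trans _ _ _ Hw (Rmin_l _ _)).
Qed.

Lemma Pdiff_mult p q t v w : Pdiff p t v -> Pdiff q t w ->
  Pdiff (fun s => (p s * q s)%C) t (v * q t + p t * w).
Proof.
  intros Hf Hg. pose proof (Pdiff_cont _ _ _ Hg) as Cg. revert Hf Hg.
  intros (f & Hp & <- & d & Hd & E) (g & Hq & <- & d' & Hd' & E').
  exists (fun s => (f s * q s + p t * g s)%C); repeat split.
  - apply Rcont_plus; apply Rcont_mult; auto. apply Rcont_const.
  - exists (Rmin d d'); split; [apply Rmin_pos; auto|]; intros s Hs.
    transitivity ((p s - p t) * q s + p t * (q s - q t))%C; [ring|].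
    rewrite E, E'; [ring| |].
    + apply (Rlt_le_trans _ _ _ Hs (Rmin_r _ _)).
    + apply (Rlt_le_trans _ _ _ Hs (Rmin_l _ _)).
Qed.

Lemma Pdiff_affine a b t : Pdiff (fun s => (a + RtoC s * b)%C) t b.
Proof.
  exists (fun _ => b); repeat split; [apply Rcont_const|]. exists 1; split; [lra|].
  intros s _. rewrite RtoC_minus. ring.
Qed.

Lemma Pdiff_RtoC t : Pdiff RtoC t 1.
Proof.
  exists (fun _ => RtoC 1); repeat split; [apply Rcont_const|]. exists 1; split; [lra|].
  intros s _. rewrite RtoC_minus. ring.
Qed.

Lemma Cmod_le_abs z : Cmod z <= Rabs (Re z) + Rabs (Im z).
Proof.
  destruct z as [x y]; unfold Cmod; simpl fst; simpl snd; simpl Re; simpl Im.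
  apply Rsqr_incr_0_var; [|apply Rplus_le_le_0_compat; apply Rabs_pos].
  rewrite Rsqr_sqrt by nra. unfold Rsqr.
  pose proof (Rabs_pos x); pose proof (Rabs_pos y).
  assert (x^2 = Rabs x * Rabs x) by (rewrite <- Rabs_mult, Rabs_right; nra).
  assert (y^2 = Rabs y * Rabs y) by (rewrite <- Rabs_mult, Rabs_right; nra).
  nra.
Qed.

Lemma im_le_Cmod z : Rabs (Im z) <= Cmod z.
Proof. eapply Rle_trans; [apply Rmax_r|apply Rmax_Cmod]. Qed.

(** With [Pdiff_elim] it translates between the Caratheodory form, convenient for products and
    compositions, and real derivatives of the coordinates, on which [auto_derive] and real
    integration operate. *)
Lemma Pdiff_intro p t v :
  is_derive (fun s => Re (p s)) t (Re v) -> is_derive (fun s => Im (p s)) t (Im v) ->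
  Pdiff p t v.
Proof.
  intros H1 H2. apply is_derive_Reals in H1, H2.
  exists (fun s => if Req_dec_T s t then v else ((p s - p t) / RtoC (s - t))%C).
  repeat split.
  - intros eps He.
    destruct (H1 (eps/2)) as [d1 K1]; [lra|]. destruct (H2 (eps/2)) as [d2 K2]; [lra|].
    exists (Rmin d1 d2); split; [apply Rmin_pos; apply cond_pos|]; intros s Hs.
    destruct (Req_dec_T t t) as [_|N]; [|now elim N].
    destruct (Req_dec_T s t) as [->|N].
    { replace (v - v)%C with (RtoC 0) by ring. rewrite Cmod_0; lra. }
    assert (N' : s - t <> 0) by lra.
    specialize (K1 (s - t) N' (Rlt_le_trans _ _ _ Hs (Rmin_l _ _))).
    specialize (K2 (s - t) N' (Rlt_le_trans _ _ _ Hs (Rmin_r _ _))).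
    replace (t + (s - t)) with s in K1, K2 by ring.
    eapply Rle_lt_trans; [apply Cmod_le_abs|].
    assert (E : ((p s - p t) / RtoC (s - t))%C = ((Re (p s) - Re (p t)) / (s - t), (Im (p s) - Im (p t))/(s - t))).
    { apply Rmult_eq_reg_l in N' || idtac.
      unfold Cdiv. rewrite <- RtoC_inv by auto.
      destruct (p s) as [a b], (p t) as [c e]. unfold Cminus, Cmult, RtoC; simpl.
      f_equal; field; auto. }
    rewrite E. destruct v as [v1 v2]; simpl in *.
    unfold Rminus in *. lra.
  - destruct (Req_dec_T t t) as [_|N]; [easy|now elim N].
  - exists 1; split; [lra|]; intros s _.
    destruct (Req_dec_T s t) as [->|N].
    + replace (t - t) with 0 by ring. ring.
    + field. intros E. apply RtoC_inj in E. lra.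
Qed.

Lemma Pdiff_elim p t v : Pdiff p t v ->
  is_derive (fun s => Re (p s)) t (Re v) /\ is_derive (fun s => Im (p s)) t (Im v).
Proof.
  intros (phi & Hc & <- & d & Hd & E).
  assert (H : forall eps, 0 < eps -> exists d : posreal, forall h, h <> 0 -> Rabs h < d ->
     Cmod ((p (t+h)%R - p t) * RtoC (/ h) - phi t)%C < eps).
  { intros eps He. destruct (Hc eps He) as [d' [Hd' H']].
    exists (mkposreal _ (Rmin_pos _ _ Hd Hd')); simpl; intros h Hh Hs.
    rewrite E.
    - replace (t + h - t) with h by ring.
      rewrite <- Cmult_assoc, <- RtoC_mult, Rinv_r, Cmult_1_r by auto. apply H'.
      replace (t + h - t) with h by ring. apply (Rlt_le_trans _ _ _ Hs (Rmin_r _ _)).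
    - replace (t + h - t) with h by ring. apply (Rlt_le_trans _ _ _ Hs (Rmin_l _ _)). }
  split; apply is_derive_Reals; intros eps He; destruct (H eps He) as [d' H']; exists d';
  intros h Hh Hs; specialize (H' h Hh Hs).
  - eapply Rle_lt_trans; [|exact H'].
    eapply Rle_trans; [|apply re_le_Cmod]. right; f_equal.
    destruct (p (t+h)), (p t), (phi t); simpl. field; auto.
  - eapply Rle_lt_trans; [|exact H'].
    eapply Rle_trans; [|apply im_le_Cmod]. right; f_equal.
    destruct (p (t+h)), (p t), (phi t); simpl. field; auto.
Qed.

Lemma Rcont_Re p t : Rcont p t -> continuous (fun s => Re (p s)) t.
Proof.
  intros H. apply continuity_pt_filterlim. intros eps He.
  destruct (H eps He) as [d [Hd K]]. exists d; split; auto. intros s [_ Hs].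
  eapply Rle_lt_trans; [|apply (K s Hs)].
  eapply Rle_trans; [|apply re_le_Cmod]. right. simpl. unfold Rdist. f_equal.
Qed.

Lemma Rcont_Im p t : Rcont p t -> continuous (fun s => Im (p s)) t.
Proof.
  intros H. apply continuity_pt_filterlim. intros eps He.
  destruct (H eps He) as [d [Hd K]]. exists d; split; auto. intros s [_ Hs].
  eapply Rle_lt_trans; [|apply (K s Hs)].
  eapply Rle_trans; [|apply im_le_Cmod]. right. simpl. unfold Rdist. f_equal.
Qed.

(** * Integrals of complex-valued functions of a real variable *)

Definition CInt (f : R -> C) (a b : R) : C :=
  RInt (V := C_R_CompleteNormedModule) f a b.

Definition is_CInt (f : R -> C) (a b : R) (l : C) : Prop :=
  is_RInt (V := C_R_NormedModule) f a b l.

Lemma is_CInt_unique f a b l : is_CInt f a b l -> CInt f a b = l.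
Proof. apply (is_RInt_unique (V := C_R_CompleteNormedModule)). Qed.

Lemma is_CInt_pair f a b l1 l2 :
  is_RInt (fun t => Re (f t)) a b l1 -> is_RInt (fun t => Im (f t)) a b l2 ->
  is_CInt f a b (l1, l2).
Proof. intros; now apply is_RInt_fct_extend_pair. Qed.

Lemma CInt_pair f a b :
  (forall t, Rmin a b <= t <= Rmax a b -> Rcont f t) ->
  is_CInt f a b (RInt (fun t => Re (f t)) a b, RInt (fun t => Im (f t)) a b).
Proof.
  intros H. apply is_CInt_pair.
  - apply (RInt_correct (V := R_CompleteNormedModule)), ex_RInt_continuous. intros; now apply Rcont_Re, H.
  - apply (RInt_correct (V := R_CompleteNormedModule)), ex_RInt_continuous. intros; now apply Rcont_Im, H.
Qed.

Lemma CInt_FTC P f a b :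
  (forall t, Rmin a b <= t <= Rmax a b -> Pdiff P t (f t)) ->
  (forall t, Rmin a b <= t <= Rmax a b -> Rcont f t) ->
  is_CInt f a b (P b - P a)%C.
Proof.
  intros HP Hf.
  replace (P b - P a)%C with (Re (P b) - Re (P a), Im (P b) - Im (P a))
    by (now destruct (P b), (P a)).
  apply is_CInt_pair.
  - apply (is_RInt_derive (fun t => Re (P t)) (fun t => Re (f t))).
    + intros t Ht. apply (Pdiff_elim _ _ _ (HP t Ht)).
    + intros t Ht. now apply Rcont_Re, Hf.
  - apply (is_RInt_derive (fun t => Im (P t)) (fun t => Im (f t))).
    + intros t Ht. apply (Pdiff_elim _ _ _ (HP t Ht)).
    + intros t Ht. now apply Rcont_Im, Hf.
Qed.

Lemma is_CInt_bound f a b l M : a <= b ->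
  (forall t, a <= t <= b -> Cmod (f t) <= M) -> is_CInt f a b l -> Cmod l <= (b - a) * M.
Proof.
  intros Hab HM Hl. rewrite Cmod_norm.
  apply (norm_RInt_le_const (V := C_R_NormedModule) f a b l M Hab); auto.
  intros t Ht. specialize (HM t Ht). now rewrite Cmod_norm in HM.
Qed.

Lemma upper_half_open z w : upper_half z -> Cmod (w - z)%C < Im z -> upper_half w.
Proof.
  unfold upper_half; intros Hz Hw. pose proof (im_le_Cmod (w - z)) as H.
  destruct w, z; simpl in *. apply Rabs_le_between in H. lra.
Qed.

Lemma upper_half_segment a b t : upper_half a -> upper_half b -> 0 <= t <= 1 ->
  upper_half (a + RtoC t * (b - a))%C.
Proof.
  unfold upper_half; destruct a as [a1 a2], b as [b1 b2]; simpl; intros.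
  replace (a2 + (t * (b2 + - a2) + 0 * (b1 + - a1))) with ((1-t)*a2 + t*b2) by ring.
  destruct (Req_dec_T t 0); [subst; lra|]. nra.
Qed.

(** Continuity of the derivative is included because the primitive is found by differentiating under
    the integral sign. *)
Definition holo_on_H (f f' : C -> C) : Prop :=
  forall z, upper_half z -> Cdiff f z (f' z) /\ Ccont f' z.

Definition holo (f : C -> C) : Prop := exists f', holo_on_H f f'.

Lemma Ccont_Re z : Ccont (fun w => RtoC (Re w)) z.
Proof.
  intros eps He; exists eps; split; auto; intros w Hw.
  rewrite <- RtoC_minus, Cmod_R. eapply Rle_lt_trans; [|exact Hw].
  eapply Rle_trans; [|apply re_le_Cmod]. right; f_equal.
Qed.

Lemma Ccont_Im z : Ccont (fun w => RtoC (Im w)) z.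
Proof.
  intros eps He; exists eps; split; auto; intros w Hw.
  rewrite <- RtoC_minus, Cmod_R. eapply Rle_lt_trans; [|exact Hw].
  eapply Rle_trans; [|apply im_le_Cmod]. right; f_equal.
Qed.

(* A function of two real variables is packed as a function of one complex variable. *)
Lemma Ccont_2d_Re k x y : Ccont k (x, y) -> continuity_2d_pt (fun u v => Re (k (u, v))) x y.
Proof.
  intros H eps. destruct (H eps (cond_pos eps)) as [d [Hd K]].
  assert (Hd2 : 0 < d / 2) by lra.
  exists (mkposreal _ Hd2); simpl; intros u v Hu Hv.
  eapply Rle_lt_trans; [|apply (K (u, v))].
  - eapply Rle_trans; [|apply re_le_Cmod]. right; f_equal.
  - eapply Rle_lt_trans; [apply Cmod_le_abs|]. simpl.
    unfold Rminus in *. lra.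
Qed.

Lemma Ccont_2d_Im k x y : Ccont k (x, y) -> continuity_2d_pt (fun u v => Im (k (u, v))) x y.
Proof.
  intros H eps. destruct (H eps (cond_pos eps)) as [d [Hd K]].
  assert (Hd2 : 0 < d / 2) by lra.
  exists (mkposreal _ Hd2); simpl; intros u v Hu Hv.
  eapply Rle_lt_trans; [|apply (K (u, v))].
  - eapply Rle_trans; [|apply im_le_Cmod]. right; f_equal.
  - eapply Rle_lt_trans; [apply Cmod_le_abs|]. simpl.
    unfold Rminus in *. lra.
Qed.

Lemma holo_cont f f' z : holo_on_H f f' -> upper_half z -> Ccont f z.
Proof. intros H Hz. eapply Cdiff_cont, (H z Hz). Qed.

Lemma Rcont_segment f a b t : Ccont f (a + RtoC t * (b - a))%C ->
  Rcont (fun s => (f (a + RtoC s * (b - a)) * (b - a))%C) t.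
Proof.
  intros H. apply Rcont_mult; [|apply Rcont_const].
  apply (Rcont_comp f (fun s => (a + RtoC s * (b - a))%C)); auto.
  eapply Pdiff_cont, Pdiff_affine.
Qed.

(** * A primitive on the upper half-plane *)

Section Primitive.
Variables f f' : C -> C.
Hypothesis hf : holo_on_H f f'.

Let F (z : C) : C := path_integral f Ci z.

Section Segment.
Variables z v : C.
Let Z (s : R) : C := (z + RtoC s * v)%C.
Let K (s t : R) : C := (f (Ci + RtoC t * (Z s - Ci)) * (Z s - Ci))%C.
Let K' (s t : R) : C :=
  ((f' (Ci + RtoC t * (Z s - Ci)) * (RtoC t * v)) * (Z s - Ci)
   + f (Ci + RtoC t * (Z s - Ci)) * v)%C.

Lemma upper_half_Ci : upper_half Ci.
Proof. unfold upper_half; simpl; lra. Qed.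

Lemma K_diff s t : upper_half (Ci + RtoC t * (Z s - Ci))%C ->
  Pdiff (fun u => K u t) s (K' s t).
Proof.
  intros H. unfold K, K'.
  apply Pdiff_mult.
  - apply (Pdiff_comp f (fun u => (Ci + RtoC t * (Z u - Ci))%C)); [|apply hf, H].
    unfold Z. pose proof (Pdiff_affine (Ci + RtoC t * (z - Ci)) (RtoC t * v) s) as P.
    destruct P as (p & P1 & P2 & d & Hd & P3). exists p; split; [auto|split; [auto|]].
    exists d; split; auto. intros u Hu; rewrite <- P3 by auto. ring.
  - pose proof (Pdiff_affine (z - Ci) v s) as P. unfold Z.
    destruct P as (p & P1 & P2 & d & Hd & P3). exists p; split; [auto|split; [auto|]].
    exists d; split; auto. intros u Hu; rewrite <- P3 by auto. ring.
Qed.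

Lemma K'_cont s t : upper_half (Ci + RtoC t * (Z s - Ci))%C ->
  Ccont (fun w => K' (Re w) (Im w)) (s, t).
Proof.
  intros H. unfold K', Z in *.
  assert (Hp : Ccont (fun w => (Ci + RtoC (Im w) * (z + RtoC (Re w) * v - Ci))%C) (s, t)).
  { apply Ccont_plus; [apply Ccont_const|]. apply Ccont_mult; [apply Ccont_Im|].
    apply (Ccont_plus (fun w => (z + RtoC (Re w) * v)%C) (fun _ => (- Ci)%C));
    [|apply Ccont_const].
    apply Ccont_plus; [apply Ccont_const|]. apply Ccont_mult; [apply Ccont_Re|apply Ccont_const]. }
  assert (Hq : Ccont (fun w => (z + RtoC (Re w) * v - Ci)%C) (s, t)).
  { apply (Ccont_plus (fun w => (z + RtoC (Re w) * v)%C) (fun _ => (- Ci)%C));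
    [|apply Ccont_const].
    apply Ccont_plus; [apply Ccont_const|]. apply Ccont_mult; [apply Ccont_Re|apply Ccont_const]. }
  apply Ccont_plus; apply Ccont_mult; auto; try apply Ccont_const.
  - apply Ccont_mult.
    + apply (Ccont_comp f' (fun w => (Ci + RtoC (Im w) * (z + RtoC (Re w) * v - Ci))%C)); auto.
      apply (hf _ H).
    + apply Ccont_mult; [apply Ccont_Im|apply Ccont_const].
  - apply (Ccont_comp f (fun w => (Ci + RtoC (Im w) * (z + RtoC (Re w) * v - Ci))%C)); auto.
    eapply holo_cont; eauto.
Qed.

Lemma Z_near s : upper_half (Z s) -> exists d : posreal, forall u, Rabs (u - s) < d -> upper_half (Z u).
Proof.
  intros H.
  destruct (Pdiff_cont _ _ _ (Pdiff_affine z v s) (Im (Z s)) H) as [d [Hd E]].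
  exists (mkposreal d Hd); intros u Hu. apply upper_half_open with (Z s); auto.
  apply (E u Hu).
Qed.

Lemma point_near s t : upper_half (Ci + RtoC t * (Z s - Ci))%C ->
  exists d : posreal, forall u r, Rabs (u - s) < d -> Rabs (r - t) < d ->
    upper_half (Ci + RtoC r * (Z u - Ci))%C.
Proof.
  intros H.
  assert (Hp : Ccont (fun w => (Ci + RtoC (Im w) * (z + RtoC (Re w) * v - Ci))%C) (s, t)).
  { apply Ccont_plus; [apply Ccont_const|]. apply Ccont_mult; [apply Ccont_Im|].
    apply (Ccont_plus (fun w => (z + RtoC (Re w) * v)%C) (fun _ => (- Ci)%C));
    [|apply Ccont_const].
    apply Ccont_plus; [apply Ccont_const|]. apply Ccont_mult; [apply Ccont_Re|apply Ccont_const]. }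
  destruct (Hp _ H) as [d [Hd E]]. assert (Hd2 : 0 < d/2) by lra.
  exists (mkposreal _ Hd2); simpl; intros u r Hu Hr.
  apply upper_half_open with (1:=H). apply (E (u, r)).
  eapply Rle_lt_trans; [apply Cmod_le_abs|]. simpl. unfold Rminus in *; lra.
Qed.

(** As a function of [t], [K' s t] is the derivative of [t v f(i + t (Z s - i))]. This exactness
    takes the place of Cauchy's theorem: the derivative of the integral depends only on the value of
    [f] at the end point. *)
Lemma K'_int s : upper_half (Z s) -> is_CInt (fun t => K' s t) 0 1 (f (Z s) * v)%C.
Proof.
  intros H.
  replace (f (Z s) * v)%C with
    (RtoC 1 * v * f (Ci + RtoC 1 * (Z s - Ci)) - RtoC 0 * v * f (Ci + RtoC 0 * (Z s - Ci)))%C.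
  2: { replace (Ci + RtoC 1 * (Z s - Ci))%C with (Z s) by ring. ring. }
  apply (CInt_FTC (fun t => (RtoC t * v * f (Ci + RtoC t * (Z s - Ci)))%C)).
  - intros t Ht. rewrite Rmin_left, Rmax_right in Ht by lra.
    assert (Hp := upper_half_segment Ci (Z s) t upper_half_Ci H Ht).
    replace (K' s t) with (v * f (Ci + RtoC t * (Z s - Ci)) + RtoC t * v * (f' (Ci + RtoC t * (Z s - Ci)) * (Z s - Ci)))%C
      by (unfold K'; ring).
    apply (Pdiff_mult (fun t => (RtoC t * v)%C) (fun t => f (Ci + RtoC t * (Z s - Ci))%C)).
    + pose proof (Pdiff_mult RtoC (fun _ => v) t 1 0 (Pdiff_RtoC t)) as P.
      cbv beta in P. replace (RtoC 1 * v + RtoC t * 0)%C with v in P by ring. apply P.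
      exists (fun _ => RtoC 0); repeat split; [apply Rcont_const|].
      exists 1; split; [lra|]; intros; ring.
    + apply (Pdiff_comp f (fun t => (Ci + RtoC t * (Z s - Ci))%C)); [apply Pdiff_affine|apply hf, Hp].
  - intros t Ht. rewrite Rmin_left, Rmax_right in Ht by lra.
    assert (Hp := upper_half_segment Ci (Z s) t upper_half_Ci H Ht).
    intros eps He. destruct (K'_cont s t Hp eps He) as [d [Hd E]].
    exists d; split; auto. intros u Hu. apply (E (s, u)).
    replace ((s, u) - (s, t))%C with (Ci * RtoC (u - t))%C.
    + rewrite Cmod_mult, Cmod_Ci, Cmod_R; lra.
    + unfold Ci, Cminus, Cmult, Cplus, Copp, RtoC; simpl. f_equal; ring.
Qed.

Lemma K_cont s t : upper_half (Z s) -> 0 <= t <= 1 -> Rcont (fun r => K s r) t.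
Proof.
  intros H Ht. apply Rcont_segment. eapply holo_cont; eauto.
  apply upper_half_segment; auto. apply upper_half_Ci.
Qed.

Lemma F_pair s : upper_half (Z s) ->
  F (Z s) = (RInt (fun t => Re (K s t)) 0 1, RInt (fun t => Im (K s t)) 0 1).
Proof.
  intros H. apply is_CInt_unique, CInt_pair. intros t Ht.
  rewrite Rmin_left, Rmax_right in Ht by lra. now apply K_cont.
Qed.

(** Differentiation under the integral sign, done separately for the real and the imaginary part;
    [K'_int] evaluates the differentiated integral. *)
Lemma F_along s : upper_half (Z s) -> Pdiff (fun u => F (Z u)) s (f (Z s) * v)%C.
Proof.
  intros H. destruct (Z_near s H) as [d Hd].
  assert (HK : forall t, 0 <= t <= 1 -> upper_half (Ci + RtoC t * (Z s - Ci))%C).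
  { intros; apply upper_half_segment; auto; apply upper_half_Ci. }
  pose proof (K'_int s H) as HI. pose proof (is_CInt_unique _ _ _ _ HI) as HU.
  assert (HP : CInt (fun t => K' s t) 0 1 = (RInt (fun t => Re (K' s t)) 0 1, RInt (fun t => Im (K' s t)) 0 1)).
  { apply is_CInt_unique, CInt_pair. intros t Ht. rewrite Rmin_left, Rmax_right in Ht by lra.
    intros eps He. destruct (K'_cont s t (HK t Ht) eps He) as [d' [Hd' E]].
    exists d'; split; auto. intros u Hu. apply (E (s, u)).
    replace ((s, u) - (s, t))%C with (Ci * RtoC (u - t))%C.
    + rewrite Cmod_mult, Cmod_Ci, Cmod_R; lra.
    + unfold Ci, Cminus, Cmult, Cplus, Copp, RtoC; simpl. f_equal; ring. }
  rewrite HP in HU. clear HP HI.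
  apply Pdiff_intro; rewrite <- HU; cbn [Re Im fst snd].
  - apply (is_derive_ext_loc (fun u => RInt (fun t => Re (K u t)) 0 1)).
    { exists d; intros u Hu. pose proof (F_pair u (Hd u Hu)) as E. rewrite E. reflexivity. }
    replace (RInt (fun t => Re (K' s t)) 0 1) with (RInt (fun t => Derive (fun u => Re (K u t)) s) 0 1).
    2: { apply RInt_ext; intros t Ht. rewrite Rmin_left, Rmax_right in Ht by lra.
         apply is_derive_unique, (Pdiff_elim (fun u => K u t)), K_diff, HK. lra. }
    apply (is_derive_RInt_param (fun u t => Re (K u t)) 0 1 s).
    + exists d; intros u Hu t Ht. rewrite Rmin_left, Rmax_right in Ht by lra.
      eexists. apply (Pdiff_elim (fun u => K u t)), K_diff.
      exact (upper_half_segment Ci (Z u) t upper_half_Ci (Hd u Hu) Ht).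
    + intros t Ht. rewrite Rmin_left, Rmax_right in Ht by lra.
      apply continuity_2d_pt_ext_loc with (fun u t => Re (K' u t)).
      * destruct (point_near s t (HK t Ht)) as [d' E].
        exists d'; intros u r Hu Hr. symmetry.
        apply is_derive_unique, (Pdiff_elim (fun u => K u r)), K_diff, E; auto.
      * apply (Ccont_2d_Re (fun w => K' (Re w) (Im w))), K'_cont, HK, Ht.
    + exists d; intros u Hu. apply (ex_RInt_continuous (V := R_CompleteNormedModule)); intros t Ht.
      rewrite Rmin_left, Rmax_right in Ht by lra. apply (Rcont_Re (fun t => K u t)), K_cont; [exact (Hd u Hu)|exact Ht].
  - apply (is_derive_ext_loc (fun u => RInt (fun t => Im (K u t)) 0 1)).
    { exists d; intros u Hu. pose proof (F_pair u (Hd u Hu)) as E. rewrite E. reflexivity. }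
    replace (RInt (fun t => Im (K' s t)) 0 1) with (RInt (fun t => Derive (fun u => Im (K u t)) s) 0 1).
    2: { apply RInt_ext; intros t Ht. rewrite Rmin_left, Rmax_right in Ht by lra.
         apply is_derive_unique, (Pdiff_elim (fun u => K u t)), K_diff, HK. lra. }
    apply (is_derive_RInt_param (fun u t => Im (K u t)) 0 1 s).
    + exists d; intros u Hu t Ht. rewrite Rmin_left, Rmax_right in Ht by lra.
      eexists. apply (Pdiff_elim (fun u => K u t)), K_diff.
      exact (upper_half_segment Ci (Z u) t upper_half_Ci (Hd u Hu) Ht).
    + intros t Ht. rewrite Rmin_left, Rmax_right in Ht by lra.
      apply continuity_2d_pt_ext_loc with (fun u t => Im (K' u t)).
      * destruct (point_near s t (HK t Ht)) as [d' E].
        exists d'; intros u r Hu Hr. symmetry.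
        apply is_derive_unique, (Pdiff_elim (fun u => K u r)), K_diff, E; auto.
      * apply (Ccont_2d_Im (fun w => K' (Re w) (Im w))), K'_cont, HK, Ht.
    + exists d; intros u Hu. apply (ex_RInt_continuous (V := R_CompleteNormedModule)); intros t Ht.
      rewrite Rmin_left, Rmax_right in Ht by lra. apply (Rcont_Im (fun t => K u t)), K_cont; [exact (Hd u Hu)|exact Ht].
Qed.

End Segment.

Lemma path_integral_primitive a b (G : C -> C) (g : C -> C) :
  (forall z, upper_half z -> Cdiff G z (g z)) -> (forall z, upper_half z -> Ccont g z) ->
  upper_half a -> upper_half b ->
  is_CInt (fun t => (g (a + RtoC t * (b - a)) * (b - a))%C) 0 1 (G b - G a)%C.
Proof.
  intros HG Hg Ha Hb.
  replace (G b - G a)%C with (G (a + RtoC 1 * (b - a)) - G (a + RtoC 0 * (b - a)))%C.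
  2: { f_equal; [f_equal; ring| f_equal; f_equal; ring]. }
  apply (CInt_FTC (fun t => G (a + RtoC t * (b - a))%C)); intros t Ht;
  rewrite Rmin_left, Rmax_right in Ht by lra;
  assert (Hp := upper_half_segment a b t Ha Hb Ht).
  - apply (Pdiff_comp G (fun t => (a + RtoC t * (b - a))%C)); [apply Pdiff_affine|auto].
  - apply Rcont_segment; auto.
Qed.

Lemma F_primitive z : upper_half z -> Cdiff F z (f z).
Proof.
  intros Hz.
  (* The mean of [f] over the segment from [z] to [w] serves as Caratheodory difference quotient; it
     is continuous at [z] because [f] is. *)
  exists (fun w => CInt (fun t => f (z + RtoC t * (w - z))%C) 0 1).
  assert (Cf : Ccont f z) by (eapply holo_cont; eauto).
  assert (Hc : forall w, upper_half w ->
    is_CInt (fun t => f (z + RtoC t * (w - z))%C) 0 1 (CInt (fun t => f (z + RtoC t * (w - z))%C) 0 1)).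
  { intros w Hw.
    assert (H := CInt_pair (fun t => f (z + RtoC t * (w - z))%C) 0 1).
    rewrite (is_CInt_unique _ _ _ _ (H ltac:(
      intros t Ht; rewrite Rmin_left, Rmax_right in Ht by lra;
      apply (Rcont_comp f (fun t => (z + RtoC t * (w - z))%C));
      [eapply Pdiff_cont, Pdiff_affine|eapply holo_cont; eauto; apply upper_half_segment; auto]))).
    apply H. intros t Ht; rewrite Rmin_left, Rmax_right in Ht by lra.
    apply (Rcont_comp f (fun t => (z + RtoC t * (w - z))%C));
      [eapply Pdiff_cont, Pdiff_affine|eapply holo_cont; eauto; apply upper_half_segment; auto]. }
  assert (E0 : CInt (fun t => f (z + RtoC t * (z - z))%C) 0 1 = f z).
  { apply is_CInt_unique.
    replace (f z) with (RtoC 1 * f z - RtoC 0 * f z)%C by ring.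
    apply (is_RInt_ext (V := C_R_NormedModule) (fun _ => f z)).
    - intros t _. f_equal. ring.
    - apply (CInt_FTC (fun t => (RtoC t * f z)%C)); intros t _.
      + pose proof (Pdiff_affine 0 (f z) t) as (p & P1 & P2 & d & Hd & P3).
        exists p; repeat split; auto. exists d; split; auto. intros s Hs. rewrite <- P3 by auto. ring.
      + apply Rcont_const. }
  repeat split; auto.
  - intros eps He. destruct (Cf (eps/2)) as [d [Hd H]]; [lra|].
    exists (Rmin d (Im z)); split; [apply Rmin_pos; auto|]; intros w Hw.
    assert (Hw' : upper_half w).
    { apply upper_half_open with z; auto. apply (Rlt_le_trans _ _ _ Hw (Rmin_r _ _)). }
    rewrite E0. apply Rle_lt_trans with ((1 - 0) * (eps/2)); [|lra].
    apply (is_CInt_bound (fun t => (f (z + RtoC t * (w - z)) - f z)%C)); [lra| |].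
    + intros t Ht. apply Rlt_le, H.
      replace (z + RtoC t * (w - z) - z)%C with (RtoC t * (w - z))%C by ring.
      rewrite Cmod_mult, Cmod_R, Rabs_right by lra.
      apply Rle_lt_trans with (Cmod (w - z)).
      * pose proof (Cmod_ge_0 (w - z)). nra.
      * apply (Rlt_le_trans _ _ _ Hw (Rmin_l _ _)).
    + apply (is_RInt_minus (V := C_R_NormedModule)); [now apply Hc|].
      pose proof (Hc z Hz) as Hz'. rewrite E0 in Hz'. apply (is_RInt_ext (V := C_R_NormedModule) (fun t => f (z + RtoC t * (z - z))%C)).
      * intros t _. f_equal. ring.
      * exact Hz'.
  - exists (Im z); split; [exact Hz|]; intros w Hw.
    assert (Hw' : upper_half w) by (apply upper_half_open with z; auto).
    assert (Hs : forall s, 0 <= s <= 1 -> upper_half (z + RtoC s * (w - z))%C).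
    { intros; now apply upper_half_segment. }
    assert (H1 : is_CInt (fun s => (f (z + RtoC s * (w - z)) * (w - z))%C) 0 1 (F w - F z)%C).
    { replace (F w - F z)%C with (F (z + RtoC 1 * (w - z)) - F (z + RtoC 0 * (w - z)))%C.
      2: { f_equal; [f_equal; ring| f_equal; f_equal; ring]. }
      apply (CInt_FTC (fun s => F (z + RtoC s * (w - z))%C)); intros s Hs';
      rewrite Rmin_left, Rmax_right in Hs' by lra.
      - apply F_along; auto.
      - apply Rcont_segment. eapply holo_cont; eauto. }
    apply is_CInt_unique in H1. rewrite <- H1. apply is_CInt_unique.
    specialize (Hc w Hw').
    set (I := CInt (fun t => f (z + RtoC t * (w - z))%C) 0 1) in *.
    (* The complex constant [w - z] is taken out of the integral in coordinates, where linearity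
       over the reals is enough. *)
    pose proof (is_RInt_fct_extend_fst (U := R_NormedModule) (V := R_NormedModule) _ _ _ _ Hc) as Q1.
    pose proof (is_RInt_fct_extend_snd (U := R_NormedModule) (V := R_NormedModule) _ _ _ _ Hc) as Q2.
    destruct (w - z)%C as [a b]. destruct I as [i1 i2]. simpl in Q1, Q2.
    apply is_CInt_pair; simpl.
    + apply (is_RInt_ext (fun t => minus (scal a (fst (f (z + RtoC t * (a, b))%C))) (scal b (snd (f (z + RtoC t * (a, b))%C))))).
      { intros t _. unfold minus, plus, opp, scal, mult; simpl. unfold mult; simpl. ring_simplify. reflexivity. }
      replace (i1 * a - i2 * b) with (minus (scal a i1) (scal b i2)) by
        (unfold minus, plus, opp, scal, mult; simpl; unfold mult; simpl; ring).
      apply (is_RInt_minus (V := R_NormedModule)); now apply (is_RInt_scal (V := R_NormedModule)).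
    + apply (is_RInt_ext (fun t => plus (scal b (fst (f (z + RtoC t * (a, b))%C))) (scal a (snd (f (z + RtoC t * (a, b))%C))))).
      { intros t _. unfold minus, plus, opp, scal, mult; simpl. unfold mult; simpl. ring_simplify. reflexivity. }
      replace (i1 * b + i2 * a) with (plus (scal b i1) (scal a i2)) by
        (unfold minus, plus, opp, scal, mult; simpl; unfold mult; simpl; ring).
      apply (is_RInt_plus (V := R_NormedModule)); now apply (is_RInt_scal (V := R_NormedModule)).
Qed.

End Primitive.

(** * Path independence and closure properties of holomorphic functions *)

Lemma holo_primitive f : holo f -> exists F, forall z, upper_half z -> Cdiff F z (f z).
Proof. intros [f' H]. exists (path_integral f Ci). intros; eapply F_primitive; eauto. Qed.

Lemma holo_Ccont f z : holo f -> upper_half z -> Ccont f z.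
Proof. intros [f' H] Hz. eapply holo_cont; eauto. Qed.

Lemma path_integral_eq f F a b : holo f -> (forall z, upper_half z -> Cdiff F z (f z)) ->
  upper_half a -> upper_half b -> path_integral f a b = (F b - F a)%C.
Proof.
  intros Hf HF Ha Hb. apply is_CInt_unique, path_integral_primitive; auto.
  intros; now apply holo_Ccont.
Qed.

Lemma path_integral_chasles f a b c : holo f -> upper_half a -> upper_half b -> upper_half c ->
  (path_integral f a b + path_integral f b c)%C = path_integral f a c.
Proof.
  intros Hf Ha Hb Hc. destruct (holo_primitive f Hf) as [F HF].
  rewrite !(path_integral_eq f F) by auto. ring.
Qed.

Lemma path_integral_bound f a b M : holo f -> upper_half a -> upper_half b ->
  (forall t, 0 <= t <= 1 -> Cmod (f (a + RtoC t * (b - a))%C) <= M) ->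
  Cmod (path_integral f a b) <= M * Cmod (b - a)%C.
Proof.
  intros Hf Ha Hb HM. destruct (holo_primitive f Hf) as [F HF].
  rewrite (path_integral_eq f F) by auto.
  replace (M * Cmod (b - a)) with ((1 - 0) * (M * Cmod (b - a))) by ring.
  apply (is_CInt_bound (fun t => (f (a + RtoC t * (b - a)) * (b - a))%C)); [lra| |].
  - intros t Ht. rewrite Cmod_mult. apply Rmult_le_compat_r; [apply Cmod_ge_0|auto].
  - apply path_integral_primitive; auto. intros; now apply holo_Ccont.
Qed.

(** Both integrals are the increment of one primitive. This is used for Moebius images of segments
    and for geodesics. *)
Lemma path_integral_curve f p v a b : holo f -> a <= b ->
  (forall t, a <= t <= b -> upper_half (p t) /\ Pdiff p t (v t) /\ Rcont v t) ->
  is_CInt (fun t => (f (p t) * v t)%C) a b (path_integral f (p a) (p b)).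
Proof.
  intros Hf Hab H. destruct (holo_primitive f Hf) as [F HF].
  rewrite (path_integral_eq f F); auto; try (apply H; lra).
  apply (CInt_FTC (fun t => F (p t))); intros t Ht;
  rewrite Rmin_left, Rmax_right in Ht by lra; destruct (H t Ht) as (H1 & H2 & H3).
  - apply Pdiff_comp; auto.
  - apply Rcont_mult; auto. apply Rcont_comp; [eapply Pdiff_cont; eauto|].
    now apply holo_Ccont.
Qed.

Lemma holo_mult f g : holo f -> holo g -> holo (fun z => (f z * g z)%C).
Proof.
  intros [f' Hf] [g' Hg]. exists (fun z => (f' z * g z + f z * g' z)%C).
  intros z Hz. split; [apply Cdiff_mult; [apply Hf|apply Hg]; auto|].
  destruct (Hf z Hz) as [F1 F2], (Hg z Hz) as [G1 G2].
  apply Cdiff_cont in F1, G1. apply Ccont_plus; apply Ccont_mult; auto.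
Qed.

Lemma holo_plus f g : holo f -> holo g -> holo (fun z => (f z + g z)%C).
Proof.
  intros [f' Hf] [g' Hg]. exists (fun z => (f' z + g' z)%C).
  intros z Hz. split; [apply Cdiff_plus; [apply Hf|apply Hg]; auto|].
  apply Ccont_plus; [apply Hf|apply Hg]; auto.
Qed.

Lemma holo_const c : holo (fun _ => c).
Proof. exists (fun _ => RtoC 0); intros z Hz; split; [apply Cdiff_const|apply Ccont_const]. Qed.

Lemma holo_id : holo (fun z => z).
Proof. exists (fun _ => RtoC 1); intros z Hz; split; [apply Cdiff_id|apply Ccont_const]. Qed.

Lemma holo_inv f : holo f -> (forall z, upper_half z -> f z <> 0) -> holo (fun z => (/ f z)%C).
Proof.
  intros [f' Hf] Hn. exists (fun z => (- f' z * / (f z * f z))%C).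
  intros z Hz. destruct (Hf z Hz) as [F1 F2]. split; [now apply Cdiff_inv; auto|].
  apply Cdiff_cont in F1. apply Ccont_mult; [now apply Ccont_opp|].
  apply Ccont_inv; [now apply Ccont_mult|]. apply Cmult_neq_0; auto.
Qed.

Lemma holo_pow f n : holo f -> holo (fun z => (f z ^ n)%C).
Proof.
  intros Hf; induction n; simpl; [apply holo_const|]. now apply (holo_mult f).
Qed.

Lemma holo_ext f g : (forall z, upper_half z -> f z = g z) -> holo f -> holo g.
Proof.
  intros E [f' Hf]. exists f'. intros z Hz. split; [|apply Hf; auto].
  apply Cdiff_ext_loc with f (Im z); auto; [|apply Hf; auto].
  intros w Hw. apply E, upper_half_open with z; auto.
Qed.

(** * Complex series *)

Definition Clim (u : nat -> C) (l : C) : Prop :=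
  is_lim_seq (fun n => Cmod (u n - l)%C) 0.

Lemma is_lim_seq_0_le (u v : nat -> R) : (forall n, 0 <= u n <= v n) ->
  is_lim_seq v 0 -> is_lim_seq u 0.
Proof.
  intros H Hv. apply (is_lim_seq_le_le (fun _ => 0) u v); auto. apply is_lim_seq_const.
Qed.

Lemma is_lim_seq_0_iff (u : nat -> R) : is_lim_seq u 0 <->
  forall eps, 0 < eps -> exists N, forall n, (N <= n)%nat -> Rabs (u n) < eps.
Proof.
  split.
  - intros H eps He. apply is_lim_seq_spec in H. destruct (H (mkposreal eps He)) as [N HN].
    exists N. intros n Hn. specialize (HN n Hn). now rewrite Rminus_0_r in HN.
  - intros H. apply is_lim_seq_spec. intros eps. destruct (H eps (cond_pos eps)) as [N HN].
    exists N. intros n Hn. rewrite Rminus_0_r. auto.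
Qed.

Lemma Clim_eps u l : Clim u l <->
  forall eps, 0 < eps -> exists N, forall n, (N <= n)%nat -> Cmod (u n - l)%C < eps.
Proof.
  unfold Clim. rewrite is_lim_seq_0_iff. split; intros H eps He; destruct (H eps He) as [N HN];
  exists N; intros n Hn; specialize (HN n Hn).
  - eapply Rle_lt_trans; [apply Rle_abs|exact HN].
  - rewrite Rabs_right; [auto|apply Rle_ge, Cmod_ge_0].
Qed.

Lemma Clim_const c : Clim (fun _ => c) c.
Proof.
  apply Clim_eps; intros eps He; exists O; intros.
  replace (c - c)%C with (RtoC 0) by ring. now rewrite Cmod_0.
Qed.

Lemma Clim_ext_loc u v l : eventually (fun n => u n = v n) -> Clim u l -> Clim v l.
Proof.
  intros H. apply is_lim_seq_ext_loc. destruct H as [N H]; exists N; intros n Hn.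
  now rewrite H.
Qed.

Lemma Clim_ext u v l : (forall n, u n = v n) -> Clim u l -> Clim v l.
Proof. intros H. apply Clim_ext_loc. exists O; auto. Qed.

Lemma Clim_plus u v l m : Clim u l -> Clim v m -> Clim (fun n => (u n + v n)%C) (l + m).
Proof.
  intros Hu Hv. apply (is_lim_seq_0_le _ (fun n => Cmod (u n - l)%C + Cmod (v n - m)%C)).
  - intros n; split; [apply Cmod_ge_0|].
    replace (u n + v n - (l + m))%C with ((u n - l) + (v n - m))%C by ring. apply Cmod_triangle.
  - replace 0 with (0 + 0) by ring. now apply is_lim_seq_plus'.
Qed.

Lemma Clim_scal c u l : Clim u l -> Clim (fun n => (c * u n)%C) (c * l).
Proof.
  intros Hu. apply (is_lim_seq_0_le _ (fun n => Cmod c * Cmod (u n - l)%C)).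
  - intros n; split; [apply Cmod_ge_0|].
    replace (c * u n - c * l)%C with (c * (u n - l))%C by ring. rewrite Cmod_mult; lra.
  - replace 0 with (Cmod c * 0) by ring. now apply (is_lim_seq_scal_l _ _ 0).
Qed.

Lemma Clim_minus u v l m : Clim u l -> Clim v m -> Clim (fun n => (u n - v n)%C) (l - m).
Proof.
  intros Hu Hv. apply (Clim_ext (fun n => (u n + (-(1)) * v n)%C)).
  - intros; ring.
  - replace (l - m)%C with (l + (-(1)) * m)%C by ring. apply Clim_plus; auto. now apply Clim_scal.
Qed.

Lemma Clim_comp f u l : Ccont f l -> Clim u l -> Clim (fun n => f (u n)) (f l).
Proof.
  intros Hf Hu. apply Clim_eps; intros eps He.
  destruct (Hf eps He) as [d [Hd H]]. rewrite Clim_eps in Hu.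
  destruct (Hu d Hd) as [N HN]. exists N; auto.
Qed.

Lemma Clim_unique u l m : Clim u l -> Clim u m -> l = m.
Proof.
  intros Hl Hm. pose proof (Clim_minus _ _ _ _ Hl Hm) as H.
  apply (Clim_ext _ (fun _ => RtoC 0)) in H; [|intros; ring].
  unfold Clim in H. apply is_lim_seq_unique in H. rewrite Lim_seq_const in H.
  injection H as H. apply Cmod_eq_0 in H.
  replace l with (m + - (0 - (l - m)))%C by ring. rewrite H. ring.
Qed.

Lemma Clim_Re u l : Clim u l -> is_lim_seq (fun n => Re (u n)) (Re l).
Proof.
  intros H. rewrite Clim_eps in H. apply is_lim_seq_spec. intros eps.
  destruct (H eps (cond_pos eps)) as [N HN]; exists N; intros n Hn.
  eapply Rle_lt_trans; [|apply (HN n Hn)].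
  eapply Rle_trans; [|apply re_le_Cmod]. right; f_equal.
Qed.

Lemma Clim_Im u l : Clim u l -> is_lim_seq (fun n => Im (u n)) (Im l).
Proof.
  intros H. rewrite Clim_eps in H. apply is_lim_seq_spec. intros eps.
  destruct (H eps (cond_pos eps)) as [N HN]; exists N; intros n Hn.
  eapply Rle_lt_trans; [|apply (HN n Hn)].
  eapply Rle_trans; [|apply im_le_Cmod]. right; f_equal.
Qed.

Lemma Clim_pair u (a b : R) : is_lim_seq (fun n => Re (u n)) a -> is_lim_seq (fun n => Im (u n)) b ->
  Clim u (a, b).
Proof.
  intros Ha Hb.
  apply (is_lim_seq_0_le _ (fun n => Rabs (Re (u n) - a) + Rabs (Im (u n) - b))).
  - intros n; split; [apply Cmod_ge_0|]. eapply Rle_trans; [apply Cmod_le_abs|].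
    right; f_equal.
  - replace 0 with (Rabs (a - a) + Rabs (b - b)) by (rewrite !Rminus_diag, Rabs_R0; ring).
    apply is_lim_seq_plus'; apply (is_lim_seq_abs _ (Finite _));
    apply is_lim_seq_minus'; auto; apply is_lim_seq_const.
Qed.

(** * Finite sums and convergent series *)

Fixpoint Csum (f : nat -> C) (n : nat) : C :=
  match n with O => 0 | S n => (Csum f n + f n)%C end.

Fixpoint Rsum (f : nat -> R) (n : nat) : R :=
  match n with O => 0 | S n => Rsum f n + f n end.

Lemma Csum_ext f g n : (forall i, (i < n)%nat -> f i = g i) -> Csum f n = Csum g n.
Proof.
  induction n as [|n IH]; simpl; auto; intros H. rewrite IH, H by auto with arith. easy.
Qed.

Lemma Csum_plus f g n : Csum (fun i => (f i + g i)%C) n = (Csum f n + Csum g n)%C.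
Proof. induction n as [|n IH]; simpl; [ring|rewrite IH; ring]. Qed.

Lemma Csum_scal c f n : Csum (fun i => (c * f i)%C) n = (c * Csum f n)%C.
Proof. induction n as [|n IH]; simpl; [ring|rewrite IH; ring]. Qed.

Lemma Csum_add f n m : Csum f (n + m) = (Csum f n + Csum (fun i => f (n + i)%nat) m)%C.
Proof.
  induction m as [|m IH]; [rewrite Nat.add_0_r; simpl; ring|].
  rewrite Nat.add_succ_r; simpl. rewrite IH; ring.
Qed.

Lemma Csum_first f n : Csum f (S n) = (f O + Csum (fun i => f (S i)) n)%C.
Proof. change (S n) with (1 + n)%nat. rewrite Csum_add. simpl. ring. Qed.

Lemma Csum_rev f n : Csum f n = Csum (fun i => f (n - 1 - i)%nat) n.
Proof.
  induction n as [|n IH]; auto.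
  rewrite (Csum_first (fun i => f (S n - 1 - i)%nat)). simpl Csum at 1. rewrite IH.
  rewrite Cplus_comm. f_equal; [f_equal; lia|].
  apply Csum_ext; intros; f_equal; lia.
Qed.

Lemma Csum_swap a n m : Csum (fun i => Csum (a i) m) n = Csum (fun j => Csum (fun i => a i j) n) m.
Proof.
  induction n as [|n IH]; simpl.
  - induction m; simpl; auto. rewrite <- IHm; ring.
  - rewrite IH, <- Csum_plus. easy.
Qed.

Lemma Rsum_scal c f n : Rsum (fun i => c * f i) n = c * Rsum f n.
Proof. induction n as [|n IH]; simpl; [ring|rewrite IH; ring]. Qed.

Lemma Rsum_add f n m : Rsum f (n + m) = Rsum f n + Rsum (fun i => f (n + i)%nat) m.
Proof.
  induction m as [|m IH]; [rewrite Nat.add_0_r; simpl; ring|].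
  rewrite Nat.add_succ_r; simpl. rewrite IH; ring.
Qed.

Lemma Rsum_le f g n : (forall i, (i < n)%nat -> f i <= g i) -> Rsum f n <= Rsum g n.
Proof.
  induction n as [|n IH]; simpl; intros H; [lra|]. apply Rplus_le_compat; auto with arith.
Qed.

Lemma Csum_Cmod f n : Cmod (Csum f n) <= Rsum (fun i => Cmod (f i)) n.
Proof.
  induction n as [|n IH]; simpl; [rewrite Cmod_0; lra|].
  eapply Rle_trans; [apply Cmod_triangle|]. lra.
Qed.

Lemma Csum_bound f b n : (forall i, (i < n)%nat -> Cmod (f i) <= b i) -> Cmod (Csum f n) <= Rsum b n.
Proof. intros. eapply Rle_trans; [apply Csum_Cmod|now apply Rsum_le]. Qed.

Lemma Rsum_sum_n f n : Rsum f (S n) = sum_n f n.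
Proof.
  induction n as [|n IH]; [simpl; rewrite sum_O; ring|].
  rewrite sum_Sn, <- IH. easy.
Qed.

Lemma Csum_Re f n : Re (Csum f n) = Rsum (fun i => Re (f i)) n.
Proof. induction n as [|n IH]; simpl; auto. rewrite <- IH. easy. Qed.

Lemma Csum_Im f n : Im (Csum f n) = Rsum (fun i => Im (f i)) n.
Proof. induction n as [|n IH]; simpl; auto. rewrite <- IH. easy. Qed.

Lemma is_series_Rsum f (l : R) : is_series f l <-> is_lim_seq (Rsum f) l.
Proof.
  rewrite (is_lim_seq_incr_1 (Rsum f)). split; intros H.
  - apply (is_lim_seq_ext (sum_n f)); auto. intros; now rewrite Rsum_sum_n.
  - apply (is_lim_seq_ext _ (sum_n f)) in H; auto. intros; now rewrite Rsum_sum_n.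
Qed.

Lemma Series_Rsum f : ex_series f -> is_lim_seq (Rsum f) (Series f).
Proof. intros H. apply is_series_Rsum, Series_correct, H. Qed.

Lemma Rsum_le_Series f n : ex_series f -> (forall i, 0 <= f i) -> Rsum f n <= Series f.
Proof.
  intros H Hp. apply (is_lim_seq_incr_compare (Rsum f)); [now apply Series_Rsum|].
  intros k; simpl. specialize (Hp k); lra.
Qed.

Lemma ex_series_bounded f M : (forall i, 0 <= f i) -> (forall n, Rsum f n <= M) -> ex_series f.
Proof.
  intros Hp HM.
  destruct (ex_finite_lim_seq_incr (Rsum f) M) as [l Hl]; auto.
  - intros n; simpl. specialize (Hp n); lra.
  - exists l. now apply is_series_Rsum.
Qed.

Lemma ex_series_le_nonneg f g : (forall i, 0 <= f i <= g i) -> ex_series g -> ex_series f.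
Proof.
  intros H Hg. apply (ex_series_le (V := R_CompleteNormedModule) f g); auto. intros n.
  change (Rabs (f n) <= g n). rewrite Rabs_right; [apply H|apply Rle_ge, H].
Qed.

Lemma ex_series_scal_R (c : R) f : ex_series f -> ex_series (fun n => c * f n).
Proof. exact (ex_series_scal_l (K := R_AbsRing) c f). Qed.

(** A convergence statement, in contrast to the total function [CSeries]; [CSeries_unique] and
    [CSeries_conv] connect the two. *)
Definition Cser (a : nat -> C) (l : C) : Prop := Clim (Csum a) l.

Lemma CSeries_unique a l : Cser a l -> CSeries a = l.
Proof.
  intros H. unfold CSeries.
  rewrite (is_series_unique (fun n => Re (a n)) (Re l)), (is_series_unique (fun n => Im (a n)) (Im l)).
  - now destruct l.
  - apply is_series_Rsum. apply (is_lim_seq_ext (fun n => Im (Csum a n))); [|now apply Clim_Im].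
    intros; apply Csum_Im.
  - apply is_series_Rsum. apply (is_lim_seq_ext (fun n => Re (Csum a n))); [|now apply Clim_Re].
    intros; apply Csum_Re.
Qed.

Lemma CSeries_conv a b : (forall n, Cmod (a n) <= b n) -> ex_series b -> Cser a (CSeries a).
Proof.
  intros H Hb. apply Clim_pair.
  - apply (is_lim_seq_ext (Rsum (fun n => Re (a n)))); [intros; now rewrite Csum_Re|].
    apply Series_Rsum, (ex_series_le (V := R_CompleteNormedModule) _ b); auto. intros n.
    eapply Rle_trans; [apply re_le_Cmod|auto].
  - apply (is_lim_seq_ext (Rsum (fun n => Im (a n)))); [intros; now rewrite Csum_Im|].
    apply Series_Rsum, (ex_series_le (V := R_CompleteNormedModule) _ b); auto. intros n.
    eapply Rle_trans; [apply im_le_Cmod|auto].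
Qed.

Lemma Cser_ext a b l : (forall n, a n = b n) -> Cser a l -> Cser b l.
Proof. intros H. apply Clim_ext. intros; apply Csum_ext; auto. Qed.

Lemma CSeries_ext a b : (forall n, a n = b n) -> CSeries a = CSeries b.
Proof. intros H. unfold CSeries. f_equal; apply Series_ext; intros; now rewrite H. Qed.

Lemma Cser_plus a b l m : Cser a l -> Cser b m -> Cser (fun n => (a n + b n)%C) (l + m).
Proof.
  intros Ha Hb. apply (Clim_ext (fun n => (Csum a n + Csum b n)%C)).
  - intros; now rewrite Csum_plus.
  - now apply Clim_plus.
Qed.

Lemma Cser_scal c a l : Cser a l -> Cser (fun n => (c * a n)%C) (c * l).
Proof.
  intros Ha. apply (Clim_ext (fun n => (c * Csum a n)%C)).
  - intros; now rewrite Csum_scal.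
  - now apply Clim_scal.
Qed.

Lemma is_lim_seq_Cmod u l : Clim u l -> is_lim_seq (fun n => Cmod (u n)) (Cmod l).
Proof.
  intros H. apply is_lim_seq_spec. intros eps. rewrite Clim_eps in H.
  destruct (H eps (cond_pos eps)) as [N HN]; exists N; intros n Hn. specialize (HN n Hn).
  eapply Rle_lt_trans; [|exact HN]. apply Rabs_le.
  assert (Cmod (u n) <= Cmod (u n - l)%C + Cmod l).
  { replace (u n) with ((u n - l) + l)%C at 1 by ring. apply Cmod_triangle. }
  assert (Cmod l <= Cmod (u n - l)%C + Cmod (u n)); [|lra].
  rewrite <- (Cmod_opp (u n - l)%C).
  replace l with (- (u n - l) + u n)%C at 1 by ring. apply Cmod_triangle.
Qed.

Lemma CSeries_tail a b n : (forall n, Cmod (a n) <= b n) -> ex_series b ->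
  Cmod (CSeries a - Csum a n)%C <= Series b - Rsum b n.
Proof.
  intros H Hb.
  apply (is_lim_seq_le (fun k => Cmod (Csum a (n + k)%nat - Csum a n)%C) (fun k => Rsum b (n + k)%nat - Rsum b n)
     (Finite _) (Finite _)).
  - intros k. rewrite Csum_add, Rsum_add.
    replace (Csum a n + Csum (fun i => a (n + i)%nat) k - Csum a n)%C with (Csum (fun i => a (n + i)%nat) k) by ring.
    replace (Rsum b n + Rsum (fun i => b (n + i)%nat) k - Rsum b n) with (Rsum (fun i => b (n + i)%nat) k) by ring.
    now apply Csum_bound.
  - apply (is_lim_seq_Cmod (fun k => (Csum a (n + k)%nat - Csum a n)%C)).
    apply (Clim_minus (fun k => Csum a (n + k)%nat) (fun _ => Csum a n)); [|apply Clim_const].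
    pose proof (CSeries_conv a b H Hb) as HC.
    apply (is_lim_seq_incr_n _ n) in HC. eapply is_lim_seq_ext; [|exact HC].
    intros k. simpl. now rewrite Nat.add_comm.
  - apply is_lim_seq_minus'; [|apply is_lim_seq_const].
    pose proof (Series_Rsum b Hb) as HC. apply (is_lim_seq_incr_n _ n) in HC.
    eapply is_lim_seq_ext; [|exact HC]. intros k. simpl. now rewrite Nat.add_comm.
Qed.

Lemma CSeries_bound a b : (forall n, Cmod (a n) <= b n) -> ex_series b ->
  Cmod (CSeries a) <= Series b.
Proof.
  intros H Hb. pose proof (CSeries_tail a b 0 H Hb) as K. simpl in K.
  replace (CSeries a) with (CSeries a - 0)%C by ring. lra.
Qed.

Lemma Rsum_tail_lim b : ex_series b -> is_lim_seq (fun n => Series b - Rsum b n) 0.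
Proof.
  intros H. replace 0 with (Series b - Series b) by ring.
  apply is_lim_seq_minus'; [apply is_lim_seq_const|now apply Series_Rsum].
Qed.

(** Cutting row [m] at [N] costs at most [u m] times the tail of [v]; summed over the rows, the
    error is at most [Series u] times that tail. *)
Lemma Fubini_square a u v : (forall m n, Cmod (a m n) <= u m * v n) ->
  (forall m, 0 <= u m) -> (forall n, 0 <= v n) -> ex_series u -> ex_series v ->
  Clim (fun N => Csum (fun m => Csum (a m) N) N) (CSeries (fun m => CSeries (a m))).
Proof.
  intros H Hu Hv Eu Ev.
  assert (Er : Cser (fun m => CSeries (a m)) (CSeries (fun m => CSeries (a m)))).
  { apply CSeries_conv with (fun m => Series v * u m).
    - intros m. rewrite Rmult_comm, <- Series_scal_l. apply CSeries_bound; auto.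
      now apply ex_series_scal_R.
    - now apply ex_series_scal_R. }
  assert (Ed : Clim (fun N => Csum (fun m => (CSeries (a m) - Csum (a m) N)%C) N) 0).
  { apply (is_lim_seq_0_le _ (fun N => Series u * (Series v - Rsum v N))).
    - intros N; split; [apply Cmod_ge_0|].
      replace (Csum (fun m => (CSeries (a m) - Csum (a m) N)%C) N - 0)%C with
        (Csum (fun m => (CSeries (a m) - Csum (a m) N)%C) N) by ring.
      assert (0 <= Series v - Rsum v N) by (pose proof (Rsum_le_Series v N Ev Hv); lra).
      apply Rle_trans with (Rsum (fun m => (Series v - Rsum v N) * u m) N).
      + apply Csum_bound. intros m _.
        eapply Rle_trans; [apply CSeries_tail with (b := fun n => u m * v n); auto|].
        * now apply ex_series_scal_R.
        * rewrite Series_scal_l, Rsum_scal. right; ring.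
      + rewrite Rsum_scal, Rmult_comm. apply Rmult_le_compat_r; auto.
        now apply Rsum_le_Series.
    - replace 0 with (Series u * 0) by ring.
      now apply (is_lim_seq_scal_l _ _ 0), Rsum_tail_lim. }
  pose proof (Clim_minus _ _ _ _ Er Ed) as L.
  replace (CSeries (fun m => CSeries (a m)) - 0)%C with (CSeries (fun m => CSeries (a m))) in L by ring.
  eapply Clim_ext; [|exact L]. intros N. cbv beta.
  rewrite (Csum_ext (fun m => (CSeries (a m) - Csum (a m) N)%C) (fun m => (CSeries (a m) + (-(1)) * Csum (a m) N)%C))
    by (intros; ring).
  rewrite Csum_plus, Csum_scal. ring.
Qed.

(** The square partial sums are finite, so their order is immaterial, and both iterated sums are
    their limit. *)
Lemma Fubini a u v : (forall m n, Cmod (a m n) <= u m * v n) ->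
  (forall m, 0 <= u m) -> (forall n, 0 <= v n) -> ex_series u -> ex_series v ->
  CSeries (fun m => CSeries (a m)) = CSeries (fun n => CSeries (fun m => a m n)).
Proof.
  intros H Hu Hv Eu Ev.
  eapply Clim_unique; [eapply (Fubini_square a u v); eauto|].
  eapply Clim_ext; [|eapply (Fubini_square (fun n m => a m n) v u); eauto].
  - intros N. apply Csum_swap.
  - intros; rewrite Rmult_comm; auto.
Qed.

(** Dominated convergence for sums whose number of terms [K N] grows: beyond a fixed cut-off both
    the sums and the limit series are controlled by a tail of [b], and below it finitely many terms
    converge. *)
Lemma Tannery (a : nat -> nat -> C) (b : nat -> R) (c : nat -> C) (K : nat -> nat) :
  eventually (fun N => forall n, (n < K N)%nat -> Cmod (a N n) <= b n) ->
  (forall n, 0 <= b n) -> ex_series b ->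
  (forall n, Clim (fun N => a N n) (c n)) ->
  (forall n, Cmod (c n) <= b n) ->
  (forall M, eventually (fun N => (M <= K N)%nat)) ->
  Clim (fun N => Csum (a N) (K N)) (CSeries c).
Proof.
  intros [N0 Hd] Hb Eb Hc Hcb HK. apply Clim_eps. intros eps He.
  pose proof (proj1 (is_lim_seq_0_iff _) (Rsum_tail_lim b Eb) (eps/3)) as [M HM]; [lra|].
  specialize (HM M (Nat.le_refl _)).
  assert (HM' : Series b - Rsum b M < eps / 3).
  { eapply Rle_lt_trans; [apply Rle_abs|exact HM]. }
  assert (HL : Clim (fun N => Csum (a N) M) (Csum c M)).
  { clear HM HM'. induction M as [|M IH]; [apply (Clim_const 0)|]. simpl.
    apply (Clim_plus (fun N => Csum (a N) M) (fun N => a N M)); auto. }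
  rewrite Clim_eps in HL. destruct (HL (eps/3)) as [N1 HN1]; [lra|].
  destruct (HK M) as [N2 HN2].
  exists (max N0 (max N1 N2)). intros N HN.
  specialize (HN1 N ltac:(lia)). specialize (HN2 N ltac:(lia)). specialize (Hd N ltac:(lia)).
  pose proof (CSeries_tail c b M Hcb Eb) as T1.
  assert (T2 : Cmod (Csum (a N) (K N) - Csum (a N) M)%C <= Series b - Rsum b M).
  { replace (K N) with (M + (K N - M))%nat by lia. rewrite Csum_add.
    match goal with |- Cmod ?z <= _ => replace z with (Csum (fun i => a N (M + i)%nat) (K N - M)) by ring end.
    apply Rle_trans with (Rsum (fun i => b (M + i)%nat) (K N - M)).
    - apply Csum_bound. intros i Hi. apply Hd. lia.
    - pose proof (Rsum_le_Series b (M + (K N - M)) Eb Hb) as Q. rewrite Rsum_add in Q. lra. }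
  replace (Csum (a N) (K N) - CSeries c)%C with
    ((Csum (a N) (K N) - Csum (a N) M) + (Csum (a N) M - Csum c M) + - (CSeries c - Csum c M))%C by ring.
  eapply Rle_lt_trans; [apply Cmod_triangle|]. rewrite Cmod_opp.
  eapply Rle_lt_trans; [apply Rplus_le_compat_r, Cmod_triangle|]. lra.
Qed.

(** Telescoping: the partial sum up to [1 / n^2] is at most [2 - 1 / n]. *)
Lemma ex_series_inv_sq : ex_series (fun n => / INR (S n) ^ 2).
Proof.
  apply ex_series_bounded with 2.
  - intros n. apply Rlt_le, Rinv_0_lt_compat, pow_lt, lt_0_INR; lia.
  - assert (H : forall n, Rsum (fun n => / INR (S n) ^ 2) (S n) <= 2 - / INR (S n)).
    { induction n as [|n IH]; [simpl; lra|].
      change (Rsum (fun n => / INR (S n) ^ 2) (S (S n))) with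
        (Rsum (fun n => / INR (S n) ^ 2) (S n) + / INR (S (S n)) ^ 2).
      eapply Rle_trans; [apply Rplus_le_compat_r, IH|].
      rewrite (S_INR (S n)). assert (0 < INR (S n)) by (apply lt_0_INR; lia).
      set (t := INR (S n)) in *.
      assert (/ t - / (t + 1) - / (t + 1) ^ 2 = / (t * (t + 1) ^ 2)) by (field; lra).
      assert (0 < / (t * (t + 1) ^ 2)) by (apply Rinv_0_lt_compat; nra).
      lra. }
    intros [|n]; [simpl; lra|]. specialize (H n).
    assert (0 < / INR (S n)) by (apply Rinv_0_lt_compat, lt_0_INR; lia). lra.
Qed.

(** Bernoulli's inequality for [(1 + h)^n] with [1 + h = / s]. *)
Lemma INR_pow_geom_bounded s : 0 < s < 1 -> exists B, 0 < B /\ forall n, INR n * s ^ n <= B.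
Proof.
  intros Hs. set (h := / s - 1). assert (Hh : 0 < h).
  { unfold h. assert (1 < / s); [|lra]. rewrite <- Rinv_1. apply Rinv_lt_contravar; lra. }
  exists (/ h). split; [now apply Rinv_0_lt_compat|]. intros n.
  pose proof (poly n h Hh) as P. replace (1 + h) with (/ s) in P by (unfold h; ring).
  rewrite pow_inv in P. pose proof (pow_lt s n ltac:(lra)) as Q.
  apply Rmult_le_reg_r with h; auto. rewrite Rinv_l by lra.
  apply Rmult_le_compat_r with (r := s ^ n) in P; [|lra].
  rewrite Rinv_l in P by lra. nra.
Qed.

(** With [r = s * s], one factor [s ^ n] absorbs one factor [INR n], and the other keeps the series
    convergent in the induction on [k]. *)
Lemma ex_series_pow_geom k r : 0 <= r < 1 -> ex_series (fun n => INR n ^ k * r ^ n).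
Proof.
  revert r. induction k as [|k IH]; intros r Hr.
  - apply (ex_series_ext (fun n => r ^ n)); [intros; simpl; symmetry; apply Rmult_1_l|].
    apply ex_series_geom. rewrite Rabs_right; lra.
  - destruct (Req_dec_T r 0) as [->|N].
    { apply ex_series_bounded with 0.
      - intros n. apply Rmult_le_pos; apply pow_le; [apply pos_INR|lra].
      - induction n as [|n IHn]; simpl; [lra|]. destruct n; simpl in *; lra. }
    set (s := sqrt r). assert (Hs : s * s = r) by (apply sqrt_sqrt; lra).
    assert (H0 : 0 < s) by (apply sqrt_lt_R0; lra).
    assert (H1 : s < 1) by nra.
    destruct (INR_pow_geom_bounded s (conj H0 H1)) as [B [HB HB']].
    apply (ex_series_le_nonneg _ (fun n => B * (INR n ^ k * s ^ n))).
    + intros n. pose proof (pos_INR n). pose proof (pow_le _ k H). pose proof (pow_lt s n H0).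
      split; [apply Rmult_le_pos; [now apply pow_le|apply pow_le; lra]|].
      rewrite <- Hs, Rpow_mult_distr. simpl. specialize (HB' n).
      replace (INR n * INR n ^ k * (s ^ n * s ^ n)) with ((INR n * s ^ n) * (INR n ^ k * s ^ n)) by ring.
      apply Rmult_le_compat_r; auto. apply Rmult_le_pos; lra.
    + apply ex_series_scal_R, IH. lra.
Qed.

Lemma ex_series_pow_geom_S k r : 0 <= r < 1 -> ex_series (fun n => INR (S n) ^ k * r ^ S n).
Proof.
  intros Hr. apply (ex_series_incr_1 (fun n => INR n ^ k * r ^ n)). now apply ex_series_pow_geom.
Qed.

(** * The exponential and the nome *)

Lemma Ccont_real_Re (f : R -> R) z : continuous f (Re z) -> Ccont (fun w => RtoC (f (Re w))) z.
Proof.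
  intros H eps He. apply continuity_pt_filterlim in H.
  destruct (H eps He) as [d [Hd K]]. exists d; split; auto. intros w Hw.
  rewrite <- RtoC_minus, Cmod_R. destruct (Req_dec_T (Re z) (Re w)) as [E|N].
  - rewrite <- E, Rminus_diag, Rabs_R0; lra.
  - apply (K (Re w)). split; [split; [easy|auto]|]. simpl. unfold Rdist.
    eapply Rle_lt_trans; [|exact Hw].
    eapply Rle_trans; [|apply re_le_Cmod]. right; f_equal.
Qed.

Lemma Ccont_real_Im (f : R -> R) z : continuous f (Im z) -> Ccont (fun w => RtoC (f (Im w))) z.
Proof.
  intros H eps He. apply continuity_pt_filterlim in H.
  destruct (H eps He) as [d [Hd K]]. exists d; split; auto. intros w Hw.
  rewrite <- RtoC_minus, Cmod_R. destruct (Req_dec_T (Im z) (Im w)) as [E|N].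
  - rewrite <- E, Rminus_diag, Rabs_R0; lra.
  - apply (K (Im w)). split; [split; [easy|auto]|]. simpl. unfold Rdist.
    eapply Rle_lt_trans; [|exact Hw].
    eapply Rle_trans; [|apply im_le_Cmod]. right; f_equal.
Qed.

Lemma Cexp_plus a b : Cexp (a + b)%C = (Cexp a * Cexp b)%C.
Proof.
  destruct a as [a1 a2], b as [b1 b2]. unfold Cexp, Cmult; simpl.
  rewrite exp_plus, cos_plus, sin_plus. f_equal; ring.
Qed.

Lemma Cexp_0 : Cexp 0 = 1.
Proof. unfold Cexp; simpl. rewrite exp_0, cos_0, sin_0. unfold RtoC; f_equal; ring. Qed.

Lemma Cexp_cont z : Ccont Cexp z.
Proof.
  assert (H : Ccont (fun w => RtoC (exp (Re w)) * (RtoC (cos (Im w)) + Ci * RtoC (sin (Im w))))%C z).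
  { apply Ccont_mult; [apply Ccont_real_Re|apply Ccont_plus; [|apply Ccont_mult]].
    - apply continuous_exp.
    - apply Ccont_real_Im, continuous_cos.
    - apply Ccont_const.
    - apply Ccont_real_Im, continuous_sin. }
  intros eps He. destruct (H eps He) as [d [Hd K]]. exists d; split; auto. intros w Hw.
  specialize (K w Hw). revert K.
  assert (E : forall u, Cexp u = (RtoC (exp (Re u)) * (RtoC (cos (Im u)) + Ci * RtoC (sin (Im u))))%C).
  { intros u. unfold Cexp, Cmult, Cplus, Ci, RtoC; simpl. f_equal; ring. }
  now rewrite !E.
Qed.

Lemma Cexp_path h t : Pdiff (fun s => Cexp (RtoC s * h)%C) t (h * Cexp (RtoC t * h))%C.
Proof.
  destruct h as [a b]. apply Pdiff_intro; unfold Cexp; simpl.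
  - auto_derive; [easy|]. unfold Rminus; ring.
  - auto_derive; [easy|]. unfold Rminus; ring.
Qed.

(** [exp h - 1 - h] is the integral of [h (exp (t h) - 1)] over [t] in [0, 1], and this integrand is
    small by continuity of [Cexp] at 0. *)
Lemma Cexp_near_0 eps : 0 < eps -> exists d, 0 < d /\
  forall h, Cmod h < d -> Cmod (Cexp h - 1 - h)%C <= eps * Cmod h.
Proof.
  intros He. destruct (Cexp_cont 0 eps He) as [d [Hd K]]. exists d; split; auto. intros h Hh.
  replace (eps * Cmod h) with ((1 - 0) * (eps * Cmod h)) by ring.
  apply (is_CInt_bound (fun t => (h * Cexp (RtoC t * h) + (- h))%C)); [lra| |].
  - intros t Ht. replace (h * Cexp (RtoC t * h) + - h)%C with ((Cexp (RtoC t * h) - 1) * h)%C by ring.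
    rewrite Cmod_mult. apply Rmult_le_compat_r; [apply Cmod_ge_0|].
    rewrite <- Cexp_0. apply Rlt_le, K.
    replace (RtoC t * h - 0)%C with (RtoC t * h)%C by ring.
    rewrite Cmod_mult, Cmod_R, Rabs_right by lra.
    pose proof (Cmod_ge_0 h). nra.
  - replace (Cexp h - 1 - h)%C with ((Cexp (RtoC 1 * h) + RtoC 1 * (- h)) - (Cexp (RtoC 0 * h) + RtoC 0 * (- h)))%C.
    2: { replace (RtoC 0 * h)%C with (RtoC 0) by ring. rewrite Cexp_0, !Cmult_1_l. ring. }
    apply (CInt_FTC (fun t => (Cexp (RtoC t * h) + RtoC t * (- h))%C)); intros t _.
    + destruct (Cexp_path h t) as (p & P1 & P2 & e & He' & P3).
      exists (fun s => (p s + - h)%C). split; [|split].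
      * apply Rcont_plus; auto. apply Rcont_const.
      * rewrite <- P2. ring.
      * exists e; split; auto. intros s Hs. specialize (P3 s Hs).
        transitivity ((Cexp (RtoC s * h) - Cexp (RtoC t * h)) + RtoC (s - t) * - h)%C.
        { rewrite RtoC_minus; ring. }
        rewrite P3. ring.
    + apply Rcont_plus; [|apply Rcont_const]. apply Rcont_mult; [apply Rcont_const|].
      apply (Pdiff_cont _ _ _ (Cexp_path h t)).
Qed.

Lemma Cdiff_intro f z l :
  (forall eps, 0 < eps -> exists d, 0 < d /\ forall h, Cmod h < d ->
     Cmod (f (z + h) - f z - l * h)%C <= eps * Cmod h) -> Cdiff f z l.
Proof.
  intros H.
  exists (fun w => if Ceq_dec w z then l else ((f w - f z) / (w - z))%C).
  split; [|split].
  - intros eps He. destruct (H (eps/2)) as [d [Hd K]]; [lra|].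
    exists d; split; auto. intros w Hw.
    destruct (Ceq_dec z z) as [_|N]; [|now elim N].
    destruct (Ceq_dec w z) as [->|N].
    { replace (l - l)%C with (RtoC 0) by ring. rewrite Cmod_0; lra. }
    specialize (K (w - z)%C Hw). replace (z + (w - z))%C with w in K by ring.
    assert (N' : (w - z <> 0)%C) by now apply Cminus_eq_contra.
    replace ((f w - f z) / (w - z) - l)%C with ((f w - f z - l * (w - z)) / (w - z))%C by (field; auto).
    rewrite Cmod_div by auto. pose proof (proj1 (Cmod_gt_0 _) N').
    apply Rle_lt_trans with (eps/2); [|lra].
    apply Rmult_le_reg_r with (Cmod (w - z)); auto.
    unfold Rdiv at 1. rewrite Rmult_assoc, Rinv_l by lra. lra.
  - destruct (Ceq_dec z z) as [_|N]; [easy|now elim N].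
  - exists 1; split; [lra|]. intros w _. destruct (Ceq_dec w z) as [->|N]; [ring|].
    field. now apply Cminus_eq_contra.
Qed.

Lemma Cexp_diff z : Cdiff Cexp z (Cexp z).
Proof.
  apply Cdiff_intro. intros eps He.
  destruct (Cexp_near_0 (eps / (Cmod (Cexp z) + 1))) as [d [Hd K]].
  { apply Rdiv_lt_0_compat; auto. pose proof (Cmod_ge_0 (Cexp z)); lra. }
  exists d; split; auto. intros h Hh. specialize (K h Hh).
  rewrite Cexp_plus.
  replace (Cexp z * Cexp h - Cexp z - Cexp z * h)%C with (Cexp z * (Cexp h - 1 - h))%C by ring.
  rewrite Cmod_mult. pose proof (Cmod_ge_0 (Cexp z)). pose proof (Cmod_ge_0 h).
  set (m := Cmod (Cexp z)) in *.
  apply Rle_trans with (m * (eps / (m + 1) * Cmod h)); [now apply Rmult_le_compat_l|].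
  replace (eps * Cmod h) with ((m + 1) * (eps / (m + 1) * Cmod h)) by (field; lra).
  apply Rmult_le_compat_r; [|lra]. apply Rmult_le_pos; auto.
  apply Rlt_le, Rdiv_lt_0_compat; lra.
Qed.

Lemma nome_plus a b : nome (a + b)%C = (nome a * nome b)%C.
Proof. unfold nome. rewrite <- Cexp_plus. f_equal. ring. Qed.

Lemma nome_0 : nome 0 = 1.
Proof. unfold nome. rewrite <- Cexp_0. f_equal. ring. Qed.

Lemma nome_expand z : nome z = (exp (- (2 * PI * Im z)) * cos (2 * PI * Re z), exp (- (2 * PI * Im z)) * sin (2 * PI * Re z)).
Proof.
  unfold nome, Cexp. destruct z as [x y].
  replace (2 * PI * Ci * (x, y))%C with ((- (2 * PI * y), 2 * PI * x) : C).
  - reflexivity.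
  - unfold Cmult, Ci, RtoC; simpl. f_equal; ring.
Qed.

Lemma nome_half : nome (/ 2)%C = (- (1))%C.
Proof.
  rewrite nome_expand. replace (/ 2)%C with (RtoC (/2)) by (rewrite RtoC_inv; [auto|lra]).
  simpl. replace (2 * PI * / 2) with PI by field. rewrite Rmult_0_r, Ropp_0, exp_0, cos_PI, sin_PI.
  unfold Copp, RtoC; simpl; f_equal; ring.
Qed.

Lemma nome_1 : nome 1 = 1.
Proof.
  replace (RtoC 1) with (/2 + /2)%C at 1 by field. rewrite nome_plus, nome_half. ring.
Qed.

Lemma nome_mod z : Cmod (nome z) = exp (- (2 * PI * Im z)).
Proof.
  rewrite nome_expand. unfold Cmod; simpl fst; simpl snd.
  set (E := exp _). set (t := 2 * PI * Re z).
  replace ((E * cos t)^2 + (E * sin t)^2) with (E^2 * (Rsqr (sin t) + Rsqr (cos t))) by (unfold Rsqr; ring).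
  rewrite sin2_cos2, Rmult_1_r. replace (E^2) with (Rsqr E) by (unfold Rsqr; ring).
  apply sqrt_Rsqr. apply Rlt_le, exp_pos.
Qed.

Lemma nome_mod_lt_1 z : upper_half z -> Cmod (nome z) < 1.
Proof.
  unfold upper_half; intros H. rewrite nome_mod, <- exp_0. apply exp_increasing.
  pose proof PI_RGT_0. nra.
Qed.

Lemma nome_mod_le_1 z : 0 <= Im z -> Cmod (nome z) <= 1.
Proof.
  intros H. rewrite nome_mod, <- exp_0. destruct H as [H|<-].
  - apply Rlt_le, exp_increasing. pose proof PI_RGT_0. nra.
  - rewrite Rmult_0_r, Ropp_0. lra.
Qed.

Lemma nome_neq_0 z : nome z <> 0.
Proof. apply Cmod_gt_0. rewrite nome_mod. apply exp_pos. Qed.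

Lemma nome_mult_nat n z : nome (RtoC (INR n) * z)%C = (nome z ^ n)%C.
Proof.
  induction n as [|n IH].
  - simpl. replace (RtoC 0 * z)%C with (RtoC 0) by ring. apply nome_0.
  - rewrite S_INR, RtoC_plus. replace ((INR n + 1) * z)%C with (z + INR n * z)%C by ring.
    rewrite nome_plus, IH. easy.
Qed.

Lemma nome_nat n : nome (RtoC (INR n)) = 1.
Proof. replace (RtoC (INR n)) with (INR n * 1)%C by ring. rewrite nome_mult_nat, nome_1. apply Cpow_1_l. Qed.

Lemma nome_shift_nat n z : nome (z + RtoC (INR n))%C = nome z.
Proof. rewrite nome_plus, nome_nat. ring. Qed.

Lemma nome_diff z : Cdiff nome z (2 * PI * Ci * nome z)%C.
Proof.
  replace (2 * PI * Ci * nome z)%C with (nome z * (0 * z + (2 * PI * Ci) * 1))%C by ring.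
  apply (Cdiff_comp Cexp (fun z => (2 * PI * Ci * z)%C)).
  - apply (Cdiff_mult (fun _ => (2 * PI * Ci)%C) (fun z => z)); [apply Cdiff_const|apply Cdiff_id].
  - apply Cexp_diff.
Qed.

(** In [|1 - r e^(i t)|^2 = (1 - r)^2 + 2 r (1 - cos t)] the two summands control [Im w] and [Re w].
    The strip [|Re w| <= 9/16] contains no zero of [1 - nome] other than 0; the margin beyond 1/2
    accommodates the real part of [z] in [onesided_lim]. *)
Lemma one_minus_nome_lower : exists c, 0 < c /\ forall w, 0 <= Im w <= 1 -> Rabs (Re w) <= 9/16 ->
  c * Cmod w <= Cmod (1 - nome w)%C.
Proof.
  (* A lower bound for the modulus of [nome w], as [2 PI y <= 8]. *)
  set (r0 := exp (-8)). assert (H0 : 0 < r0) by apply exp_pos.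
  assert (H1 : r0 < 1) by (unfold r0; rewrite <- exp_0; apply exp_increasing; lra).
  exists (r0 / 2). split; [lra|]. intros w Hy Hx.
  destruct w as [x y]; simpl in Hy, Hx.
  rewrite nome_expand; simpl Re; simpl Im.
  assert (PI3 : 3 <= PI) by (pose proof PI2_3_2; lra). pose proof PI_4 as PI4.
  set (r := exp (- (2 * PI * y))). set (t := 2 * PI * x).
  assert (Hr0 : r0 <= r).
  { unfold r0, r. destruct (Req_dec_T (-8) (-(2*PI*y))) as [->|N]; [lra|].
    apply Rlt_le, exp_increasing. assert (2 * PI * y <= 8) by nra. lra. }
  assert (Hr1 : r0 * y <= 1 - r).
  { pose proof (exp_ineq1_le (2 * PI * y)) as H.
    assert (r * exp (2 * PI * y) = 1).
    { unfold r. rewrite <- exp_plus, <- exp_0. f_equal; ring. }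
    assert (0 < r) by apply exp_pos.
    assert (r * (1 + 2 * PI * y) <= 1) by nra.
    assert (y <= 2 * PI * y) by nra.
    assert (r0 * y <= r * (2 * PI * y)) by (apply Rmult_le_compat; lra). lra. }
  (* With [PI <= 4] the argument is at most 9/4, where [sin v >= v (1 - v^2 / 6)] leaves a factor of
     at least 1 - 81/96. *)
  assert (Hs : 0.16 * x ^ 2 <= sin (PI * x) ^ 2).
  { assert (G : forall u, 0 <= u <= 9/16 -> 0.4 * u <= sin (PI * u)).
    { intros u Hu. assert (0 <= PI * u <= 9/4) by nra.
      pose proof (sin_bound (PI * u) 0) as [B _]; [lra|lra|].
      unfold sin_approx in B; simpl in B. unfold sin_term in B; simpl in B.
      assert (E : (PI * u) ^ 2 <= 81/16) by nra.
      assert (PI * u * (1 - (PI*u)^2/6) <= sin (PI * u)) by lra.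
      assert (PI * u * (1 - 81/96) <= PI * u * (1 - (PI*u)^2/6)) by (apply Rmult_le_compat_l; lra).
      assert (3 * u <= PI * u) by nra. lra. }
    apply Rabs_le_between in Hx. destruct (Rle_dec 0 x).
    - specialize (G x ltac:(lra)). nra.
    - specialize (G (-x) ltac:(lra)). replace (PI * - x) with (- (PI * x)) in G by ring.
      rewrite sin_neg in G. nra. }
  assert (Hc : cos t = 1 - 2 * sin (PI * x) ^ 2).
  { unfold t. replace (2 * PI * x) with (2 * (PI * x)) by ring. rewrite cos_2a_sin. ring. }
  pose proof (sin2_cos2 t) as Hsc. unfold Rsqr in Hsc.
  unfold Cmod. simpl fst; simpl snd.
  replace (r0 / 2) with (sqrt ((r0/2)^2)).
  2: { replace ((r0/2)^2) with (Rsqr (r0/2)) by (unfold Rsqr; ring). apply sqrt_Rsqr; lra. }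
  rewrite <- sqrt_mult by nra. apply sqrt_le_1_alt.
  replace ((1 + - (r * cos t)) ^ 2 + (0 + - (r * sin t)) ^ 2) with
    ((1 - r)^2 + 2 * r * (1 - cos t) + r^2 * (sin t * sin t + cos t * cos t - 1)) by ring.
  rewrite Hsc, Hc.
  assert (r0^2 * y^2 <= (1-r)^2).
  { replace (r0^2*y^2) with ((r0*y)^2) by ring. apply pow_incr. split; [nra|lra]. }
  assert (r0^2 * x^2 * 0.16 <= r * sin (PI * x)^2).
  { apply Rle_trans with (r0 * (0.16 * x^2)); [|apply Rmult_le_compat; nra]. nra. }
  nra.
Qed.

(** * Modularity of the Eisenstein series *)

(** The imaginary part of [Cconj z * (z + r)] is [- (Im z * r)], while its modulus is
    [|z| |z + r|]. *)
Lemma Cmod_plus_real_lower z (r : R) : upper_half z ->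
  Im z / Cmod z * Rabs r <= Cmod (z + RtoC r)%C.
Proof.
  unfold upper_half. intros Hz.
  assert (Hm : 0 < Cmod z).
  { eapply Rlt_le_trans; [|apply im_le_Cmod]. rewrite Rabs_right; lra. }
  apply Rmult_le_reg_l with (Cmod z); auto.
  replace (Cmod z * (Im z / Cmod z * Rabs r)) with (Im z * Rabs r) by (field; lra).
  rewrite <- Cmod_mult. destruct z as [x y]. simpl in *.
  replace (y * Rabs r) with (Rabs (Im (Cconj (x, y) * ((x, y) + RtoC r))%C)).
  2: { simpl. replace (x * (y + 0) + - y * (x + r)) with (- (y * r)) by ring.
       rewrite Rabs_Ropp, Rabs_mult, (Rabs_right y); lra. }
  eapply Rle_trans; [apply im_le_Cmod|]. rewrite !Cmod_mult.
  rewrite Cmod_conj; lra.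
Qed.

Lemma pow2_unbounded M : exists N, forall n, (N <= n)%nat -> M <= 2 ^ n.
Proof.
  destruct (Pow_x_infinity 2 ltac:(rewrite Rabs_right; lra) M) as [N HN].
  exists N. intros n Hn. specialize (HN n Hn). rewrite Rabs_right in HN; [lra|].
  apply Rle_ge, pow_le; lra.
Qed.

Lemma INR_pow2 n : INR (2 ^ n) = 2 ^ n.
Proof. rewrite pow_INR. easy. Qed.

Lemma Clim_div_pow2 z : Clim (fun N => (z / RtoC (2 ^ S N))%C) 0.
Proof.
  apply Clim_eps. intros eps He.
  destruct (pow2_unbounded (Cmod z / eps + 1)) as [N HN]. exists N. intros n Hn.
  specialize (HN (S n) ltac:(lia)).
  assert (0 < 2 ^ S n) by (apply pow_lt; lra).
  replace (z / RtoC (2 ^ S n) - 0)%C with (z / RtoC (2 ^ S n))%C by ring.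
  rewrite Cmod_div, Cmod_R, Rabs_right by (try (intros E; apply RtoC_inj in E); lra).
  apply Rmult_lt_reg_r with (2 ^ S n); auto.
  unfold Rdiv at 1. rewrite Rmult_assoc, Rinv_l, Rmult_1_r by lra.
  apply Rlt_le_trans with (eps * (Cmod z / eps + 1)).
  - replace (eps * (Cmod z / eps + 1)) with (Cmod z + eps) by (field; lra). lra.
  - apply Rmult_le_compat_l; lra.
Qed.

Lemma Cdiv_pow (z t : C) k : t <> 0 -> ((z / t) ^ k = z ^ k / t ^ k)%C.
Proof. intros H. unfold Cdiv. rewrite Cpow_mult_l, Cpow_inv by exact H. reflexivity. Qed.

Lemma pow2_neq N : RtoC (2 ^ N) <> 0.
Proof. intros E; apply RtoC_inj in E. pose proof (pow_lt 2 N); lra. Qed.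

Lemma RtoC_neq r : r <> 0 -> RtoC r <> 0.
Proof. intros H E; apply RtoC_inj in E; auto. Qed.

Lemma upper_half_neq_0 z : upper_half z -> z <> 0.
Proof. unfold upper_half; intros H E; rewrite E in H; simpl in H; lra. Qed.

Lemma upper_half_plus_real z r : upper_half z -> upper_half (z + RtoC r)%C.
Proof. unfold upper_half; destruct z; simpl; lra. Qed.

Lemma upper_half_scal r z : 0 < r -> upper_half z -> upper_half (RtoC r * z)%C.
Proof. unfold upper_half; destruct z; simpl; intros. nra. Qed.

Lemma upper_half_div r z : 0 < r -> upper_half z -> upper_half (z / RtoC r)%C.
Proof.
  intros Hr Hz. unfold Cdiv. rewrite Cmult_comm, <- RtoC_inv by lra.
  apply upper_half_scal; auto. now apply Rinv_0_lt_compat.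
Qed.

Lemma nome_neq_1 z : upper_half z -> nome z <> 1.
Proof. intros H E. apply nome_mod_lt_1 in H. rewrite E, Cmod_1 in H. lra. Qed.

Lemma nome_real_neq_1 x : 0 < x < 1 -> nome (RtoC x) <> 1.
Proof.
  intros H E. apply (f_equal Re) in E. rewrite nome_expand in E. simpl in E.
  rewrite Rmult_0_r, Ropp_0, exp_0 in E.
  replace (2 * PI * x) with (2 * (PI * x)) in E by ring. rewrite cos_2a_sin in E.
  assert (0 < sin (PI * x)); [|nra]. pose proof PI_RGT_0. apply sin_gt_0; nra.
Qed.

(** * The Lipschitz formula and the Eisenstein series of weight k *)

Section Weight.
Variables (k : nat) (A P : C -> C) (f a1 : C).
Hypothesis hk : (4 <= k)%nat.
Hypothesis hkeven : forall x : C, ((- x) ^ k = x ^ k)%C.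
Hypothesis hA : forall u : C, u <> 1 -> (A u = P u / (1 - u) ^ k)%C.
Hypothesis hPc : forall u : C, Ccont P u.
Hypothesis hPb : exists M, forall u, Cmod u <= 1 -> Cmod (P u) <= M.
Hypothesis hP1 : P 1 = f.
Hypothesis hdist : forall v : C, v <> 1 -> v <> (-(1))%C -> (A v + A (- v) = 2 ^ k * A (v * v))%C.
Hypothesis ha1 : A (-(1))%C = a1.

(** The limit of [A (nome u) * u ^ k] at 0, which is the constant of the Lipschitz formula. In the
    two applications [f], the value of the numerator at 1, is 3! and 5!. *)
Definition wkappa : C := (f / (2 * PI * Ci) ^ k)%C.

Lemma two_pi_i_neq_0 : (2 * PI * Ci)%C <> 0.
Proof.
  repeat apply Cmult_neq_0; [apply RtoC_neq; lra|apply RtoC_neq; pose proof PI_RGT_0; lra|apply Ci_nz].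
Qed.

(** The pole of order [k] is cancelled: with [nome u - 1 = phi u * u] for the Caratheodory quotient
    [phi], the product is [P (nome u) / (- phi u)^k], which is continuous at 0. *)
Lemma weight_term_lim (u : nat -> C) : (forall N, u N <> 0) -> Clim u 0 ->
  Clim (fun N => (A (nome (u N)) * u N ^ k)%C) wkappa.
Proof.
  intros Hu Lu.
  destruct (nome_diff 0) as (phi & Hphi & Ephi & d & Hd & Dphi).
  rewrite nome_0, Cmult_1_r in Ephi.
  assert (N0 : phi 0 <> 0) by (rewrite Ephi; apply two_pi_i_neq_0).
  destruct (Ccont_nonzero phi 0 Hphi N0) as [d' [Hd' H']].
  apply Clim_ext_loc with (fun N => (P (nome (u N)) * (/ (- phi (u N))) ^ k)%C).
  - rewrite Clim_eps in Lu. destruct (Lu (Rmin d d')) as [N HN]; [now apply Rmin_pos|].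
    exists N. intros n Hn. specialize (HN n Hn).
    specialize (Dphi (u n) (Rlt_le_trans _ _ _ HN (Rmin_l _ _))).
    specialize (H' (u n) (Rlt_le_trans _ _ _ HN (Rmin_r _ _))).
    assert (Np : phi (u n) <> 0).
    { apply Cmod_pos_neq. apply Cmod_gt_0 in N0. lra. }
    rewrite nome_0 in Dphi.
    replace (phi (u n) * (u n - 0))%C with (phi (u n) * u n)%C in Dphi by ring.
    assert (Nn : nome (u n) <> 1).
    { intros E. rewrite E in Dphi. apply (Cmult_neq_0 _ _ Np (Hu n)). rewrite <- Dphi. ring. }
    rewrite hA by auto.
    replace (1 - nome (u n))%C with (- phi (u n) * u n)%C.
    2: { replace (- phi (u n) * u n)%C with (- (phi (u n) * u n))%C by ring. rewrite <- Dphi. ring. }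
    assert (- phi (u n) <> 0)%C.
    { intros E. apply Np. replace (phi (u n)) with (- - phi (u n))%C by ring. rewrite E. ring. }
    rewrite Cpow_mult_l, Cpow_inv by auto.
    pose proof (Cpow_nz _ k (Hu n)). pose proof (Cpow_nz _ k H). field. auto.
  - replace wkappa with (P (nome 0) * (/ (- phi 0)) ^ k)%C.
    + apply (Clim_comp (fun w => (P (nome w) * (/ (- phi w)) ^ k)%C) u); auto.
      apply Ccont_mult.
      * apply (Ccont_comp P nome); auto. eapply Cdiff_cont, nome_diff.
      * apply (Ccont_pow (fun w => (/ (- phi w))%C)).
        apply (Ccont_inv (fun w => (- phi w)%C)); [now apply Ccont_opp|].
        intros E. apply N0. replace (phi 0) with (- - phi 0)%C by ring. rewrite E. ring.
    + rewrite nome_0, hP1, Ephi. unfold wkappa. rewrite Cpow_inv, hkeven.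
      * easy.
      * intros E. apply two_pi_i_neq_0. replace (2 * PI * Ci)%C with (- - (2 * PI * Ci))%C by ring. rewrite E. ring.
Qed.

(** The majorant for the passage to the limit term by term: [P] is bounded on the closed unit disc,
    and [w / (1 - nome w)] on the box of [one_minus_nome_lower]. *)
Lemma weight_term_bound : exists M, 0 <= M /\ forall w, 0 <= Im w <= 1 -> Rabs (Re w) <= 9/16 -> w <> 0 ->
  Cmod (A (nome w) * w ^ k)%C <= M.
Proof.
  destruct hPb as [M HM]. destruct one_minus_nome_lower as [c [Hc H]].
  assert (HM0 : 0 <= M).
  { eapply Rle_trans; [apply Cmod_ge_0|apply (HM 0)]. rewrite Cmod_0; lra. }
  exists (M * (/ c) ^ k). split.
  { apply Rmult_le_pos; auto. apply pow_le, Rlt_le, Rinv_0_lt_compat, Hc. }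
  intros w Hi Hr Hw. specialize (H w Hi Hr).
  pose proof (proj1 (Cmod_gt_0 _) Hw) as Hw'.
  assert (Hn : 0 < Cmod (1 - nome w)%C) by nra.
  assert (N1 : (1 - nome w)%C <> 0) by now apply Cmod_pos_neq.
  assert (N2 : nome w <> 1) by (intros E; apply N1; rewrite E; ring).
  rewrite hA by auto.
  replace (P (nome w) / (1 - nome w) ^ k * w ^ k)%C with (P (nome w) * (w / (1 - nome w)) ^ k)%C.
  2: { rewrite Cdiv_pow by auto. pose proof (Cpow_nz _ k N1). field; auto. }
  rewrite Cmod_mult, Cmod_pow, Cmod_div by auto.
  apply Rmult_le_compat; [apply Cmod_ge_0|apply pow_le, Rmult_le_pos; [lra|apply Rlt_le, Rinv_0_lt_compat, Hn]| |].
  - apply HM, nome_mod_le_1; lra.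
  - apply pow_incr. split; [apply Rmult_le_pos; [lra|apply Rlt_le, Rinv_0_lt_compat, Hn]|].
    apply Rmult_le_reg_r with (Cmod (1 - nome w)); auto.
    unfold Rdiv. rewrite Rmult_assoc, Rinv_l, Rmult_1_r by lra.
    apply Rmult_le_reg_l with c; auto. rewrite <- Rmult_assoc, Rinv_r by lra. lra.
Qed.

(** The points [z + n] and [z - n] with [n = i + 1], for [s = 1] and [s = -1]; the point [z] itself
    is treated apart. *)
Definition spt (z : C) (s : R) (i : nat) : C := (z + RtoC (s * INR (S i)))%C.

Lemma inv_pow_bound (c t x : R) : 0 < c -> 1 <= t -> c * t <= x -> / x ^ k <= (/ c) ^ k * / t ^ 2.
Proof.
  intros Hc Ht Hx.
  assert (0 < c * t) by nra.
  assert ((c * t) ^ k <= x ^ k) by (apply pow_incr; lra).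
  assert (0 < (c * t) ^ k) by (apply pow_lt; lra).
  apply Rle_trans with (/ (c * t) ^ k); [apply Rinv_le_contravar; auto|].
  rewrite Rpow_mult_distr, Rinv_mult, pow_inv. apply Rmult_le_compat_l.
  - apply Rlt_le, Rinv_0_lt_compat, pow_lt, Hc.
  - apply Rinv_le_contravar; [apply pow_lt; lra|]. apply Rle_pow; auto; lia.
Qed.

(** Each term equals [A (nome w) w^k] over [spt z s i ^ k], where [w = spt z s i / 2^(N+1)] tends to
    0, so [Tannery] applies. The lower bound by [c * INR (S i)] is available both in the half-plane
    and at [z = 0], the two cases in which the lemma is used. *)
Lemma onesided_lim z s c : 0 <= Im z -> Rabs s = 1 -> 0 < c ->
  (forall i, c * INR (S i) <= Cmod (spt z s i)) ->
  Clim (fun N => Csum (fun i => (A (nome (spt z s i / RtoC (2 ^ S N))) / RtoC (2 ^ S N) ^ k)%C) (2 ^ N))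
       (CSeries (fun i => (wkappa / spt z s i ^ k)%C)) /\
  ex_series (fun i => Cmod (wkappa / spt z s i ^ k)%C).
Proof.
  intros Hz Hs Hc Hl.
  destruct weight_term_bound as [M [HM0 HM]].
  set (b := fun n => (M + Cmod wkappa) * (/ c) ^ k * / INR (S n) ^ 2).
  assert (HS : forall i, 1 <= INR (S i)) by (intros; rewrite S_INR; pose proof (pos_INR i); lra).
  assert (Hn : forall i, 0 < Cmod (spt z s i)) by (intros i; specialize (Hl i); specialize (HS i); nra).
  assert (Hn' : forall i, spt z s i <> 0) by (intros; apply Cmod_pos_neq; auto).
  assert (Hb : forall n, 0 <= b n).
  { intros n. pose proof (Cmod_ge_0 wkappa). unfold b.
    repeat apply Rmult_le_pos; try lra; [apply pow_le, Rlt_le, Rinv_0_lt_compat, Hc|].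
    apply Rlt_le, Rinv_0_lt_compat, pow_lt. specialize (HS n); lra. }
  assert (Eb : ex_series b) by apply ex_series_scal_R, ex_series_inv_sq.
  assert (Hcb : forall i, Cmod (wkappa / spt z s i ^ k)%C <= b i).
  { intros i. rewrite Cmod_div, Cmod_pow by (apply Cpow_nz; auto).
    unfold b, Rdiv. rewrite Rmult_assoc. apply Rmult_le_compat; [apply Cmod_ge_0| |lra|now apply inv_pow_bound].
    apply Rlt_le, Rinv_0_lt_compat, pow_lt; auto. }
  split.
  2: { apply (ex_series_le_nonneg _ b); auto. intros; split; [apply Cmod_ge_0|auto]. }
  assert (HT : forall N i, (A (nome (spt z s i / RtoC (2 ^ S N))) / RtoC (2 ^ S N) ^ k)%C =
     ((A (nome (spt z s i / RtoC (2 ^ S N))) * (spt z s i / RtoC (2 ^ S N)) ^ k) * / (spt z s i) ^ k)%C).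
  { intros N i. pose proof (pow2_neq (S N)) as E. rewrite Cdiv_pow by auto.
    pose proof (Cpow_nz _ k E). pose proof (Cpow_nz _ k (Hn' i)). field; auto. }
  apply (Tannery _ b); auto.
  (* The 16 gives [|Re z| / 2^(N+1) <= 1/16]; as [n < 2^N], the real part of the scaled point is at
     most 1/16 + 1/2 = 9/16 in absolute value. *)
  - destruct (pow2_unbounded (16 * Rabs (Re z) + Im z)) as [N0 HN0]. exists N0.
    intros N HN n Hn2. specialize (HN0 (S N) ltac:(lia)).
    rewrite HT. rewrite Cmod_mult, Cmod_inv, Cmod_pow by (apply Cpow_nz; auto).
    unfold b. rewrite Rmult_assoc. apply Rmult_le_compat; [apply Cmod_ge_0| | |now apply inv_pow_bound].
    { apply Rlt_le, Rinv_0_lt_compat, pow_lt; auto. }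
    apply Rle_trans with M; [|pose proof (Cmod_ge_0 wkappa); lra].
    assert (H2 : 0 < 2 ^ S N) by (apply pow_lt; lra).
    assert (Hin : INR (S n) <= 2 ^ N) by (rewrite <- INR_pow2; apply le_INR; lia).
    pose proof (Rabs_pos (Re z)).
    assert (Ere : Re (spt z s n / RtoC (2 ^ S N)) = (Re z + s * INR (S n)) / 2 ^ S N).
    { unfold Cdiv, spt. rewrite <- RtoC_inv, re_scal_r by lra. destruct z; simpl; easy. }
    assert (Eim : Im (spt z s n / RtoC (2 ^ S N)) = Im z / 2 ^ S N).
    { unfold Cdiv, spt. rewrite <- RtoC_inv, im_scal_r by lra. destruct z; simpl. now rewrite Rplus_0_r. }
    apply HM.
    + rewrite Eim. split; [apply Rmult_le_pos; [lra|apply Rlt_le, Rinv_0_lt_compat; lra]|].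
      apply Rmult_le_reg_r with (2 ^ S N); auto.
      unfold Rdiv; rewrite Rmult_assoc, Rinv_l by lra. lra.
    + rewrite Ere. unfold Rdiv at 1. rewrite Rabs_mult, (Rabs_right (/ _)) by (apply Rle_ge, Rlt_le, Rinv_0_lt_compat; lra).
      apply Rmult_le_reg_r with (2 ^ S N); auto. rewrite Rmult_assoc, Rinv_l by lra.
      rewrite Rmult_1_r. eapply Rle_trans; [apply Rabs_triang|].
      rewrite Rabs_mult, Hs, (Rabs_right (INR _)) by (apply Rle_ge, pos_INR).
      simpl in HN0 |- *. simpl in Hin. lra.
    + unfold Cdiv. apply Cmult_neq_0; auto. rewrite <- RtoC_inv by lra. apply RtoC_neq.
      apply Rinv_neq_0_compat; lra.
  - intros n. apply (Clim_ext _ _ _ (fun N => eq_sym (HT N n))).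
    apply (Clim_ext (fun N => (/ spt z s n ^ k * (A (nome (spt z s n / RtoC (2 ^ S N))) * (spt z s n / RtoC (2 ^ S N)) ^ k))%C)).
    { intros; ring. }
    replace (wkappa / spt z s n ^ k)%C with (/ spt z s n ^ k * wkappa)%C by (unfold Cdiv; ring).
    apply Clim_scal. apply weight_term_lim; [|apply Clim_div_pow2].
    intros N. unfold Cdiv. apply Cmult_neq_0; auto. pose proof (pow_lt 2 (S N)).
    rewrite <- RtoC_inv by lra. apply RtoC_neq, Rinv_neq_0_compat; lra.
  - intros Mm. destruct (pow2_unbounded (INR Mm)) as [N HN]. exists N. intros n Hn2.
    specialize (HN n Hn2). rewrite <- INR_pow2 in HN. now apply INR_le.
Qed.

(** The values [nome ((z + n) / 2^N)] are the [2^N]-th roots of [nome z]. The root with [n = 0] is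
    left out because for [z = 0] it is 1, the pole of [A]. *)
Definition Ysum (z : C) (N : nat) : C :=
  Csum (fun i => A (nome (spt z 1 i / RtoC (2 ^ N)))) (2 ^ N - 1).

Lemma pow2_pos N : (1 <= 2 ^ N)%nat.
Proof. induction N; simpl; lia. Qed.

Lemma nome_shift_half z N m n : INR m = INR n + 2 ^ N ->
  nome ((z + RtoC (INR m)) / RtoC (2 ^ S N))%C = (- nome ((z + RtoC (INR n)) / RtoC (2 ^ S N)))%C.
Proof.
  intros E.
  replace ((z + RtoC (INR m)) / RtoC (2 ^ S N))%C with ((z + RtoC (INR n)) / RtoC (2 ^ S N) + / 2)%C.
  - rewrite nome_plus, nome_half. ring.
  - rewrite E. simpl pow. rewrite RtoC_plus, RtoC_mult.
    pose proof (pow2_neq N). field; auto.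
Qed.

(** The indices [n] and [n + 2^N] give opposite roots [v] and [- v], so the duplication formula
    [hdist] turns each pair into a term of level [N]; the index [n = 2^N] remains alone. *)
Lemma Ysum_rec z N : (forall n, (1 <= n < 2 ^ N)%nat -> nome ((z + RtoC (INR n)) / RtoC (2 ^ N))%C <> 1) ->
  Ysum z (S N) = (2 ^ k * Ysum z N + A (- nome (z / RtoC (2 ^ S N))))%C.
Proof.
  intros H. unfold Ysum. pose proof (pow2_pos N).
  replace (2 ^ S N - 1)%nat with ((2 ^ N - 1) + S (2 ^ N - 1))%nat by (simpl; lia).
  rewrite Csum_add, Csum_first.
  assert (E1 : A (nome (spt z 1 (2 ^ N - 1 + 0) / RtoC (2 ^ S N)))  = A (- nome (z / RtoC (2 ^ S N)))).
  { f_equal. unfold spt. rewrite Rmult_1_l.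
    rewrite (nome_shift_half z N (S (2 ^ N - 1 + 0)) 0).
    - simpl INR. now rewrite Cplus_0_r.
    - replace (S (2 ^ N - 1 + 0)) with (2 ^ N)%nat by lia. rewrite INR_pow2. simpl; ring. }
  rewrite E1, (Cplus_comm (A _)), Cplus_assoc, <- Csum_plus. f_equal.
  rewrite <- Csum_scal. apply Csum_ext. intros i Hi.
  set (v := nome (spt z 1 i / RtoC (2 ^ S N))).
  assert (Ev : nome (spt z 1 i / RtoC (2 ^ N)) = (v * v)%C).
  { unfold v. rewrite <- nome_plus. f_equal. simpl pow. rewrite RtoC_mult.
    pose proof (pow2_neq N). field; auto. }
  assert (Hv : (v * v <> 1)%C).
  { rewrite <- Ev. unfold spt. rewrite Rmult_1_l. apply H. lia. }
  rewrite Ev, <- hdist.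
  - f_equal. f_equal. unfold v, spt. rewrite !Rmult_1_l. apply nome_shift_half.
    rewrite <- INR_pow2, <- plus_INR. f_equal. lia.
  - intros E; apply Hv; rewrite E; ring.
  - intros E; apply Hv; rewrite E; ring.
Qed.

(** By periodicity [z - n] may be replaced by [z + 2^(N+1) - n]. The indices then run once through
    1, ..., 2^(N+1) - 1, except that [2^N] occurs twice. *)
Lemma twosided_sum z N :
  (Csum (fun i => A (nome (spt z 1 i / RtoC (2 ^ S N)))) (2 ^ N) +
   Csum (fun i => A (nome (spt z (-1) i / RtoC (2 ^ S N)))) (2 ^ N))%C
  = (Ysum z (S N) + A (- nome (z / RtoC (2 ^ S N))))%C.
Proof.
  unfold Ysum. pose proof (pow2_pos N).
  replace (2 ^ S N - 1)%nat with (2 ^ N + (2 ^ N - 1))%nat by (simpl; lia).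
  rewrite Csum_add, <- Cplus_assoc. f_equal.
  replace (2 ^ N)%nat with (S (2 ^ N - 1)) at 1 by lia. simpl Csum at 1.
  assert (G : forall m i, (m + S i = 2 ^ S N)%nat ->
     nome (spt z (-1) i / RtoC (2 ^ S N)) = nome ((z + RtoC (INR m)) / RtoC (2 ^ S N))%C).
  { intros m i E. unfold spt.
    replace ((z + RtoC (INR m)) / RtoC (2 ^ S N))%C with ((z + RtoC (-1 * INR (S i))) / RtoC (2 ^ S N) + RtoC (INR 1))%C.
    - now rewrite nome_shift_nat.
    - assert (E' : INR m = 2 ^ S N + -1 * INR (S i)).
      { rewrite <- INR_pow2, <- E, plus_INR. ring. }
      rewrite E', RtoC_plus. pose proof (pow2_neq (S N)). simpl INR. field. auto. }
  f_equal.
  - rewrite Csum_rev. apply Csum_ext. intros i Hi. f_equal.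
    rewrite (G (S (2 ^ N + i))).
    + unfold spt. now rewrite Rmult_1_l.
    + simpl. lia.
  - f_equal. rewrite (G (2 ^ N)%nat) by (simpl; lia).
    rewrite (nome_shift_half z N (2 ^ N) 0).
    + simpl INR. now rewrite Cplus_0_r.
    + rewrite INR_pow2. simpl; ring.
Qed.

(** [- nome (z / 2^(N+1))] tends to -1, where [A] is continuous, and the denominators tend to
    infinity. *)
Lemma small_term_lim z : Clim (fun N => (A (- nome (z / RtoC (2 ^ S N))) / RtoC (2 ^ S N) ^ k)%C) 0.
Proof.
  assert (HA1 : Ccont (fun w => A (- nome w)%C) 0).
  { apply (Ccont_ext_loc (fun w => (P (- nome w) * / (1 - (- nome w)) ^ k)%C) _ 0 1 Rlt_0_1 ltac:(intros; reflexivity)) || idtac.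
    assert (Hn : Ccont (fun w => (- nome w)%C) 0) by (apply Ccont_opp; eapply Cdiff_cont, nome_diff).
    assert (H1 : Ccont (fun w => (1 - (- nome w))%C) 0).
    { apply (Ccont_plus (fun _ => RtoC 1)); [apply Ccont_const|]. now apply Ccont_opp. }
    assert (N1 : (1 - (- nome 0) <> 0)%C).
    { rewrite nome_0. replace (1 - - (1))%C with (RtoC 2) by ring. apply RtoC_neq; lra. }
    destruct (Ccont_nonzero _ _ H1 N1) as [d [Hd Hnz]].
    apply (Ccont_ext_loc (fun w => (P (- nome w) * / (1 - (- nome w)) ^ k)%C) _ _ d Hd).
    - intros w Hw. specialize (Hnz w Hw). cbv beta in Hnz. rewrite hA; [easy|].
      intros E. rewrite E in Hnz. replace (1 - 1)%C with (RtoC 0) in Hnz by ring.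
      rewrite Cmod_0 in Hnz. apply Cmod_gt_0 in N1. lra.
    - apply Ccont_mult.
      + apply (Ccont_comp P (fun w => (- nome w)%C)); auto.
      + apply (Ccont_inv (fun w => ((1 - (- nome w)) ^ k)%C)).
        * now apply (Ccont_pow (fun w => (1 - (- nome w))%C)).
        * now apply Cpow_nz. }
  pose proof (Clim_comp _ _ _ HA1 (Clim_div_pow2 z)) as L.
  pose proof (is_lim_seq_Cmod _ _ L) as L1.
  assert (L2 : is_lim_seq (fun N => / 2 ^ S N) 0).
  { apply (is_lim_seq_ext (fun N => (/2) ^ S N)); [intros; apply pow_inv|].
    apply (is_lim_seq_incr_1 (fun n => (/2)^n)). apply is_lim_seq_geom. rewrite Rabs_right; lra. }
  apply (is_lim_seq_0_le _ (fun N => Cmod (A (- nome (z / RtoC (2 ^ S N)))) * / 2 ^ S N)).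
  - intros N. split; [apply Cmod_ge_0|].
    match goal with |- Cmod ?u <= _ => replace u with (A (- nome (z / RtoC (2 ^ S N))) / RtoC (2 ^ S N) ^ k)%C by ring end.
    pose proof (pow2_neq (S N)) as E.
    rewrite Cmod_div, Cmod_pow, Cmod_R by now apply Cpow_nz.
    assert (1 <= 2 ^ S N) by (apply pow_R1_Rle; lra).
    rewrite Rabs_right by lra. apply Rmult_le_compat_l; [apply Cmod_ge_0|].
    apply Rinv_le_contravar; [lra|].
    replace (2 ^ S N) with ((2 ^ S N) ^ 1) at 1 by ring. apply Rle_pow; auto; lia.
  - replace 0 with (Cmod (A (- nome 0)) * 0) by ring. now apply is_lim_seq_mult'.
Qed.

Lemma twosided_lim z c : 0 <= Im z -> 0 < c ->
  (forall i, c * INR (S i) <= Cmod (spt z 1 i)) -> (forall i, c * INR (S i) <= Cmod (spt z (-1) i)) ->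
  Clim (fun N => (Ysum z (S N) / RtoC (2 ^ S N) ^ k)%C)
    (CSeries (fun i => (wkappa / spt z 1 i ^ k)%C) + CSeries (fun i => (wkappa / spt z (-1) i ^ k)%C)).
Proof.
  intros Hz Hc H1 H2.
  destruct (onesided_lim z 1 c Hz ltac:(rewrite Rabs_right; lra) Hc H1) as [L1 _].
  destruct (onesided_lim z (-1) c Hz ltac:(rewrite Rabs_left; lra) Hc H2) as [L2 _].
  pose proof (Clim_minus _ _ _ _ (Clim_plus _ _ _ _ L1 L2) (small_term_lim z)) as L.
  match type of L with Clim _ (?x - _)%C => replace (x - 0)%C with x in L by ring end.
  eapply Clim_ext; [|exact L]. intros N. cbv beta.
  unfold Cdiv at 3 5.
  rewrite (Csum_ext _ (fun i => (/ RtoC (2 ^ S N) ^ k * A (nome (spt z 1 i / RtoC (2 ^ S N))))%C))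
    by (intros; unfold Cdiv; ring).
  rewrite (Csum_ext (fun i => (A (nome (spt z (-1) i / RtoC (2 ^ S N))) / RtoC (2 ^ S N) ^ k)%C)
     (fun i => (/ RtoC (2 ^ S N) ^ k * A (nome (spt z (-1) i / RtoC (2 ^ S N))))%C))
    by (intros; unfold Cdiv; ring).
  rewrite !Csum_scal.
  transitivity (/ RtoC (2 ^ S N) ^ k * (Csum (fun i => A (nome (spt z 1 i / RtoC (2 ^ S N)))) (2 ^ N) +
   Csum (fun i => A (nome (spt z (-1) i / RtoC (2 ^ S N)))) (2 ^ N)) - A (- nome (z / RtoC (2 ^ S N))) / RtoC (2 ^ S N) ^ k)%C.
  - unfold Cdiv. ring.
  - rewrite twosided_sum. unfold Cdiv. ring.
Qed.

Lemma pow2_pow_S N : (RtoC (2 ^ S N) ^ k = 2 ^ k * RtoC (2 ^ N) ^ k)%C.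
Proof. simpl pow. rewrite RtoC_mult, Cpow_mult_l. easy. Qed.

(** The full sum over the [2^N]-th roots equals [2^(k N) A (nome z)] for every [N]; after division
    by [2^(k N)] one side is constant and the other tends to the lattice sum. *)
Lemma lipschitz z : upper_half z ->
  (A (nome z) = wkappa / z ^ k + (CSeries (fun i => (wkappa / spt z 1 i ^ k)%C)
    + CSeries (fun i => (wkappa / spt z (-1) i ^ k)%C)))%C.
Proof.
  intros Hz. pose proof (upper_half_neq_0 z Hz) as Nz.
  pose proof (proj1 (Cmod_gt_0 _) Nz) as Hm.
  assert (Hc : 0 < Im z / Cmod z) by now apply Rdiv_lt_0_compat.
  assert (Hs : forall s, Rabs s = 1 -> forall i, Im z / Cmod z * INR (S i) <= Cmod (spt z s i)).
  { intros s Hs i. pose proof (Cmod_plus_real_lower z (s * INR (S i)) Hz) as H.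
    rewrite Rabs_mult, Hs, Rmult_1_l, (Rabs_right (INR _)) in H; [auto|apply Rle_ge, pos_INR]. }
  pose proof (twosided_lim z _ ltac:(apply Rlt_le, Hz) Hc (Hs 1 ltac:(rewrite Rabs_right; lra)) (Hs (-1) ltac:(rewrite Rabs_left; lra))) as L1.
  assert (HY : forall N, (Ysum z N + A (nome (z / RtoC (2 ^ N))) = RtoC (2 ^ N) ^ k * A (nome z))%C).
  { induction N as [|N IH].
    - unfold Ysum. simpl. rewrite Cpow_1_l. replace (z / 1)%C with z by field. ring.
    - rewrite Ysum_rec.
      2: { intros n Hn. apply nome_neq_1, upper_half_div; [apply pow_lt; lra|].
           now apply upper_half_plus_real. }
      rewrite pow2_pow_S, <- Cmult_assoc, <- IH.
      set (v := nome (z / RtoC (2 ^ S N))).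
      assert (Ev : nome (z / RtoC (2 ^ N)) = (v * v)%C).
      { unfold v. rewrite <- nome_plus. f_equal. simpl pow. rewrite RtoC_mult.
        pose proof (pow2_neq N). field; auto. }
      assert (Hv : (v * v <> 1)%C).
      { rewrite <- Ev. apply nome_neq_1, upper_half_div; auto. apply pow_lt; lra. }
      rewrite Ev, Cmult_plus_distr_l, <- hdist; [ring| |]; intros E; apply Hv; rewrite E; ring. }
  assert (L2 : Clim (fun N => (A (nome (z / RtoC (2 ^ S N))) / RtoC (2 ^ S N) ^ k)%C) (wkappa / z ^ k)).
  { assert (Hu : forall N, (z / RtoC (2 ^ S N) <> 0)%C).
    { intros N. unfold Cdiv. apply Cmult_neq_0; auto. pose proof (pow_lt 2 (S N)).
      rewrite <- RtoC_inv by lra. apply RtoC_neq, Rinv_neq_0_compat; lra. }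
    pose proof (Clim_scal (/ z ^ k) _ _ (weight_term_lim _ Hu (Clim_div_pow2 z))) as L.
    replace (wkappa / z ^ k)%C with (/ z ^ k * wkappa)%C by (unfold Cdiv; ring).
    eapply Clim_ext; [|exact L]. intros N. cbv beta. pose proof (pow2_neq (S N)) as E.
    rewrite Cdiv_pow by auto. pose proof (Cpow_nz _ k E). pose proof (Cpow_nz _ k Nz). field; auto. }
  eapply Clim_unique; [|exact (Clim_plus _ _ _ _ L2 L1)].
  eapply Clim_ext; [|apply Clim_const]. intros N. cbv beta.
  pose proof (HY (S N)) as E. pose proof (Cpow_nz _ k (pow2_neq (S N))) as En.
  transitivity ((Ysum z (S N) + A (nome (z / RtoC (2 ^ S N)))) / RtoC (2 ^ S N) ^ k)%C.
  - rewrite E. field; auto.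
  - field; auto.
Qed.

Definition wzeta : C := CSeries (fun i => (wkappa / RtoC (INR (S i)) ^ k)%C).

Lemma two_pow_neq : (2 ^ k - 1 <> 0)%C.
Proof.
  rewrite <- RtoC_pow, <- RtoC_minus. apply RtoC_neq.
  assert (2 ^ 1 <= 2 ^ k); [apply Rle_pow; [lra|lia]|]. simpl in *; lra.
Qed.

(** The same limit at [z = 0]: there [Ysum 0 N] satisfies [Y_(N+1) = 2^k Y_N + a1] and is a
    geometric sum. This identifies the rational constant term of the Eisenstein series with a
    lattice sum. *)
Lemma zeta_value : (a1 / (2 ^ k - 1) = 2 * wzeta)%C.
Proof.
  assert (Hs : forall s, Rabs s = 1 -> forall i, 1 * INR (S i) <= Cmod (spt 0 s i)).
  { intros s Hs i. unfold spt. rewrite Cplus_0_l, Cmod_R, Rabs_mult, Hs, Rabs_right; [lra|apply Rle_ge, pos_INR]. }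
  pose proof (twosided_lim 0 1 ltac:(simpl; lra) Rlt_0_1 (Hs 1 ltac:(rewrite Rabs_right; lra)) (Hs (-1) ltac:(rewrite Rabs_left; lra))) as L1.
  assert (E1 : CSeries (fun i => (wkappa / spt 0 1 i ^ k)%C) = wzeta).
  { apply CSeries_ext. intros i. unfold spt. now rewrite Cplus_0_l, Rmult_1_l. }
  assert (E2 : CSeries (fun i => (wkappa / spt 0 (-1) i ^ k)%C) = wzeta).
  { apply CSeries_ext. intros i. unfold spt. rewrite Cplus_0_l, RtoC_mult.
    replace (RtoC (-1) * RtoC (INR (S i)))%C with (- RtoC (INR (S i)))%C by ring. now rewrite hkeven. }
  rewrite E1, E2 in L1. replace (wzeta + wzeta)%C with (2 * wzeta)%C in L1 by ring.
  eapply Clim_unique; [|exact L1].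
  assert (HY : forall N, (Ysum 0 N = a1 * (RtoC (2 ^ N) ^ k - 1) / (2 ^ k - 1))%C).
  { induction N as [|N IH].
    - unfold Ysum. simpl. rewrite Cpow_1_l. field. apply two_pow_neq.
    - rewrite Ysum_rec.
      2: { intros n Hn. rewrite Cplus_0_l. rewrite <- RtoC_div by (pose proof (pow_lt 2 N); lra).
           apply nome_real_neq_1. rewrite <- INR_pow2. split.
           - apply Rdiv_lt_0_compat; apply lt_0_INR; lia.
           - apply Rmult_lt_reg_r with (INR (2 ^ N)); [apply lt_0_INR; lia|].
             unfold Rdiv. rewrite Rmult_assoc, Rinv_l, Rmult_1_l, Rmult_1_r.
             + apply lt_INR; lia.
             + apply not_0_INR; lia. }
      rewrite IH, pow2_pow_S.
      replace (0 / RtoC (2 ^ S N))%C with (RtoC 0) by (field; apply pow2_neq).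
      rewrite nome_0, ha1. field. apply two_pow_neq. }
  pose proof (small_term_lim 0) as L2.
  pose proof (Clim_scal (/ (2 ^ k - 1)) _ _ L2) as L3.
  pose proof (Clim_minus _ _ _ _ (Clim_const (a1 / (2 ^ k - 1))) L3) as L4.
  match type of L4 with Clim _ ?x => replace x with (a1 / (2 ^ k - 1))%C in L4 by ring end.
  eapply Clim_ext; [|exact L4]. intros N. cbv beta. rewrite HY.
  replace (0 / RtoC (2 ^ S N))%C with (RtoC 0) by (field; apply pow2_neq).
  rewrite nome_0, ha1. pose proof (Cpow_nz _ k (pow2_neq (S N))). field. split; auto. apply two_pow_neq.
Qed.

Definition lat (z : C) (m i : nat) : C :=
  (wkappa / spt (RtoC (INR (S m)) * z) 1 i ^ k + wkappa / spt (RtoC (INR (S m)) * z) (-1) i ^ k)%C.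

(** A multiple of the Eisenstein series, given by its q-expansion; [zeta_value] explains the
    constant term. *)
Definition weis (z : C) : C :=
  (a1 / (2 ^ k - 1) + 2 * CSeries (fun m => A (nome (RtoC (INR (S m)) * z))))%C.

Lemma INR_S_ge_1 n : 1 <= INR (S n).
Proof. rewrite S_INR. pose proof (pos_INR n). lra. Qed.

Lemma lat_point_lower z : upper_half z -> exists c, 0 < c /\ forall m i s, Rabs s = 1 ->
  c * INR (S i) <= Cmod (spt (RtoC (INR (S m)) * z) s i) /\
  c * INR (S m) <= Cmod (spt (RtoC (INR (S m)) * z) s i).
Proof.
  intros Hz. pose proof (proj1 (Cmod_gt_0 _) (upper_half_neq_0 z Hz)) as Hm.
  exists (Rmin (Im z / Cmod z) (Im z)). split.
  { apply Rmin_pos; [now apply Rdiv_lt_0_compat|exact Hz]. }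
  intros m i s Hs. pose proof (INR_S_ge_1 m). pose proof (INR_S_ge_1 i). split.
  - pose proof (Cmod_plus_real_lower (RtoC (INR (S m)) * z) (s * INR (S i)) ltac:(apply upper_half_scal; auto; lra)) as L.
    rewrite im_scal_l, Cmod_mult, Cmod_R, (Rabs_right (INR (S m))), Rabs_mult, Hs, (Rabs_right (INR (S i))) in L by lra.
    eapply Rle_trans; [|exact L].
    replace (INR (S m) * Im z / (INR (S m) * Cmod z) * (1 * INR (S i))) with (Im z / Cmod z * INR (S i)) by (field; lra).
    apply Rmult_le_compat_r; [lra|apply Rmin_l].
  - eapply Rle_trans; [|apply im_le_Cmod]. unfold spt.
    replace (Im (RtoC (INR (S m)) * z + RtoC (s * INR (S i)))) with (INR (S m) * Im z) by (destruct z; simpl; ring).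
    unfold upper_half in Hz. rewrite Rabs_right by nra.
    rewrite Rmult_comm. apply Rmult_le_compat_l; [lra|apply Rmin_r].
Qed.

(** Of the [k >= 4] factors of [|m z + n|^k], two are bounded below by a multiple of [m] and two by
    a multiple of [n]. The product form of the majorant is what [Fubini] asks for. *)
Lemma lat_bound z : upper_half z -> exists M, 0 <= M /\ forall m i,
  Cmod (lat z m i) <= (M * / INR (S m) ^ 2) * / INR (S i) ^ 2.
Proof.
  intros Hz. destruct (lat_point_lower z Hz) as [c [Hc H]].
  exists (2 * Cmod wkappa * (/ c) ^ k). split.
  { pose proof (Cmod_ge_0 wkappa). apply Rmult_le_pos; [lra|]. apply pow_le, Rlt_le, Rinv_0_lt_compat, Hc. }
  assert (G : forall m i s, Rabs s = 1 -> Cmod (wkappa / spt (RtoC (INR (S m)) * z) s i ^ k)%C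
     <= Cmod wkappa * ((/ c) ^ k * (/ INR (S m) ^ 2 * / INR (S i) ^ 2))).
  { intros m i s Hs. destruct (H m i s Hs) as [H1 H2].
    pose proof (INR_S_ge_1 m) as Im1. pose proof (INR_S_ge_1 i) as Ii1.
    set (p := spt (RtoC (INR (S m)) * z) s i) in *.
    assert (Hp : 0 < Cmod p) by nra.
    rewrite Cmod_div, Cmod_pow by (apply Cpow_nz, Cmod_pos_neq; auto).
    apply Rmult_le_compat_l; [apply Cmod_ge_0|].
    set (a := INR (S m)) in *. set (b := INR (S i)) in *.
    assert (E : c ^ k * (a ^ 2 * b ^ 2) <= Cmod p ^ k).
    { replace k with (2 + (2 + (k - 4)))%nat by lia. rewrite !pow_add.
      replace (c ^ 2 * (c ^ 2 * c ^ (k - 4)) * (a ^ 2 * b ^ 2)) with ((c * a) ^ 2 * ((c * b) ^ 2 * c ^ (k - 4))) by ring.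
      assert (Ca : 0 <= c * a) by nra. assert (Cb : 0 <= c * b) by nra. assert (Cc : c <= Cmod p) by nra.
      apply Rmult_le_compat; [now apply pow_le|apply Rmult_le_pos; apply pow_le; lra|now apply pow_incr|].
      apply Rmult_le_compat; [now apply pow_le|apply pow_le; lra|now apply pow_incr|apply pow_incr; lra]. }
    rewrite pow_inv, <- !Rinv_mult. apply Rinv_le_contravar; auto.
    repeat (apply Rmult_lt_0_compat || apply pow_lt); lra. }
  intros m i. unfold lat. eapply Rle_trans; [apply Cmod_triangle|].
  pose proof (G m i 1 ltac:(rewrite Rabs_right; lra)). pose proof (G m i (-1) ltac:(rewrite Rabs_left; lra)).
  lra.
Qed.

Lemma ex_series_lat_row M m : ex_series (fun i => (M * / INR (S m) ^ 2) * / INR (S i) ^ 2).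
Proof. apply ex_series_scal_R, ex_series_inv_sq. Qed.

Definition wlat (z : C) : C := CSeries (fun m => CSeries (lat z m)).

(** Row [m] of the lattice is the Lipschitz formula at [m z]. The central terms of the rows sum to
    [wzeta / z^k], and the constant term supplies the row [m = 0]; the factor 2 accounts for the
    opposite half of the lattice. *)
Lemma weis_lattice z : upper_half z -> (weis z = 2 * (wzeta + wzeta / z ^ k + wlat z))%C.
Proof.
  intros Hz. pose proof (upper_half_neq_0 z Hz) as Nz. unfold weis. rewrite zeta_value.
  assert (E : CSeries (fun m => A (nome (RtoC (INR (S m)) * z))) = (/ z ^ k * wzeta + wlat z)%C).
  2: { rewrite E. unfold Cdiv. ring. }
  destruct (lat_bound z Hz) as [M [HM0 HM]].
  apply CSeries_unique. apply (Cser_ext (fun m => (/ z ^ k * (wkappa / RtoC (INR (S m)) ^ k) + CSeries (lat z m))%C)).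
  - intros m. pose proof (INR_S_ge_1 m) as H1.
    rewrite lipschitz by (apply upper_half_scal; auto; lra). f_equal.
    + rewrite Cpow_mult_l. assert (E : RtoC (INR (S m)) <> 0) by (apply RtoC_neq; lra).
      pose proof (Cpow_nz _ k E). pose proof (Cpow_nz _ k Nz). field; auto.
    + destruct (lat_point_lower z Hz) as [c [Hc H]].
      destruct (onesided_lim (RtoC (INR (S m)) * z) 1 c) as [_ Q1]; auto.
      { rewrite im_scal_l. unfold upper_half in Hz. nra. }
      { rewrite Rabs_right; lra. }
      { intros i. apply (H m i 1). rewrite Rabs_right; lra. }
      destruct (onesided_lim (RtoC (INR (S m)) * z) (-1) c) as [_ Q2]; auto.
      { rewrite im_scal_l. unfold upper_half in Hz. nra. }
      { rewrite Rabs_left; lra. }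
      { intros i. apply (H m i (-1)). rewrite Rabs_left; lra. }
      apply CSeries_unique, Cser_plus.
      * apply (CSeries_conv _ _ (fun n => Rle_refl _) Q1).
      * apply (CSeries_conv _ _ (fun n => Rle_refl _) Q2).
  - apply Cser_plus.
    + apply Cser_scal. destruct (onesided_lim 0 1 1) as [_ Q1]; try (simpl; lra).
      { rewrite Rabs_right; lra. }
      { intros i. unfold spt. rewrite Cplus_0_l, Cmod_R, Rmult_1_l, Rabs_right; [lra|apply Rle_ge, pos_INR]. }
      apply (CSeries_conv _ (fun i => Cmod (wkappa / spt 0 1 i ^ k)%C)); auto.
      intros n. unfold spt. rewrite Cplus_0_l, Rmult_1_l. lra.
    + apply CSeries_conv with (fun m => (M * Series (fun i => / INR (S i) ^ 2)) * / INR (S m) ^ 2).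
      * intros m. replace (M * Series (fun i => / INR (S i) ^ 2) * / INR (S m) ^ 2) with
         ((M * / INR (S m) ^ 2) * Series (fun i => / INR (S i) ^ 2)) by ring.
        rewrite <- Series_scal_l. apply CSeries_bound; auto. apply ex_series_lat_row.
      * apply ex_series_scal_R, ex_series_inv_sq.
Qed.

Lemma upper_half_inv z : upper_half z -> upper_half (- / z)%C.
Proof.
  unfold upper_half; intros H. destruct z as [x y]; simpl in *.
  assert (0 < x * (x * 1) + y * (y * 1)) by nra.
  replace (- (- y / (x * (x * 1) + y * (y * 1)))) with (y / (x * (x * 1) + y * (y * 1))) by (field; lra).
  now apply Rdiv_lt_0_compat.
Qed.

Lemma lat_inv z m i : upper_half z -> lat (- / z)%C m i = (z ^ k * lat z i m)%C.
Proof.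
  intros Hz. pose proof (upper_half_neq_0 z Hz) as Nz.
  destruct (lat_point_lower z Hz) as [c [Hc H]].
  assert (Hp : forall s, Rabs s = 1 -> spt (RtoC (INR (S i)) * z) s m <> 0).
  { intros s Hs. destruct (H i m s Hs) as [H1 _]. pose proof (INR_S_ge_1 m). apply Cmod_pos_neq. nra. }
  pose proof (Hp 1 ltac:(rewrite Rabs_right; lra)) as P1.
  pose proof (Hp (-1) ltac:(rewrite Rabs_left; lra)) as P2.
  unfold lat.
  replace (spt (RtoC (INR (S m)) * - / z) 1 i) with (spt (RtoC (INR (S i)) * z) (-1) m / z)%C.
  2: { unfold spt. rewrite !RtoC_mult. field; auto. }
  replace (spt (RtoC (INR (S m)) * - / z) (-1) i) with ((- spt (RtoC (INR (S i)) * z) 1 m) / z)%C.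
  2: { unfold spt. rewrite !RtoC_mult. field; auto. }
  rewrite !Cdiv_pow, hkeven by auto.
  pose proof (Cpow_nz _ k P1). pose proof (Cpow_nz _ k P2). pose proof (Cpow_nz _ k Nz).
  field; auto.
Qed.

(** Under [z -> - 1 / z] the axes [wzeta] and [wzeta / z^k] are exchanged up to [z^k], and so are
    the two indices of [lat]; [Fubini] restores the order of summation. *)
Lemma weis_inv z : upper_half z -> weis (- / z)%C = (z ^ k * weis z)%C.
Proof.
  intros Hz. pose proof (upper_half_neq_0 z Hz) as Nz. pose proof (upper_half_inv z Hz) as Hz'.
  rewrite !weis_lattice by auto.
  assert (E : wlat (- / z)%C = (z ^ k * wlat z)%C).
  { destruct (lat_bound z Hz) as [M [HM0 HM]].
    unfold wlat.
    assert (Hpos : forall n, 0 <= / INR (S n) ^ 2).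
    { intros n. apply Rlt_le, Rinv_0_lt_compat, pow_lt. pose proof (INR_S_ge_1 n). lra. }
    rewrite (Fubini (lat z) (fun m => M * / INR (S m) ^ 2) (fun i => / INR (S i) ^ 2)); auto.
    2: { intros m. apply Rmult_le_pos; auto. }
    2: apply ex_series_scal_R, ex_series_inv_sq.
    2: apply ex_series_inv_sq.
    apply CSeries_unique. apply (Cser_ext (fun n => (z ^ k * CSeries (fun m => lat z m n))%C)).
    - intros n. symmetry. apply CSeries_unique.
      apply (Cser_ext (fun m => (z ^ k * lat z m n)%C)); [intros; now rewrite lat_inv|].
      apply Cser_scal. apply (CSeries_conv _ (fun m => (M * / INR (S n) ^ 2) * / INR (S m) ^ 2)).
      + intros m. eapply Rle_trans; [apply HM|]. right; ring.
      + apply ex_series_lat_row.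
    - apply Cser_scal. apply (CSeries_conv _ (fun n => (M * Series (fun i => / INR (S i) ^ 2)) * / INR (S n) ^ 2)).
      + intros n. replace (M * Series (fun i => / INR (S i) ^ 2) * / INR (S n) ^ 2) with
         ((M * / INR (S n) ^ 2) * Series (fun i => / INR (S i) ^ 2)) by ring.
        rewrite <- Series_scal_l. apply CSeries_bound; [|apply ex_series_lat_row].
        intros m. eapply Rle_trans; [apply HM|]. right; ring.
      + apply ex_series_scal_R, ex_series_inv_sq. }
  rewrite E.
  replace (- / z)%C with (-(1) / z)%C by (field; auto).
  rewrite Cdiv_pow, hkeven, Cpow_1_l by auto. pose proof (Cpow_nz _ k Nz). field; auto.
Qed.

End Weight.

(** * Power sums and Lambert series *)

Lemma Cser_incr a l : Cser (fun n => a (S n)) l -> Cser a (a O + l)%C.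
Proof.
  intros H. unfold Cser, Clim. apply is_lim_seq_incr_1.
  apply (Clim_ext (fun n => (a O + Csum (fun n => a (S n)) n)%C)).
  - intros n. now rewrite Csum_first.
  - apply Clim_plus; auto. apply Clim_const.
Qed.

Lemma Clim_pow_0 u : Cmod u < 1 -> Clim (fun n => (u ^ n)%C) 0.
Proof.
  intros Hu. apply (is_lim_seq_ext (fun n => Cmod u ^ n)).
  - intros n. replace (u ^ n - 0)%C with (u ^ n)%C by ring. now rewrite Cmod_pow.
  - apply is_lim_seq_geom. rewrite Rabs_right; auto. apply Rle_ge, Cmod_ge_0.
Qed.

Lemma Cser_geom u : Cmod u < 1 -> Cser (fun n => (u ^ n)%C) (/ (1 - u)).
Proof.
  intros Hu.
  assert (N : (1 - u <> 0)%C).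
  { intros E. assert (u = 1) by (replace u with (1 - (1 - u))%C by ring; rewrite E; ring).
    rewrite H, Cmod_1 in Hu; lra. }
  apply (Clim_ext (fun n => (/ (1 - u) - / (1 - u) * u ^ n)%C)).
  - induction n as [|n IH]; simpl; [field; auto|]. rewrite <- IH. field; auto.
  - pose proof (Clim_minus _ _ _ _ (Clim_const (/ (1 - u))) (Clim_scal (/ (1 - u)) _ _ (Clim_pow_0 u Hu))) as L.
    now replace (/ (1 - u) - / (1 - u) * 0)%C with (/ (1 - u))%C in L by ring.
Qed.

Definition pgeom (u : C) (j n : nat) : C := (RtoC (INR n ^ j) * u ^ n)%C.

Section PowerGeom.
Variable u : C.
Hypothesis hu : Cmod u < 1.

Lemma one_minus_neq_0 : (1 - u <> 0)%C.
Proof.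
  intros E. assert (H : u = 1) by (replace u with (1 - (1 - u))%C by ring; rewrite E; ring).
  rewrite H, Cmod_1 in hu; lra.
Qed.

Lemma pgeom_0 : Cser (pgeom u 0) (/ (1 - u)).
Proof.
  apply (Cser_ext (fun n => (u ^ n)%C)); [|now apply Cser_geom].
  intros n. unfold pgeom. simpl. ring.
Qed.

Lemma pgeom_conv j : exists l, Cser (pgeom u j) l.
Proof.
  exists (CSeries (pgeom u j)). apply CSeries_conv with (fun n => INR n ^ j * Cmod u ^ n).
  - intros n. unfold pgeom. rewrite Cmod_mult, Cmod_R, Cmod_pow, Rabs_right; [lra|].
    apply Rle_ge, pow_le, pos_INR.
  - apply ex_series_pow_geom. split; auto. apply Cmod_ge_0.
Qed.

Lemma pgeom_step j l r : (0 < j)%nat -> Cser (pgeom u j) l -> Cser (fun n => pgeom u j (S n)) r -> l = r.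
Proof.
  intros Hj Hl Hr. apply Cser_incr in Hr.
  replace (pgeom u j 0 + r)%C with r in Hr.
  - eapply Clim_unique; eauto.
  - unfold pgeom. simpl. rewrite pow_i by auto. ring.
Qed.

(** Shifting the index and expanding [(n + 1)^j] expresses each sum through the lower ones. The
    numerators that appear are the Eulerian polynomials. *)
Lemma pgeom_values : exists s1 s2 s4,
  Cser (pgeom u 1) s1 /\ Cser (pgeom u 2) s2 /\
  Cser (pgeom u 3) (u * (1 + 4 * u + u ^ 2) / (1 - u) ^ 4)%C /\ Cser (pgeom u 4) s4 /\
  Cser (pgeom u 5) (u * (1 + 26 * u + 66 * u ^ 2 + 26 * u ^ 3 + u ^ 4) / (1 - u) ^ 6)%C.
Proof.
  pose proof one_minus_neq_0 as N. pose proof pgeom_0 as H0.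
  destruct (pgeom_conv 1) as [s1 H1]. destruct (pgeom_conv 2) as [s2 H2].
  destruct (pgeom_conv 3) as [s3 H3]. destruct (pgeom_conv 4) as [s4 H4].
  destruct (pgeom_conv 5) as [s5 H5].
  set (s0 := (/ (1 - u))%C) in *.
  assert (E1 : s1 = (u * (s1 + s0))%C).
  { apply (pgeom_step 1); auto. eapply Cser_ext; [|exact (Cser_scal u _ _ (Cser_plus _ _ _ _ H1 H0))].
    intros n. unfold pgeom. rewrite S_INR, !RtoC_pow, RtoC_plus. simpl; ring. }
  assert (E2 : s2 = (u * ((s2 + 2 * s1) + s0))%C).
  { apply (pgeom_step 2); auto. eapply Cser_ext; [|exact (Cser_scal u _ _ (Cser_plus _ _ _ _
     (Cser_plus _ _ _ _ H2 (Cser_scal 2 _ _ H1)) H0))].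
    intros n. unfold pgeom. rewrite S_INR, !RtoC_pow, RtoC_plus. simpl; ring. }
  assert (E3 : s3 = (u * (((s3 + 3 * s2) + 3 * s1) + s0))%C).
  { apply (pgeom_step 3); auto. eapply Cser_ext; [|exact (Cser_scal u _ _ (Cser_plus _ _ _ _
     (Cser_plus _ _ _ _ (Cser_plus _ _ _ _ H3 (Cser_scal 3 _ _ H2)) (Cser_scal 3 _ _ H1)) H0))].
    intros n. unfold pgeom. rewrite S_INR, !RtoC_pow, RtoC_plus. simpl; ring. }
  assert (E4 : s4 = (u * ((((s4 + 4 * s3) + 6 * s2) + 4 * s1) + s0))%C).
  { apply (pgeom_step 4); auto. eapply Cser_ext; [|exact (Cser_scal u _ _ (Cser_plus _ _ _ _
     (Cser_plus _ _ _ _ (Cser_plus _ _ _ _ (Cser_plus _ _ _ _ H4 (Cser_scal 4 _ _ H3)) (Cser_scal 6 _ _ H2)) (Cser_scal 4 _ _ H1)) H0))].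
    intros n. unfold pgeom. rewrite S_INR, !RtoC_pow, RtoC_plus. simpl; ring. }
  assert (E5 : s5 = (u * (((((s5 + 5 * s4) + 10 * s3) + 10 * s2) + 5 * s1) + s0))%C).
  { apply (pgeom_step 5 _ _ ltac:(lia)); auto. eapply Cser_ext; [|exact (Cser_scal u _ _ (Cser_plus _ _ _ _
     (Cser_plus _ _ _ _ (Cser_plus _ _ _ _ (Cser_plus _ _ _ _ (Cser_plus _ _ _ _ H5 (Cser_scal 5 _ _ H4)) (Cser_scal 10 _ _ H3)) (Cser_scal 10 _ _ H2)) (Cser_scal 5 _ _ H1)) H0))].
    intros n. unfold pgeom. rewrite S_INR, !RtoC_pow, RtoC_plus. simpl; ring. }
  assert (G : forall s t : C, s = (u * (s + t))%C -> s = (u * t / (1 - u))%C).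
  { intros s t E. replace (u * t)%C with (s * (1 - u))%C; [field; auto|]. rewrite E at 1.
    transitivity (u * (s + t) - u * s)%C; [|ring]. rewrite <- E. ring. }
  apply G in E1.
  assert (F2 : s2 = (u * (2 * s1 + s0) / (1 - u))%C).
  { apply G. rewrite E2 at 1. ring. }
  assert (F3 : s3 = (u * (3 * s2 + 3 * s1 + s0) / (1 - u))%C).
  { apply G. rewrite E3 at 1. ring. }
  assert (F4 : s4 = (u * (4 * s3 + 6 * s2 + 4 * s1 + s0) / (1 - u))%C).
  { apply G. rewrite E4 at 1. ring. }
  assert (F5 : s5 = (u * (5 * s4 + 10 * s3 + 10 * s2 + 5 * s1 + s0) / (1 - u))%C).
  { apply G. rewrite E5 at 1. ring. }
  clear E2 E3 E4 E5.
  assert (K1 : s1 = (u / (1 - u) ^ 2)%C) by (rewrite E1; unfold s0; field; auto).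
  assert (K2 : s2 = (u * (1 + u) / (1 - u) ^ 3)%C) by (rewrite F2, K1; unfold s0; field; auto).
  assert (K3 : s3 = (u * (1 + 4 * u + u ^ 2) / (1 - u) ^ 4)%C) by (rewrite F3, K2, K1; unfold s0; field; auto).
  assert (K4 : s4 = (u * (1 + 11 * u + 11 * u ^ 2 + u ^ 3) / (1 - u) ^ 5)%C)
    by (rewrite F4, K3, K2, K1; unfold s0; field; auto).
  exists s1, s2, s4. repeat split; auto.
  - now rewrite <- K3.
  - replace (u * (1 + 26 * u + 66 * u ^ 2 + 26 * u ^ 3 + u ^ 4) / (1 - u) ^ 6)%C with s5; auto.
    rewrite F5, K4, K3, K2, K1; unfold s0; field; auto.
Qed.

End PowerGeom.

(** Closed forms of the sums of [n^3 u^n] and [n^5 u^n], taken as rational functions so that the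
    value at -1 and the duplication formula outside the unit disc make sense. *)
Definition A3 (u : C) : C := (u * (1 + 4 * u + u ^ 2) / (1 - u) ^ 4)%C.
Definition A5 (u : C) : C := (u * (1 + 26 * u + 66 * u ^ 2 + 26 * u ^ 3 + u ^ 4) / (1 - u) ^ 6)%C.

Lemma Cser_pgeom_S u j l : (0 < j)%nat -> Cser (pgeom u j) l ->
  Cser (fun n => (RtoC (INR (S n) ^ j) * u ^ S n)%C) l.
Proof.
  intros Hj H. unfold Cser, Clim in H. apply is_lim_seq_incr_1 in H.
  eapply Clim_ext; [|exact H]. intros n. cbv beta. rewrite Csum_first.
  replace (pgeom u j 0) with (RtoC 0).
  - unfold pgeom. ring.
  - unfold pgeom. simpl. rewrite pow_i by auto. ring.
Qed.

(** Expansion of [1 / (1 - q^n)] as a geometric series and exchange of the two summations. The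
    majorant rests on [(n + 1) (m + 1) >= n + (m + 1)]. *)
Lemma lambert_double j A q : Cmod q < 1 ->
  (forall u, Cmod u < 1 -> Cser (fun n => (RtoC (INR (S n) ^ j) * u ^ S n)%C) (A u)) ->
  lambert j q = CSeries (fun m => A (q ^ S m)%C).
Proof.
  intros Hq HA. unfold lambert.
  (* The floor 1/2 keeps [r] positive when [q = 0]; one majorant is obtained through a division by
     [r]. *)
  set (r := Rmax (Cmod q) (/2)).
  assert (Hr : 0 < r < 1).
  { unfold r. split; [apply Rlt_le_trans with (/2); [lra|apply Rmax_r]|apply Rmax_lub_lt; lra]. }
  assert (Hqr : Cmod q <= r) by apply Rmax_l.
  assert (Hqn : forall n, Cmod (q ^ S n)%C < 1).
  { intros n. rewrite Cmod_pow. simpl. pose proof (Cmod_ge_0 q).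
    assert (Cmod q ^ n <= 1) by (rewrite <- (pow1 n); apply pow_incr; lra).
    pose proof (pow_le _ n H). nra. }
  transitivity (CSeries (fun n => CSeries (fun m => (RtoC (INR (S n) ^ j) * (q ^ S n) ^ S m)%C))).
  - apply CSeries_ext. intros n. symmetry. apply CSeries_unique.
    pose proof (Cser_scal (RtoC (INR (S n) ^ j) * q ^ S n) _ _ (Cser_geom (q ^ S n)%C (Hqn n))) as L.
    unfold Cdiv. eapply Cser_ext; [|exact L]. intros m. cbv beta. rewrite (Cpow_S (q ^ S n)%C m). ring.
  - rewrite (Fubini _ (fun n => INR (S n) ^ j * r ^ n) (fun m => r ^ S m)).
    + apply CSeries_ext. intros m. apply CSeries_unique.
      eapply Cser_ext; [|apply (HA _ (Hqn m))]. intros n. cbv beta.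
      now rewrite <- !Cpow_mult_r, (Nat.mul_comm (S n)).
    + intros n m. rewrite Cmod_mult, Cmod_R, Rabs_right by (apply Rle_ge, pow_le, pos_INR).
      rewrite Rmult_assoc. apply Rmult_le_compat_l; [apply pow_le, pos_INR|].
      rewrite <- Cpow_mult_r, Cmod_pow, <- pow_add.
      apply Rle_trans with (r ^ (S n * S m)).
      * apply pow_incr. split; auto. apply Cmod_ge_0.
      * replace (S n * S m)%nat with ((n + S m) + n * m)%nat by lia. rewrite (pow_add r (n + S m)).
        assert (r ^ (n * m) <= 1) by (rewrite <- (pow1 (n*m)); apply pow_incr; lra).
        pose proof (pow_lt r (n + S m) ltac:(lra)). nra.
    + intros n. apply Rmult_le_pos; apply pow_le; [apply pos_INR|lra].
    + intros m. apply pow_le; lra.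
    + apply (ex_series_ext (fun n => / r * (INR (S n) ^ j * r ^ S n))).
      * intros n. match goal with |- ?a = ?b => change (@eq R a b) end. simpl pow. field. lra.
      * apply ex_series_scal_R, ex_series_pow_geom_S. lra.
    + apply (ex_series_ext (fun m => INR (S m) ^ 0 * r ^ S m)); [intros; match goal with |- ?a = ?b => change (@eq R a b) end; simpl; ring|].
      apply ex_series_pow_geom_S. lra.
Qed.

Lemma lambert_A3 q : Cmod q < 1 -> lambert 3 q = CSeries (fun m => A3 (q ^ S m)%C).
Proof.
  intros Hq. apply lambert_double; auto. intros u Hu. apply Cser_pgeom_S; [lia|].
  destruct (pgeom_values u Hu) as (s1 & s2 & s4 & H). apply H.
Qed.

Lemma lambert_A5 q : Cmod q < 1 -> lambert 5 q = CSeries (fun m => A5 (q ^ S m)%C).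
Proof.
  intros Hq. apply lambert_double; auto. intros u Hu. apply Cser_pgeom_S; [lia|].
  destruct (pgeom_values u Hu) as (s1 & s2 & s4 & H). apply H.
Qed.

(** * Inversion formulas for E4 and E6 *)

Lemma neq_1_minus (v : C) : v <> 1 -> (1 - v <> 0)%C.
Proof. intros H E. apply H. replace v with (1 - (1 - v))%C by ring. rewrite E. ring. Qed.

Lemma neq_m1_plus (v : C) : v <> (-(1))%C -> (1 + v <> 0)%C.
Proof. intros H E. apply H. replace v with ((1 + v) - 1)%C by ring. rewrite E. ring. Qed.

Lemma Cmod_le_1_pow u n : Cmod u <= 1 -> Cmod (u ^ n)%C <= 1.
Proof. intros H. rewrite Cmod_pow, <- (pow1 n). apply pow_incr. split; auto. apply Cmod_ge_0. Qed.

Lemma Cmod_scal_le (r : R) (u : C) (M : R) : 0 <= r -> Cmod u <= M -> Cmod (RtoC r * u)%C <= r * M.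
Proof. intros Hr Hu. rewrite Cmod_mult, Cmod_R, Rabs_right by lra. now apply Rmult_le_compat_l. Qed.

Lemma Cmod_plus_le (u v : C) (a b : R) : Cmod u <= a -> Cmod v <= b -> Cmod (u + v)%C <= a + b.
Proof. intros. eapply Rle_trans; [apply Cmod_triangle|lra]. Qed.

(** [120 * (1/8) / (2^4 - 1) = 1] and [120 * 2 = 240]; for [E6] the constants -252 and -1/4 play the
    same role with [2^6 - 1 = 63]. *)
Lemma E4_weis z : upper_half z -> E4 z = (120 * weis 4 A3 (/ 8) z)%C.
Proof.
  intros Hz. unfold E4, weis. rewrite lambert_A3 by now apply nome_mod_lt_1.
  rewrite (CSeries_ext (fun m => A3 (nome (RtoC (INR (S m)) * z))) (fun m => A3 (nome z ^ S m)%C)).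
  - replace (2 ^ 4 - 1)%C with (RtoC 15) by ring. field.
  - intros m. now rewrite nome_mult_nat.
Qed.

Lemma E6_weis z : upper_half z -> E6 z = (- 252 * weis 6 A5 (- / 4) z)%C.
Proof.
  intros Hz. unfold E6, weis. rewrite lambert_A5 by now apply nome_mod_lt_1.
  rewrite (CSeries_ext (fun m => A5 (nome (RtoC (INR (S m)) * z))) (fun m => A5 (nome z ^ S m)%C)).
  - replace (2 ^ 6 - 1)%C with (RtoC 63) by ring. field.
  - intros m. now rewrite nome_mult_nat.
Qed.

Lemma E4_inv z : upper_half z -> E4 (- / z)%C = (z ^ 4 * E4 z)%C.
Proof.
  intros Hz. rewrite !E4_weis by (auto; now apply upper_half_inv).
  (* 6 is the value at 1 of the numerator of [A3], and 1/8 is the value of [A3] at -1. *)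
  rewrite (weis_inv 4 A3 (fun u => (u * (1 + 4 * u + u ^ 2))%C) 6 (/ 8)); auto.
  - ring.
  - intros x. ring.
  - intros u. apply Ccont_mult; [apply Ccont_id|]. repeat apply Ccont_plus; try apply Ccont_const.
    + apply Ccont_mult; [apply Ccont_const|apply Ccont_id].
    + apply (Ccont_pow (fun w => w)), Ccont_id.
  - exists (1 * (1 + 4 * 1 + 1)). intros u Hu. rewrite Cmod_mult.
    apply Rmult_le_compat; try apply Cmod_ge_0; auto.
    repeat apply Cmod_plus_le; [rewrite Cmod_1; lra|apply Cmod_scal_le; lra|now apply Cmod_le_1_pow].
  - ring.
  - intros v H1 H2. unfold A3.
    apply neq_1_minus in H1. apply neq_m1_plus in H2.
    assert ((1 - v * v <> 0)%C).
    { replace (1 - v * v)%C with ((1 - v) * (1 + v))%C by ring. now apply Cmult_neq_0. }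
    replace (1 - - v)%C with (1 + v)%C by ring.
    replace (1 - v * v)%C with ((1 - v) * (1 + v))%C by ring.
    field. auto.
  - unfold A3. replace (1 - - (1))%C with (RtoC 2) by ring. field.
Qed.

Lemma E6_inv z : upper_half z -> E6 (- / z)%C = (z ^ 6 * E6 z)%C.
Proof.
  intros Hz. rewrite !E6_weis by (auto; now apply upper_half_inv).
  rewrite (weis_inv 6 A5 (fun u => (u * (1 + 26 * u + 66 * u ^ 2 + 26 * u ^ 3 + u ^ 4))%C) 120 (- / 4)); auto.
  - ring.
  - intros x. ring.
  - intros u. apply Ccont_mult; [apply Ccont_id|]. repeat apply Ccont_plus; try apply Ccont_const.
    + apply Ccont_mult; [apply Ccont_const|apply Ccont_id].
    + apply (Ccont_mult (fun _ => RtoC 66)); [apply Ccont_const|]. apply (Ccont_pow (fun w => w)), Ccont_id.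
    + apply (Ccont_mult (fun _ => RtoC 26)); [apply Ccont_const|]. apply (Ccont_pow (fun w => w)), Ccont_id.
    + apply (Ccont_pow (fun w => w)), Ccont_id.
  - exists (1 * (1 + 26 * 1 + 66 * 1 + 26 * 1 + 1)). intros u Hu. rewrite Cmod_mult.
    apply Rmult_le_compat; try apply Cmod_ge_0; auto.
    repeat apply Cmod_plus_le; [rewrite Cmod_1; lra|apply Cmod_scal_le; lra| | |now apply Cmod_le_1_pow];
    (apply Cmod_scal_le; [lra|now apply Cmod_le_1_pow]).
  - ring.
  - intros v H1 H2. unfold A5.
    apply neq_1_minus in H1. apply neq_m1_plus in H2.
    replace (1 - - v)%C with (1 + v)%C by ring.
    replace (1 - v * v)%C with ((1 - v) * (1 + v))%C by ring.
    field. auto.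
  - unfold A5. replace (1 - - (1))%C with (RtoC 2) by ring. field.
Qed.

(** * The discriminant and the j-function *)

(** A quadratic remainder with summable constants passes to the sum and gives differentiability.
    Adding the estimates at [q] and at [w] bounds [(S' w - S' q) (w - q)] quadratically, hence the
    derivative is continuous. *)
Lemma series_diff (f f' : nat -> C -> C) (M : nat -> R) (r : R) :
  (forall n q q', Cmod q <= r -> Cmod q' <= r ->
     Cmod (f n q' - f n q - f' n q * (q' - q))%C <= M n * Cmod (q' - q)%C ^ 2) ->
  ex_series M ->
  (forall q, Cmod q <= r -> exists b, ex_series b /\ forall n, Cmod (f n q) <= b n) ->
  (forall q, Cmod q <= r -> exists b, ex_series b /\ forall n, Cmod (f' n q) <= b n) ->
  forall q, Cmod q < r ->
    Cdiff (fun q => CSeries (fun n => f n q)) q (CSeries (fun n => f' n q)) /\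
    Ccont (fun q => CSeries (fun n => f' n q)) q.
Proof.
  intros HQ EM Hf Hf'.
  set (S := fun q => CSeries (fun n => f n q)). set (S' := fun q => CSeries (fun n => f' n q)).
  assert (K : forall q q', Cmod q <= r -> Cmod q' <= r ->
     Cmod (S q' - S q - S' q * (q' - q))%C <= Rabs (Series M) * Cmod (q' - q)%C ^ 2).
  { intros q q' Hq Hq'.
    destruct (Hf q Hq) as [b [Eb Hb]]. destruct (Hf q' Hq') as [b1 [Eb1 Hb1]].
    destruct (Hf' q Hq) as [b2 [Eb2 Hb2]].
    assert (L : Cser (fun n => (f n q' - f n q - f' n q * (q' - q))%C) (S q' - S q - S' q * (q' - q))%C).
    { pose proof (Cser_plus _ _ _ _ (Cser_plus _ _ _ _ (CSeries_conv _ _ Hb1 Eb1)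
        (Cser_scal (-(1)) _ _ (CSeries_conv _ _ Hb Eb))) (Cser_scal (- (q' - q)) _ _ (CSeries_conv _ _ Hb2 Eb2))) as L.
      match type of L with Cser _ ?x => replace (S q' - S q - S' q * (q' - q))%C with x by (unfold S, S'; ring) end.
      eapply Cser_ext; [|exact L]. intros n; cbv beta; ring. }
    rewrite <- (CSeries_unique _ _ L).
    apply Rle_trans with (Series (fun n => Cmod (q' - q)%C ^ 2 * M n)).
    - apply CSeries_bound; [|now apply ex_series_scal_R].
      intros n. rewrite Rmult_comm. auto.
    - rewrite Series_scal_l, Rmult_comm. apply Rmult_le_compat_r; [apply pow_le, Cmod_ge_0|apply Rle_abs]. }
  set (T := Rabs (Series M)) in *. assert (HT : 0 <= T) by apply Rabs_pos.
  intros q Hq. split.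
  - apply Cdiff_intro. intros eps He. exists (Rmin (r - Cmod q) (eps / (T + 1))).
    split; [apply Rmin_pos; [lra|apply Rdiv_lt_0_compat; lra]|]. intros h Hh.
    assert (Hh1 : Cmod h < r - Cmod q) by apply (Rlt_le_trans _ _ _ Hh (Rmin_l _ _)).
    assert (Hh2 : Cmod h < eps / (T + 1)) by apply (Rlt_le_trans _ _ _ Hh (Rmin_r _ _)).
    specialize (K q (q + h)%C ltac:(lra)).
    replace (q + h - q)%C with h in K by ring.
    eapply Rle_trans; [apply K|].
    { eapply Rle_trans; [apply Cmod_triangle|lra]. }
    pose proof (Cmod_ge_0 h).
    assert (T * Cmod h <= eps).
    { apply Rle_trans with (T * (eps / (T + 1))); [apply Rmult_le_compat_l; lra|].
      apply Rmult_le_reg_r with (T + 1); [lra|]. replace (T * (eps / (T+1)) * (T+1)) with (T * eps) by (field; lra). nra. }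
    nra.
  - intros eps He. exists (Rmin (r - Cmod q) (eps / (2 * T + 1))).
    split; [apply Rmin_pos; [lra|apply Rdiv_lt_0_compat; lra]|]. intros w Hw.
    assert (Hh1 : Cmod (w - q) < r - Cmod q) by apply (Rlt_le_trans _ _ _ Hw (Rmin_l _ _)).
    assert (Hh2 : Cmod (w - q) < eps / (2 * T + 1)) by apply (Rlt_le_trans _ _ _ Hw (Rmin_r _ _)).
    destruct (Ceq_dec w q) as [->|N].
    { replace (S' q - S' q)%C with (RtoC 0) by ring. now rewrite Cmod_0. }
    assert (Hwr : Cmod w <= r).
    { replace w with ((w - q) + q)%C by ring. eapply Rle_trans; [apply Cmod_triangle|lra]. }
    pose proof (K q w ltac:(lra) Hwr) as K1. pose proof (K w q Hwr ltac:(lra)) as K2.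
    assert (N' : 0 < Cmod (w - q)) by (apply Cmod_gt_0; now apply Cminus_eq_contra).
    replace (Cmod (q - w)) with (Cmod (w - q)) in K2.
    2: { rewrite <- Cmod_opp. f_equal; ring. }
    assert (K3 : Cmod ((S' w - S' q) * (w - q))%C <= 2 * T * Cmod (w - q) ^ 2).
    { replace ((S' w - S' q) * (w - q))%C with
       ((S w - S q - S' q * (w - q)) + (S q - S w - S' w * (q - w)))%C by ring.
      eapply Rle_trans; [apply Cmod_triangle|lra]. }
    rewrite Cmod_mult in K3.
    assert (K4 : Cmod (S' w - S' q)%C <= 2 * T * Cmod (w - q)).
    { apply Rmult_le_reg_r with (Cmod (w - q)); auto. lra. }
    eapply Rle_lt_trans; [exact K4|].
    apply Rle_lt_trans with (2 * T * (eps / (2 * T + 1))); [apply Rmult_le_compat_l; lra|].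
    apply Rmult_lt_reg_r with (2 * T + 1); [lra|].
    replace (2 * T * (eps / (2*T+1)) * (2*T+1)) with (2 * T * eps) by (field; lra). nra.
Qed.

Definition lterm (j n : nat) (q : C) : C := (RtoC (INR (S n) ^ j) * q ^ S n / (1 - q ^ S n))%C.
Definition lterm' (j n : nat) (q : C) : C :=
  (RtoC (INR (S n) ^ j) * (RtoC (INR (S n)) * q ^ n) / (1 - q ^ S n) ^ 2)%C.

(** Induction from [q'^(n+2) = q' q'^(n+1)]. The factor [r ^ 2] on the left avoids the exponent
    [n - 1] on the right. *)
Lemma pow_remainder r q q' n : 0 < r -> Cmod q <= r -> Cmod q' <= r ->
  Cmod (q' ^ S n - q ^ S n - RtoC (INR (S n)) * q ^ n * (q' - q))%C * r ^ 2
    <= INR (S n) ^ 2 * r ^ S n * Cmod (q' - q)%C ^ 2.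
Proof.
  intros Hr Hq Hq'. set (h := (q' - q)%C).
  induction n as [|n IH].
  - replace (q' ^ 1 - q ^ 1 - RtoC (INR 1) * q ^ 0 * h)%C with (RtoC 0) by (unfold h; simpl; ring).
    rewrite Cmod_0. pose proof (Cmod_ge_0 h). simpl. nra.
  - replace (q' ^ S (S n) - q ^ S (S n) - RtoC (INR (S (S n))) * q ^ S n * h)%C with
      (q' * (q' ^ S n - q ^ S n - RtoC (INR (S n)) * q ^ n * h) + RtoC (INR (S n)) * q ^ n * (h * h))%C.
    2: { rewrite (S_INR (S n)), RtoC_plus. unfold h. simpl. ring. }
    set (e := (q' ^ S n - q ^ S n - RtoC (INR (S n)) * q ^ n * h)%C) in *.
    apply Rle_trans with ((r * Cmod e + INR (S n) * r ^ n * Cmod h ^ 2) * r ^ 2).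
    + apply Rmult_le_compat_r; [apply pow_le; lra|].
      eapply Rle_trans; [apply Cmod_triangle|]. apply Rplus_le_compat.
      * rewrite Cmod_mult. apply Rmult_le_compat_r; auto. apply Cmod_ge_0.
      * rewrite !Cmod_mult, Cmod_pow, Cmod_R, Rabs_right by (apply Rle_ge, pos_INR).
        replace (Cmod h * Cmod h) with (Cmod h ^ 2) by ring.
        apply Rmult_le_compat_r; [apply pow_le, Cmod_ge_0|].
        apply Rmult_le_compat_l; [apply pos_INR|]. apply pow_incr. split; auto. apply Cmod_ge_0.
    + replace ((r * Cmod e + INR (S n) * r ^ n * Cmod h ^ 2) * r ^ 2) with
       (r * (Cmod e * r ^ 2) + INR (S n) * r ^ S (S n) * Cmod h ^ 2) by (simpl; ring).
      apply Rle_trans with (r * (INR (S n) ^ 2 * r ^ S n * Cmod h ^ 2) + INR (S n) * r ^ S (S n) * Cmod h ^ 2).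
      * apply Rplus_le_compat_r, Rmult_le_compat_l; lra.
      * replace (r * (INR (S n) ^ 2 * r ^ S n * Cmod h ^ 2) + INR (S n) * r ^ S (S n) * Cmod h ^ 2) with
         ((INR (S n) ^ 2 + INR (S n)) * (r ^ S (S n) * Cmod h ^ 2)) by (simpl; ring).
        rewrite (Rmult_assoc (INR (S (S n)) ^ 2)). apply Rmult_le_compat_r.
        { apply Rmult_le_pos; apply pow_le; [lra|apply Cmod_ge_0]. }
        rewrite (S_INR (S n)). pose proof (pos_INR (S n)). nra.
Qed.

Lemma pow_lipschitz r q q' n : 0 < r -> Cmod q <= r -> Cmod q' <= r ->
  Cmod (q' ^ S n - q ^ S n)%C <= INR (S n) * r ^ n * Cmod (q' - q)%C.
Proof.
  intros Hr Hq Hq'. induction n as [|n IH].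
  - simpl. rewrite !Cmult_1_r. lra.
  - replace (q' ^ S (S n) - q ^ S (S n))%C with (q' * (q' ^ S n - q ^ S n) + q ^ S n * (q' - q))%C by (simpl; ring).
    eapply Rle_trans; [apply Cmod_triangle|]. rewrite !Cmod_mult.
    apply Rle_trans with (r * (INR (S n) * r ^ n * Cmod (q' - q)) + r ^ S n * Cmod (q' - q)).
    + apply Rplus_le_compat.
      * apply Rmult_le_compat; auto; apply Cmod_ge_0.
      * apply Rmult_le_compat_r; [apply Cmod_ge_0|]. rewrite Cmod_pow. apply pow_incr. split; auto. apply Cmod_ge_0.
    + rewrite (S_INR (S n)). simpl. right; ring.
Qed.

Lemma one_minus_pow_lower r q n : 0 <= r < 1 -> Cmod q <= r -> 1 - r <= Cmod (1 - q ^ S n)%C.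
Proof.
  intros Hr Hq.
  assert (Cmod (q ^ S n)%C <= r).
  { rewrite Cmod_pow. apply Rle_trans with (r ^ S n).
    - apply pow_incr; split; auto. apply Cmod_ge_0.
    - simpl. assert (r ^ n <= 1) by (rewrite <- (pow1 n); apply pow_incr; lra).
      pose proof (pow_le r n ltac:(lra)). nra. }
  assert (Cmod 1 <= Cmod (1 - q ^ S n) + Cmod (q ^ S n)).
  { replace (RtoC 1) with ((1 - q ^ S n) + q ^ S n)%C at 1 by ring. apply Cmod_triangle. }
  rewrite Cmod_1 in *. lra.
Qed.

Lemma lterm_bound j r n q : 0 < r < 1 -> Cmod q <= r ->
  Cmod (lterm j n q) <= / (1 - r) * (INR (S n) ^ j * r ^ S n).
Proof.
  intros Hr Hq. pose proof (one_minus_pow_lower r q n ltac:(lra) Hq) as L.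
  unfold lterm. rewrite Cmod_div by (apply Cmod_pos_neq; lra).
  rewrite Cmod_mult, Cmod_R, Rabs_right by (apply Rle_ge, pow_le, pos_INR).
  rewrite Cmod_pow. unfold Rdiv. rewrite Rmult_comm. apply Rmult_le_compat.
  - apply Rlt_le, Rinv_0_lt_compat; lra.
  - apply Rmult_le_pos; apply pow_le; [apply pos_INR|apply Cmod_ge_0].
  - apply Rinv_le_contravar; lra.
  - apply Rmult_le_compat_l; [apply pow_le, pos_INR|]. apply pow_incr; split; auto. apply Cmod_ge_0.
Qed.

Lemma lterm'_bound j r n q : 0 < r < 1 -> Cmod q <= r ->
  Cmod (lterm' j n q) <= / ((1 - r) ^ 2 * r) * (INR (S n) ^ S j * r ^ S n).
Proof.
  intros Hr Hq. pose proof (one_minus_pow_lower r q n ltac:(lra) Hq) as L.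
  unfold lterm'. rewrite Cmod_div by (apply Cpow_nz, Cmod_pos_neq; lra).
  rewrite !Cmod_mult, !Cmod_pow, !Cmod_R, !Rabs_right by (apply Rle_ge; try apply pow_le; apply pos_INR).
  replace (/ ((1 - r) ^ 2 * r) * (INR (S n) ^ S j * r ^ S n)) with ((INR (S n) ^ j * (INR (S n) * r ^ n)) * / (1 - r) ^ 2)
    by (simpl; field; lra).
  unfold Rdiv. apply Rmult_le_compat.
  - repeat apply Rmult_le_pos; try apply pow_le; try apply pos_INR; apply Cmod_ge_0.
  - apply Rlt_le, Rinv_0_lt_compat, pow_lt; lra.
  - apply Rmult_le_compat_l; [apply pow_le, pos_INR|]. apply Rmult_le_compat_l; [apply pos_INR|].
    apply pow_incr; split; auto. apply Cmod_ge_0.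
  - apply Rinv_le_contravar; [apply pow_lt; lra|]. apply pow_incr; lra.
Qed.

(** With [u = q^(n+1)] and [v = q'^(n+1)], the remainder of [u / (1 - u)] is the remainder of the
    power over [(1 - u)^2] plus [(v - u)^2 / ((1 - v) (1 - u)^2)]; both are quadratic in
    [q' - q]. *)
Lemma lterm_quad j r n q q' : 0 < r < 1 -> Cmod q <= r -> Cmod q' <= r ->
  Cmod (lterm j n q' - lterm j n q - lterm' j n q * (q' - q))%C <=
  (2 / (r ^ 2 * (1 - r) ^ 3)) * (INR (S n) ^ (j + 2) * r ^ S n) * Cmod (q' - q)%C ^ 2.
Proof.
  intros Hr Hq Hq'.
  pose proof (one_minus_pow_lower r q n ltac:(lra) Hq) as L.
  pose proof (one_minus_pow_lower r q' n ltac:(lra) Hq') as L'.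
  pose proof (pow_remainder r q q' n ltac:(lra) Hq Hq') as R1.
  pose proof (pow_lipschitz r q q' n ltac:(lra) Hq Hq') as R2.
  set (h := (q' - q)%C) in *. set (N := INR (S n)) in *. assert (HN : 0 <= N) by apply pos_INR.
  set (u := (q ^ S n)%C) in *. set (v := (q' ^ S n)%C) in *.
  assert (Nu : (1 - u <> 0)%C) by (apply Cmod_pos_neq; lra).
  assert (Nv : (1 - v <> 0)%C) by (apply Cmod_pos_neq; lra).
  replace (lterm j n q' - lterm j n q - lterm' j n q * h)%C with
    (RtoC (N ^ j) * ((v - u - RtoC N * q ^ n * h) / (1 - u) ^ 2 + (v - u) ^ 2 / ((1 - v) * (1 - u) ^ 2)))%C.
  2: { unfold lterm, lterm'. fold u v N. field. auto. }
  rewrite Cmod_mult, Cmod_R, Rabs_right by (apply Rle_ge, pow_le; auto).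
  set (e := (v - u - RtoC N * q ^ n * h)%C) in *.
  set (B := N ^ 2 * r ^ S n * Cmod h ^ 2 / (r ^ 2 * (1 - r) ^ 3)).
  assert (HB0 : 0 <= N ^ 2 * r ^ S n * Cmod h ^ 2).
  { repeat apply Rmult_le_pos; try apply pow_le; auto; try lra. all: apply Cmod_ge_0. }
  assert (HB : Cmod (e / (1 - u) ^ 2 + (v - u) ^ 2 / ((1 - v) * (1 - u) ^ 2))%C <= 2 * B).
  { eapply Rle_trans; [apply Cmod_triangle|].
    assert (Q1 : 0 < (1 - r) ^ 2 <= 1) by (split; nra).
    assert (Q2 : 0 < (1 - r) ^ 3) by (apply pow_lt; lra).
    assert (Q3 : 0 < r ^ 2 < 1) by (split; nra).
    replace (2 * B) with (B + B) by ring. apply Rplus_le_compat.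
    - rewrite Cmod_div, Cmod_pow by now apply Cpow_nz.
      apply Rle_trans with ((N ^ 2 * r ^ S n * Cmod h ^ 2 / r ^ 2) * / (1 - r) ^ 3).
      + unfold Rdiv. apply Rmult_le_compat; [apply Cmod_ge_0|apply Rlt_le, Rinv_0_lt_compat, pow_lt; lra| |].
        * apply Rmult_le_reg_r with (r ^ 2); [lra|]. rewrite (Rmult_assoc (N ^ 2 * _ * _)), Rinv_l by lra. lra.
        * apply Rinv_le_contravar; auto. apply Rle_trans with ((1 - r) ^ 2); [simpl; nra|apply pow_incr; lra].
      + right. unfold B. field. lra.
    - rewrite Cmod_div, Cmod_mult, !Cmod_pow by (apply Cmult_neq_0; auto; now apply Cpow_nz).
      apply Rle_trans with ((N * r ^ n * Cmod h) ^ 2 * / (1 - r) ^ 3).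
      + unfold Rdiv. apply Rmult_le_compat; [apply pow_le, Cmod_ge_0| | |].
        * apply Rlt_le, Rinv_0_lt_compat. apply Rmult_lt_0_compat; [lra|apply pow_lt; lra].
        * apply pow_incr. split; auto. apply Cmod_ge_0.
        * apply Rinv_le_contravar; auto. replace ((1-r)^3) with ((1-r) * (1-r)^2) by ring.
          apply Rmult_le_compat; [lra|apply Rlt_le, Q1|lra|apply pow_incr; lra].
      + unfold B. replace (N ^ 2 * r ^ S n * Cmod h ^ 2 / (r ^ 2 * (1 - r) ^ 3)) with
          ((N ^ 2 * r ^ S n * Cmod h ^ 2 / r ^ 2) * / (1 - r) ^ 3) by (field; lra).
        apply Rmult_le_compat_r; [apply Rlt_le, Rinv_0_lt_compat; lra|].
        apply Rmult_le_reg_r with (r ^ 2); [lra|].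
        unfold Rdiv. rewrite (Rmult_assoc (N ^ 2 * _ * _)), Rinv_l, Rmult_1_r by lra.
        replace ((N * r ^ n * Cmod h) ^ 2 * r ^ 2) with ((N ^ 2 * Cmod h ^ 2) * (r ^ S n * r ^ S n)) by (simpl; ring).
        replace (N ^ 2 * r ^ S n * Cmod h ^ 2) with ((N ^ 2 * Cmod h ^ 2) * (r ^ S n * 1)) by ring.
        apply Rmult_le_compat_l; [apply Rmult_le_pos; apply pow_le; auto; apply Cmod_ge_0|].
        apply Rmult_le_compat_l; [apply pow_le; lra|]. rewrite <- (pow1 (S n)). apply pow_incr; lra. }
  apply Rle_trans with (N ^ j * (2 * B)); [apply Rmult_le_compat_l; auto; now apply pow_le|].
  right. unfold B. rewrite pow_add. field. lra.
Qed.

Lemma lambert_diff j q : Cmod q < 1 ->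
  Cdiff (lambert j) q (CSeries (fun n => lterm' j n q)) /\
  Ccont (fun q => CSeries (fun n => lterm' j n q)) q.
Proof.
  intros Hq. set (r := (1 + Cmod q) / 2). pose proof (Cmod_ge_0 q).
  assert (Hr : 0 < r < 1) by (unfold r; lra).
  apply (series_diff (lterm j) (lterm' j) (fun n => (2 / (r ^ 2 * (1 - r) ^ 3)) * (INR (S n) ^ (j + 2) * r ^ S n)) r).
  - intros n x y Hx Hy. now apply lterm_quad.
  - apply ex_series_scal_R, ex_series_pow_geom_S; lra.
  - intros x Hx. eexists. split; [|intros n; apply (lterm_bound j r n x Hr Hx)].
    apply ex_series_scal_R, ex_series_pow_geom_S; lra.
  - intros x Hx. eexists. split; [|intros n; apply (lterm'_bound j r n x Hr Hx)].
    apply ex_series_scal_R, ex_series_pow_geom_S; lra.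
  - unfold r; lra.
Qed.

Lemma holo_lambert j : holo (fun z => lambert j (nome z)).
Proof.
  exists (fun z => (CSeries (fun n => lterm' j n (nome z)) * (2 * PI * Ci * nome z))%C).
  intros z Hz. destruct (lambert_diff j (nome z) (nome_mod_lt_1 z Hz)) as [D1 D2]. split.
  - apply (Cdiff_comp (lambert j) nome); auto. apply nome_diff.
  - apply Ccont_mult.
    + apply (Ccont_comp (fun q => CSeries (fun n => lterm' j n q)) nome); auto.
      eapply Cdiff_cont, nome_diff.
    + apply Ccont_mult; [apply Ccont_const|]. eapply Cdiff_cont, nome_diff.
Qed.

Lemma holo_E4 : holo E4.
Proof.
  apply (holo_plus (fun _ => RtoC 1)); [apply holo_const|].
  apply (holo_mult (fun _ => RtoC 240)); [apply holo_const|apply holo_lambert].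
Qed.

Lemma holo_E6 : holo E6.
Proof.
  apply (holo_ext (fun z => (1 + (- 504) * lambert 5 (nome z))%C)); [intros; unfold E6; ring|].
  apply (holo_plus (fun _ => RtoC 1)); [apply holo_const|].
  apply (holo_mult (fun _ => (- 504)%C)); [apply holo_const|apply holo_lambert].
Qed.

(** The first term is [q / (1 - q) = q + q^2 / (1 - q)]; the others are dominated by a geometric
    series of ratio [c r], where [c] bounds the growth of [n^j] from one integer to the next. *)
Lemma lambert_near_q j c q r : 0 < r <= / 200 -> Cmod q = r -> 0 < c <= 8 ->
  (forall n, INR (S (S n)) ^ j <= 2 ^ j * c ^ n) ->
  Cmod (lambert j q - q)%C <= r ^ 2 * ((1 + 2 ^ j / (1 - c * r)) / (1 - r)).
Proof.
  intros Hr Hq Hc Hj.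
  assert (Hcr : 0 <= c * r < 1) by nra.
  assert (L0 : forall n, 1 - r <= Cmod (1 - q ^ S n)%C).
  { intros n. apply one_minus_pow_lower; lra. }
  assert (Nq : (1 - q <> 0)%C).
  { apply Cmod_pos_neq. specialize (L0 O). simpl in L0. rewrite Cmult_1_r in L0. lra. }
  set (b := fun n => (2 ^ j * r ^ 2 / (1 - r)) * (c * r) ^ n).
  assert (Eb : ex_series b).
  { apply ex_series_scal_R, ex_series_geom. rewrite Rabs_right; lra. }
  assert (Sb : Series b = (2 ^ j * r ^ 2 / (1 - r)) / (1 - c * r)).
  { unfold b. rewrite Series_scal_l, Series_geom by (rewrite Rabs_right; lra). easy. }
  assert (Hb : forall n, Cmod (lterm j (S n) q) <= b n).
  { intros n. eapply Rle_trans; [apply (lterm_bound j r); lra|].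
    unfold b. rewrite Rpow_mult_distr.
    replace (2 ^ j * r ^ 2 / (1 - r) * (c ^ n * r ^ n)) with (/ (1 - r) * ((2 ^ j * c ^ n) * r ^ S (S n))) by (simpl; field; lra).
    apply Rmult_le_compat_l; [apply Rlt_le, Rinv_0_lt_compat; lra|].
    apply Rmult_le_compat_r; auto. apply pow_le; lra. }
  assert (E : (lambert j q = lterm j 0 q + CSeries (fun n => lterm j (S n) q))%C).
  { apply CSeries_unique, (Cser_incr (fun n => lterm j n q)). now apply CSeries_conv with b. }
  rewrite E.
  replace (lterm j 0 q + CSeries (fun n => lterm j (S n) q) - q)%C with
    (q ^ 2 / (1 - q) + CSeries (fun n => lterm j (S n) q))%C.
  2: { unfold lterm at 2. simpl INR. rewrite pow1. simpl Cpow. field. auto. }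
  eapply Rle_trans; [apply Cmod_triangle|].
  apply Rle_trans with (r ^ 2 * / (1 - r) + Series b).
  - apply Rplus_le_compat; [|now apply CSeries_bound].
    rewrite Cmod_div, Cmod_pow, Hq by auto. apply Rmult_le_compat_l; [apply pow_le; lra|].
    apply Rinv_le_contravar; [lra|]. specialize (L0 O). simpl in L0. now rewrite Cmult_1_r in L0.
  - rewrite Sb. right. field. lra.
Qed.

(** In the applications the worst ratio [((t + 1) / t)^j] occurs at [t = 2]; it is below 4 for
    [j = 3] and below 8 for [j = 5]. *)
Lemma pow_ratio j c : (forall t, 2 <= t -> (t + 1) ^ j <= c * t ^ j) -> 0 < c ->
  forall n, INR (S (S n)) ^ j <= 2 ^ j * c ^ n.
Proof.
  intros H Hc. induction n as [|n IH].
  - simpl. right. replace (1 + 1) with 2 by ring. ring.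
  - rewrite (S_INR (S (S n))). eapply Rle_trans; [apply H|].
    + rewrite !S_INR. pose proof (pos_INR n). lra.
    + simpl. simpl in IH. apply Rle_trans with (c * (2 ^ j * c ^ n)); [apply Rmult_le_compat_l; lra|right; ring].
Qed.

Lemma lambert3_near q r : 0 < r <= / 200 -> Cmod q = r -> Cmod (lambert 3 q - q)%C <= 10 * r ^ 2.
Proof.
  intros Hr Hq. eapply Rle_trans; [apply (lambert_near_q 3 4 q r Hr Hq); [lra|]|].
  - apply pow_ratio; [|lra]. intros t Ht. nra.
  - rewrite Rmult_comm. apply Rmult_le_compat_r; [apply pow_le; lra|].
    apply Rmult_le_reg_r with (1 - r); [lra|]. unfold Rdiv at 1. rewrite Rmult_assoc, Rinv_l by lra.
    apply Rmult_le_reg_r with (1 - 4 * r); [lra|].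
    replace ((1 + 2 ^ 3 / (1 - 4 * r)) * 1 * (1 - 4 * r)) with (1 - 4 * r + 8) by (field; lra). nra.
Qed.

Lemma lambert5_near q r : 0 < r <= / 200 -> Cmod q = r -> Cmod (lambert 5 q - q)%C <= 35 * r ^ 2.
Proof.
  intros Hr Hq. eapply Rle_trans; [apply (lambert_near_q 5 8 q r Hr Hq); [lra|]|].
  - apply pow_ratio; [|lra]. intros t Ht.
    apply Rle_trans with ((3/2 * t) ^ 5); [apply pow_incr; lra|]. rewrite Rpow_mult_distr.
    apply Rmult_le_compat_r; [apply pow_le; lra|lra].
  - rewrite Rmult_comm. apply Rmult_le_compat_r; [apply pow_le; lra|].
    apply Rmult_le_reg_r with (1 - r); [lra|]. unfold Rdiv at 1. rewrite Rmult_assoc, Rinv_l by lra.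
    apply Rmult_le_reg_r with (1 - 8 * r); [lra|].
    replace ((1 + 2 ^ 5 / (1 - 8 * r)) * 1 * (1 - 8 * r)) with (1 - 8 * r + 32) by (field; lra). nra.
Qed.

(** * Nonvanishing of the discriminant *)

Definition Disc (z : C) : C := (E4 z ^ 3 - E6 z ^ 2)%C.

(** The [q]-coefficient of [E4^3 - E6^2] is [3 * 240 + 2 * 504 = 1728]. For [|q| <= 1/200] the
    remaining terms together are smaller than [1728 |q|]. *)
Lemma Disc_neq_0_near_cusp z : Cmod (nome z) <= / 200 -> Disc z <> 0.
Proof.
  intros Hz E. set (q := nome z) in *. set (r := Cmod q) in *.
  assert (Hr : 0 < r <= / 200) by (split; [apply Cmod_gt_0, nome_neq_0|auto]).
  pose proof (lambert3_near q r Hr eq_refl) as H3.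
  pose proof (lambert5_near q r Hr eq_refl) as H5.
  unfold Disc, E4, E6 in E. fold q in E.
  set (s := (lambert 3 q - q)%C) in *. set (t := (lambert 5 q - q)%C) in *.
  replace (lambert 3 q) with (q + s)%C in E by (unfold s; ring).
  replace (lambert 5 q) with (q + t)%C in E by (unfold t; ring).
  (* The two terms in [q^2] are merged into one with coefficient 254016 - 172800 = 81216; estimated
     separately they would exceed [1728 r] at [r = 1/200]. *)
  assert (K : (1728 * q = (-720) * s + (-1008) * t + 81216 * q ^ 2 + (-172800) * (2 * (q * s) + s * s)
     + 254016 * (2 * (q * t) + t * t) + (-13824000) * (q + s) ^ 3)%C).
  { apply Ceq_minus. rewrite <- E. ring. }
  assert (Hs : Cmod s <= 10 * r ^ 2) by auto. assert (Ht : Cmod t <= 35 * r ^ 2) by auto.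
  assert (Hss : Cmod (s * s)%C <= (10 * r ^ 2) * (10 * r ^ 2)).
  { rewrite Cmod_mult. apply Rmult_le_compat; auto; apply Cmod_ge_0. }
  assert (Htt : Cmod (t * t)%C <= (35 * r ^ 2) * (35 * r ^ 2)).
  { rewrite Cmod_mult. apply Rmult_le_compat; auto; apply Cmod_ge_0. }
  assert (Hqs : Cmod (q * s)%C <= r * (10 * r ^ 2)).
  { rewrite Cmod_mult. apply Rmult_le_compat; auto; try apply Cmod_ge_0. apply Rle_refl. }
  assert (Hqt : Cmod (q * t)%C <= r * (35 * r ^ 2)).
  { rewrite Cmod_mult. apply Rmult_le_compat; auto; try apply Cmod_ge_0. apply Rle_refl. }
  assert (Hc : Cmod ((q + s) ^ 3)%C <= (r + 10 * r ^ 2) ^ 3).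
  { rewrite Cmod_pow. apply pow_incr. split; [apply Cmod_ge_0|]. apply Cmod_plus_le; auto. apply Rle_refl. }
  assert (Hq2 : Cmod (q ^ 2)%C <= r ^ 2) by (rewrite Cmod_pow; apply Rle_refl).
  assert (G : forall (a : R) (u : C) (M : R), Cmod u <= M -> Cmod (RtoC a * u)%C <= Rabs a * M).
  { intros a u M Hu. rewrite Cmod_mult, Cmod_R. apply Rmult_le_compat_l; auto. apply Rabs_pos. }
  assert (Kb : Cmod (1728 * q)%C <= Rabs (-720) * (10 * r ^ 2) + Rabs (-1008) * (35 * r ^ 2) + Rabs 81216 * r ^ 2
    + Rabs (-172800) * (Rabs 2 * (r * (10 * r ^ 2)) + (10 * r ^ 2) * (10 * r ^ 2))
    + Rabs 254016 * (Rabs 2 * (r * (35 * r ^ 2)) + (35 * r ^ 2) * (35 * r ^ 2))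
    + Rabs (-13824000) * (r + 10 * r ^ 2) ^ 3).
  { rewrite K. repeat first [apply Cmod_plus_le | apply G | assumption]. }
  rewrite Cmod_mult, Cmod_R in Kb. fold r in Kb.
  rewrite (Rabs_left (-720)), (Rabs_left (-1008)), (Rabs_left (-172800)), (Rabs_left (-13824000)) in Kb by lra.
  rewrite (Rabs_right 1728), (Rabs_right 2), (Rabs_right 81216), (Rabs_right 254016) in Kb by lra.
  assert (r + 10 * r ^ 2 <= 1.05 * r) by nra.
  assert ((r + 10 * r ^ 2) ^ 3 <= (1.05 * r) ^ 3) by (apply pow_incr; nra).
  assert (R2 : r ^ 2 <= / 200 * r) by nra.
  assert (R3 : r ^ 3 <= / 200 * / 200 * r) by nra.
  assert (R4 : r ^ 4 <= / 200 * / 200 * / 200 * r).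
  { replace (r ^ 4) with (r * r ^ 3) by ring. nra. }
  lra.
Qed.

(** The Taylor polynomial of degree 6 is a lower bound of the cosine; if [PI <= 3.12], it would be
    positive at [PI / 2]. *)
Lemma PI_lower : 3.12 < PI.
Proof.
  destruct (Rlt_dec 3.12 PI) as [H|H]; auto. exfalso.
  pose proof PI2_3_2 as H1.
  destruct (cos_bound (PI / 2) 1) as [B _]; [lra|lra|].
  rewrite cos_PI2 in B. unfold cos_approx in B. simpl in B. unfold cos_term in B. simpl in B.
  assert (Ha1 : 3 / 2 <= PI / 2) by lra.
  assert (Ha2 : PI / 2 <= 1.56) by lra.
  set (a := PI / 2) in *. assert (Ha : 3/2 <= a <= 1.56) by (split; assumption).
  assert (B' : 1 - a^2/2 + a^4/24 - a^6/720 <= 0) by (simpl in *; lra).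
  set (s := a ^ 2). assert (Hs : 2.25 <= s <= 2.4336) by (unfold s; nra).
  replace (a^4) with (s^2) in B' by (unfold s; ring).
  replace (a^6) with (s^3) in B' by (unfold s; ring).
  fold s in B'. nra.
Qed.

Lemma pow_sq_lower t k a b : 0 <= a -> a <= t ^ k -> b <= a * a -> b <= t ^ (k + k).
Proof. intros H1 H2 H3. rewrite pow_add. nra. Qed.

(** 5.3664 is [2 * 3.12 * 0.86]. The bound [exp t >= 1 + t] at [t = x / 512] is squared nine times,
    rounding down each time. *)
Lemma exp_lower_200 x : 5.36640 <= x -> 200 <= exp x.
Proof.
  intros Hx.
  assert (H0 : 1.01048 <= exp (x / 512)).
  { eapply Rle_trans; [|apply exp_ineq1_le]. lra. }
  assert (E : exp x = exp (x / 512) ^ 512).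
  { rewrite <- Rpower_pow by apply exp_pos. unfold Rpower. rewrite ln_exp. f_equal.
    replace (INR 512) with 512 by (simpl; lra). field. }
  rewrite E. clear E. set (t := exp (x / 512)) in *. clearbody t.
  assert (T1 : 1.01048 <= t ^ 1) by (rewrite pow_1; exact H0).
  assert (T2 := pow_sq_lower t 1 1.01048 1.02106 ltac:(lra) T1 ltac:(lra)).
  assert (T3 := pow_sq_lower t _ 1.02106 1.04256 ltac:(lra) T2 ltac:(lra)).
  assert (T4 := pow_sq_lower t _ 1.04256 1.08693 ltac:(lra) T3 ltac:(lra)).
  assert (T5 := pow_sq_lower t _ 1.08693 1.18141 ltac:(lra) T4 ltac:(lra)).
  assert (T6 := pow_sq_lower t _ 1.18141 1.39572 ltac:(lra) T5 ltac:(lra)).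
  assert (T7 := pow_sq_lower t _ 1.39572 1.94803 ltac:(lra) T6 ltac:(lra)).
  assert (T8 := pow_sq_lower t _ 1.94803 3.79482 ltac:(lra) T7 ltac:(lra)).
  assert (T9 := pow_sq_lower t _ 3.79482 14.4006 ltac:(lra) T8 ltac:(lra)).
  assert (T10 := pow_sq_lower t _ 14.4006 207.37 ltac:(lra) T9 ltac:(lra)).
  eapply Rle_trans; [|apply T10]. lra.
Qed.

Lemma Disc_neq_0_high z : upper_half z -> 0.74 <= Im z ^ 2 -> Disc z <> 0.
Proof.
  unfold upper_half; intros Hz Hy. apply Disc_neq_0_near_cusp.
  rewrite nome_mod, exp_Ropp. apply Rinv_le_contravar; [lra|].
  apply exp_lower_200. pose proof PI_lower. assert (0.86 <= Im z) by nra. nra.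
Qed.

Lemma nome_shift_Z n z : nome (z + RtoC (IZR n))%C = nome z.
Proof.
  destruct (Z_le_gt_dec 0 n) as [H|H].
  - rewrite <- (Z2Nat.id n H), <- INR_IZR_INZ. apply nome_shift_nat.
  - rewrite <- (nome_shift_nat (Z.to_nat (- n)) (z + RtoC (IZR n))%C).
    f_equal. rewrite INR_IZR_INZ, Z2Nat.id by lia. rewrite opp_IZR, RtoC_opp. ring.
Qed.

Lemma E4_shift n z : E4 (z + RtoC (IZR n))%C = E4 z.
Proof. unfold E4. now rewrite nome_shift_Z. Qed.

Lemma E6_shift n z : E6 (z + RtoC (IZR n))%C = E6 z.
Proof. unfold E6. now rewrite nome_shift_Z. Qed.

Lemma Disc_shift n z : Disc (z + RtoC (IZR n))%C = Disc z.
Proof. unfold Disc. now rewrite E4_shift, E6_shift. Qed.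

Lemma Disc_inv z : upper_half z -> Disc (- / z)%C = (z ^ 12 * Disc z)%C.
Proof. intros Hz. unfold Disc. rewrite E4_inv, E6_inv by auto. ring. Qed.

Lemma nearest_int x : exists n : Z, Rabs (x - IZR n) <= / 2.
Proof.
  exists (up (x - / 2)). destruct (archimed (x - / 2)) as [H1 H2].
  apply Rabs_le. lra.
Qed.

Lemma Im_inv (z : C) : z <> 0 -> Im (- / z)%C = Im z / Cmod z ^ 2.
Proof.
  intros Hz. rewrite Cmod2_alt. apply Cmod_gt_0 in Hz.
  assert (0 < Re z ^ 2 + Im z ^ 2) by (rewrite <- Cmod2_alt; nra).
  destruct z as [x y]; simpl in *. field. lra.
Qed.

(** Below the threshold a translation gives [(Re v)^2 <= 1/4], hence [|v|^2 <= 0.99], and the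
    inversion enlarges [(Im w)^2] by a factor of at least [1 / 0.99]. Taking 0.74 rather than 3/4
    makes this factor uniform, so finitely many steps reach [Disc_neq_0_high]. *)
Lemma Disc_neq_0 z : upper_half z -> Disc z <> 0.
Proof.
  assert (G : forall n z, upper_half z -> 0.74 * 0.99 ^ n <= Im z ^ 2 -> Disc z <> 0).
  { induction n as [|n IH]; intros w Hw Hn.
    - apply Disc_neq_0_high; auto. simpl in Hn |- *. lra.
    - destruct (Rle_dec 0.74 (Im w ^ 2)) as [H|H]; [now apply Disc_neq_0_high|].
      destruct (nearest_int (Re w)) as [m Hm].
      set (v := (w + RtoC (IZR (- m)))%C).
      assert (Hv : upper_half v) by now apply upper_half_plus_real.
      rewrite <- (Disc_shift (- m)). fold v.
      assert (Im v = Im w) by (unfold v; destruct w; simpl; ring).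
      assert (Re v = Re w - IZR m) by (unfold v; destruct w; simpl; rewrite opp_IZR; ring).
      assert (Hm2 : Re v ^ 2 <= / 4).
      { rewrite H1. apply Rabs_le_between in Hm. nra. }
      pose proof (upper_half_neq_0 v Hv) as Nv.
      intros E. apply (IH (- / v)%C).
      + now apply upper_half_inv.
      + rewrite Im_inv by auto. rewrite Cmod2_alt.
        assert (0 < Re v ^ 2 + Im v ^ 2 <= 0.99) by (unfold upper_half in Hv; rewrite H0 in *; nra).
        set (m2 := Re v ^ 2 + Im v ^ 2) in *.
        assert (0 < 0.99 ^ n) by (apply pow_lt; lra).
        rewrite H0 in *. simpl in Hn.
        replace ((Im w / m2) ^ 2) with (Im w ^ 2 * / (m2 * m2)) by (field; lra).
        apply Rmult_le_reg_r with (m2 * m2); [nra|].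
        replace (Im w ^ 2 * / (m2 * m2) * (m2 * m2)) with (Im w ^ 2) by (field; lra).
        set (e := 0.99 ^ n) in *. assert (m2 * m2 <= 0.99) by nra.
        apply Rle_trans with (0.74 * e * 0.99); [|lra]. apply Rmult_le_compat_l; lra.
      + rewrite Disc_inv, E by auto. ring. }
  intros Hz.
  assert (L : is_lim_seq (fun n => 0.74 * 0.99 ^ n) 0).
  { replace 0 with (0.74 * 0) by ring. apply (is_lim_seq_scal_l _ _ 0), is_lim_seq_geom.
    rewrite Rabs_right; lra. }
  rewrite is_lim_seq_0_iff in L. destruct (L (Im z ^ 2)) as [n Hn]; [unfold upper_half in Hz; nra|].
  apply (G n); auto. specialize (Hn n (Nat.le_refl _)). apply Rlt_le.
  eapply Rle_lt_trans; [apply Rle_abs|exact Hn].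
Qed.

Lemma holo_jfun : holo jfun.
Proof.
  apply (holo_ext (fun z => (1728 * E4 z ^ 3 * / (E4 z ^ 3 + - (1) * E6 z ^ 2))%C)).
  { intros z _. unfold jfun, Cdiv. f_equal. f_equal. ring. }
  apply holo_mult; [apply (holo_mult (fun _ => RtoC 1728)); [apply holo_const|apply holo_pow, holo_E4]|].
  apply holo_inv.
  - apply holo_plus; [apply holo_pow, holo_E4|].
    apply holo_mult; [apply holo_const|apply holo_pow, holo_E6].
  - intros z Hz E. apply (Disc_neq_0 z Hz). unfold Disc. rewrite <- E. ring.
Qed.

Lemma jfun_shift n z : jfun (z + RtoC (IZR n))%C = jfun z.
Proof. unfold jfun. now rewrite E4_shift, E6_shift. Qed.

Lemma jfun_inv z : upper_half z -> jfun (- / z)%C = jfun z.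
Proof.
  intros Hz. unfold jfun. rewrite E4_inv, E6_inv by auto.
  pose proof (Disc_neq_0 z Hz) as D. unfold Disc in D.
  pose proof (upper_half_neq_0 z Hz) as Nz.
  replace ((z ^ 4 * E4 z) ^ 3 - (z ^ 6 * E6 z) ^ 2)%C with (z ^ 12 * (E4 z ^ 3 - E6 z ^ 2))%C by ring.
  field. auto.
Qed.

(** * Moebius transformations and invariance under SL2(Z) *)

Lemma mden_neq_0 (c d : Z) z : upper_half z -> (c, d) <> (0, 0)%Z ->
  (RtoC (IZR c) * z + RtoC (IZR d))%C <> 0.
Proof.
  unfold upper_half. intros Hz Hcd E. destruct z as [x y]. simpl in Hz.
  pose proof (f_equal Re E) as E1. pose proof (f_equal Im E) as E2. simpl in E1, E2.
  assert (IZR c * y = 0) by lra. apply Rmult_integral in H. destruct H; [|lra].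
  assert (IZR d = 0) by (rewrite H in E1; lra).
  apply eq_IZR in H, H0. subst. now apply Hcd.
Qed.

Lemma SL2Z_bottom A : SL2Z A -> (m21 A, m22 A) <> (0, 0)%Z.
Proof. unfold SL2Z; intros H E. injection E as E1 E2. rewrite E1, E2 in H. lia. Qed.

Lemma SL2Z_R A : SL2Z A -> IZR (m11 A) * IZR (m22 A) - IZR (m12 A) * IZR (m21 A) = 1.
Proof. intros H. rewrite <- !mult_IZR, <- minus_IZR. f_equal. exact H. Qed.

Lemma SL2Z_C A : SL2Z A ->
  (RtoC (IZR (m11 A)) * RtoC (IZR (m22 A)) - RtoC (IZR (m12 A)) * RtoC (IZR (m21 A)) = 1)%C.
Proof. intros H. rewrite <- !RtoC_mult, <- RtoC_minus. f_equal. now apply SL2Z_R. Qed.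

Lemma moebius_im A z : SL2Z A -> upper_half z ->
  Im (moebius A z) = Im z / Cmod (RtoC (IZR (m21 A)) * z + RtoC (IZR (m22 A)))%C ^ 2.
Proof.
  intros HA Hz. pose proof (mden_neq_0 _ _ z Hz (SL2Z_bottom A HA)) as N.
  apply Cmod_gt_0 in N. pose proof (Cmod2_alt (RtoC (IZR (m21 A)) * z + RtoC (IZR (m22 A)))%C) as E.
  pose proof (SL2Z_R A HA) as D.
  set (m := Cmod _) in *. unfold moebius. destruct z as [x y]. simpl in *.
  set (a := IZR (m11 A)) in *. set (b := IZR (m12 A)) in *. set (c := IZR (m21 A)) in *. set (d := IZR (m22 A)) in *.
  assert (E' : m * (m * 1) = (c * x - 0 * y + d) * ((c * x - 0 * y + d) * 1) +
     (c * y + 0 * x + 0) * ((c * y + 0 * x + 0) * 1)) by (rewrite E; ring).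
  rewrite <- E'. clear E E'.
  replace ((a * x - 0 * y + b) * (- (c * y + 0 * x + 0) / (m * (m * 1))) +
    (a * y + 0 * x + 0) * ((c * x - 0 * y + d) / (m * (m * 1)))) with ((a * d - b * c) * y / (m * (m * 1))) by (field; lra).
  rewrite D. field; lra.
Qed.

Lemma moebius_upper A z : SL2Z A -> upper_half z -> upper_half (moebius A z).
Proof.
  intros HA Hz. unfold upper_half. rewrite moebius_im by auto.
  apply Rdiv_lt_0_compat; [exact Hz|]. apply pow_lt, Cmod_gt_0.
  apply mden_neq_0; auto. now apply SL2Z_bottom.
Qed.

(** The Euclidean algorithm on the bottom row: SL2(Z) is generated by the translations and [z -> -1/z]. *)
Lemma SL2Z_ind (P : mat2 -> Prop) :
  (forall b, P (Mat2 1 b 0 1)) -> (forall b, P (Mat2 (-1) b 0 (-1))) ->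
  (forall A k, SL2Z A -> (m21 A <> 0)%Z ->
     P (Mat2 (- m21 A) (- m22 A) (m11 A - k * m21 A) (m12 A - k * m22 A)) -> P A) ->
  forall A, SL2Z A -> P A.
Proof.
  intros H1 H2 HI.
  assert (G : forall n A, (Z.abs_nat (m21 A) <= n)%nat -> SL2Z A -> P A).
  { induction n as [|n IH]; intros [a b c d] Hn HA; unfold SL2Z in HA; simpl in *.
    - assert (c = 0)%Z by lia. subst c.
      assert (a * d = 1)%Z by lia.
      destruct (Z.mul_eq_1 a d H) as [-> | ->]; assert (d = 1 \/ d = -1)%Z by lia; destruct H0; subst; try lia; auto.
    - destruct (Z.eq_dec c 0) as [->|Nc].
      { assert (a * d = 1)%Z by lia.
        destruct (Z.mul_eq_1 a d H) as [-> | ->]; assert (d = 1 \/ d = -1)%Z by lia; destruct H0; subst; try lia; auto. }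
      apply (HI (Mat2 a b c d) (a / c)%Z); auto; simpl.
      apply IH; unfold SL2Z; simpl; [|nia].
      pose proof (Z.mod_eq a c Nc). replace (a - a / c * c)%Z with (a mod c)%Z by lia.
      destruct (Z_lt_le_dec 0 c).
      + pose proof (Z.mod_pos_bound a c l). lia.
      + pose proof (Z.mod_neg_bound a c ltac:(lia)). lia. }
  intros A. now apply (G (Z.abs_nat (m21 A))).
Qed.

Lemma invariant_SL2Z (g : C -> C) :
  (forall n z, upper_half z -> g (z + RtoC (IZR n))%C = g z) ->
  (forall z, upper_half z -> g (- / z)%C = g z) ->
  forall A z, SL2Z A -> upper_half z -> g (moebius A z) = g z.
Proof.
  intros HT HS A z HA Hz. revert A HA. apply (SL2Z_ind (fun A => g (moebius A z) = g z)).
  - intros b. unfold moebius; simpl. rewrite <- (HT b z Hz). f_equal. field.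
  - intros b. unfold moebius; simpl. rewrite <- (HT (- b)%Z z Hz). f_equal.
    rewrite opp_IZR, RtoC_opp. field.
  - intros A k HA Nc IH. rewrite <- IH.
    pose proof (moebius_upper A z HA Hz) as HM.
    rewrite <- (HT (- k)%Z _ HM), <- HS by now apply upper_half_plus_real.
    f_equal. unfold moebius; simpl.
    pose proof (mden_neq_0 _ _ z Hz (SL2Z_bottom A HA)) as N.
    assert (N2 : (RtoC (IZR (m11 A - k * m21 A)) * z + RtoC (IZR (m12 A - k * m22 A)))%C <> 0).
    { apply mden_neq_0; auto. intros E. injection E as E1 E2. unfold SL2Z in HA. nia. }
    rewrite !opp_IZR, !minus_IZR, !mult_IZR in *. rewrite !RtoC_opp, !RtoC_minus, !RtoC_mult in *.
    field. split; auto.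
Qed.

Lemma jfun_SL2Z A z : SL2Z A -> upper_half z -> jfun (moebius A z) = jfun z.
Proof.
  apply invariant_SL2Z.
  - intros; apply jfun_shift.
  - apply jfun_inv.
Qed.

(** * Continued fractions *)

(** The next complete quotient; in contrast to the usual Gauss map, its values at irrational numbers
    exceed 1. *)
Definition gauss (x : R) : R := / (x - IZR (Int_part x)).
Fixpoint cq (x : R) (n : nat) : R := match n with O => x | S n => cq (gauss x) n end.
Definition cfk (x : R) (n : nat) : Z := Int_part (cq x n).
Fixpoint Dprod (x : R) (n : nat) : R := match n with O => 1 | S n => gauss x * Dprod (gauss x) n end.
Definition cflist (x : R) (n : nat) : list Z := map (cfk x) (seq 0 n).

Lemma Int_part_bounds x : IZR (Int_part x) <= x < IZR (Int_part x) + 1.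
Proof. destruct (base_Int_part x); lra. Qed.

Lemma Int_part_unique x n : IZR n <= x < IZR n + 1 -> Int_part x = n.
Proof. intros H. symmetry. apply Int_part_spec. lra. Qed.

Lemma irrational_int x n : irrational x -> x <> IZR n.
Proof. intros H E. apply (H n 1%Z); [easy|]. rewrite E. field. Qed.

Lemma irrational_shift x n : irrational x -> irrational (x + IZR n).
Proof.
  intros H p q Hq E. apply (H (p - n * q)%Z q Hq).
  rewrite minus_IZR, mult_IZR. assert (IZR q <> 0) by (now apply not_0_IZR).
  replace x with (IZR p / IZR q - IZR n) by lra. field; auto.
Qed.

Lemma irrational_inv x : irrational x -> irrational (/ x).
Proof.
  intros H p q Hq E. assert (N : IZR q <> 0) by (now apply not_0_IZR).
  assert (x <> 0) by (apply (irrational_int x 0 H)).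
  assert (p <> 0)%Z.
  { intros ->. unfold Rdiv in E. rewrite Rmult_0_l in E. apply Rinv_neq_0_compat in H0. auto. }
  apply (H q p H1). rewrite <- (Rinv_inv x), E. field. split; auto. now apply not_0_IZR.
Qed.

Lemma irrational_opp x : irrational x -> irrational (- x).
Proof.
  intros H p q Hq E. apply (H (- p)%Z q Hq). rewrite opp_IZR.
  replace x with (- (IZR p / IZR q)) by lra. field. now apply not_0_IZR.
Qed.

Lemma irrational_gauss x : irrational x -> irrational (gauss x).
Proof.
  intros H. unfold gauss. apply irrational_inv.
  replace (x - IZR (Int_part x)) with (x + IZR (- Int_part x)) by (rewrite opp_IZR; ring).
  now apply irrational_shift.
Qed.

Lemma irrational_cq x n : irrational x -> irrational (cq x n).
Proof. revert x; induction n; intros x H; simpl; auto. apply IHn, irrational_gauss, H. Qed.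

Lemma gauss_gt_1 x : irrational x -> 1 < gauss x.
Proof.
  intros H. pose proof (Int_part_bounds x). pose proof (irrational_int x (Int_part x) H).
  unfold gauss. rewrite <- Rinv_1. apply Rinv_lt_contravar; lra.
Qed.

Lemma gauss_eq x : irrational x -> x = IZR (Int_part x) + / gauss x.
Proof. intros H. unfold gauss. rewrite Rinv_inv. ring. Qed.

Lemma cq_add x n m : cq x (n + m) = cq (cq x n) m.
Proof. revert x; induction n; intros; simpl; auto. Qed.

Lemma cq_S x n : cq x (S n) = gauss (cq x n).
Proof. replace (S n) with (n + 1)%nat by lia. now rewrite cq_add. Qed.

Lemma cq_gt_1 x n : irrational x -> (1 <= n)%nat -> 1 < cq x n.
Proof.
  intros H Hn. destruct n; [lia|]. rewrite cq_S. apply gauss_gt_1, irrational_cq, H.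
Qed.

Lemma cfk_pos x n : irrational x -> (1 <= n)%nat -> (0 < cfk x n)%Z.
Proof.
  intros H Hn. pose proof (cq_gt_1 x n H Hn). unfold cfk.
  pose proof (Int_part_bounds (cq x n)). apply lt_IZR. lra || (apply Z.lt_le_trans with 1%Z; [lia|]).
Qed.

Lemma cfk_gauss x n : cfk (gauss x) n = cfk x (S n).
Proof. easy. Qed.

Lemma cflist_S x n : cflist x (S n) = cfk x 0 :: cflist (gauss x) n.
Proof. unfold cflist. simpl. f_equal. rewrite <- seq_shift, map_map. easy. Qed.

Lemma cflist_length x n : length (cflist x n) = n.
Proof. unfold cflist. now rewrite length_map, length_seq. Qed.

Lemma cflist_add x n m : cflist x (n + m) = cflist x n ++ cflist (cq x n) m.
Proof.
  revert x; induction n; intros x; [easy|]. change (S n + m)%nat with (S (n + m))%nat.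
  rewrite !cflist_S. simpl. now rewrite IHn.
Qed.

Lemma Dprod_add x n m : Dprod x (n + m) = Dprod x n * Dprod (cq x n) m.
Proof. revert x; induction n; intros; simpl; [ring|]. rewrite IHn; ring. Qed.

Lemma Dprod_S x n : Dprod x (S n) = Dprod x n * cq x (S n).
Proof. replace (S n) with (n + 1)%nat by lia. rewrite Dprod_add, cq_add. simpl; ring. Qed.

Lemma Dprod_ge_1 x n : irrational x -> 1 <= Dprod x n.
Proof.
  revert x; induction n; intros x H; simpl; [lra|].
  pose proof (gauss_gt_1 x H). specialize (IHn _ (irrational_gauss x H)). nra.
Qed.

Lemma Dprod_mono x n : irrational x -> Dprod x n <= Dprod x (S n).
Proof.
  intros H. rewrite Dprod_S. pose proof (Dprod_ge_1 x n H).
  pose proof (cq_gt_1 x (S n) H ltac:(lia)). nra.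
Qed.

(** The product of two consecutive complete quotients is [k xi + 1] with [k >= 1] and [xi > 1]. *)
Lemma Dprod_2 x n : irrational x -> 2 * Dprod x n <= Dprod x (n + 2).
Proof.
  intros H. rewrite Dprod_add. pose proof (Dprod_ge_1 x n H).
  set (y := cq x n). assert (Hy : irrational y) by now apply irrational_cq.
  simpl. rewrite Rmult_1_r.
  pose proof (gauss_gt_1 _ (irrational_gauss y Hy)).
  pose proof (gauss_eq _ (irrational_gauss y Hy)) as E.
  assert (1 <= IZR (Int_part (gauss y))).
  { pose proof (cfk_pos y 1 Hy ltac:(lia)) as P. unfold cfk in P; simpl in P. apply IZR_le. lia. }
  set (g := gauss (gauss y)) in *. rewrite E.
  assert ((IZR (Int_part (gauss y)) + / g) * g = IZR (Int_part (gauss y)) * g + 1) by (field; lra).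
  assert (2 <= (IZR (Int_part (gauss y)) + / g) * g) by nra. nra.
Qed.

Lemma Dprod_lower x n : irrational x -> 2 ^ n <= Dprod x (2 * n).
Proof.
  intros H. induction n as [|n IH]; [simpl; lra|].
  replace (2 * S n)%nat with (2 * n + 2)%nat by lia.
  pose proof (Dprod_2 x (2 * n) H). simpl pow. lra.
Qed.

(** * Convergence and uniqueness of continued fractions *)

Fixpoint cfR (l : list Z) : R := match l with [] => 0 | k :: l => IZR k + / cfR l end.

Lemma Q2R_cfQ l : Q2R (cfQ l) = cfR l.
Proof.
  induction l as [|k l IH]; simpl; [unfold Q2R; simpl; ring|].
  rewrite Q2R_plus, <- IH. f_equal.
  - unfold Q2R, inject_Z; simpl. field.
  (* Inversion sends 0 to 0 both in [Q] and in [R], so the two conventions for an empty tail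
     agree. *)
  - destruct (Qeq_dec (cfQ l) 0) as [E|N].
    + rewrite (Qeq_eqR _ _ E). replace (Q2R 0) with 0 by (unfold Q2R; simpl; ring).
      rewrite Rinv_0. destruct (cfQ l) as [a b]. unfold Qeq in E. simpl in E.
      assert (a = 0)%Z by lia. subst. unfold Qinv; simpl. unfold Q2R; simpl; ring.
    + now apply Q2R_inv.
Qed.

Lemma is_cf_R k x : is_cf k x <-> (forall n, (1 <= n)%nat -> (0 < k n)%Z) /\
  is_lim_seq (fun n => cfR (map k (seq 0 n))) x.
Proof.
  unfold is_cf. split; intros [H1 H2]; split; auto; (eapply is_lim_seq_ext; [|exact H2]); intros n; simpl;
  now rewrite Q2R_cfQ.
Qed.

Lemma cfR_pos l : List.Forall (fun k => (0 < k)%Z) l -> l <> [] -> 1 <= cfR l.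
Proof.
  intros H. induction l as [|k l IH]; [easy|]. intros _. inversion H; subst. simpl.
  assert (1 <= IZR k) by (apply IZR_le; lia).
  destruct l as [|k' l]; [simpl; rewrite Rinv_0; lra|].
  assert (1 <= cfR (k' :: l)) by (apply IH; auto; easy).
  assert (0 < / cfR (k' :: l)) by (apply Rinv_0_lt_compat; lra). lra.
Qed.

Lemma cf_tail_pos (k : nat -> Z) n : (forall n, (1 <= n)%nat -> (0 < k n)%Z) ->
  List.Forall (fun k => (0 < k)%Z) (map k (seq 1 n)).
Proof.
  intros H. apply List.Forall_forall. intros z Hz. apply in_map_iff in Hz.
  destruct Hz as (i & <- & Hi). apply in_seq in Hi. apply H. lia.
Qed.

(** The convergents lie between [k O] and [k O + 1], hence so does [x]; irrationality excludes the
    upper end and identifies [k O] with the integer part. The tails then converge by continuity of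
    the inverse at [x - k O], which is not 0. *)
Lemma is_cf_shift k x : irrational x -> is_cf k x ->
  k O = Int_part x /\ is_cf (fun n => k (S n)) (gauss x).
Proof.
  intros Hx H. apply is_cf_R in H. destruct H as [Hp HL].
  set (y := fun n => cfR (map k (seq 1 n))).
  assert (Hy : forall n, 1 <= y (S n)).
  { intros n. apply cfR_pos; [now apply cf_tail_pos|easy]. }
  assert (L1 : is_lim_seq (fun n => IZR (k O) + / y (S n)) x).
  (* The shift by two keeps the tail nonempty, so that its value is at least 1. *)
  { apply (is_lim_seq_incr_n _ 2) in HL. eapply is_lim_seq_ext; [|exact HL].
    intros n. cbv beta. rewrite (Nat.add_comm n 2). reflexivity. }
  assert (B : forall n, 0 <= / y (S n) <= 1).
  { intros n. specialize (Hy n). split.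
    - apply Rlt_le, Rinv_0_lt_compat; lra.
    - rewrite <- Rinv_1. apply Rinv_le_contravar; lra. }
  assert (B1 : IZR (k O) <= x).
  { apply (is_lim_seq_le (fun _ => IZR (k O)) _ (Finite _) (Finite _)) with (3 := L1).
    - intros n. specialize (B n); lra.
    - apply is_lim_seq_const. }
  assert (B2 : x <= IZR (k O) + 1).
  { apply (is_lim_seq_le _ (fun _ => IZR (k O) + 1) (Finite _) (Finite _)) with (2 := L1).
    - intros n. specialize (B n); lra.
    - apply is_lim_seq_const. }
  assert (E : k O = Int_part x).
  { symmetry. apply Int_part_unique. split; auto.
    destruct B2 as [B2|B2]; auto. exfalso. apply (irrational_int x (k O + 1) Hx). rewrite plus_IZR. auto. }
  split; auto. apply is_cf_R. split; [intros; apply Hp; lia|].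
  apply (is_lim_seq_ext y).
  { intros n. unfold y. rewrite <- seq_shift, map_map. easy. }
  apply is_lim_seq_incr_1.
  apply (is_lim_seq_ext (fun n => / (IZR (k O) + / y (S n) - IZR (k O)))).
  { intros n. replace (IZR (k O) + / y (S n) - IZR (k O)) with (/ y (S n)) by ring. apply Rinv_inv. }
  unfold gauss. rewrite <- E.
  pose proof (irrational_int x (k O) Hx).
  apply (is_lim_seq_inv _ (x - IZR (k O))).
  - apply is_lim_seq_minus'; auto. apply is_lim_seq_const.
  - intros F. injection F. lra.
Qed.

Lemma is_cf_unique k x n : irrational x -> is_cf k x -> k n = cfk x n.
Proof.
  revert k x; induction n as [|n IH]; intros k x Hx H; destruct (is_cf_shift k x Hx H) as [H1 H2].
  - exact H1.
  - apply (IH (fun n => k (S n)) (gauss x)); auto. now apply irrational_gauss.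
Qed.

Lemma cflist_pos x n : irrational x -> List.Forall (fun k => (0 < k)%Z) (cflist (gauss x) n).
Proof.
  intros H. apply List.Forall_forall. intros z Hz. unfold cflist in Hz. apply in_map_iff in Hz.
  destruct Hz as (i & <- & Hi). rewrite cfk_gauss. apply cfk_pos; auto; lia.
Qed.

(** If [c] is the convergent of the next quotient [xi], the error is [(c - xi) / (xi c)], and
    [c >= 1]. *)
Lemma cf_error_step x n : irrational x -> (1 <= n)%nat ->
  Rabs (x - cfR (cflist x (S n))) <= Rabs (gauss x - cfR (cflist (gauss x) n)) / gauss x.
Proof.
  intros H Hn. rewrite cflist_S. simpl cfR. unfold cfk; simpl cq.
  rewrite (gauss_eq x H) at 1.
  assert (1 <= cfR (cflist (gauss x) n)).
  { apply cfR_pos; [now apply cflist_pos|]. destruct n; [lia|]. rewrite cflist_S. easy. }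
  pose proof (gauss_gt_1 x H). set (c := cfR _) in *. set (g := gauss x) in *.
  replace (IZR (Int_part x) + / g - (IZR (Int_part x) + / c)) with ((c - g) / g * / c) by (field; lra).
  rewrite Rabs_mult. rewrite (Rabs_right (/ c)) by (apply Rle_ge, Rlt_le, Rinv_0_lt_compat; lra).
  unfold Rdiv. rewrite Rabs_mult, (Rabs_right (/ g)) by (apply Rle_ge, Rlt_le, Rinv_0_lt_compat; lra).
  rewrite (Rabs_minus_sym g c).
  assert (/ c <= 1) by (rewrite <- Rinv_1; apply Rinv_le_contravar; lra).
  assert (0 < / g) by (apply Rinv_0_lt_compat; lra).
  pose proof (Rabs_pos (c - g)).
  assert (0 <= Rabs (c - g) * / g) by nra. nra.
Qed.

Lemma cf_error x n : irrational x -> Rabs (x - cfR (cflist x (S n))) <= / Dprod x n.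
Proof.
  revert x; induction n as [|n IH]; intros x H.
  - simpl. unfold cfk; simpl. rewrite Rinv_0, Rinv_1. pose proof (Int_part_bounds x).
    apply Rabs_le; lra.
  - eapply Rle_trans; [apply cf_error_step; auto; lia|]. simpl Dprod.
    pose proof (gauss_gt_1 x H). unfold Rdiv. rewrite Rinv_mult, (Rmult_comm (/ gauss x)). apply Rmult_le_compat_r.
    + apply Rlt_le, Rinv_0_lt_compat; lra.
    + apply IH. now apply irrational_gauss.
Qed.

Lemma Dprod_unbounded x M : irrational x -> exists N, forall n, (N <= n)%nat -> M <= Dprod x n.
Proof.
  intros H. destruct (pow2_unbounded M) as [N HN]. exists (2 * N)%nat.
  assert (G : forall m, M <= Dprod x (2 * N + m)).
  { induction m as [|m IH].
    - rewrite Nat.add_0_r. eapply Rle_trans; [apply HN, Nat.le_refl|now apply Dprod_lower].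
    - rewrite Nat.add_succ_r. eapply Rle_trans; [exact IH|now apply Dprod_mono]. }
  intros n Hn. replace n with (2 * N + (n - 2 * N))%nat by lia. apply G.
Qed.

Lemma is_cf_cfk x : irrational x -> is_cf (cfk x) x.
Proof.
  intros H. apply is_cf_R. split; [intros; now apply cfk_pos|].
  apply is_lim_seq_incr_1.
  assert (L : is_lim_seq (fun n => x - cfR (cflist x (S n))) 0).
  { apply is_lim_seq_0_iff. intros eps He.
    destruct (Dprod_unbounded x (/ eps + 1) H) as [N HN]. exists N. intros n Hn.
    specialize (HN n Hn). eapply Rle_lt_trans; [now apply cf_error|].
    assert (0 < / eps) by now apply Rinv_0_lt_compat.
    rewrite <- (Rinv_inv eps). apply Rinv_lt_contravar; nra. }
  pose proof (is_lim_seq_minus' _ _ _ _ (is_lim_seq_const x) L) as L2.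
  rewrite Rminus_0_r in L2. eapply is_lim_seq_ext; [|exact L2]. intros n. unfold cflist. cbv beta. ring.
Qed.

(** * Convergent matrices *)

Lemma gamma_cons k l : gamma (k :: l) =
  Mat2 (k * m11 (gamma l) + m21 (gamma l)) (k * m12 (gamma l) + m22 (gamma l)) (m11 (gamma l)) (m12 (gamma l)).
Proof.
  unfold gamma at 1. simpl fold_right. fold (gamma l). unfold mat_mul.
  cbn [m11 m12 m21 m22]. f_equal; ring.
Qed.

(** By [x xi = k xi + 1] the matrix [(k 1; 1 0)] sends the column [(xi, 1)] to [xi] times [(x, 1)];
    over [n] steps these factors multiply to [Dprod x n]. *)
Lemma gamma_action x n : irrational x ->
  let A := gamma (cflist x n) in
  IZR (m11 A) * cq x n + IZR (m12 A) = x * Dprod x n /\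
  IZR (m21 A) * cq x n + IZR (m22 A) = Dprod x n.
Proof.
  revert x; induction n as [|n IH]; intros x H.
  - simpl. split; ring.
  - rewrite cflist_S, gamma_cons. cbn [m11 m12 m21 m22]. simpl cq. simpl Dprod.
    destruct (IH _ (irrational_gauss x H)) as [E1 E2].
    rewrite !plus_IZR, !mult_IZR. split.
    + pose proof (gauss_eq x H) as E. unfold cfk; simpl cq. pose proof (gauss_gt_1 x H).
      replace (x * (gauss x * Dprod (gauss x) n)) with ((x * gauss x) * Dprod (gauss x) n) by ring.
      apply (f_equal (fun t => t * gauss x)) in E. cbv beta in E.
      rewrite Rmult_plus_distr_r, Rinv_l in E by lra. rewrite E.
      transitivity (IZR (Int_part x) * (IZR (m11 (gamma (cflist (gauss x) n))) * cq (gauss x) n +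
        IZR (m12 (gamma (cflist (gauss x) n)))) + (IZR (m21 (gamma (cflist (gauss x) n))) * cq (gauss x) n +
        IZR (m22 (gamma (cflist (gauss x) n))))); [ring|]. rewrite E1, E2. ring.
    + exact E1.
Qed.

Lemma gamma_det l : (m11 (gamma l) * m22 (gamma l) - m12 (gamma l) * m21 (gamma l) =
  (-1) ^ Z.of_nat (length l))%Z.
Proof.
  induction l as [|k l IH]; [easy|]. rewrite gamma_cons. cbn [m11 m12 m21 m22].
  simpl length. rewrite Nat2Z.inj_succ, Z.pow_succ_r by lia. rewrite <- IH. ring.
Qed.

Lemma gamma_SL2Z l : Nat.Even (length l) -> SL2Z (gamma l).
Proof.
  intros [m Hm]. unfold SL2Z. rewrite gamma_det, Hm, Nat2Z.inj_mul.
  rewrite Z.pow_mul_r by lia. change ((-1) ^ Z.of_nat 2)%Z with 1%Z. apply Z.pow_1_l. lia.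
Qed.

Lemma gamma_pos l : List.Forall (fun k => (0 < k)%Z) l ->
  (0 <= m12 (gamma l) <= m11 (gamma l) /\ 1 <= m11 (gamma l) /\ 0 <= m21 (gamma l) /\ 0 <= m22 (gamma l) /\
  (l <> [] -> m22 (gamma l) <= m21 (gamma l)))%Z.
Proof.
  induction l as [|k l IH]; intros H.
  - unfold gamma, mat_one; simpl. repeat split; try lia. easy.
  - inversion H; subst. specialize (IH H3). rewrite gamma_cons. cbn [m11 m12 m21 m22].
    destruct IH as (I1 & I2 & I3 & I4 & I5).
    destruct l as [|k' l]; [unfold gamma, mat_one in *; simpl in *; repeat split; lia|].
    specialize (I5 ltac:(easy)). repeat split; nia.
Qed.

Lemma gamma_bottom x n : irrational x -> (1 <= n)%nat ->
  let A := gamma (cflist x n) in (0 <= m22 A <= m21 A /\ 1 <= m21 A)%Z.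
Proof.
  intros H Hn. destruct n; [lia|]. rewrite cflist_S, gamma_cons. cbn [m11 m12 m21 m22].
  pose proof (gamma_pos _ (cflist_pos x n H)) as P. tauto.
Qed.

Definition golden : R := (1 + sqrt 5) / 2.

Lemma golden_sq : golden ^ 2 = golden + 1.
Proof.
  unfold golden. pose proof (sqrt_sqrt 5 ltac:(lra)).
  replace (((1 + sqrt 5) / 2) ^ 2) with ((1 + 2 * sqrt 5 + sqrt 5 * sqrt 5) / 4) by field. rewrite H. field.
Qed.

Lemma golden_gt_1 : 1 < golden.
Proof. unfold golden. assert (1 < sqrt 5); [|lra]. rewrite <- sqrt_1. apply sqrt_lt_1; lra. Qed.

(** Induction on both entries of the first column, with [golden^2 = golden + 1] matching the
    recursion [k a + c >= a + c]. The summand 1 handles the empty word, whose lower left entry is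
    0. *)
Lemma gamma_golden l : List.Forall (fun k => (0 < k)%Z) l ->
  golden ^ length l <= golden * IZR (m11 (gamma l)) /\
  golden ^ length l <= golden ^ 2 * IZR (m21 (gamma l)) + (if l then 1 else 0).
Proof.
  pose proof golden_gt_1 as G1. pose proof golden_sq as G2.
  induction l as [|k l IH]; intros H.
  - unfold gamma, mat_one; simpl. lra.
  - inversion H; subst. destruct (IH H3) as [I1 I2]. rewrite gamma_cons. cbn [m11 m12 m21 m22].
    pose proof (gamma_pos l H3) as (P1 & P2 & P3 & P4 & P5).
    change (golden ^ length (k :: l)) with (golden * golden ^ length l). cbv iota. split.
    + rewrite plus_IZR, mult_IZR. apply Rmult_le_compat_l; [lra|].
      apply IZR_le in P2, P3. assert (1 <= IZR k) by (apply IZR_le; lia).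
      destruct l as [|k' l].
      * unfold gamma, mat_one; simpl. lra.
      * apply Rle_trans with (IZR (m11 (gamma (k' :: l))) + IZR (m21 (gamma (k' :: l)))); [|nra].
        apply Rmult_le_reg_l with (golden ^ 2); [nra|].
        rewrite G2 at 1. rewrite Rmult_plus_distr_l. rewrite Rplus_0_r in I2.
        assert (golden * golden ^ length (k' :: l) <= golden ^ 2 * IZR (m11 (gamma (k' :: l)))).
        { replace (golden ^ 2 * IZR (m11 (gamma (k' :: l)))) with (golden * (golden * IZR (m11 (gamma (k' :: l))))) by ring.
          apply Rmult_le_compat_l; lra. }
        lra.
    + rewrite Rplus_0_r. replace (golden ^ 2 * IZR (m11 (gamma l))) with (golden * (golden * IZR (m11 (gamma l)))) by ring.
      apply Rmult_le_compat_l; lra.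
Qed.

Lemma gamma_bottom_golden x n : irrational x -> (1 <= n)%nat ->
  golden ^ n <= golden ^ 2 * IZR (m21 (gamma (cflist x n))).
Proof.
  intros H Hn. destruct n; [lia|]. rewrite cflist_S, gamma_cons. cbn [m11 m12 m21 m22].
  pose proof (gamma_golden _ (cflist_pos x n H)) as [P _]. rewrite cflist_length in P.
  pose proof golden_gt_1. replace (golden ^ S n) with (golden * golden ^ n) by easy.
  replace (golden ^ 2 * IZR (m11 (gamma (cflist (gauss x) n)))) with (golden * (golden * IZR (m11 (gamma (cflist (gauss x) n))))) by ring.
  apply Rmult_le_compat_l; lra.
Qed.

Lemma cfQ_gamma k l : List.Forall (fun k => (0 < k)%Z) l ->
  (cfQ (k :: l) == m11 (gamma (k :: l)) # Z.to_pos (m21 (gamma (k :: l))))%Q.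
Proof.
  revert k; induction l as [|k' l IH]; intros k H.
  - unfold gamma, mat_mul, mat_one; simpl. unfold Qeq; simpl. lia.
  - inversion H; subst. specialize (IH k' H3). simpl cfQ in IH |- *. rewrite IH.
    pose proof (gamma_pos (k' :: l) H) as (P1 & P2 & P3 & P4 & P5).
    pose proof (gamma_pos l H3) as (R1 & R2 & R3 & R4 & R5).
    rewrite (gamma_cons k (k' :: l)). cbn [m11 m12 m21 m22].
    assert (Q : (1 <= m21 (gamma (k' :: l)))%Z) by (rewrite gamma_cons; cbn [m21]; lia).
    set (a := m11 (gamma (k' :: l))) in *. set (c := m21 (gamma (k' :: l))) in *.
    destruct a as [|a|a]; try lia. destruct c as [|c|c]; try lia.
    unfold Qeq, Qplus, inject_Z, Qinv; simpl. lia.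
Qed.

(** The determinant is 1 or -1 and so provides a Bezout relation: the fraction given by the first
    column is already in lowest terms. *)
Lemma cf_den_gamma k l : List.Forall (fun k => (0 < k)%Z) l ->
  Zpos (cf_den (k :: l)) = m21 (gamma (k :: l)).
Proof.
  intros H. unfold cf_den. rewrite (Qred_complete _ _ (cfQ_gamma k l H)).
  pose proof (gamma_pos l H) as (R1 & R2 & R3 & R4 & R5).
  assert (Q : (1 <= m21 (gamma (k :: l)))%Z) by (rewrite gamma_cons; cbn [m21]; lia).
  rewrite Qred_identity.
  - cbn [Qden]. rewrite Z2Pos.id by lia. reflexivity.
  - cbn [Qden Qnum]. rewrite Z2Pos.id by lia.
    pose proof (gamma_det (k :: l)) as D.
    set (a := m11 (gamma (k :: l))) in *. set (c := m21 (gamma (k :: l))) in *.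
    set (b := m12 (gamma (k :: l))) in *. set (d := m22 (gamma (k :: l))) in *.
    apply Zgcd_1_rel_prime.
    assert (E : ((-1) ^ Z.of_nat (length (k :: l)) = 1 \/ (-1) ^ Z.of_nat (length (k :: l)) = -1)%Z).
    { generalize (length (k :: l)). induction n as [|n [IHn|IHn]]; [now left| |];
      rewrite Nat2Z.inj_succ, Z.pow_succ_r, IHn by lia; [now right|now left]. }
    apply bezout_rel_prime. destruct E as [E|E]; rewrite E in D.
    + apply Bezout_intro with d (- b)%Z. lia.
    + apply Bezout_intro with (- d)%Z b. lia.
Qed.

Lemma cf_den_cflist x n : irrational x -> (1 <= n)%nat ->
  Zpos (cf_den (cflist x n)) = m21 (gamma (cflist x n)).
Proof.
  intros H Hn. destruct n; [lia|]. rewrite cflist_S. apply cf_den_gamma, cflist_pos, H.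
Qed.

(** * Tail equivalence of continued fractions *)

Definition tail_equiv (x y : R) : Prop := exists m n, cq x m = cq y n.

Lemma tail_equiv_sym x y : tail_equiv x y -> tail_equiv y x.
Proof. intros (m & n & E). now exists n, m. Qed.

Lemma tail_equiv_trans x y z : tail_equiv x y -> tail_equiv y z -> tail_equiv x z.
Proof.
  intros (m & n & E) (p & q & F). exists (m + p)%nat, (q + n)%nat.
  rewrite !cq_add, E, <- F, <- !cq_add. f_equal. lia.
Qed.

Lemma tail_equiv_gauss x : tail_equiv x (gauss x).
Proof. now exists 1%nat, O. Qed.

Lemma gauss_shift x n : gauss (x + IZR n) = gauss x.
Proof.
  unfold gauss. pose proof (Int_part_bounds x).
  rewrite (Int_part_unique (x + IZR n) (Int_part x + n)) by (rewrite plus_IZR; lra).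
  rewrite plus_IZR. f_equal; ring.
Qed.

Lemma tail_equiv_shift x n : tail_equiv x (x + IZR n).
Proof. exists 1%nat, 1%nat. simpl. symmetry. apply gauss_shift. Qed.

Lemma gauss_unit x : 0 < x < 1 -> gauss x = / x.
Proof.
  intros H. unfold gauss. rewrite (Int_part_unique x 0) by (simpl; lra). f_equal; ring.
Qed.

Lemma tail_equiv_inv_pos x : irrational x -> 0 < x -> tail_equiv x (/ x).
Proof.
  intros H Hx. pose proof (irrational_int x 1 H).
  destruct (Rlt_dec x 1) as [L|L].
  - rewrite <- gauss_unit by lra. apply tail_equiv_gauss.
  - apply tail_equiv_sym. rewrite <- (Rinv_inv x) at 2. rewrite <- (gauss_unit (/ x)).
    + apply tail_equiv_gauss.
    + split; [apply Rinv_0_lt_compat; lra|]. rewrite <- Rinv_1. apply Rinv_lt_contravar; lra.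
Qed.

(** [1 - [0, k, ...] = [0, 1, k - 1, ...]], where [x < 1/2] ensures [k >= 2]; the expansions agree
    after the entry [k - 1]. *)
Lemma tail_equiv_one_minus x : irrational x -> 0 < x < / 2 -> tail_equiv x (1 - x).
Proof.
  intros H Hx. eapply tail_equiv_trans; [apply tail_equiv_gauss|]. rewrite gauss_unit by lra.
  apply tail_equiv_sym. eapply tail_equiv_trans; [apply tail_equiv_gauss|]. rewrite gauss_unit by lra.
  assert (1 < / (1 - x) < 2).
  { split; [rewrite <- Rinv_1; apply Rinv_lt_contravar; lra|].
    rewrite <- (Rinv_inv 2). apply Rinv_lt_contravar; lra. }
  eapply tail_equiv_trans; [apply (tail_equiv_shift _ (-1))|].
  eapply tail_equiv_trans; [apply tail_equiv_gauss|]. rewrite gauss_unit by (simpl; lra).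
  replace (/ (/ (1 - x) + -1)) with (/ x + IZR (-1)) by (simpl; field; lra).
  apply tail_equiv_sym, tail_equiv_shift.
Qed.

Lemma tail_equiv_opp x : irrational x -> tail_equiv x (- x).
Proof.
  intros H.
  assert (G : forall u, irrational u -> 0 < u < 1 -> tail_equiv u (- u)).
  { intros u Hu B. apply tail_equiv_trans with (1 - u).
    - pose proof (irrational_int (2 * u) 1) as I.
      assert (u <> / 2) by (intros E; apply (Hu 1 2)%Z; [easy|rewrite E; lra]).
      destruct (Rlt_dec u (/ 2)).
      + apply tail_equiv_one_minus; auto. lra.
      + apply tail_equiv_sym. replace u with (1 - (1 - u)) at 2 by ring. apply tail_equiv_one_minus; [|lra].
        replace (1 - u) with (- u + IZR 1) by (simpl; ring). now apply irrational_shift, irrational_opp.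
    - replace (1 - u) with (- u + IZR 1) by (simpl; ring). apply tail_equiv_sym, tail_equiv_shift. }
  set (n := Int_part x). pose proof (Int_part_bounds x) as B. fold n in B.
  pose proof (irrational_int x n H).
  apply tail_equiv_trans with (x + IZR (- n)); [apply tail_equiv_shift|].
  apply tail_equiv_trans with (- (x + IZR (- n))).
  - apply G; [now apply irrational_shift|]. rewrite opp_IZR. lra.
  - apply tail_equiv_sym. replace (- (x + IZR (- n))) with (- x + IZR n) by (rewrite opp_IZR; ring).
    apply tail_equiv_shift.
Qed.

Lemma tail_equiv_inv x : irrational x -> tail_equiv x (/ x).
Proof.
  intros H. pose proof (irrational_int x 0 H).
  destruct (Rlt_dec 0 x) as [P|P]; [now apply tail_equiv_inv_pos|].
  apply tail_equiv_trans with (- x); [now apply tail_equiv_opp|].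
  apply tail_equiv_trans with (/ (- x)); [apply tail_equiv_inv_pos; [now apply irrational_opp|lra]|].
  rewrite Rinv_opp. apply tail_equiv_sym, tail_equiv_opp, irrational_inv, H.
Qed.

Lemma mdenR_neq_0 (c d : Z) x : irrational x -> (c, d) <> (0, 0)%Z -> IZR c * x + IZR d <> 0.
Proof.
  intros H N E. destruct (Z.eq_dec c 0) as [->|Nc].
  - assert (IZR d = 0) by lra. apply eq_IZR in H0. subst. now apply N.
  - apply (H (- d)%Z c Nc). rewrite opp_IZR. apply not_0_IZR in Nc.
    apply Rmult_eq_reg_l with (IZR c); auto. replace (IZR c * (- IZR d / IZR c)) with (- IZR d) by (field; auto). lra.
Qed.

Lemma moebiusR_step A k x : irrational x -> SL2Z A ->
  moebiusR (Mat2 (- m21 A) (- m22 A) (m11 A - k * m21 A) (m12 A - k * m22 A)) x = - / (moebiusR A x + IZR (- k)).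
Proof.
  intros H HA. pose proof (mdenR_neq_0 _ _ x H (SL2Z_bottom A HA)) as N.
  assert (N2 : IZR (m11 A - k * m21 A) * x + IZR (m12 A - k * m22 A) <> 0).
  { apply mdenR_neq_0; auto. intros E. injection E as E1 E2. unfold SL2Z in HA. nia. }
  unfold moebiusR. cbn [m11 m12 m21 m22]. rewrite !opp_IZR, !minus_IZR, !mult_IZR in *. field.
  split; auto. intros E. apply N2. rewrite <- E. ring.
Qed.

(** One direction of Serre's theorem: translations and [x -> - 1 / x] change only an initial part of
    the expansion. Irrationality is carried through the induction because the inversion step relies
    on it. *)
Lemma moebiusR_equiv A x : irrational x -> SL2Z A -> irrational (moebiusR A x) /\ tail_equiv x (moebiusR A x).
Proof.
  intros H. revert A. apply (SL2Z_ind (fun A => irrational (moebiusR A x) /\ tail_equiv x (moebiusR A x))).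
  - intros b. unfold moebiusR; simpl. replace ((1 * x + IZR b) / (0 * x + 1)) with (x + IZR b) by field.
    split; [now apply irrational_shift|apply tail_equiv_shift].
  - intros b. unfold moebiusR; simpl. replace ((-1 * x + IZR b) / (0 * x + -1)) with (x + IZR (- b)) by (rewrite opp_IZR; field).
    split; [now apply irrational_shift|apply tail_equiv_shift].
  - intros A k HA _. rewrite moebiusR_step by auto. intros [I E].
    set (y := moebiusR A x) in *.
    assert (I2 : irrational (y + IZR (- k))).
    { rewrite <- (Rinv_inv (y + IZR (- k))). apply irrational_inv.
      rewrite <- (Ropp_involutive (/ _)). now apply irrational_opp. }
    assert (I1 : irrational y).
    { replace y with ((y + IZR (- k)) + IZR k) by (rewrite opp_IZR; ring). now apply irrational_shift. }
    split; auto. eapply tail_equiv_trans; [exact E|].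
    apply tail_equiv_trans with (/ (y + IZR (- k))).
    + apply tail_equiv_sym, tail_equiv_opp, irrational_inv, I2.
    + apply tail_equiv_trans with (y + IZR (- k)).
      * now apply tail_equiv_sym, tail_equiv_inv.
      * apply tail_equiv_sym, tail_equiv_shift.
Qed.

(** * Bounded partial quotients *)

Definition bounded_cf (x B : R) : Prop := irrational x /\ forall n, (1 <= n)%nat -> cq x n <= B.

Lemma badly_approximable_bounded x : badly_approximable x <-> exists B, bounded_cf x B.
Proof.
  split.
  - intros [H (k & Hk & M & HM)]. exists (IZR M + 1). split; auto. intros n Hn.
    specialize (HM n). rewrite (is_cf_unique k x n H Hk) in HM. unfold cfk in HM.
    pose proof (Int_part_bounds (cq x n)). assert (Int_part (cq x n) <= M)%Z by lia.
    apply IZR_le in H1. lra.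
  - intros [B [H HB]]. split; auto. exists (cfk x). split; [now apply is_cf_cfk|].
    exists (Z.max (Z.abs (cfk x 0)) (up B)). intros [|n]; [lia|].
    pose proof (cfk_pos x (S n) H ltac:(lia)) as P. specialize (HB (S n) ltac:(lia)).
    assert (cfk x (S n) < up B)%Z; [|lia]. unfold cfk in *. apply lt_IZR.
    pose proof (Int_part_bounds (cq x (S n))). destruct (archimed B). lra.
Qed.

Lemma tail_equiv_bounded x y B : bounded_cf x B -> irrational y -> tail_equiv x y -> exists B', bounded_cf y B'.
Proof.
  intros [H HB] Hy (m & n & E).
  assert (G : forall k, exists b, forall i, (i <= k)%nat -> cq y i <= b).
  { induction k as [|k [b Hb]].
    - exists (cq y 0). intros i Hi. replace i with O by lia. lra.
    - exists (Rmax b (cq y (S k))). intros i Hi. destruct (Nat.eq_dec i (S k)) as [->|N].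
      + apply Rmax_r.
      + eapply Rle_trans; [apply Hb; lia|apply Rmax_l]. }
  destruct (G n) as [b Hb]. exists (Rmax b B). split; auto. intros i Hi.
  destruct (Nat.le_gt_cases i n) as [L|L].
  - eapply Rle_trans; [now apply Hb|apply Rmax_l].
  - replace i with (n + (i - n))%nat by lia. rewrite cq_add, <- E, <- cq_add.
    eapply Rle_trans; [apply HB; lia|apply Rmax_r].
Qed.

(** * Integrals towards a badly approximable number *)

(** Uniform continuity with tolerance 1: walking from the corner [(a, c)] to [(x, y)] in a fixed
    number of short steps changes [f] by less than 1 at each step. *)
Lemma bounded_rectangle f a b c d : a <= b -> c <= d ->
  (forall x y, a <= x <= b -> c <= y <= d -> continuity_2d_pt f x y) ->
  exists M, 0 <= M /\ forall x y, a <= x <= b -> c <= y <= d -> Rabs (f x y) <= M.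
Proof.
  intros Hab Hcd Hf.
  destruct (uniform_continuity_2d f a b c d Hf (mkposreal 1 Rlt_0_1)) as [[delta Hd] HU]; simpl in HU.
  destruct (nfloor_ex ((b - a + (d - c)) / delta)) as [n [_ Hn]].
  { apply Rmult_le_pos; [lra|]. apply Rlt_le, Rinv_0_lt_compat, Hd. }
  set (N := INR n + 1) in *. assert (HN : 0 < N) by (unfold N; pose proof (pos_INR n); lra).
  assert (HNd : b - a + (d - c) < N * delta).
  { apply Rmult_lt_compat_r with (r := delta) in Hn; auto.
    unfold Rdiv in Hn. rewrite Rmult_assoc, Rinv_l, Rmult_1_r in Hn by lra. auto. }
  exists (Rabs (f a c) + N). split; [pose proof (Rabs_pos (f a c)); lra|].
  intros x y Hx Hy.
  set (px := fun k : nat => a + INR k / N * (x - a)). set (py := fun k : nat => c + INR k / N * (y - c)).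
  assert (Hr : forall k, (k <= S n)%nat -> 0 <= INR k / N <= 1).
  { intros k Hk. pose proof (pos_INR k). assert (INR k <= N) by (apply le_INR in Hk; rewrite S_INR in Hk; exact Hk).
    split; [apply Rmult_le_pos; [lra|apply Rlt_le, Rinv_0_lt_compat, HN]|].
    apply Rmult_le_reg_r with N; auto. unfold Rdiv. rewrite Rmult_assoc, Rinv_l by lra. lra. }
  assert (G : forall k, (k <= S n)%nat -> Rabs (f (px k) (py k)) <= Rabs (f a c) + INR k).
  { induction k as [|k IH]; intros Hk.
    - unfold px, py. simpl INR. replace (a + 0 / N * (x - a)) with a by (field; lra).
      replace (c + 0 / N * (y - c)) with c by (field; lra). lra.
    - specialize (IH ltac:(lia)). pose proof (Hr k ltac:(lia)). pose proof (Hr (S k) Hk).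
      assert (E1 : px (S k) - px k = / N * (x - a)) by (unfold px; rewrite S_INR; field; lra).
      assert (E2 : py (S k) - py k = / N * (y - c)) by (unfold py; rewrite S_INR; field; lra).
      assert (H1 : Rabs (f (px (S k)) (py (S k)) - f (px k) (py k)) < 1).
      { assert (B : forall s, 0 <= s <= b - a + (d - c) -> Rabs (/ N * s) < delta).
        { intros s Hs. rewrite Rabs_right.
          - apply Rmult_lt_reg_l with N; auto. rewrite <- Rmult_assoc, Rinv_r by lra. lra.
          - apply Rle_ge, Rmult_le_pos; [apply Rlt_le, Rinv_0_lt_compat, HN|lra]. }
        apply HU; [| | | |rewrite E1; apply B; lra|rewrite E2; apply B; lra]; unfold px, py; nra. }
      replace (f (px (S k)) (py (S k))) with (f (px k) (py k) + (f (px (S k)) (py (S k)) - f (px k) (py k))) by ring.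
      eapply Rle_trans; [apply Rabs_triang|]. rewrite S_INR. lra. }
  specialize (G (S n) (Nat.le_refl _)).
  unfold px, py in G. rewrite S_INR in G. fold N in G.
  replace (a + N / N * (x - a)) with x in G by (field; lra).
  replace (c + N / N * (y - c)) with y in G by (field; lra). exact G.
Qed.

Lemma holo_bounded_box g R0 d D : holo g -> 0 < d -> exists M, 0 <= M /\ forall z,
  Rabs (Re z) <= R0 -> d <= Im z <= D -> Cmod (g z) <= M.
Proof.
  intros Hg Hd.
  destruct (Rle_dec 0 R0) as [H0|H0].
  2: { exists 0. split; [lra|]. intros z Hz. pose proof (Rabs_pos (Re z)). lra. }
  destruct (Rle_dec d D) as [H1|H1]; [|exists 0; split; [lra|]; intros z _ Hz; lra].
  assert (C : forall x y, d <= y <= D -> Ccont g (x, y)).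
  { intros x y Hy. apply holo_Ccont; auto. unfold upper_half; simpl; lra. }
  destruct (bounded_rectangle (fun u v => Re (g (u, v))) (- R0) R0 d D) as [M1 [P1 B1]]; try lra.
  { intros; apply (Ccont_2d_Re g); auto. }
  destruct (bounded_rectangle (fun u v => Im (g (u, v))) (- R0) R0 d D) as [M2 [P2 B2]]; try lra.
  { intros; apply (Ccont_2d_Im g); auto. }
  exists (M1 + M2). split; [lra|]. intros [x y] Hx Hy. simpl in Hx, Hy. apply Rabs_le_between in Hx.
  eapply Rle_trans; [apply Cmod_le_abs|].
  specialize (B1 x y ltac:(lra) Hy). specialize (B2 x y ltac:(lra) Hy). lra.
Qed.

Lemma upper_half_minus_real_neq z r : upper_half z -> (z - RtoC r <> 0)%C.
Proof.
  intros Hz E. apply (f_equal Im) in E. destruct z; unfold upper_half in Hz; simpl in *. lra.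
Qed.

Lemma holo_simple_pole p : holo (simple_pole p).
Proof.
  destruct p as [r|]; simpl; [|apply holo_const].
  apply (holo_inv (fun z => (z - RtoC r)%C)).
  - apply (holo_plus (fun z => z)); [apply holo_id|apply holo_const].
  - intros; now apply upper_half_minus_real_neq.
Qed.

Lemma holo_eta x' x : holo (eta x' x).
Proof.
  apply (holo_ext (fun z => (simple_pole x' z + (-(1)) * simple_pole x z)%C)).
  - intros. unfold eta. ring.
  - apply holo_plus; [apply holo_simple_pole|]. apply holo_mult; [apply holo_const|apply holo_simple_pole].
Qed.

Lemma simple_pole_bound p z : upper_half z -> Cmod (simple_pole p z) <= / Im z.
Proof.
  intros Hz. unfold upper_half in Hz. destruct p as [r|]; simpl.
  - rewrite Cmod_inv by now apply upper_half_minus_real_neq. apply Rinv_le_contravar; auto.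
    eapply Rle_trans; [|apply im_le_Cmod]. rewrite Rabs_right; destruct z; simpl in *; lra.
  - rewrite Cmod_0. now apply Rlt_le, Rinv_0_lt_compat.
Qed.

(** The bound is uniform in both poles, infinity included, and scales like the hyperbolic metric. *)
Lemma eta_bound x' x z : upper_half z -> Cmod (eta x' x z) <= 2 / Im z.
Proof.
  intros Hz. unfold eta. replace (simple_pole x' z - simple_pole x z)%C with (simple_pole x' z + - simple_pole x z)%C by ring.
  eapply Rle_trans; [apply Cmod_triangle|]. rewrite Cmod_opp.
  pose proof (simple_pole_bound x' z Hz). pose proof (simple_pole_bound x z Hz). unfold Rdiv. lra.
Qed.

Lemma path_integral_plus f1 f2 a b : holo f1 -> holo f2 -> upper_half a -> upper_half b ->
  path_integral (fun z => (f1 z + f2 z)%C) a b = (path_integral f1 a b + path_integral f2 a b)%C.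
Proof.
  intros H1 H2 Ha Hb.
  destruct (holo_primitive f1 H1) as [F1 D1]. destruct (holo_primitive f2 H2) as [F2 D2].
  rewrite (path_integral_eq f1 F1), (path_integral_eq f2 F2) by auto.
  rewrite (path_integral_eq _ (fun z => (F1 z + F2 z)%C)); auto; [ring|now apply holo_plus|].
  intros; apply Cdiff_plus; auto.
Qed.

Lemma path_integral_ext f1 f2 a b : (forall z, upper_half z -> f1 z = f2 z) ->
  upper_half a -> upper_half b -> path_integral f1 a b = path_integral f2 a b.
Proof.
  intros E Ha Hb. unfold path_integral. apply (RInt_ext (V := C_R_CompleteNormedModule)).
  intros t Ht. rewrite Rmin_left, Rmax_right in Ht by lra.
  rewrite E; auto. apply upper_half_segment; auto; lra.
Qed.

(** * Transformation of the integrals under SL2(Z) *)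

Definition mden (A : mat2) (z : C) : C := (RtoC (IZR (m21 A)) * z + RtoC (IZR (m22 A)))%C.

Lemma mden_nz A z : SL2Z A -> upper_half z -> mden A z <> 0.
Proof. intros HA Hz. apply mden_neq_0; auto. now apply SL2Z_bottom. Qed.

Lemma moebius_diff A z : SL2Z A -> upper_half z -> Cdiff (moebius A) z (/ (mden A z) ^ 2)%C.
Proof.
  intros HA Hz. pose proof (mden_nz A z HA Hz) as N. pose proof (SL2Z_C A HA) as D.
  assert (L : forall a b : C, Cdiff (fun z => (a * z + b)%C) z a).
  { intros a b. pose proof (Cdiff_plus _ _ z _ _ (Cdiff_mult _ _ z _ _ (Cdiff_const a z) (Cdiff_id z)) (Cdiff_const b z)) as L.
    cbv beta in L. replace (0 * z + a * 1 + 0)%C with a in L by ring. exact L. }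
  unfold moebius, Cdiv.
  pose proof (Cdiff_mult _ _ z _ _ (L (RtoC (IZR (m11 A))) (RtoC (IZR (m12 A)))) (Cdiff_inv _ z _ (L (RtoC (IZR (m21 A))) (RtoC (IZR (m22 A)))) N)) as Q.
  cbv beta in Q. unfold mden in *.
  match type of Q with Cdiff _ _ ?l => replace (/ (RtoC (IZR (m21 A)) * z + RtoC (IZR (m22 A))) ^ 2)%C with l end; [exact Q|].
  apply Cminus_diag_eq || idtac.
  transitivity ((RtoC (IZR (m11 A)) * RtoC (IZR (m22 A)) - RtoC (IZR (m12 A)) * RtoC (IZR (m21 A))) / (RtoC (IZR (m21 A)) * z + RtoC (IZR (m22 A))) ^ 2)%C.
  - field. auto.
  - rewrite D. field. auto.
Qed.

Lemma mden_cont A z : Ccont (mden A) z.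
Proof.
  apply Ccont_plus; [|apply Ccont_const]. apply Ccont_mult; [apply Ccont_const|apply Ccont_id].
Qed.

Lemma path_integral_moebius f A a b : holo f -> SL2Z A -> upper_half a -> upper_half b ->
  is_CInt (fun t => let z := (a + RtoC t * (b - a))%C in (f (moebius A z) * (/ (mden A z) ^ 2 * (b - a)))%C) 0 1
    (path_integral f (moebius A a) (moebius A b)).
Proof.
  intros Hf HA Ha Hb.
  pose proof (path_integral_curve f (fun t => moebius A (a + RtoC t * (b - a))%C)
    (fun t => (/ (mden A (a + RtoC t * (b - a))) ^ 2 * (b - a))%C) 0 1 Hf ltac:(lra)) as H.
  cbv beta in H.
  replace (a + RtoC 0 * (b - a))%C with a in H by ring.
  replace (a + RtoC 1 * (b - a))%C with b in H by ring.
  apply H. intros t Ht. assert (Hz := upper_half_segment a b t Ha Hb Ht). split; [|split].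
  - now apply moebius_upper.
  - apply (Pdiff_comp (moebius A) (fun t => (a + RtoC t * (b - a))%C)); [apply Pdiff_affine|now apply moebius_diff].
  - apply Rcont_mult; [|apply Rcont_const].
    apply (Rcont_comp (fun z => (/ (mden A z) ^ 2)%C) (fun t => (a + RtoC t * (b - a))%C)).
    + eapply Pdiff_cont, Pdiff_affine.
    + apply (Ccont_inv (fun z => (mden A z ^ 2)%C)); [apply Ccont_pow, mden_cont|].
      now apply Cpow_nz, mden_nz.
Qed.

Section Invariant.
Variable g : C -> C.
Hypothesis hg : holo g.
Hypothesis ginv : forall A z, SL2Z A -> upper_half z -> g (moebius A z) = g z.

Definition ge (x' x : P1R) (z : C) : C := (g z * eta x' x z)%C.

Lemma holo_ge x' x : holo (ge x' x).
Proof. apply holo_mult; [exact hg|apply holo_eta]. Qed.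

Lemma ge_bound x' x z G : upper_half z -> Cmod (g z) <= G -> Cmod (ge x' x z) <= G * (2 / Im z).
Proof.
  intros Hz HG. unfold ge. rewrite Cmod_mult.
  apply Rmult_le_compat; auto; try apply Cmod_ge_0. now apply eta_bound.
Qed.

Lemma box_segment (a b : C) t R0 d D : 0 <= t <= 1 ->
  Rabs (Re a) <= R0 -> Rabs (Re b) <= R0 -> d <= Im a <= D -> d <= Im b <= D ->
  Rabs (Re (a + RtoC t * (b - a))%C) <= R0 /\ d <= Im (a + RtoC t * (b - a))%C <= D.
Proof.
  intros Ht H1 H2 H3 H4. destruct a as [a1 a2], b as [b1 b2]. simpl in *.
  apply Rabs_le_between in H1. apply Rabs_le_between in H2.
  replace (a1 + (t * (b1 + - a1) - 0 * (b2 + - a2))) with ((1 - t) * a1 + t * b1) by ring.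
  replace (a2 + (t * (b2 + - a2) + 0 * (b1 + - a1))) with ((1 - t) * a2 + t * b2) by ring.
  split; [apply Rabs_le|]; nra.
Qed.

(** The bound does not depend on [A] because [|eta| <= 2 / Im]. *)
Lemma moebius_segment_bound R0 d D : 0 < d -> exists K, 0 <= K /\ forall A a b x' x, SL2Z A ->
  Rabs (Re a) <= R0 -> Rabs (Re b) <= R0 -> d <= Im a <= D -> d <= Im b <= D ->
  Cmod (path_integral (ge x' x) (moebius A a) (moebius A b)) <= K.
Proof.
  intros Hd. destruct (holo_bounded_box g R0 d D hg Hd) as [G [HG0 HG]].
  exists (G * (2 / d) * (2 * Rabs R0 + 2 * Rabs D)).
  assert (0 < 2 / d) by (apply Rdiv_lt_0_compat; lra).
  pose proof (Rabs_pos R0). pose proof (Rabs_pos D).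
  split; [apply Rmult_le_pos; [apply Rmult_le_pos|]; lra|].
  intros A a b x' x HA Ha1 Hb1 Ha2 Hb2.
  assert (Ha : upper_half a) by (unfold upper_half; lra).
  assert (Hb : upper_half b) by (unfold upper_half; lra).
  apply Rle_trans with ((1 - 0) * (G * (2 / d) * Cmod (b - a))).
  - eapply is_CInt_bound; [lra| |apply path_integral_moebius; auto; apply holo_ge].
    intros t Ht. cbv beta zeta. set (z := (a + RtoC t * (b - a))%C).
    destruct (box_segment a b t R0 d D Ht Ha1 Hb1 Ha2 Hb2) as [B1 B2]. fold z in B1, B2.
    assert (Hz : upper_half z) by (unfold upper_half; lra).
    pose proof (mden_nz A z HA Hz) as N. pose proof (proj1 (Cmod_gt_0 _) N) as Nm.
    replace (ge x' x (moebius A z) * (/ mden A z ^ 2 * (b - a)))%C with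
      ((g z * (eta x' x (moebius A z) * / mden A z ^ 2)) * (b - a))%C by (unfold ge; rewrite ginv by auto; ring).
    rewrite Cmod_mult. apply Rmult_le_compat_r; [apply Cmod_ge_0|].
    rewrite Cmod_mult. apply Rmult_le_compat; try apply Cmod_ge_0; [now apply HG|].
    rewrite Cmod_mult, Cmod_inv, Cmod_pow by now apply Cpow_nz.
    apply Rle_trans with (2 / Im (moebius A z) * / Cmod (mden A z) ^ 2).
    + apply Rmult_le_compat_r; [apply Rlt_le, Rinv_0_lt_compat, pow_lt, Nm|]. apply eta_bound.
      now apply moebius_upper.
    + rewrite moebius_im by auto. fold (mden A z).
      replace (2 / (Im z / Cmod (mden A z) ^ 2) * / Cmod (mden A z) ^ 2) with (2 / Im z) by (field; lra).
      apply Rmult_le_compat_l; [lra|]. apply Rinv_le_contravar; lra.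
  - rewrite Rminus_0_r, Rmult_1_l. apply Rmult_le_compat_l; [apply Rmult_le_pos; lra|].
    eapply Rle_trans; [apply Cmod_le_abs|]. destruct a as [a1 a2], b as [b1 b2]. simpl in *.
    apply Rabs_le_between in Ha1. apply Rabs_le_between in Hb1.
    pose proof (Rle_abs R0). pose proof (Rle_abs D).
    assert (Rabs (b1 + - a1) <= 2 * Rabs R0) by (apply Rabs_le; lra).
    assert (Rabs (b2 + - a2) <= 2 * Rabs D) by (apply Rabs_le; lra). lra.
Qed.

Definition mdenR (A : mat2) (r : R) : R := IZR (m21 A) * r + IZR (m22 A).

(** [A z - A r = (z - r) / ((c z + d) (c r + d))] by determinant 1; in the difference of the two
    poles the derivative factor [(c z + d)^2] cancels. *)
Lemma eta_moebius A r s z : SL2Z A -> upper_half z -> mdenR A r <> 0 -> mdenR A s <> 0 ->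
  (eta (Some (moebiusR A r)) (Some (moebiusR A s)) (moebius A z) * / mden A z ^ 2)%C = eta (Some r) (Some s) z.
Proof.
  intros HA Hz Hr Hs. pose proof (mden_nz A z HA Hz) as N. pose proof (SL2Z_C A HA) as D.
  assert (G : forall r, mdenR A r <> 0 ->
     (moebius A z - RtoC (moebiusR A r))%C = ((z - RtoC r) / (mden A z * RtoC (mdenR A r)))%C).
  { intros t Ht. unfold moebius, moebiusR. fold (mden A z). fold (mdenR A t). rewrite RtoC_div by auto.
    apply RtoC_neq in Ht. unfold mden, mdenR in *. rewrite !RtoC_plus, !RtoC_mult in *.
    transitivity ((RtoC (IZR (m11 A)) * RtoC (IZR (m22 A)) - RtoC (IZR (m12 A)) * RtoC (IZR (m21 A))) * (z - RtoC t)
      / ((RtoC (IZR (m21 A)) * z + RtoC (IZR (m22 A))) * (RtoC (IZR (m21 A)) * RtoC t + RtoC (IZR (m22 A)))))%C.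
    - field. auto.
    - rewrite D. field. auto. }
  unfold eta, simple_pole. rewrite !G by auto.
  pose proof (upper_half_minus_real_neq z r Hz) as Z1. pose proof (upper_half_minus_real_neq z s Hz) as Z2.
  assert (Nr := RtoC_neq _ Hr). assert (Ns := RtoC_neq _ Hs).
  transitivity ((RtoC (mdenR A r) * (z - RtoC s) - RtoC (mdenR A s) * (z - RtoC r)) / (mden A z * ((z - RtoC r) * (z - RtoC s))))%C.
  - field. auto.
  - unfold mdenR, mden in *. rewrite !RtoC_plus, !RtoC_mult. field. auto.
Qed.

Lemma path_integral_transform A r s a b : SL2Z A -> upper_half a -> upper_half b ->
  mdenR A r <> 0 -> mdenR A s <> 0 ->
  path_integral (ge (Some (moebiusR A r)) (Some (moebiusR A s))) (moebius A a) (moebius A b) =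
  path_integral (ge (Some r) (Some s)) a b.
Proof.
  intros HA Ha Hb Hr Hs.
  pose proof (is_CInt_unique _ _ _ _ (path_integral_moebius _ A a b (holo_ge (Some (moebiusR A r)) (Some (moebiusR A s))) HA Ha Hb)) as E.
  rewrite <- E. unfold path_integral. apply (RInt_ext (V := C_R_CompleteNormedModule)).
  intros t Ht. rewrite Rmin_left, Rmax_right in Ht by lra. cbv beta zeta.
  assert (Hz := upper_half_segment a b t Ha Hb ltac:(lra)). set (z := (a + RtoC t * (b - a))%C) in *.
  unfold ge. rewrite ginv by auto. rewrite <- (eta_moebius A r s z) by auto. match goal with |- ?u = ?v => change (@eq C u v) end. ring.
Qed.

End Invariant.

(** * Renormalization on cones *)

Definition in_cone (x C0 Y0 : R) (z : C) : Prop := 0 < Im z <= Y0 /\ Rabs (Re z - x) <= C0 * Im z.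

(** In contrast to [bounded_cf] the index 0 is included, so [B] also bounds [|x|]; this puts the
    renormalized points into one box from [r = 0] on. *)
Definition cf_bound (x B : R) : Prop := irrational x /\ 1 <= B /\ forall n, Rabs (cq x n) <= B.

Lemma cf_bound_exists x : badly_approximable x -> exists B, cf_bound x B.
Proof.
  intros H. apply badly_approximable_bounded in H. destruct H as [B [H HB]].
  exists (Rmax 1 (Rmax B (Rabs x))). split; auto. split; [apply Rmax_l|]. intros [|n].
  - simpl. eapply Rle_trans; [|apply Rmax_r]. apply Rmax_r.
  - rewrite Rabs_right by (pose proof (cq_gt_1 x (S n) H ltac:(lia)); lra).
    eapply Rle_trans; [apply HB; lia|]. eapply Rle_trans; [|apply Rmax_r]. apply Rmax_l.
Qed.

Lemma cf_bound_S x B n : cf_bound x B -> 1 < cq x (S n) <= B.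
Proof.
  intros (H & _ & HB). pose proof (cq_gt_1 x (S n) H ltac:(lia)) as H1. specialize (HB (S n)).
  rewrite Rabs_right in HB; lra.
Qed.

Lemma Dprod_S_le x B n : cf_bound x B -> Dprod x n <= Dprod x (S n) <= B * Dprod x n.
Proof.
  intros H. pose proof (cf_bound_S x B n H). destruct H as (H & _). split; [now apply Dprod_mono|].
  rewrite Dprod_S, Rmult_comm. apply Rmult_le_compat_r; [|lra]. pose proof (Dprod_ge_1 x n H); lra.
Qed.

Definition cfmat (x : R) (n : nat) : mat2 := gamma (cflist x n).

Lemma cfmat_even x r : SL2Z (cfmat x (2 * r)).
Proof. apply gamma_SL2Z. rewrite cflist_length. now exists r. Qed.

Lemma cfmat_bottom_le x n : irrational x ->
  0 <= IZR (m21 (cfmat x n)) <= Dprod x n.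
Proof.
  intros H. destruct n as [|n].
  - unfold cfmat, cflist, gamma, mat_one; simpl. lra.
  - pose proof (gamma_bottom x (S n) H ltac:(lia)) as (P1 & P2).
    destruct (gamma_action x (S n) H) as [_ E]. fold (cfmat x (S n)) in *.
    destruct P1 as [P1 P3]. apply IZR_le in P1, P2, P3.
    pose proof (cq_gt_1 x (S n) H ltac:(lia)). nra.
Qed.

(** Renormalization: pulling a cone point at height about [D_{2r}^-2] back by [gamma_{2r}]
    brings it into a box depending only on the constants. *)
Lemma cusp_window x B C0 s Y r p : cf_bound x B -> 0 <= C0 -> 0 < s -> 0 < Y ->
  s / Dprod x (2 * r) ^ 2 <= Im p <= Y / Dprod x (2 * r) ^ 2 -> Rabs (Re p - x) <= C0 * Im p ->
  exists w, p = moebius (cfmat x (2 * r)) w /\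
    Rabs (Re w) <= B + (1 + C0) ^ 2 * Y /\ s / (1 + (C0 + 1) * Y) ^ 2 <= Im w <= (1 + C0) ^ 2 * Y.
Proof.
  intros (H & HB1 & HB) HC Hs HY Hp Hre.
  pose proof (cfmat_even x r) as HA. destruct (gamma_action x (2 * r) H) as [E1 E2].
  fold (cfmat x (2 * r)) in E1, E2. pose proof (cfmat_bottom_le x (2 * r) H) as Hc.
  pose proof (SL2Z_R _ HA) as Hdet.
  pose proof (Dprod_ge_1 x (2 * r) H) as HD. specialize (HB (2 * r)%nat).
  set (A := cfmat x (2 * r)) in *. set (D := Dprod x (2 * r)) in *. set (xi := cq x (2 * r)) in *.
  set (a := IZR (m11 A)) in *. set (b := IZR (m12 A)) in *. set (c := IZR (m21 A)) in *. set (d := IZR (m22 A)) in *.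
  assert (HD2 : 0 < D ^ 2) by (apply pow_lt; lra).
  assert (Hy0 : 0 < Im p) by (eapply Rlt_le_trans; [|apply Hp]; now apply Rdiv_lt_0_compat).
  assert (Eac : a - c * x = / D).
  { apply Rmult_eq_reg_r with D; [|lra]. rewrite Rinv_l by lra.
    replace ((a - c * x) * D) with (a * D - c * (x * D)) by ring. rewrite <- E1, <- E2, <- Hdet. ring. }
  assert (HyD : Im p * D <= Y / D).
  { apply Rmult_le_reg_r with D; [lra|]. replace (Y / D * D) with Y by (field; lra).
    replace (Im p * D * D) with (Im p * D ^ 2) by ring.
    apply Rle_trans with (Y / D ^ 2 * D ^ 2); [apply Rmult_le_compat_r; lra|]. right; field; lra. }
  (* The denominator of the inverse of [A] at [p]. It equals [1 / D - c (p - x)] and has size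
     [1 / D]: from above because [c <= D] and [Im p <= Y / D^2], from below because its real and
     imaginary parts cannot both be small for [p] in the cone. *)
  set (den := (RtoC a - RtoC c * p)%C).
  set (u := Re p) in *. set (y := Im p) in *.
  assert (Ere : Re den = / D - c * (u - x)).
  { rewrite <- Eac. unfold den, u. destruct p; simpl. ring. }
  assert (Eim : Im den = - (c * y)).
  { unfold den, y. destruct p; simpl. ring. }
  assert (Hpx : Rabs (u - x) + y <= (C0 + 1) * y) by lra.
  assert (Hup : Cmod den <= (1 + (C0 + 1) * Y) / D).
  { eapply Rle_trans; [apply Cmod_le_abs|]. rewrite Ere, Eim, Rabs_Ropp, Rabs_mult, (Rabs_right c), (Rabs_right y) by lra.
    apply Rle_trans with (/ D + c * (Rabs (u - x) + y)).
    - assert (Rabs (/ D - c * (u - x)) <= / D + c * Rabs (u - x)); [|lra].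
      eapply Rle_trans; [apply Rabs_triang|]. rewrite Rabs_Ropp, Rabs_mult, (Rabs_right c) by lra.
      rewrite Rabs_right by (apply Rle_ge, Rlt_le, Rinv_0_lt_compat; lra). lra.
    - apply Rle_trans with (/ D + D * ((C0 + 1) * y)).
      + apply Rplus_le_compat_l. apply Rmult_le_compat; try lra.
        pose proof (Rabs_pos (u - x)); lra.
      + replace ((1 + (C0 + 1) * Y) / D) with (/ D + (C0 + 1) * (Y / D)) by (field; lra).
        replace (D * ((C0 + 1) * y)) with ((C0 + 1) * (y * D)) by ring.
        apply Rplus_le_compat_l, Rmult_le_compat_l; lra. }
  assert (Hlow : / D <= (1 + C0) * Cmod den).
  { pose proof (re_le_Cmod den) as R1. pose proof (im_le_Cmod den) as R2.
    rewrite Ere in R1. rewrite Eim, Rabs_Ropp in R2.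
    assert (R3 : / D - c * (u - x) <= Cmod den) by (eapply Rle_trans; [apply Rle_abs|exact R1]).
    assert (R4 : c * y <= Cmod den) by (eapply Rle_trans; [apply Rle_abs|exact R2]).
    assert (u - x <= C0 * y) by (eapply Rle_trans; [apply Rle_abs|exact Hre]).
    assert (c * (u - x) <= c * (C0 * y)) by (apply Rmult_le_compat_l; lra).
    assert (C0 * (c * y) <= C0 * Cmod den) by (apply Rmult_le_compat_l; lra). lra. }
  assert (HiD : 0 < / D) by (apply Rinv_0_lt_compat; lra).
  assert (Hden : 0 < Cmod den) by nra.
  assert (Nden : den <> 0) by now apply Cmod_pos_neq.
  (* The preimage of [p] under [A]. Its distance to [xi], the preimage of [x], is
     [D |p - x| / |den|], which is bounded. *)
  set (w := ((RtoC d * p - RtoC b) / den)%C).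
  assert (Hw : (w - RtoC xi)%C = (RtoC D * (p - RtoC x) / den)%C).
  { unfold w. replace (RtoC D * (p - RtoC x))%C with (RtoC D * p - RtoC (x * D))%C by (rewrite RtoC_mult; ring).
    rewrite <- E1, <- E2. rewrite !RtoC_plus, !RtoC_mult. unfold den in *. field. auto. }
  assert (Hm : (RtoC c * w + RtoC d = / den)%C).
  { unfold w. transitivity ((RtoC (a * d - b * c)) / den)%C.
    - rewrite RtoC_minus, !RtoC_mult. unfold den in *. field. auto.
    - rewrite Hdet. unfold Cdiv. ring. }
  assert (Him : Im w = y / Cmod den ^ 2).
  { assert (G : w = ((RtoC d * p - RtoC b) * Cconj den / RtoC (Cmod den ^ 2))%C).
    { rewrite Cmod2_conj. unfold w.
      field. split; auto. intros E. apply Nden. rewrite <- (Cconj_conj den), E. unfold Cconj, RtoC; simpl. f_equal; ring. }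
    rewrite G. unfold Cdiv. rewrite <- RtoC_inv by (apply Rgt_not_eq, pow_lt, Hden).
    rewrite im_scal_r. unfold Rdiv. f_equal. unfold den, y. destruct p as [p1 p2]. simpl.
    transitivity ((a * d - b * c) * p2); [ring|rewrite Hdet; ring]. }
  exists w. split; [|split].
  - unfold moebius. fold a b c d.
    assert (N2 : (RtoC c * w + RtoC d <> 0)%C) by (rewrite Hm; apply Cinv_nz || (intros E; apply C1_nz; rewrite <- (Cinv_r den Nden), E; ring)).
    transitivity ((RtoC (a * d - b * c)) * p / (den * (RtoC c * w + RtoC d)))%C.
    + rewrite Hdet, Hm. field. auto.
    + unfold w in *. rewrite RtoC_minus, !RtoC_mult. unfold den in *. field. split; auto.
      intros E. apply N2.
      replace (RtoC c * ((RtoC d * p - RtoC b) / (RtoC a - RtoC c * p)) + RtoC d)%C with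
        ((RtoC c * (RtoC d * p - RtoC b) + RtoC d * (RtoC a - RtoC c * p)) / (RtoC a - RtoC c * p))%C by (field; auto).
      rewrite E. unfold Cdiv; ring.
  - assert (Hwx : Cmod (w - RtoC xi)%C <= (1 + C0) ^ 2 * Y).
    { rewrite Hw, Cmod_div, Cmod_mult, Cmod_R, Rabs_right by (auto; lra).
      apply Rmult_le_reg_r with (Cmod den); auto. unfold Rdiv. rewrite Rmult_assoc, Rinv_l, Rmult_1_r by lra.
      assert (Cmod (p - RtoC x) <= (C0 + 1) * y).
      { eapply Rle_trans; [apply Cmod_le_abs|]. unfold u, y in *. destruct p as [p1 p2]; simpl in *.
        rewrite Ropp_0, Rplus_0_r, (Rabs_right p2) by lra. unfold Rminus in Hpx. exact Hpx. }
      apply Rle_trans with (D * ((C0 + 1) * y)); [apply Rmult_le_compat_l; lra|].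
      apply Rle_trans with ((C0 + 1) * (Y * / D)).
      - replace (D * ((C0 + 1) * y)) with ((C0 + 1) * (y * D)) by ring. apply Rmult_le_compat_l; lra.
      - replace ((1 + C0) ^ 2 * Y * Cmod den) with ((C0 + 1) * (Y * ((1 + C0) * Cmod den))) by ring.
        apply Rmult_le_compat_l; [lra|]. apply Rmult_le_compat_l; lra. }
    pose proof (re_le_Cmod (w - RtoC xi)%C) as R1.
    replace (Re (w - RtoC xi)%C) with (Re w - xi) in R1 by (destruct w; simpl; ring).
    replace (Re w) with (xi + (Re w - xi)) by ring. eapply Rle_trans; [apply Rabs_triang|]. lra.
  - split.
    + rewrite Him. assert (Q : 0 < 1 + (C0 + 1) * Y) by nra.
      apply Rmult_le_reg_r with (Cmod den ^ 2); [now apply pow_lt|].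
      replace (y / Cmod den ^ 2 * Cmod den ^ 2) with y by (field; lra).
      apply Rle_trans with (s / (1 + (C0 + 1) * Y) ^ 2 * ((1 + (C0 + 1) * Y) / D) ^ 2).
      * apply Rmult_le_compat_l; [apply Rlt_le, Rdiv_lt_0_compat; auto; now apply pow_lt|].
        apply pow_incr. lra.
      * apply Rle_trans with (s / D ^ 2); [|lra]. right. field. lra.
    + pose proof (im_le_Cmod (w - RtoC xi)%C) as R1.
      replace (Im (w - RtoC xi)%C) with (Im w) in R1 by (destruct w; simpl; ring).
      apply Rle_trans with (Cmod (w - RtoC xi)%C); [eapply Rle_trans; [apply Rle_abs|exact R1]|].
      rewrite Hw, Cmod_div, Cmod_mult, Cmod_R, Rabs_right by (auto; lra).
      apply Rmult_le_reg_r with (Cmod den); auto. unfold Rdiv. rewrite Rmult_assoc, Rinv_l, Rmult_1_r by lra.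
      assert (Cmod (p - RtoC x) <= (C0 + 1) * y).
      { eapply Rle_trans; [apply Cmod_le_abs|]. unfold u, y in *. destruct p as [p1 p2]; simpl in *.
        rewrite Ropp_0, Rplus_0_r, (Rabs_right p2) by lra. unfold Rminus in Hpx. exact Hpx. }
      apply Rle_trans with (D * ((C0 + 1) * y)); [apply Rmult_le_compat_l; lra|].
      apply Rle_trans with ((C0 + 1) * (Y * / D)).
      * replace (D * ((C0 + 1) * y)) with ((C0 + 1) * (y * D)) by ring. apply Rmult_le_compat_l; lra.
      * replace ((1 + C0) ^ 2 * Y * Cmod den) with ((C0 + 1) * (Y * ((1 + C0) * Cmod den))) by ring.
        apply Rmult_le_compat_l; [lra|]. apply Rmult_le_compat_l; lra.
Qed.

(** Take an index at which the upper bound holds and fails for the next one;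
    [D_(2r+2) <= B^2 D_(2r)] then gives the lower bound with the factor [B ^ 4]. *)
Lemma window_cover x B Y0 y : cf_bound x B -> 0 < Y0 -> 0 < y <= Y0 ->
  exists r, (Y0 / B ^ 4) / Dprod x (2 * r) ^ 2 <= y <= Y0 / Dprod x (2 * r) ^ 2.
Proof.
  intros HB HY Hy. pose proof HB as (H & HB1 & _).
  assert (HB4 : 0 < B ^ 4) by (apply pow_lt; lra).
  destruct (Dprod_unbounded x (Y0 / y + 1) H) as [N HN].
  assert (G : forall n, (exists r, (Y0 / B ^ 4) / Dprod x (2 * r) ^ 2 <= y <= Y0 / Dprod x (2 * r) ^ 2) \/
     y <= Y0 / Dprod x (2 * n) ^ 2).
  { induction n as [|n [IH|IH]]; [right; simpl; rewrite Rdiv_1_r || idtac|now left|].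
    - replace (Y0 / (1 * (1 * 1))) with Y0 by field. lra.
    - destruct (Rle_dec y (Y0 / Dprod x (2 * S n) ^ 2)) as [L|L]; [now right|left].
      exists n. split; auto. apply Rnot_le_lt in L. apply Rlt_le. eapply Rle_lt_trans; [|exact L].
      pose proof (Dprod_ge_1 x (2 * n) H).
      pose proof (Dprod_ge_1 x (2 * S n) H).
      assert (Dprod x (2 * S n) <= B ^ 2 * Dprod x (2 * n)).
      { replace (2 * S n)%nat with (S (S (2 * n))) by lia.
        pose proof (Dprod_S_le x B (2 * n) HB). pose proof (Dprod_S_le x B (S (2 * n)) HB). nra. }
      replace (Y0 / B ^ 4 / Dprod x (2 * n) ^ 2) with (Y0 / (B ^ 2 * Dprod x (2 * n)) ^ 2) by (field; split; lra).
      apply Rmult_le_compat_l; [lra|]. apply Rinv_le_contravar; [apply pow_lt; lra|]. apply pow_incr; lra. }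
  destruct (G N) as [R|R]; auto. exfalso. specialize (HN (2 * N)%nat ltac:(lia)).
  set (D := Dprod x (2 * N)) in *.
  assert (0 < Y0 / y) by (apply Rdiv_lt_0_compat; lra).
  assert (D <= D ^ 2) by nra.
  apply Rmult_le_compat_r with (r := D ^ 2) in R; [|nra].
  replace (Y0 / D ^ 2 * D ^ 2) with Y0 in R by (field; lra).
  assert (y * (Y0 / y + 1) <= y * D ^ 2) by (apply Rmult_le_compat_l; lra).
  replace (y * (Y0 / y + 1)) with (Y0 + y) in H2 by (field; lra). lra.
Qed.

Lemma Cmod_minus_sym (a b : C) : Cmod (a - b)%C = Cmod (b - a)%C.
Proof. rewrite <- Cmod_opp. f_equal. ring. Qed.

Lemma Ceq_parts (a b : C) : Re a = Re b -> Im a = Im b -> a = b.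
Proof. destruct a, b; simpl; congruence. Qed.

(** * Vertical integrals at x *)

Section Cusp.
Variable g : C -> C.
Hypothesis hg : holo g.
Hypothesis ginv : forall A z, SL2Z A -> upper_half z -> g (moebius A z) = g z.
Variables (x B : R).
Hypothesis hB : cf_bound x B.

Lemma cone_bounded C0 Y0 : 0 <= C0 -> 0 < Y0 ->
  exists G, 0 <= G /\ forall p, in_cone x C0 Y0 p -> Cmod (g p) <= G.
Proof.
  intros HC HY. pose proof hB as (H & HB1 & _).
  assert (HB4 : 0 < B ^ 4) by (apply pow_lt; lra).
  set (s := Y0 / B ^ 4). assert (Hs : 0 < s) by now apply Rdiv_lt_0_compat.
  destruct (holo_bounded_box g (B + (1 + C0) ^ 2 * Y0) (s / (1 + (C0 + 1) * Y0) ^ 2) ((1 + C0) ^ 2 * Y0) hg) as [G [HG0 HG]].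
  { apply Rdiv_lt_0_compat; auto. apply pow_lt. nra. }
  exists G. split; auto. intros p [Hp1 Hp2].
  destruct (window_cover x B Y0 (Im p) hB HY Hp1) as [r Hr]. fold s in Hr.
  destruct (cusp_window x B C0 s Y0 r p hB HC Hs HY Hr Hp2) as (w & -> & W1 & W2).
  rewrite ginv; auto; [apply cfmat_even|]. unfold upper_half.
  eapply Rlt_le_trans; [|apply W2]. apply Rdiv_lt_0_compat; auto. apply pow_lt. nra.
Qed.

Definition vpt (y : R) : C := (RtoC x + Ci * RtoC y)%C.

Lemma vpt_re y : Re (vpt y) = x.
Proof. unfold vpt. simpl. ring. Qed.
Lemma vpt_im y : Im (vpt y) = y.
Proof. unfold vpt. simpl. ring. Qed.
Lemma vpt_upper y : 0 < y -> upper_half (vpt y).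
Proof. intros. unfold upper_half. now rewrite vpt_im. Qed.

Definition hint (y : R) : C := path_integral (ge g None (Some x)) (vpt 1) (vpt y).

Lemma vpt_cone y Y0 : 0 < y <= Y0 -> in_cone x 0 Y0 (vpt y).
Proof.
  intros H. split; rewrite ?vpt_im, ?vpt_re; auto. rewrite Rminus_diag, Rabs_R0. lra.
Qed.

Lemma vseg_im a b t : Im (vpt a + RtoC t * (vpt b - vpt a))%C = (1 - t) * a + t * b.
Proof. unfold vpt. simpl. ring. Qed.
Lemma vseg_re a b t : Re (vpt a + RtoC t * (vpt b - vpt a))%C = x.
Proof. unfold vpt. simpl. ring. Qed.
Lemma vseg_len a b : Cmod (vpt b - vpt a)%C = Rabs (b - a).
Proof.
  replace (vpt b - vpt a)%C with (Ci * RtoC (b - a))%C by (unfold vpt; rewrite RtoC_minus; ring).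
  rewrite Cmod_mult, Cmod_Ci, Cmod_R. ring.
Qed.

Lemma vseg_bound x' Y0 : 0 < Y0 -> exists G, 0 <= G /\ forall a b m, 0 < m -> m <= a <= Y0 -> m <= b <= Y0 ->
  Cmod (path_integral (ge g x' (Some x)) (vpt a) (vpt b)) <= G * (2 / m) * Rabs (b - a).
Proof.
  intros HY. destruct (cone_bounded 0 Y0 ltac:(lra) HY) as [G [HG0 HG]].
  exists G. split; auto. intros a b m Hm Ha Hb.
  rewrite <- vseg_len. apply path_integral_bound; try (apply vpt_upper; lra).
  { now apply holo_ge. }
  intros t Ht. set (z := (vpt a + RtoC t * (vpt b - vpt a))%C).
  assert (Hz : m <= Im z <= Y0) by (unfold z; rewrite vseg_im; nra).
  eapply Rle_trans; [apply (ge_bound g _ _ _ G)|].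
  - unfold upper_half; lra.
  - apply HG. split; [lra|]. unfold z at 1. rewrite vseg_re, Rminus_diag, Rabs_R0. lra.
  - apply Rmult_le_compat_l; auto. apply Rmult_le_compat_l; [lra|]. apply Rinv_le_contravar; lra.
Qed.

Lemma hint_diff a b : 0 < a -> 0 < b ->
  (hint b - hint a)%C = path_integral (ge g None (Some x)) (vpt a) (vpt b).
Proof.
  intros Ha Hb. unfold hint.
  rewrite <- (path_integral_chasles _ (vpt 1) (vpt a) (vpt b)); [ring|now apply holo_ge| | |];
  apply vpt_upper; lra.
Qed.

(** Above the smaller height [m] the integrand is at most [2 G / m], and the segment has length at
    most [lam m]. *)
Lemma hint_ratio lam Y0 : 1 <= lam -> 0 < Y0 -> exists K, 0 <= K /\ forall a b,
  0 < a <= Y0 -> 0 < b <= Y0 -> a <= lam * b -> b <= lam * a -> Cmod (hint b - hint a)%C <= K.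
Proof.
  intros Hl HY. destruct (vseg_bound None Y0 HY) as [G [HG0 HG]].
  exists (G * 2 * lam). split; [nra|]. intros a b Ha Hb Hab Hba.
  rewrite hint_diff by lra. set (m := Rmin a b).
  assert (Hm : 0 < m) by (apply Rmin_pos; lra).
  eapply Rle_trans; [apply (HG a b m)|]; try (split; [|lra]); auto; [apply Rmin_l|apply Rmin_r|].
  assert (Rabs (b - a) <= lam * m).
  { unfold m, Rmin. destruct (Rle_dec a b).
    - rewrite Rabs_right; nra.
    - rewrite Rabs_left; nra. }
  unfold Rdiv. replace (G * (2 * / m) * Rabs (b - a)) with (G * 2 * (/ m * Rabs (b - a))) by ring.
  apply Rmult_le_compat_l; [lra|]. apply Rmult_le_reg_l with m; auto.
  rewrite <- Rmult_assoc, Rinv_r by lra. lra.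
Qed.

(** On the line [Re z = x] the pole [x'] stays at distance at least [|x - x'|], so its contribution
    is bounded. The segment starts at height 1, which explains [Y1]. *)
Lemma pole_part_bound x' Y0 : x' <> Some x -> 0 < Y0 -> exists K, 0 <= K /\ forall y, 0 < y <= Y0 ->
  Cmod (path_integral (ge g x' (Some x)) (vpt 1) (vpt y) - hint y)%C <= K.
Proof.
  intros Hx' HY. set (Y1 := Rmax 1 Y0). assert (HY1 : 1 <= Y1) by apply Rmax_l.
  assert (HY2 : Y0 <= Y1) by apply Rmax_r.
  destruct (cone_bounded 0 Y1 ltac:(lra) ltac:(lra)) as [G [HG0 HG]].
  set (e := match x' with Some r => / Rabs (x - r) | None => 0 end).
  assert (He : 0 <= e).
  { unfold e. destruct x' as [r|]; [|lra]. apply Rlt_le, Rinv_0_lt_compat, Rabs_pos_lt.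
    intros E. apply Hx'. f_equal. lra. }
  assert (HP : holo (fun z => (g z * simple_pole x' z)%C)) by (apply holo_mult; [auto|apply holo_simple_pole]).
  exists (G * e * Y1). split; [repeat apply Rmult_le_pos; lra|]. intros y Hy.
  assert (U1 : upper_half (vpt 1)) by (apply vpt_upper; lra).
  assert (Uy : upper_half (vpt y)) by (apply vpt_upper; lra).
  assert (E : path_integral (ge g x' (Some x)) (vpt 1) (vpt y) =
    (hint y + path_integral (fun z => (g z * simple_pole x' z)%C) (vpt 1) (vpt y))%C).
  { unfold hint. rewrite <- path_integral_plus; auto; [|now apply holo_ge].
    apply path_integral_ext; auto. intros z _. unfold ge, eta. simpl. ring. }
  rewrite E.
  match goal with |- Cmod ?u <= _ => replace u with (path_integral (fun z => (g z * simple_pole x' z)%C) (vpt 1) (vpt y)) by ring end.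
  eapply Rle_trans; [apply (path_integral_bound _ _ _ (G * e)); auto|].
  - intros t Ht. set (z := (vpt 1 + RtoC t * (vpt y - vpt 1))%C).
    assert (Iz : 0 < Im z <= Y1) by (unfold z; rewrite vseg_im; nra).
    rewrite Cmod_mult. apply Rmult_le_compat; try apply Cmod_ge_0.
    + apply HG. split; auto. unfold z at 1. rewrite vseg_re, Rminus_diag, Rabs_R0. lra.
    + unfold e. destruct x' as [r|]; simpl; [|rewrite Cmod_0; lra].
      assert (N : 0 < Rabs (x - r)) by (apply Rabs_pos_lt; intros E'; apply Hx'; f_equal; lra).
      rewrite Cmod_inv by (apply upper_half_minus_real_neq; unfold upper_half; lra).
      apply Rinv_le_contravar; auto. eapply Rle_trans; [|apply re_le_Cmod].
      right. f_equal. replace (Re (z - RtoC r)%C) with (Re z - r) by (destruct z; simpl; ring).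
      unfold z. now rewrite vseg_re.
  - apply Rmult_le_compat_l; [apply Rmult_le_pos; lra|]. rewrite vseg_len. apply Rabs_le. lra.
Qed.

(** The path descends vertically to the height [y] of [p] and then runs horizontally over a length
    of at most [C0 y], where the integrand is at most [2 G / y]. *)
Lemma cone_integral z0 x' C0 Y0 : upper_half z0 -> x' <> Some x -> 0 <= C0 -> 0 < Y0 ->
  exists K, 0 <= K /\ forall p, in_cone x C0 Y0 p ->
    Cmod (path_integral (ge g x' (Some x)) z0 p - hint (Im p))%C <= K.
Proof.
  intros Hz0 Hx' HC HY.
  destruct (pole_part_bound x' Y0 Hx' HY) as [K1 [HK1 P1]].
  destruct (cone_bounded C0 Y0 HC HY) as [G [HG0 HG]].
  exists (Cmod (path_integral (ge g x' (Some x)) z0 (vpt 1)) + K1 + G * 2 * C0).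
  split. { pose proof (Cmod_ge_0 (path_integral (ge g x' (Some x)) z0 (vpt 1))). assert (0 <= G * 2 * C0) by nra. lra. }
  intros p [Hp1 Hp2]. set (y := Im p) in *.
  assert (Hp : upper_half p) by (unfold upper_half; apply Hp1).
  assert (U1 : upper_half (vpt 1)) by (apply vpt_upper; lra).
  assert (Uy : upper_half (vpt y)) by (apply vpt_upper; lra).
  pose proof (holo_ge g hg x' (Some x)) as HH.
  rewrite <- (path_integral_chasles _ z0 (vpt 1) p), <- (path_integral_chasles _ (vpt 1) (vpt y) p) by auto.
  match goal with |- Cmod (?a + (?b + ?c) - ?d)%C <= _ => replace (a + (b + c) - d)%C with (a + (b - d) + c)%C by ring end.
  apply Cmod_plus_le; [apply Cmod_plus_le; [lra|apply P1, Hp1]|].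
  eapply Rle_trans; [apply (path_integral_bound _ _ _ (G * (2 / y))); auto|].
  - intros t Ht. set (z := (vpt y + RtoC t * (p - vpt y))%C).
    assert (Iz : Im z = y) by (unfold z, y, vpt; destruct p; simpl; ring).
    assert (Rz : Re z - x = t * (Re p - x)) by (unfold z, vpt; destruct p; simpl; ring).
    rewrite <- Iz. apply ge_bound; [unfold upper_half; lra|]. apply HG. split; rewrite Iz; auto.
    rewrite Rz, Rabs_mult, (Rabs_right t) by lra. pose proof (Rabs_pos (Re p - x)). nra.
  - assert (L : Cmod (p - vpt y)%C <= C0 * y).
    { replace (p - vpt y)%C with (RtoC (Re p - x)).
      - now rewrite Cmod_R.
      - apply Ceq_parts; unfold vpt, y; destruct p; simpl; ring. }
    apply Rle_trans with (G * (2 / y) * (C0 * y)).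
    + apply Rmult_le_compat_l; auto. apply Rmult_le_pos; auto. apply Rlt_le, Rdiv_lt_0_compat; lra.
    + right. field. lra.
Qed.

Definition aseq (n : nat) : C := hint (/ Dprod x n ^ 2).

Lemma inv_D2_bounds n : 0 < / Dprod x n ^ 2 <= 1.
Proof.
  pose proof hB as (H & _). pose proof (Dprod_ge_1 x n H).
  assert (1 <= Dprod x n ^ 2) by nra. split; [apply Rinv_0_lt_compat; lra|].
  rewrite <- Rinv_1. apply Rinv_le_contravar; lra.
Qed.

Lemma aseq_step : exists K, 0 <= K /\ forall n, Cmod (aseq (S n) - aseq n)%C <= K.
Proof.
  pose proof hB as (H & HB1 & _).
  destruct (hint_ratio (B ^ 2) 1) as [K [HK0 HK]]; [nra|lra|].
  exists K. split; auto. intros n. pose proof (inv_D2_bounds n) as I1. pose proof (inv_D2_bounds (S n)) as I2.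
  pose proof (Dprod_S_le x B n hB) as [D1 D2]. pose proof (Dprod_ge_1 x n H).
  apply HK; try lra.
  - rewrite <- (Rinv_inv (B ^ 2)), <- Rinv_mult. apply Rinv_le_contravar.
    + apply Rmult_lt_0_compat; [apply Rinv_0_lt_compat; nra|nra].
    + apply Rmult_le_reg_l with (B ^ 2); [nra|]. rewrite <- Rmult_assoc, Rinv_r by nra.
      rewrite Rmult_1_l. replace (B ^ 2 * Dprod x n ^ 2) with ((B * Dprod x n) ^ 2) by ring. apply pow_incr; lra.
  - apply Rle_trans with (/ Dprod x n ^ 2).
    + apply Rinv_le_contravar; [nra|]. apply pow_incr; lra.
    + assert (1 <= B ^ 2) by nra. nra.
Qed.

(** The vertical point at height [D^-2] and [A z0] are both images under [A] of points of a fixed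
    box, so [moebius_segment_bound] compares them uniformly in [r]. *)
Lemma aseq_gamma z0 x' : upper_half z0 -> x' <> Some x ->
  exists K, 0 <= K /\ forall r,
    Cmod (path_integral (ge g x' (Some x)) z0 (moebius (cfmat x (2 * r)) z0) - aseq (2 * r))%C <= K.
Proof.
  intros Hz0 Hx'. pose proof hB as (H & HB1 & _).
  destruct (cone_integral z0 x' 0 1 Hz0 Hx') as [K1 [HK1 P1]]; try lra.
  set (R0 := Rmax (B + (1 + 0) ^ 2 * 1) (Rabs (Re z0))).
  set (d := Rmin (1 / (1 + (0 + 1) * 1) ^ 2) (Im z0)).
  set (D := Rmax ((1 + 0) ^ 2 * 1) (Im z0)).
  assert (Hd : 0 < d) by (apply Rmin_pos; [lra|exact Hz0]).
  destruct (moebius_segment_bound g hg ginv R0 d D Hd) as [K2 [HK2 P2]].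
  exists (K1 + K2). split; [lra|]. intros r. set (A := cfmat x (2 * r)).
  pose proof (cfmat_even x r) as HA. fold A in HA.
  pose proof (inv_D2_bounds (2 * r)) as I.
  set (y := / Dprod x (2 * r) ^ 2) in *.
  destruct (cusp_window x B 0 1 1 r (vpt y) hB) as (w & Ew & W1 & W2); try lra.
  { rewrite vpt_im. unfold y, Rdiv. lra. }
  { rewrite vpt_re, Rminus_diag, Rabs_R0. lra. }
  fold A in Ew.
  assert (Hw : upper_half w) by (unfold upper_half; lra).
  assert (Uy : upper_half (vpt y)) by (apply vpt_upper; lra).
  rewrite <- (path_integral_chasles _ z0 (vpt y) (moebius A z0)); auto;
    [|now apply holo_ge|now apply moebius_upper].
  match goal with |- Cmod (?a + ?b - ?c)%C <= _ => replace (a + b - c)%C with ((a - c) + b)%C by ring end.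
  apply Cmod_plus_le.
  - unfold aseq. fold y. rewrite <- (vpt_im y) at 2. apply P1, vpt_cone. lra.
  - rewrite Ew. apply P2; auto.
    + eapply Rle_trans; [exact W1|apply Rmax_l].
    + apply Rmax_r.
    + split; [eapply Rle_trans; [apply Rmin_l|apply W2]|eapply Rle_trans; [apply W2|apply Rmax_l]].
    + split; [apply Rmin_r|apply Rmax_r].
Qed.

Lemma aseq_points z0 x' lam : upper_half z0 -> x' <> Some x -> 1 <= lam ->
  exists K, 0 <= K /\ forall n p, Re p = x ->
    / Dprod x n ^ 2 <= lam * Im p -> Im p <= lam * / Dprod x n ^ 2 ->
    Cmod (path_integral (ge g x' (Some x)) z0 p - aseq n)%C <= K.
Proof.
  intros Hz0 Hx' Hl.
  destruct (cone_integral z0 x' 0 lam Hz0 Hx') as [K1 [HK1 P1]]; try lra.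
  destruct (hint_ratio lam lam Hl) as [K2 [HK2 P2]]; try lra.
  exists (K1 + K2). split; [lra|]. intros n p Hre H1 H2.
  pose proof (inv_D2_bounds n) as I. set (y := / Dprod x n ^ 2) in *.
  assert (Ip : 0 < Im p) by nra. assert (Ip2 : Im p <= lam) by nra.
  replace (path_integral (ge g x' (Some x)) z0 p - aseq n)%C with
    ((path_integral (ge g x' (Some x)) z0 p - hint (Im p)) + (hint (Im p) - aseq n))%C by ring.
  apply Cmod_plus_le.
  - apply P1. split; [lra|]. rewrite Hre, Rminus_diag, Rabs_R0. lra.
  - unfold aseq. fold y. apply P2; lra.
Qed.

End Cusp.

Lemma hint_one x y : 0 < y -> hint (fun _ => RtoC 1) x y = RtoC (- ln y).
Proof.
  intros Hy. unfold hint.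
  apply is_CInt_unique.
  replace (RtoC (- ln y)) with (RtoC (- ln (1 + 1 * (y - 1))) - RtoC (- ln (1 + 0 * (y - 1))))%C.
  2: { rewrite <- RtoC_minus. f_equal. replace (1 + 0 * (y - 1)) with 1 by ring. rewrite ln_1. ring_simplify. f_equal. f_equal. ring. }
  assert (HP : forall t, 0 <= t <= 1 -> 0 < 1 + t * (y - 1)) by (intros; nra).
  assert (E : forall t, 0 <= t <= 1 ->
   (ge (fun _ => RtoC 1) None (Some x) (vpt x 1 + RtoC t * (vpt x y - vpt x 1)) * (vpt x y - vpt x 1))%C
    = RtoC (- (/ (1 + t * (y - 1)) * (y - 1)))).
  { intros t Ht. specialize (HP t Ht). unfold ge, eta, simple_pole.
    replace (vpt x 1 + RtoC t * (vpt x y - vpt x 1) - RtoC x)%C with (Ci * RtoC (1 + t * (y - 1)))%C.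
    2: { unfold vpt. rewrite RtoC_plus, RtoC_mult, RtoC_minus. ring. }
    replace (vpt x y - vpt x 1)%C with (Ci * RtoC (y - 1))%C by (unfold vpt; rewrite RtoC_minus; ring).
    rewrite RtoC_opp, RtoC_mult, RtoC_inv by lra.
    assert (N : RtoC (1 + t * (y - 1)) <> 0) by (apply RtoC_neq; lra). pose proof Ci_nz. field. auto. }
  apply (is_RInt_ext (V := C_R_NormedModule) (fun t => RtoC (- (/ (1 + t * (y - 1)) * (y - 1))))).
  { intros t Ht. rewrite Rmin_left, Rmax_right in Ht by lra. rewrite E by lra. reflexivity. }
  apply (CInt_FTC (fun t => RtoC (- ln (1 + t * (y - 1))))); intros t Ht; rewrite Rmin_left, Rmax_right in Ht by lra;
  specialize (HP t Ht).
  - apply Pdiff_intro; simpl.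
    + auto_derive; [lra|]. field. lra.
    + auto_derive; auto.
  - intros eps He.
    assert (Cc : continuous (fun t => - (/ (1 + t * (y - 1)) * (y - 1))) t).
    { apply (ex_derive_continuous (V := R_NormedModule)). auto_derive. lra. }
    apply continuity_pt_filterlim in Cc. destruct (Cc eps He) as [dd [Hd K]]. exists dd; split; auto.
    intros s Hs. rewrite <- RtoC_minus, Cmod_R. destruct (Req_dec_T t s) as [->|N].
    + rewrite Rminus_diag, Rabs_R0. auto.
    + apply (K s). split; [split; auto; exact I|exact Hs].
Qed.

Lemma aseq_one x n : irrational x -> aseq (fun _ => RtoC 1) x n = RtoC (2 * ln (Dprod x n)).
Proof.
  intros H. unfold aseq. pose proof (Dprod_ge_1 x n H).
  rewrite hint_one by (apply Rinv_0_lt_compat; nra). f_equal.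
  rewrite ln_Rinv by nra. replace (Dprod x n ^ 2) with (Dprod x n * Dprod x n) by ring.
  rewrite ln_mult by lra. ring.
Qed.

(** * Integrals along geodesics *)

Lemma Cmult_eq_reg_l (a b c : C) : a <> 0 -> (a * b = a * c)%C -> b = c.
Proof.
  intros Ha E. transitivity (a * b / a)%C; [field; auto|]. rewrite E. field. auto.
Qed.

(** The other endpoint of the full geodesic through [z0] ending at [x]. *)
Definition back_end (z0 : C) (x : R) : P1R :=
  if Req_dec_T (Re z0) x then None else Some (Re z0 + Im z0 ^ 2 / (Re z0 - x)).

Lemma back_end_neq z0 x : upper_half z0 -> back_end z0 x <> Some x.
Proof.
  unfold upper_half, back_end. intros Hz. destruct (Req_dec_T (Re z0) x) as [E|N]; [easy|].
  intros E. injection E as E.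
  assert (Im z0 ^ 2 / (Re z0 - x) = - (Re z0 - x)) by lra.
  apply (f_equal (fun t => t * (Re z0 - x))) in H. unfold Rdiv in H.
  rewrite Rmult_assoc, Rinv_l in H by lra. nra.
Qed.

(** The squared height, at the parameter [t] of [geod_path], of the geodesic from [x0 + i y0] to the
    real point [x0 + D]. *)
Definition geodQ (y0 D t : R) : R := (1 - t) * y0 ^ 2 + t * (1 - t) * D ^ 2.

Section Geodesic.
Variables (x0 y0 x s D : R).
Hypothesis hy0 : 0 < y0.
Hypothesis hs : 0 <= s < 1.
Hypothesis hD : D = x - x0.
Local Notation z0 := ((x0, y0) : C).
Local Notation z := (geod_path (x0, y0) (RtoC x) s).
Local Notation Q := (geodQ y0 D).

Lemma geodQ_pos t : 0 <= t < 1 -> 0 < Q t.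
Proof. intros Ht. unfold geodQ. assert (0 < y0 ^ 2) by nra. assert (0 <= D ^ 2) by apply pow2_ge_0.
  assert (0 <= t * (1 - t) * D ^ 2) by (apply Rmult_le_pos; nra).
  assert (0 < (1 - t) * y0 ^ 2) by (apply Rmult_lt_0_compat; lra). lra.
Qed.

Lemma geod_z : z = (x0 + s * D, sqrt (Q s)).
Proof.
  unfold geod_path, geodQ. rewrite hD. cbn [Re Im fst snd RtoC]. f_equal; [ring|]. f_equal. ring.
Qed.

(** Since [geod_path] interpolates [Re] and [|z|^2] affinely, the path from [z0] to an intermediate
    point is an initial part of the path to [x], with the parameter rescaled by [s]. *)
Lemma geod_sub t : geod_path z0 z t = (x0 + (t * s) * D, sqrt (Q (t * s))).
Proof.
  rewrite geod_z. unfold geod_path at 1. cbn [Re Im fst snd RtoC]. f_equal; [ring|]. f_equal.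
  replace (sqrt (Q s) ^ 2) with (Q s).
  - unfold geodQ. ring.
  - replace (sqrt (Q s) ^ 2) with (sqrt (Q s) * sqrt (Q s)) by ring. rewrite sqrt_sqrt; auto.
    apply Rlt_le, geodQ_pos; lra.
Qed.

Definition geod_v (t : R) : C :=
  (s * D, s * (- y0 ^ 2 + (1 - 2 * (t * s)) * D ^ 2) / (2 * sqrt (Q (t * s)))).

Lemma geod_diff t : 0 <= t <= 1 ->
  is_derive (fun u => Re (geod_path z0 z u)) t (Re (geod_v t)) /\
  is_derive (fun u => Im (geod_path z0 z u)) t (Im (geod_v t)).
Proof.
  intros Ht. assert (P : 0 < Q (t * s)) by (apply geodQ_pos; nra). split.
  - apply (is_derive_ext (fun u => x0 + (u * s) * D)); [intros; now rewrite geod_sub|].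
    simpl. auto_derive; [easy|]. ring.
  - apply (is_derive_ext (fun u => sqrt (Q (u * s)))); [intros; now rewrite geod_sub|].
    assert (N : sqrt (Q (t * s)) <> 0) by (apply Rgt_not_eq, sqrt_lt_R0, P).
    unfold geod_v. simpl Im. revert P N. unfold geodQ. intros P N.
    auto_derive; [exact P|].
    match goal with |- context [sqrt ?a] => match type of P with 0 < ?b => replace a with b by ring end end.
    field. exact N.
Qed.

(** The sum of squares is a perfect square: [4 Q D^2 + (- y0^2 + (1 - 2 t s) D^2)^2 = (D^2 +
    y0^2)^2], with [Q] taken at [t s]. *)
Lemma geod_speed t : 0 <= t <= 1 ->
  hyp_speed (geod_path z0 z) t = s * (D ^ 2 + y0 ^ 2) / (2 * Q (t * s)).
Proof.
  intros Ht. assert (P : 0 < Q (t * s)) by (apply geodQ_pos; nra).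
  destruct (geod_diff t Ht) as [D1 D2]. unfold hyp_speed.
  assert (E1 : Derive (fun u : R => Re (geod_path z0 z u)) t = Re (geod_v t)) by exact (is_derive_unique _ _ _ D1).
  assert (E2 : Derive (fun u : R => Im (geod_path z0 z u)) t = Im (geod_v t)) by exact (is_derive_unique _ _ _ D2).
  rewrite E1, E2, geod_sub. clear D1 D2 E1 E2. unfold geod_v. cbn [Re Im fst snd RtoC].
  assert (Eq : Q (t * s) = (1 - t * s) * y0 ^ 2 + t * s * (1 - t * s) * D ^ 2) by reflexivity.
  revert Eq. generalize dependent (Q (t * s)). intros q P Eq.
  pose proof (sqrt_lt_R0 q P) as Sp. pose proof (sqrt_sqrt q ltac:(lra)) as Sq.
  generalize dependent (sqrt q). intros r Sp Sq.
  replace ((s * D) ^ 2 + (s * (- y0 ^ 2 + (1 - 2 * (t * s)) * D ^ 2) / (2 * r)) ^ 2) with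
    (Rsqr (s * (D ^ 2 + y0 ^ 2) / (2 * r))).
  - rewrite sqrt_Rsqr.
    + rewrite <- Sq. field. lra.
    + apply Rmult_le_pos; [nra|]. apply Rlt_le, Rinv_0_lt_compat; lra.
  - unfold Rsqr.
    replace (s * (D ^ 2 + y0 ^ 2) / (2 * r) * (s * (D ^ 2 + y0 ^ 2) / (2 * r))) with
      ((s * (D ^ 2 + y0 ^ 2)) ^ 2 / (4 * q)) by (rewrite <- Sq; field; lra).
    replace ((s * (- y0 ^ 2 + (1 - 2 * (t * s)) * D ^ 2) / (2 * r)) ^ 2) with
      ((s * (- y0 ^ 2 + (1 - 2 * (t * s)) * D ^ 2)) ^ 2 / (4 * q)) by (rewrite <- Sq; field; lra).
    apply Rmult_eq_reg_r with (4 * q); [|lra].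
    rewrite Rmult_plus_distr_r. unfold Rdiv. rewrite !Rmult_assoc, Rinv_l, !Rmult_1_r by lra.
    rewrite Eq. ring.
Qed.

Lemma geod_upper t : 0 <= t <= 1 -> upper_half (geod_path z0 z t).
Proof.
  intros Ht. unfold upper_half. rewrite geod_sub. simpl. apply sqrt_lt_R0, geodQ_pos. nra.
Qed.

(** [eta x' x] is the logarithmic differential of [(z - x') / (z - x)], whose argument is constant
    on the geodesic from [x'] to [x]; its restriction is the arc length. Integrals against [ds]
    thereby become path integrals of [ge]. *)
Lemma geod_eta t : 0 <= t <= 1 ->
  (eta (back_end z0 x) (Some x) (geod_path z0 z t) * geod_v t)%C = RtoC (hyp_speed (geod_path z0 z) t).
Proof.
  intros Ht. assert (P : 0 < Q (t * s)) by (apply geodQ_pos; nra).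
  pose proof (geod_upper t Ht) as U. rewrite geod_speed by auto.
  pose proof (upper_half_minus_real_neq _ x U) as N1.
  rewrite geod_sub in *. unfold geod_v.
  assert (Eq : Q (t * s) = (1 - t * s) * y0 ^ 2 + t * s * (1 - t * s) * D ^ 2) by reflexivity.
  revert Eq. generalize dependent (Q (t * s)). intros q P U N1 Eq.
  pose proof (sqrt_lt_R0 q P) as Sp. pose proof (sqrt_sqrt q ltac:(lra)) as Sq.
  generalize dependent (sqrt q). intros r U N1 Sp Sq.
  remember (x0 + t * s * D) as X eqn:EX.
  remember (s * (- y0 ^ 2 + (1 - 2 * (t * s)) * D ^ 2) / (2 * r)) as V eqn:EV.
  rewrite <- Sq. rewrite <- Sq in Eq. clear q P Sq.
  unfold back_end, eta. cbn [Re Im fst snd]. destruct (Req_dec_T x0 x) as [E|N].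
  - cbn [simple_pole].
    assert (E0 : D = 0) by lra.
    apply Cmult_eq_reg_l with ((X, r) - RtoC x)%C; auto.
    transitivity (- (s * D, V)%R)%C; [field; auto|].
    apply Ceq_parts; simpl; rewrite ?EV, ?EX, ?E0, ?E; field; lra.
  - remember (x0 + y0 ^ 2 / (x0 - x)) as w eqn:Ew.
    pose proof (upper_half_minus_real_neq _ w U) as N2. cbn [simple_pole].
    assert (ND : D <> 0) by lra.
    assert (Ew2 : w = x0 - y0 ^ 2 / D) by (rewrite Ew, hD; field; lra).
    apply Cmult_eq_reg_l with (((X, r) - RtoC x) * ((X, r) - RtoC w))%C; [now apply Cmult_neq_0|].
    transitivity (RtoC (w - x) * (s * D, V)%R)%C.
    { rewrite RtoC_minus. field. auto. }
    assert (Ex : x = x0 + D) by lra.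
    assert (K1 : w - x = - (y0 ^ 2 / D) - D) by lra.
    (* The point lies on the half-circle with ends [w] and [x], that is
       [(X - x) (X - w) = - r^2]. *)
    assert (K2 : (X - x) * (X - w) - r * r = - 2 * (r * r)).
    { rewrite Eq, EX, Ex, Ew2. field. auto. }
    assert (K3 : (X - x) + (X - w) = (2 * (t * s) - 1) * D + y0 ^ 2 / D) by lra.
    apply Ceq_parts.
    + transitivity (((X - x) * (X - w) - r * r) * (s * (D ^ 2 + y0 ^ 2) / (2 * (r * r)))); [|simpl; ring].
      rewrite K2. transitivity ((w - x) * (s * D)); [simpl; ring|]. rewrite K1. field. lra.
    + transitivity (r * ((X - x) + (X - w)) * (s * (D ^ 2 + y0 ^ 2) / (2 * (r * r)))); [|simpl; ring].
      rewrite K3. transitivity ((w - x) * V); [simpl; ring|]. rewrite K1, EV. field. lra.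
Qed.

Lemma geod_v_cont t : 0 <= t <= 1 -> Rcont geod_v t.
Proof.
  intros Ht. assert (P : 0 < Q (t * s)) by (apply geodQ_pos; nra).
  assert (Cc : continuity_pt (fun t => s * (- y0 ^ 2 + (1 - 2 * (t * s)) * D ^ 2) / (2 * sqrt (Q (t * s)))) t).
  { apply derivable_continuous_pt, ex_derive_Reals_0.
    assert (N : sqrt (Q (t * s)) <> 0) by (apply Rgt_not_eq, sqrt_lt_R0, P).
    revert P N. unfold geodQ. intros P N. auto_derive. split; [exact P|]. split; [|easy].
    match goal with |- context [sqrt ?a] => match type of P with 0 < ?b => replace a with b by ring end end. lra. }
  intros eps He. destruct (Cc eps He) as [d [Hd K]]. exists d; split; auto. intros u Hu.
  destruct (Req_dec_T t u) as [<-|N].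
  { replace (geod_v t - geod_v t)%C with (RtoC 0) by ring. now rewrite Cmod_0. }
  eapply Rle_lt_trans; [apply Cmod_le_abs|].
  assert (H : Rabs (Im (geod_v u) - Im (geod_v t)) < eps).
  { apply (K u). split; [split; auto; exact I|exact Hu]. }
  replace (Re (geod_v u - geod_v t)%C) with 0 by (unfold geod_v; simpl; ring).
  rewrite Rabs_R0. replace (Im (geod_v u - geod_v t)%C) with (Im (geod_v u) - Im (geod_v t)) by easy. lra.
Qed.

Lemma geod_ends : geod_path z0 z 0 = z0 /\ geod_path z0 z 1 = z.
Proof.
  split; rewrite geod_sub.
  - unfold geodQ. f_equal; [ring|].
    replace ((1 - 0 * s) * y0 ^ 2 + 0 * s * (1 - 0 * s) * D ^ 2) with (Rsqr y0) by (unfold Rsqr; ring).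
    apply sqrt_Rsqr; lra.
  - rewrite geod_z. f_equal; [ring|]. f_equal. f_equal. ring.
Qed.

Lemma geod_integral g : holo g ->
  is_CInt (fun t => (g (geod_path z0 z t) * RtoC (hyp_speed (geod_path z0 z) t))%C) 0 1
    (path_integral (ge g (back_end z0 x) (Some x)) z0 z).
Proof.
  intros Hg. destruct geod_ends as [G0 G1].
  pose proof (path_integral_curve (ge g (back_end z0 x) (Some x)) (geod_path z0 z) geod_v 0 1 (holo_ge g Hg _ _) ltac:(lra)) as H.
  rewrite G0, G1 in H.
  eapply (is_RInt_ext (V := C_R_NormedModule)); [|apply H].
  - intros t Ht. rewrite Rmin_left, Rmax_right in Ht by lra. rewrite <- geod_eta by lra. unfold ge.
    match goal with |- ?a = ?b => change (@eq C a b) end. ring.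
  - intros t Ht. split; [now apply geod_upper|]. split; [|now apply geod_v_cont].
    destruct (geod_diff t Ht). now apply Pdiff_intro.
Qed.

Lemma ds_integral_geod g : holo g -> ds_integral g z0 z = path_integral (ge g (back_end z0 x) (Some x)) z0 z.
Proof. intros Hg. apply is_CInt_unique. now apply geod_integral. Qed.

Lemma speed_integral :
  is_RInt (hyp_speed (geod_path z0 z)) 0 1 (Re (path_integral (ge (fun _ => RtoC 1) (back_end z0 x) (Some x)) z0 z)) /\
  Im (path_integral (ge (fun _ => RtoC 1) (back_end z0 x) (Some x)) z0 z) = 0.
Proof.
  pose proof (geod_integral (fun _ => RtoC 1) (holo_const 1)) as H.
  set (L := path_integral _ z0 z) in *.
  pose proof (is_RInt_fct_extend_fst (U := R_NormedModule) (V := R_NormedModule) _ _ _ _ H) as Q1.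
  pose proof (is_RInt_fct_extend_snd (U := R_NormedModule) (V := R_NormedModule) _ _ _ _ H) as Q2.
  split.
  - eapply is_RInt_ext; [|exact Q1]. intros t _. simpl. ring.
  - assert (Z : is_RInt (fun _ => 0) 0 1 (Im L)).
    { eapply is_RInt_ext; [|exact Q2]. intros t _. simpl. ring. }
    apply (is_RInt_unique (V := R_CompleteNormedModule)) in Z. rewrite <- Z.
    rewrite (RInt_const (V := R_CompleteNormedModule)). unfold scal; simpl. unfold mult; simpl. ring.
Qed.

Lemma d_hyp_geod : RtoC (d_hyp z0 z) = path_integral (ge (fun _ => RtoC 1) (back_end z0 x) (Some x)) z0 z.
Proof.
  destruct speed_integral as [H1 H2]. unfold d_hyp.
  rewrite (is_RInt_unique (V := R_CompleteNormedModule) _ _ _ _ H1).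
  apply Ceq_parts; simpl; auto.
Qed.

(** The height is at least [(1 - t) y0], while the horizontal distance to [x] is [(1 - t) |D|]. *)
Lemma geod_cone t : 0 <= t <= s -> in_cone x (Rabs D / y0) (Rabs D + y0) (geod_path z0 (RtoC x) t).
Proof.
  intros Ht. assert (E : geod_path z0 (RtoC x) t = (x0 + t * D, sqrt (Q t))).
  { unfold geod_path, geodQ. rewrite hD. cbn [Re Im fst snd RtoC]. f_equal; [ring|]. f_equal. ring. }
  rewrite E. unfold in_cone. cbn [Re Im fst snd RtoC].
  assert (P : 0 < Q t) by (apply geodQ_pos; lra). pose proof (Rabs_pos D).
  assert (D2 : D ^ 2 = Rabs D ^ 2) by (symmetry; apply pow2_abs).
  split; [split; [now apply sqrt_lt_R0|]|].
  - apply Rle_trans with (sqrt (Rsqr (Rabs D + y0))); [|rewrite sqrt_Rsqr; lra].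
    apply sqrt_le_1_alt. unfold geodQ, Rsqr. rewrite D2. nra.
  - replace (x0 + t * D - x) with (- ((1 - t) * D)) by (rewrite hD; ring).
    rewrite Rabs_Ropp, Rabs_mult, (Rabs_right (1 - t)) by lra.
    replace ((1 - t) * Rabs D) with (Rabs D / y0 * ((1 - t) * y0)) by (field; lra).
    apply Rmult_le_compat_l; [apply Rmult_le_pos; [lra|apply Rlt_le, Rinv_0_lt_compat, hy0]|].
    assert (H0 : 0 <= (1 - t) * y0) by (apply Rmult_le_pos; lra).
    apply Rle_trans with (sqrt (Rsqr ((1 - t) * y0))); [rewrite sqrt_Rsqr; lra|].
    apply sqrt_le_1_alt. unfold geodQ, Rsqr.
    assert (H1 : 0 <= t * (1 - t) * D ^ 2) by (apply Rmult_le_pos; [apply Rmult_le_pos; lra|apply pow2_ge_0]).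
    replace ((1 - t) * y0 * ((1 - t) * y0)) with (((1 - t) * y0 ^ 2) * (1 - t)) by ring.
    assert (H2 : 0 <= (1 - t) * y0 ^ 2) by (apply Rmult_le_pos; [lra|apply pow2_ge_0]).
    assert ((1 - t) * y0 ^ 2 * (1 - t) <= (1 - t) * y0 ^ 2 * 1) by (apply Rmult_le_compat_l; lra). lra.
Qed.

Lemma geod_val_bound g G : holo g -> (forall p, in_cone x (Rabs D / y0) (Rabs D + y0) p -> Cmod (g p) <= G) ->
  Cmod (ds_integral g z0 z) <= G * d_hyp z0 z.
Proof.
  intros Hg HG. rewrite ds_integral_geod by auto.
  destruct speed_integral as [H1 H2]. unfold d_hyp.
  rewrite (is_RInt_unique (V := R_CompleteNormedModule) _ _ _ _ H1).
  pose proof (geod_integral g Hg) as HI. unfold is_CInt in HI.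
  pose proof (is_RInt_scal (V := R_NormedModule) _ 0 1 G _ H1) as HS.
  rewrite Cmod_norm.
  apply (norm_RInt_le (V := C_R_NormedModule) _ _ 0 1 _ _ ltac:(lra)) with (2 := HI) (3 := HS).
  intros t Ht.
  assert (HC : Cmod (g (geod_path z0 z t) * RtoC (hyp_speed (geod_path z0 z) t))%C <= G * hyp_speed (geod_path z0 z) t).
  2: { rewrite Cmod_norm in HC. exact HC. }
  assert (Hsp : 0 <= hyp_speed (geod_path z0 z) t).
  { rewrite geod_speed by auto. apply Rmult_le_pos; [nra|]. apply Rlt_le, Rinv_0_lt_compat.
    assert (0 < Q (t * s)) by (apply geodQ_pos; nra). lra. }
  rewrite Cmod_mult, Cmod_R, Rabs_right by lra. apply Rmult_le_compat_r; auto. apply HG.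
  rewrite geod_sub. pose proof (geod_cone (t * s) ltac:(nra)) as HC.
  replace (geod_path z0 (RtoC x) (t * s)) with (x0 + t * s * D, sqrt (Q (t * s))) in HC; auto.
  unfold geod_path, geodQ. rewrite hD. cbn [Re Im fst snd RtoC]. f_equal; [ring|]. f_equal. ring.
Qed.

End Geodesic.

(** * The geodesic limit in terms of vertical integrals *)

Lemma locally_C_iff (v : C) (P : C -> Prop) :
  locally (T := C_UniformSpace) v P <-> exists d, 0 < d /\ forall w, Cmod (w - v)%C < d -> P w.
Proof.
  split.
  - intros [d Hd]. exists d. split; [apply cond_pos|]. intros w Hw. apply Hd.
    split; [apply Rle_lt_trans with (2 := Hw); eapply Rle_trans; [|apply re_le_Cmod]
           |apply Rle_lt_trans with (2 := Hw); eapply Rle_trans; [|apply im_le_Cmod]]; right; reflexivity.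
  - intros [d [Hd H]]. assert (Hd2 : 0 < d / 2) by lra. exists (mkposreal _ Hd2). intros w [H1 H2]. apply H.
    change (Rabs (Re w - Re v) < d / 2) in H1. change (Rabs (Im w - Im v) < d / 2) in H2.
    eapply Rle_lt_trans; [apply Cmod_le_abs|].
    replace (Re (w - v)%C) with (Re w - Re v) by (destruct w, v; simpl; ring).
    replace (Im (w - v)%C) with (Im w - Im v) by (destruct w, v; simpl; ring). lra.
Qed.

Lemma val_lim_iff x z0 v : val_lim x z0 v <-> forall eps, 0 < eps -> exists d, 0 < d /\
  forall z, geodesic (Some z0) (Some (RtoC x)) z -> Cmod (z - RtoC x)%C < d -> Cmod (val_fun z0 z - v)%C < eps.
Proof.
  unfold val_lim, filterlim, filter_le, filtermap, within. split.
  - intros H eps He. specialize (H (fun w => Cmod (w - v)%C < eps)).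
    destruct (proj1 (locally_C_iff _ _) (H ltac:(apply locally_C_iff; now exists eps))) as [d [Hd K]].
    exists d. split; auto.
  - intros H P HP. apply locally_C_iff in HP. destruct HP as [e [He HP]].
    destruct (H e He) as [d [Hd K]]. apply locally_C_iff. exists d. split; auto.
Qed.

Lemma is_Clim_seq_iff u l : is_Clim_seq u l <-> Clim u l.
Proof.
  rewrite Clim_eps. unfold is_Clim_seq, filterlim, filter_le, filtermap. split.
  - intros H eps He. destruct (H (fun w => Cmod (w - l)%C < eps)) as [N HN].
    + apply locally_C_iff. now exists eps.
    + exists N. auto.
  - intros H P HP. apply locally_C_iff in HP. destruct HP as [e [He HP]].
    destruct (H e He) as [N HN]. exists N. auto.
Qed.

Lemma geodesic_param z0 x z : upper_half z0 -> geodesic (Some z0) (Some (RtoC x)) z ->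
  exists s, 0 <= s < 1 /\ z = geod_path z0 (RtoC x) s.
Proof.
  intros Hz0 [Hz (s & Hs & E)]. exists s. split; auto. split; [apply Hs|].
  destruct (Req_dec_T s 1) as [->|N]; [|lra]. exfalso. unfold upper_half in Hz. rewrite E in Hz.
  unfold geod_path in Hz. simpl in Hz.
  match type of Hz with 0 < sqrt ?a => replace a with 0 in Hz by ring end. rewrite sqrt_0 in Hz. lra.
Qed.

(** [hint g x y / (- ln y)] tends to [v], written without division; [- ln y] is the vertical
    integral for [g = 1]. *)
Definition vlim (g : C -> C) (x : R) (v : C) : Prop :=
  forall eps, 0 < eps -> exists d, 0 < d < 1 /\ forall y, 0 < y < d ->
    Cmod (hint g x y - v * RtoC (- ln y))%C <= eps * (- ln y).

(** Bounded errors in numerator and denominator are harmless once [T] is large: all errors add up to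
    at most [2 e T], and [T <= 2 T']. *)
Lemma ratio_transfer (X X' v : C) (T T' K e : R) : 0 < e -> Cmod (X' - X)%C <= K -> Rabs (T' - T) <= K ->
  0 < T -> 2 * K <= T -> K * (1 + Cmod v) <= e * T ->
  Cmod (X - v * RtoC T)%C <= e * T -> Cmod (X' - v * RtoC T')%C <= 4 * e * T' /\ 0 < T'.
Proof.
  intros He HX HT HT0 H1 H2 H3. apply Rabs_le_between in HT. split; [|lra].
  replace (X' - v * RtoC T')%C with ((X - v * RtoC T) + (X' - X) + v * RtoC (T - T'))%C by (rewrite RtoC_minus; ring).
  eapply Rle_trans; [apply Cmod_plus_le; [apply Cmod_plus_le; eassumption|]|].
  - rewrite Cmod_mult, Cmod_R. apply Rmult_le_compat_l with (r2 := K); [apply Cmod_ge_0|apply Rabs_le; lra].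
  - assert (T <= 2 * T') by lra. nra.
Qed.

Lemma minus_ln_large N : exists d, 0 < d < 1 /\ forall y, 0 < y < d -> N <= - ln y.
Proof.
  exists (exp (- (Rabs N + 1))). pose proof (Rabs_pos N). split.
  - split; [apply exp_pos|]. apply Rlt_le_trans with (exp 0); [apply exp_increasing; lra|rewrite exp_0; lra].
  - intros y Hy. apply Rlt_le. apply Rle_lt_trans with (Rabs N); [apply Rle_abs|].
    assert (ln y < - (Rabs N + 1)); [|lra]. rewrite <- (ln_exp (- (Rabs N + 1))). apply ln_increasing; lra.
Qed.

Lemma one_inv : forall (A : mat2) (z : C), SL2Z A -> upper_half z -> (fun _ : C => RtoC 1) (moebius A z) = (fun _ : C => RtoC 1) z.
Proof. easy. Qed.

Section Values.
Variable g : C -> C.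
Hypothesis hg : holo g.
Hypothesis ginv : forall A z, SL2Z A -> upper_half z -> g (moebius A z) = g z.
Variables (x B : R).
Hypothesis hB : cf_bound x B.

(** The integrals against [ds] are path integrals with the pole [back_end z0 x], and the geodesic
    stays in a cone at [x], so [cone_integral] applies to [g] and to 1. *)
Lemma geod_compare z0 : upper_half z0 -> exists K, 0 <= K /\ forall s, 0 <= s < 1 ->
  let z := geod_path z0 (RtoC x) s in
  upper_half z /\ Cmod (ds_integral g z0 z - hint g x (Im z))%C <= K /\ Rabs (d_hyp z0 z - (- ln (Im z))) <= K.
Proof.
  intros Hz0. destruct z0 as [x0 y0]. set (z0 := (x0, y0) : C) in *.
  assert (Hy0 : 0 < y0) by exact Hz0. set (D := x - x0).
  pose proof (Rabs_pos D) as HD.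
  assert (HC : 0 <= Rabs D / y0) by (apply Rmult_le_pos; [auto|apply Rlt_le, Rinv_0_lt_compat, Hy0]).
  assert (HY : 0 < Rabs D + y0) by lra.
  destruct (cone_integral g hg ginv x B hB z0 (back_end z0 x) (Rabs D / y0) (Rabs D + y0) Hz0 (back_end_neq z0 x Hz0) HC HY) as [K1 [HK1 P1]].
  destruct (cone_integral _ (holo_const 1) one_inv x B hB z0 (back_end z0 x) (Rabs D / y0) (Rabs D + y0) Hz0 (back_end_neq z0 x Hz0) HC HY) as [K2 [HK2 P2]].
  exists (K1 + K2). split; [lra|]. intros s Hs z.
  pose proof (geod_cone x0 y0 x s D Hy0 Hs eq_refl s ltac:(lra)) as HZ. fold z0 in HZ. fold z in HZ.
  assert (Hz : upper_half z) by (unfold upper_half; apply HZ).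
  split; auto. split.
  - pose proof (ds_integral_geod x0 y0 x s D Hy0 Hs eq_refl g hg) as E. fold z0 in E. fold z in E. rewrite E.
    specialize (P1 z HZ). lra.
  - specialize (P2 z HZ). rewrite hint_one in P2 by exact Hz.
    pose proof (d_hyp_geod x0 y0 x s D Hy0 Hs eq_refl) as E. fold z0 in E. fold z in E. rewrite <- E in P2.
    rewrite <- RtoC_minus, Cmod_R in P2. lra.
Qed.

Lemma hint_ratio_both lam Y0 : 1 <= lam -> 0 < Y0 -> exists K, 0 <= K /\ forall a b,
  0 < a <= Y0 -> 0 < b <= Y0 -> a <= lam * b -> b <= lam * a ->
  Cmod (hint g x b - hint g x a)%C <= K /\ Rabs (- ln b - - ln a) <= K.
Proof.
  intros Hl HY. destruct (hint_ratio g hg ginv x B hB lam Y0 Hl HY) as [K1 [HK1 P1]].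
  destruct (hint_ratio _ (holo_const 1) one_inv x B hB lam Y0 Hl HY) as [K2 [HK2 P2]].
  exists (K1 + K2). split; [lra|]. intros a b Ha Hb Hab Hba. split.
  - specialize (P1 a b Ha Hb Hab Hba). lra.
  - specialize (P2 a b Ha Hb Hab Hba). rewrite !hint_one in P2 by lra.
    rewrite <- RtoC_minus, Cmod_R in P2. lra.
Qed.

Definition gval (z0 z : C) : C := (ds_integral g z0 z / RtoC (d_hyp z0 z))%C.

Lemma vlim_val z0 v : upper_half z0 -> vlim g x v ->
  forall eps, 0 < eps -> exists d, 0 < d /\
  forall z, geodesic (Some z0) (Some (RtoC x)) z -> Cmod (z - RtoC x)%C < d -> Cmod (gval z0 z - v)%C < eps.
Proof.
  intros Hz0 Hv eps He. destruct (geod_compare z0 Hz0) as [K [HK P]].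
  set (e := eps / 8). assert (He0 : 0 < e) by (unfold e; lra).
  destruct (Hv e He0) as [d1 [Hd1 Q1]].
  destruct (minus_ln_large (1 + 2 * K + K * (1 + Cmod v) / e)) as [d2 [Hd2 Q2]].
  exists (Rmin d1 d2). split; [apply Rmin_pos; lra|]. intros z Hz Hzx.
  destruct (geodesic_param z0 x z Hz0 Hz) as (s & Hs & Ez).
  destruct (P s Hs) as (U & P1 & P2). rewrite <- Ez in U, P1, P2.
  assert (Hy : Im z < Rmin d1 d2).
  { eapply Rle_lt_trans; [|exact Hzx]. eapply Rle_trans; [apply Rle_abs|].
    eapply Rle_trans; [|apply im_le_Cmod]. right. f_equal. destruct z; simpl; ring. }
  assert (Hy1 : Im z < d1) by (eapply Rlt_le_trans; [exact Hy|apply Rmin_l]).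
  assert (Hy2 : Im z < d2) by (eapply Rlt_le_trans; [exact Hy|apply Rmin_r]).
  unfold upper_half in U. specialize (Q1 (Im z) ltac:(lra)). specialize (Q2 (Im z) ltac:(lra)).
  assert (HKv : 0 <= K * (1 + Cmod v)) by (pose proof (Cmod_ge_0 v); nra).
  assert (HKe : 0 <= K * (1 + Cmod v) / e) by (apply Rmult_le_pos; [auto|apply Rlt_le, Rinv_0_lt_compat, He0]).
  destruct (ratio_transfer _ _ v _ _ K e He0 P1 P2) as [R1 R2]; try lra.
  - apply Rle_trans with (e * (K * (1 + Cmod v) / e)); [right; field; lra|]. apply Rmult_le_compat_l; lra.
  - unfold gval. assert (N : RtoC (d_hyp z0 z) <> 0) by (apply RtoC_neq; lra).
    replace (ds_integral g z0 z / RtoC (d_hyp z0 z) - v)%C with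
      ((ds_integral g z0 z - v * RtoC (d_hyp z0 z)) / RtoC (d_hyp z0 z))%C by (field; auto).
    rewrite Cmod_div, Cmod_R, Rabs_right by (auto; lra).
    apply Rle_lt_trans with (4 * e); [|unfold e; lra].
    apply Rmult_le_reg_r with (d_hyp z0 z); auto. unfold Rdiv. rewrite Rmult_assoc, Rinv_l by lra. lra.
Qed.

Lemma val_vlim z0 v : upper_half z0 ->
  (forall eps, 0 < eps -> exists d, 0 < d /\
  forall z, geodesic (Some z0) (Some (RtoC x)) z -> Cmod (z - RtoC x)%C < d -> Cmod (gval z0 z - v)%C < eps) ->
  vlim g x v.
Proof.
  intros Hz0 H eps He. destruct (geod_compare z0 Hz0) as [K [HK P]].
  destruct z0 as [x0 y0]. set (z0 := (x0, y0) : C) in *. assert (Hy0 : 0 < y0) by exact Hz0.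
  remember (x - x0) as D eqn:ED. pose proof (Rabs_pos D) as HD.
  remember (Rabs D + y0) as M eqn:EM. assert (HM : 0 < M) by lra.
  set (lam := Rmax 1 (Rmax M (/ y0))).
  assert (L1 : 1 <= lam) by apply Rmax_l.
  assert (L2 : M <= lam) by (eapply Rle_trans; [apply Rmax_l|apply Rmax_r]).
  assert (L3 : / y0 <= lam) by (eapply Rle_trans; [apply Rmax_r|apply Rmax_r]).
  destruct (hint_ratio_both lam (1 + M) L1 ltac:(lra)) as [K2 [HK2 P2]].
  set (e := eps / 16). assert (He0 : 0 < e) by (unfold e; lra).
  destruct (H e He0) as [d1 [Hd1 Q1]].
  set (Kb := K + K2).
  destruct (minus_ln_large (1 + 4 * Kb + Kb * (1 + Cmod v) / e + K2)) as [d2 [Hd2 Q2]].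
  exists (Rmin d2 (Rmin 1 (d1 / (Rabs D + M + 1)) / 2)).
  assert (H4 : 0 < Rabs D + M + 1) by lra.
  assert (H3 : 0 < Rmin 1 (d1 / (Rabs D + M + 1))) by (apply Rmin_pos; [lra|now apply Rdiv_lt_0_compat]).
  assert (H3' : Rmin 1 (d1 / (Rabs D + M + 1)) <= 1) by apply Rmin_l.
  split; [split; [apply Rmin_pos; lra|]|].
  { eapply Rle_lt_trans; [apply Rmin_r|]. lra. }
  intros y Hy.
  assert (Y1 : y < d2) by (eapply Rlt_le_trans; [apply Hy|apply Rmin_l]).
  assert (Y2 : y < Rmin 1 (d1 / (Rabs D + M + 1)) / 2) by (eapply Rlt_le_trans; [apply Hy|apply Rmin_r]).
  assert (Y3 : y < 1) by lra.
  assert (Y4 : y * (Rabs D + M + 1) < d1).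
  { apply Rlt_le_trans with (d1 / (Rabs D + M + 1) * (Rabs D + M + 1)).
    - apply Rmult_lt_compat_r; auto. pose proof (Rmin_r 1 (d1 / (Rabs D + M + 1))). lra.
    - right; field; lra. }
  specialize (Q2 y ltac:(lra)).
  (* This parameter gives a point of height [y sqrt (y0^2 + s D^2)], comparable with [y], so every
     small height is reached up to a bounded factor. *)
  set (s := 1 - y ^ 2). assert (Hs : 0 <= s < 1) by (unfold s; nra).
  set (z := geod_path z0 (RtoC x) s).
  destruct (P s Hs) as (U & P1 & P1'). fold z in U, P1, P1'.
  assert (Ere : Re z = x0 + s * D) by (unfold z, geod_path, z0; simpl; rewrite ED; ring).
  assert (Eim : Im z = sqrt (y ^ 2 * (y0 ^ 2 + s * D ^ 2))).
  { unfold z, geod_path, z0. cbn [Re Im fst snd RtoC]. f_equal. rewrite ED. unfold s. ring. }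
  assert (D2 : D ^ 2 = Rabs D ^ 2) by (symmetry; apply pow2_abs).
  assert (SD : 0 <= s * D ^ 2 <= D ^ 2) by (pose proof (pow2_ge_0 D); nra).
  assert (I1 : y * y0 <= Im z).
  { rewrite Eim. apply Rle_trans with (sqrt (Rsqr (y * y0))); [rewrite sqrt_Rsqr; nra|].
    apply sqrt_le_1_alt. unfold Rsqr.
    replace (y * y0 * (y * y0)) with (y ^ 2 * y0 ^ 2) by ring. apply Rmult_le_compat_l; [apply pow2_ge_0|lra]. }
  assert (I2 : Im z <= y * M).
  { rewrite Eim. apply Rle_trans with (sqrt (Rsqr (y * M))); [|rewrite sqrt_Rsqr; [lra|apply Rmult_le_pos; lra]].
    apply sqrt_le_1_alt. unfold Rsqr.
    replace (y * M * (y * M)) with (y ^ 2 * M ^ 2) by ring. apply Rmult_le_compat_l; [apply pow2_ge_0|].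
    rewrite EM. rewrite D2 in SD. assert (0 <= Rabs D * y0) by (apply Rmult_le_pos; lra).
    replace ((Rabs D + y0) ^ 2) with (Rabs D ^ 2 + 2 * (Rabs D * y0) + y0 ^ 2) by ring. rewrite D2. lra. }
  assert (GZ : geodesic (Some z0) (Some (RtoC x)) z).
  { split; auto. exists s. split; [lra|reflexivity]. }
  assert (CZ : Cmod (z - RtoC x)%C < d1).
  { eapply Rle_lt_trans; [apply Cmod_le_abs|].
    replace (Re (z - RtoC x)%C) with (- (y ^ 2 * D)).
    2: { replace (Re (z - RtoC x)%C) with (Re z - x) by (destruct z; simpl; ring). rewrite Ere. unfold s. rewrite ED. ring. }
    replace (Im (z - RtoC x)%C) with (Im z) by (destruct z; simpl; ring).
    unfold upper_half in U. rewrite Rabs_Ropp, Rabs_mult, (Rabs_right (y ^ 2)), (Rabs_right (Im z)) by (try (apply Rle_ge, pow2_ge_0); lra).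
    assert (y2 : y ^ 2 <= y) by (replace (y ^ 2) with (y * y) by ring; rewrite <- (Rmult_1_r y) at 3; apply Rmult_le_compat_l; lra).
    assert (y ^ 2 * Rabs D <= y * Rabs D) by (apply Rmult_le_compat_r; lra). lra. }
  specialize (Q1 z GZ CZ). unfold upper_half in U.
  assert (I3 : y <= lam * Im z).
  { apply Rle_trans with (/ y0 * (y * y0)); [right; field; lra|]. apply Rmult_le_compat; try lra.
    - apply Rlt_le, Rinv_0_lt_compat, Hy0.
    - apply Rmult_le_pos; lra. }
  assert (I4 : Im z <= lam * y) by (eapply Rle_trans; [exact I2|]; rewrite Rmult_comm; apply Rmult_le_compat_r; lra).
  destruct (P2 (Im z) y) as [R1 R2]; try lra.
  { split; auto. eapply Rle_trans; [exact I2|]. assert (y * M <= 1 * M) by (apply Rmult_le_compat_r; lra). lra. }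
  assert (HKv : 0 <= Kb * (1 + Cmod v)) by (unfold Kb; pose proof (Cmod_ge_0 v); apply Rmult_le_pos; lra).
  assert (HKe : 0 <= Kb * (1 + Cmod v) / e) by (apply Rmult_le_pos; [auto|apply Rlt_le, Rinv_0_lt_compat, He0]).
  apply Rabs_le_between in P1'. apply Rabs_le_between in R2.
  assert (T0 : 0 < d_hyp z0 z) by (unfold Kb in *; lra).
  assert (S1 : Cmod (ds_integral g z0 z - v * RtoC (d_hyp z0 z))%C <= e * d_hyp z0 z).
  { unfold gval in Q1. assert (N : RtoC (d_hyp z0 z) <> 0) by (apply RtoC_neq; lra).
    replace (ds_integral g z0 z - v * RtoC (d_hyp z0 z))%C with
      ((ds_integral g z0 z / RtoC (d_hyp z0 z) - v) * RtoC (d_hyp z0 z))%C by (field; auto).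
    rewrite Cmod_mult, Cmod_R, Rabs_right by lra. apply Rmult_le_compat_r; lra. }
  destruct (ratio_transfer (ds_integral g z0 z) (hint g x y) v (d_hyp z0 z) (- ln y) Kb e He0) as [F1 F2].
  - replace (hint g x y - ds_integral g z0 z)%C with ((hint g x y - hint g x (Im z)) + - (ds_integral g z0 z - hint g x (Im z)))%C by ring.
    eapply Rle_trans; [apply Cmod_triangle|]. rewrite Cmod_opp. unfold Kb. lra.
  - apply Rabs_le. unfold Kb. lra.
  - exact T0.
  - unfold Kb in *. lra.
  - apply Rle_trans with (e * (Kb * (1 + Cmod v) / e)); [right; field; lra|]. apply Rmult_le_compat_l; unfold Kb in *; lra.
  - exact S1.
  - eapply Rle_trans; [exact F1|]. apply Rmult_le_compat_r; [lra|unfold e; lra].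
Qed.

End Values.

(** * Linear growth *)

Section Equivalence.
Variable g : C -> C.
Hypothesis hg : holo g.
Hypothesis ginv : forall A z, SL2Z A -> upper_half z -> g (moebius A z) = g z.
Variables (x B B' : R) (A : mat2).
Hypothesis hB : cf_bound x B.
Hypothesis hA : SL2Z A.
Hypothesis hB' : cf_bound (moebiusR A x) B'.

(** [A] maps the vertical segment at [x] into a cone at [A x], with heights comparable with [u]. The
    second pole [x + 1] is auxiliary: it is irrational and hence has a finite image, as
    [path_integral_transform] requires. *)
Lemma hint_SL2 : exists K, 0 <= K /\ forall u, 0 < u <= 1 ->
  Cmod (hint g (moebiusR A x) u - hint g x u)%C <= K.
Proof.
  pose proof hB as (Hx & _). set (y := moebiusR A x) in *.
  assert (Hx1 : irrational (x + IZR 1)) by now apply irrational_shift.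
  pose proof (mdenR_neq_0 _ _ x Hx (SL2Z_bottom A hA)) as N0. fold (mdenR A x) in N0.
  pose proof (mdenR_neq_0 _ _ _ Hx1 (SL2Z_bottom A hA)) as N1. fold (mdenR A (x + IZR 1)) in N1.
  set (m := mdenR A x) in *. set (c := IZR (m21 A)).
  assert (Hm2 : 0 < m ^ 2) by nra.
  assert (Hc2 : 0 <= c ^ 2) by apply pow2_ge_0.
  set (M := m ^ 2 + c ^ 2).
  set (C0 := sqrt M / Rabs m). set (Y0 := / m ^ 2).
  assert (HC0 : 0 <= C0).
  { apply Rmult_le_pos; [apply sqrt_pos|]. apply Rlt_le, Rinv_0_lt_compat, Rabs_pos_lt, N0. }
  assert (HY0 : 0 < Y0) by now apply Rinv_0_lt_compat.
  assert (U1 : upper_half (vpt x 1)) by (apply vpt_upper; lra).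
  assert (Hx' : Some (moebiusR A (x + IZR 1)) <> Some y).
  { intros E. injection E as E. unfold y, moebiusR in E. fold (mdenR A x) in E. fold (mdenR A (x + IZR 1)) in E.
    fold m in E. set (m1 := mdenR A (x + IZR 1)) in *.
    assert (E2 : (IZR (m11 A) * (x + IZR 1) + IZR (m12 A)) * m = (IZR (m11 A) * x + IZR (m12 A)) * m1).
    { apply (f_equal (fun t => t * (m * m1))) in E.
      replace ((IZR (m11 A) * (x + IZR 1) + IZR (m12 A)) / m1 * (m * m1)) with ((IZR (m11 A) * (x + IZR 1) + IZR (m12 A)) * m) in E by (field; auto).
      rewrite E. field. auto. }
    pose proof (SL2Z_R A hA) as Dt. unfold m, m1, mdenR in E2. simpl in E2. lra. }
  destruct (cone_integral g hg ginv y B' hB' (moebius A (vpt x 1)) (Some (moebiusR A (x + IZR 1))) C0 Y0) as [K1 [HK1 P1]]; auto.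
  { now apply moebius_upper. }
  destruct (pole_part_bound g hg ginv x B hB (Some (x + IZR 1)) 1) as [K2 [HK2 P2]]; [|lra|].
  { intros E. injection E as E. simpl in E. lra. }
  set (lam := Rmax 1 (Rmax Y0 M)).
  assert (L1 : 1 <= lam) by apply Rmax_l.
  assert (L2 : Y0 <= lam) by (eapply Rle_trans; [apply Rmax_l|apply Rmax_r]).
  assert (L3 : M <= lam) by (eapply Rle_trans; [apply Rmax_r|apply Rmax_r]).
  destruct (hint_ratio g hg ginv y B' hB' lam (1 + Y0) L1 ltac:(lra)) as [K3 [HK3 P3]].
  exists (K1 + K2 + K3). split; [lra|]. intros u Hu.
  assert (Uu : upper_half (vpt x u)) by (apply vpt_upper; lra).
  set (p := moebius A (vpt x u)).
  pose proof (mden_nz A (vpt x u) hA Uu) as Nd.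
  assert (Ed : mden A (vpt x u) = (RtoC m + Ci * RtoC (c * u))%C).
  { unfold mden, m, mdenR, vpt. fold c. rewrite RtoC_plus, !RtoC_mult. ring. }
  assert (Md : Cmod (mden A (vpt x u)) ^ 2 = m ^ 2 + (c * u) ^ 2).
  { rewrite Cmod2_alt, Ed. simpl. ring. }
  assert (cu : 0 <= (c * u) ^ 2 <= c ^ 2).
  { split; [apply pow2_ge_0|]. replace ((c * u) ^ 2) with (c ^ 2 * u ^ 2) by ring.
    assert (u ^ 2 <= 1) by nra. nra. }
  assert (Ip : Im p = u / (m ^ 2 + (c * u) ^ 2)).
  { unfold p. rewrite moebius_im by auto. fold (mden A (vpt x u)). rewrite Md, vpt_im. easy. }
  assert (Hq : 0 < m ^ 2 + (c * u) ^ 2) by lra.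
  assert (Ip0 : 0 < Im p) by (rewrite Ip; apply Rdiv_lt_0_compat; lra).
  assert (Ip1 : Im p <= Y0 * u).
  { rewrite Ip. unfold Rdiv, Y0. rewrite Rmult_comm. apply Rmult_le_compat_r; [lra|]. apply Rinv_le_contravar; lra. }
  assert (Ip2 : u <= M * Im p).
  { rewrite Ip. apply Rle_trans with ((m ^ 2 + (c * u) ^ 2) * (u / (m ^ 2 + (c * u) ^ 2))); [right; field; lra|].
    apply Rmult_le_compat_r; [apply Rlt_le, Rdiv_lt_0_compat; lra|]. unfold M. lra. }
  assert (Ip3 : Im p <= Y0) by (assert (Y0 * u <= Y0 * 1) by (apply Rmult_le_compat_l; lra); lra).
  assert (Epy : (p - RtoC y)%C = (Ci * RtoC u / (mden A (vpt x u) * RtoC m))%C).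
  { unfold p, y, moebius, moebiusR. fold (mden A (vpt x u)). fold (mdenR A x). fold m.
    rewrite RtoC_div by auto. pose proof (RtoC_neq _ N0) as Nm. pose proof (SL2Z_C A hA) as Dt.
    transitivity ((RtoC (IZR (m11 A)) * RtoC (IZR (m22 A)) - RtoC (IZR (m12 A)) * RtoC (IZR (m21 A))) * (Ci * RtoC u) / (mden A (vpt x u) * RtoC m))%C.
    - apply Cmult_eq_reg_l with (mden A (vpt x u) * RtoC m)%C; [now apply Cmult_neq_0|].
      transitivity ((RtoC (IZR (m11 A)) * vpt x u + RtoC (IZR (m12 A))) * RtoC m - RtoC (IZR (m11 A) * x + IZR (m12 A)) * mden A (vpt x u))%C; [field; auto|].
      transitivity ((RtoC (IZR (m11 A)) * RtoC (IZR (m22 A)) - RtoC (IZR (m12 A)) * RtoC (IZR (m21 A))) * (Ci * RtoC u))%C; [|field; auto].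
      unfold mden, m, mdenR, vpt. rewrite !RtoC_plus, !RtoC_mult. ring.
    - rewrite Dt. field. auto. }
  assert (HCone : in_cone y C0 Y0 p).
  { split; [lra|]. replace (Re p - y) with (Re (p - RtoC y)%C) by (destruct p; simpl; ring).
    eapply Rle_trans; [apply re_le_Cmod|]. rewrite Epy.
    pose proof (RtoC_neq _ N0) as Nm. pose proof (proj1 (Cmod_gt_0 _) Nd) as Nd'.
    rewrite Cmod_div, !Cmod_mult, Cmod_Ci, !Cmod_R, (Rabs_right u) by (try (now apply Cmult_neq_0); lra).
    rewrite Ip, <- Md. set (q := Cmod (mden A (vpt x u))) in *.
    pose proof (Rabs_pos_lt m N0) as Am.
    assert (q <= sqrt M).
    { apply Rle_trans with (sqrt (Rsqr q)); [rewrite sqrt_Rsqr; lra|]. apply sqrt_le_1_alt. unfold Rsqr.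
      replace (q * q) with (q ^ 2) by ring. rewrite Md. unfold M. lra. }
    replace (1 * u / (q * Rabs m)) with ((u / (Rabs m * q ^ 2)) * q) by (field; lra).
    replace (C0 * (u / q ^ 2)) with ((u / (Rabs m * q ^ 2)) * sqrt M) by (unfold C0; field; lra).
    apply Rmult_le_compat_l; auto. apply Rlt_le, Rdiv_lt_0_compat; [lra|]. apply Rmult_lt_0_compat; auto. apply pow_lt; auto. }
  specialize (P1 p HCone). specialize (P2 u Hu).
  assert (Hr : Cmod (hint g y u - hint g y (Im p))%C <= K3).
  { apply P3; try lra.
    - assert (Y0 * u <= lam * u) by (apply Rmult_le_compat_r; lra). lra.
    - assert (M * Im p <= lam * Im p) by (apply Rmult_le_compat_r; lra). lra. }
  pose proof (path_integral_transform g hg ginv A (x + IZR 1) x (vpt x 1) (vpt x u) hA U1 Uu N1 N0) as ET.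
  fold y in ET. fold p in ET. rewrite ET in P1.
  replace (hint g y u - hint g x u)%C with
    (- (path_integral (ge g (Some (x + IZR 1)%R) (Some x)) (vpt x 1) (vpt x u) - hint g y (Im p)) +
     (path_integral (ge g (Some (x + IZR 1)%R) (Some x)) (vpt x 1) (vpt x u) - hint g x u) + (hint g y u - hint g y (Im p)))%C by ring.
  apply Cmod_plus_le; [apply Cmod_plus_le|]; auto. now rewrite Cmod_opp.
Qed.

Lemma vlim_SL2 v : vlim g x v <-> vlim g (moebiusR A x) v.
Proof.
  destruct hint_SL2 as [K [HK P]].
  assert (G : forall y1 y2, (forall u, 0 < u <= 1 -> Cmod (hint g y2 u - hint g y1 u)%C <= K) -> vlim g y1 v -> vlim g y2 v).
  { intros y1 y2 HP H eps He. destruct (H (eps / 2)) as [d1 [Hd1 Q1]]; [lra|].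
    destruct (minus_ln_large (2 * K / eps)) as [d2 [Hd2 Q2]].
    exists (Rmin d1 d2). split.
    - split; [apply Rmin_pos; lra|]. eapply Rle_lt_trans; [apply Rmin_l|lra].
    - intros u Hu. assert (u < d1) by (eapply Rlt_le_trans; [apply Hu|apply Rmin_l]).
      assert (u < d2) by (eapply Rlt_le_trans; [apply Hu|apply Rmin_r]).
      specialize (Q1 u ltac:(lra)). specialize (Q2 u ltac:(lra)). specialize (HP u ltac:(lra)).
      replace (hint g y2 u - v * RtoC (- ln u))%C with ((hint g y1 u - v * RtoC (- ln u)) + (hint g y2 u - hint g y1 u))%C by ring.
      eapply Rle_trans; [apply Cmod_plus_le; eassumption|].
      assert (K <= eps / 2 * - ln u); [|lra].
      apply Rle_trans with (eps / 2 * (2 * K / eps)); [right; field; lra|]. apply Rmult_le_compat_l; lra. }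
  split; apply G; auto. intros u Hu. rewrite Cmod_minus_sym. auto.
Qed.

(** From the indices [m] and [n] on the complete quotients coincide, so the ratio of the two
    products [Dprod] does not depend on [l]. *)
Lemma aseq_tail : exists m n K, 0 <= K /\ forall l,
  Cmod (aseq g (moebiusR A x) (n + l) - aseq g x (m + l))%C <= K.
Proof.
  pose proof hB as (Hx & _). pose proof hB' as (Hy & _).
  destruct (moebiusR_equiv A x Hx hA) as [_ (m & n & E)].
  set (y := moebiusR A x) in *.
  destruct hint_SL2 as [K1 [HK1 P1]]. fold y in P1.
  pose proof (Dprod_ge_1 x m Hx) as Dm. pose proof (Dprod_ge_1 y n Hy) as Dn.
  set (lam := Rmax (Dprod x m ^ 2) (Dprod y n ^ 2)).
  assert (La : Dprod x m ^ 2 <= lam) by apply Rmax_l.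
  assert (Lb : Dprod y n ^ 2 <= lam) by apply Rmax_r.
  assert (L1 : 1 <= lam) by nra.
  destruct (hint_ratio g hg ginv x B hB lam 1 L1 ltac:(lra)) as [K2 [HK2 P2]].
  exists m, n, (K1 + K2). split; [lra|]. intros l. unfold aseq.
  pose proof (inv_D2_bounds x B hB (m + l)) as I1.
  pose proof (inv_D2_bounds y B' hB' (n + l)) as I2.
  pose proof (P1 _ I2) as Q1.
  assert (Q2 : Cmod (hint g x (/ Dprod y (n + l) ^ 2) - hint g x (/ Dprod x (m + l) ^ 2))%C <= K2).
  { apply P2; auto; rewrite !Dprod_add, <- E; set (D := Dprod (cq x m) l);
    assert (HD : 1 <= D) by (apply Dprod_ge_1, irrational_cq, Hx);
    rewrite !Rpow_mult_distr, !Rinv_mult, <- Rmult_assoc; apply Rmult_le_compat_r;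
    try (apply Rlt_le, Rinv_0_lt_compat; nra).
    - apply Rle_trans with 1; [rewrite <- Rinv_1; apply Rinv_le_contravar; nra|].
      apply Rmult_le_reg_r with (Dprod y n ^ 2); [nra|]. rewrite Rmult_assoc, Rinv_l by nra. lra.
    - apply Rle_trans with 1; [rewrite <- Rinv_1; apply Rinv_le_contravar; nra|].
      apply Rmult_le_reg_r with (Dprod x m ^ 2); [nra|]. rewrite Rmult_assoc, Rinv_l by nra. lra. }
  replace (hint g y (/ Dprod y (n + l) ^ 2) - hint g x (/ Dprod x (m + l) ^ 2))%C with
    ((hint g y (/ Dprod y (n + l) ^ 2) - hint g x (/ Dprod y (n + l) ^ 2)) +
     (hint g x (/ Dprod y (n + l) ^ 2) - hint g x (/ Dprod x (m + l) ^ 2)))%C by ring.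
  now apply Cmod_plus_le.
Qed.

End Equivalence.

(** [a n / n --> L], in a form stable under bounded perturbations of values and indices. *)
Definition lin_lim (a : nat -> C) (L : C) : Prop :=
  forall eps, 0 < eps -> exists N, forall n, (N <= n)%nat ->
    Cmod (a n - RtoC (INR n) * L)%C <= eps * INR n.

Lemma INR_large M : exists N, forall n, (N <= n)%nat -> M <= INR n.
Proof.
  destruct (nfloor_ex (Rabs M) (Rabs_pos M)) as [N [_ HN]]. exists (S N). intros n Hn.
  apply le_INR in Hn. rewrite S_INR in Hn. pose proof (Rle_abs M). lra.
Qed.

Lemma lin_lim_perturb a b L K : 0 <= K -> lin_lim a L ->
  (exists N0, forall k, (N0 <= k)%nat -> exists i, Rabs (INR i - INR k) <= K /\ Cmod (b k - a i)%C <= K) -> lin_lim b L.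
Proof.
  intros HK Ha [N0 H] eps He. destruct (Ha (eps / 4)) as [N HN]; [lra|].
  set (M := (K + Cmod L * K) * 4 / eps + 4 * K + INR N + K).
  destruct (INR_large M) as [N1 HN1].
  exists (max N0 N1). intros k Hk. destruct (H k ltac:(lia)) as (i & Hi & Hb).
  specialize (HN1 k ltac:(lia)). unfold M in HN1. pose proof (Cmod_ge_0 L) as HL.
  assert (0 <= (K + Cmod L * K) * 4 / eps).
  { apply Rmult_le_pos; [nra|]. apply Rlt_le, Rinv_0_lt_compat, He. }
  pose proof (pos_INR N). apply Rabs_le_between in Hi.
  assert (Hi2 : (N <= i)%nat) by (apply INR_le; lra).
  specialize (HN i Hi2).
  replace (b k - RtoC (INR k) * L)%C with ((b k - a i) + (a i - RtoC (INR i) * L) + L * RtoC (INR i - INR k))%C by (rewrite RtoC_minus; ring).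
  eapply Rle_trans; [apply Cmod_plus_le; [apply Cmod_plus_le; eassumption|]|].
  - rewrite Cmod_mult, Cmod_R. apply Rmult_le_compat_l with (r2 := K); auto. apply Rabs_le; lra.
  - assert (K + Cmod L * K <= eps / 4 * INR k).
    { apply Rle_trans with (eps / 4 * ((K + Cmod L * K) * 4 / eps)); [right; field; lra|]. apply Rmult_le_compat_l; lra. }
    assert (eps / 4 * INR i <= eps / 4 * (2 * INR k)) by (apply Rmult_le_compat_l; lra).
    assert (0 <= eps * INR k) by (apply Rmult_le_pos; [lra|apply pos_INR]). lra.
Qed.

Lemma lin_lim_shift a b L m n K : 0 <= K -> (forall l, Cmod (b (n + l)%nat - a (m + l)%nat)%C <= K) ->
  lin_lim a L -> lin_lim b L.
Proof.
  intros HK H Ha. apply (lin_lim_perturb a b L (K + INR m + INR n)); auto.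
  { pose proof (pos_INR m). pose proof (pos_INR n). lra. }
  exists n. intros k Hk. exists (m + (k - n))%nat. pose proof (pos_INR m). pose proof (pos_INR n). split.
  - rewrite plus_INR, minus_INR by auto. apply Rabs_le. lra.
  - replace k with (n + (k - n))%nat at 1 by lia. specialize (H (k - n)%nat). lra.
Qed.

Lemma seq_gap (t : nat -> nat) Bd : t O = O -> (forall n, (t n <= t (S n) <= t n + Bd)%nat) ->
  (forall m, exists n, (m <= t n)%nat) -> forall k, exists n, (t n <= k <= t n + Bd)%nat.
Proof.
  intros H0 H1 H2 k. destruct (H2 k) as [n Hn]. revert Hn. induction n as [|n IH]; intros Hn.
  - exists O. lia.
  - destruct (Nat.le_gt_cases k (t n)) as [L|L]; [auto|].
    specialize (H1 n). destruct (Nat.eq_dec (t (S n)) k) as [E|E].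
    + exists (S n). lia.
    + exists n. lia.
Qed.

Lemma seq_mono (t : nat -> nat) : (forall n, (t n <= t (S n))%nat) -> forall n m, (n <= m)%nat -> (t n <= t m)%nat.
Proof. intros H n m Hnm. induction Hnm; auto. specialize (H m). lia. Qed.

(** Every index lies within [Bd] of some [t n], and [a] changes by at most [K1] per step; the growth
    rate along [t] is therefore the growth rate along all indices. *)
Lemma lin_lim_subseq (a u : nat -> C) (t : nat -> nat) (Bd : nat) (K K1 : R) (L : C) :
  0 <= K -> 0 <= K1 -> (forall n, Cmod (a (S n) - a n)%C <= K1) ->
  t O = O -> (forall n, (t n <= t (S n) <= t n + Bd)%nat) -> (forall m, exists n, (m <= t n)%nat) ->
  (forall n, Cmod (u n - a (t n))%C <= K) ->
  (Clim (fun n => (u n / RtoC (INR (t n)))%C) L <-> lin_lim a L).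
Proof.
  intros HK HK1 Ha H0 H1 H2 Hu.
  assert (Hm : forall n m, (n <= m)%nat -> (t n <= t m)%nat) by (apply seq_mono; apply H1).
  assert (Hlarge : forall M, exists N, forall n, (N <= n)%nat -> M <= INR (t n)).
  { intros M. destruct (INR_large M) as [m Hm']. destruct (H2 m) as [N HN]. exists N. intros n Hn.
    apply Hm'. specialize (Hm N n Hn). lia. }
  assert (Hd : forall n j, Cmod (a (n + j)%nat - a n)%C <= INR j * K1).
  { intros n; induction j as [|j IH].
    - rewrite Nat.add_0_r. replace (a n - a n)%C with (RtoC 0) by ring. rewrite Cmod_0. simpl; lra.
    - rewrite Nat.add_succ_r, S_INR.
      replace (a (S (n + j)) - a n)%C with ((a (S (n + j)) - a (n + j)%nat) + (a (n + j)%nat - a n))%C by ring.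
      eapply Rle_trans; [apply Cmod_plus_le; [apply Ha|apply IH]|]. lra. }
  rewrite Clim_eps. split.
  - intros H eps He. destruct (H (eps / 4)) as [N HN]; [lra|].
    destruct (Hlarge 1) as [N1 HN1].
    set (N2 := max N N1). pose proof (Cmod_ge_0 L) as HL. pose proof (pos_INR Bd) as HBd.
    set (Q := INR Bd * K1 + K + Cmod L * INR Bd). assert (HQ : 0 <= Q) by (unfold Q; nra).
    destruct (INR_large (Q * 4 / eps + INR (t N2 + Bd) + 1)) as [N3 HN3].
    exists N3. intros k Hk. specialize (HN3 k Hk).
    destruct (seq_gap t Bd H0 H1 H2 k) as [n Hn].
    assert (HQe : 0 <= Q * 4 / eps) by (apply Rmult_le_pos; [lra|apply Rlt_le, Rinv_0_lt_compat, He]).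
    assert (Hn2 : (N2 <= n)%nat).
    { destruct (Nat.le_gt_cases N2 n) as [l|l]; auto. exfalso.
      pose proof (Hm n N2 ltac:(lia)). assert (k <= t N2 + Bd)%nat by lia. apply le_INR in H4. lra. }
    specialize (HN n ltac:(lia)). specialize (HN1 n ltac:(lia)).
    assert (Nt : RtoC (INR (t n)) <> 0) by (apply RtoC_neq; lra).
    assert (H3 : Cmod (u n - RtoC (INR (t n)) * L)%C <= eps / 4 * INR (t n)).
    { replace (u n - RtoC (INR (t n)) * L)%C with ((u n / RtoC (INR (t n)) - L) * RtoC (INR (t n)))%C by (field; auto).
      rewrite Cmod_mult, Cmod_R, Rabs_right by lra. apply Rmult_le_compat_r; lra. }
    set (j := (k - t n)%nat). assert (Ek : k = (t n + j)%nat) by (unfold j; lia).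
    assert (Hj : INR j <= INR Bd) by (apply le_INR; unfold j; lia).
    specialize (Hd (t n) j). rewrite <- Ek in Hd. specialize (Hu n).
    replace (a k - RtoC (INR k) * L)%C with ((a k - a (t n)) + - (u n - a (t n)) + (u n - RtoC (INR (t n)) * L) + L * (- RtoC (INR j)))%C.
    2: { rewrite Ek at 3. rewrite plus_INR, RtoC_plus. ring. }
    eapply Rle_trans; [apply Cmod_plus_le; [apply Cmod_plus_le; [apply Cmod_plus_le|]|]|].
    + exact Hd.
    + rewrite Cmod_opp. exact Hu.
    + exact H3.
    + rewrite Cmod_mult, Cmod_opp, Cmod_R, Rabs_right by (apply Rle_ge, pos_INR). apply Rle_refl.
    + assert (INR (t n) <= INR k) by (apply le_INR; lia).
      assert (INR j * K1 <= INR Bd * K1) by (apply Rmult_le_compat_r; auto).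
      assert (Cmod L * INR j <= Cmod L * INR Bd) by (apply Rmult_le_compat_l; auto).
      assert (Q <= eps / 4 * INR k).
      { apply Rle_trans with (eps / 4 * (Q * 4 / eps)); [right; field; lra|]. apply Rmult_le_compat_l; [lra|].
        pose proof (pos_INR (t N2 + Bd)). lra. }
      assert (eps / 4 * INR (t n) <= eps / 4 * INR k) by (apply Rmult_le_compat_l; lra).
      assert (0 <= INR k) by apply pos_INR. unfold Q in *.
      assert (0 <= eps * INR k) by (apply Rmult_le_pos; lra). lra.
  - intros H eps He. destruct (H (eps / 4)) as [N HN]; [lra|].
    destruct (Hlarge (INR N + 1 + K * 4 / eps)) as [N1 HN1].
    exists N1. intros n Hn. specialize (HN1 n Hn). pose proof (pos_INR N).
    assert (HQe : 0 <= K * 4 / eps) by (apply Rmult_le_pos; [lra|apply Rlt_le, Rinv_0_lt_compat, He]).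
    assert (Hn2 : (N <= t n)%nat) by (apply INR_le; lra).
    specialize (HN _ Hn2). specialize (Hu n).
    assert (Nt : RtoC (INR (t n)) <> 0) by (apply RtoC_neq; lra).
    replace (u n / RtoC (INR (t n)) - L)%C with (((u n - a (t n)) + (a (t n) - RtoC (INR (t n)) * L)) / RtoC (INR (t n)))%C by (field; auto).
    rewrite Cmod_div, Cmod_R, Rabs_right by (auto; lra).
    apply Rle_lt_trans with (eps / 2); [|lra].
    apply Rmult_le_reg_r with (INR (t n)); [lra|]. unfold Rdiv at 1. rewrite Rmult_assoc, Rinv_l, Rmult_1_r by lra.
    eapply Rle_trans; [apply Cmod_plus_le; eassumption|].
    assert (K <= eps / 4 * INR (t n)); [|lra].
    apply Rle_trans with (eps / 4 * (K * 4 / eps)); [right; field; lra|]. apply Rmult_le_compat_l; lra.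
Qed.

Lemma lin_lim_unique a L L' : lin_lim a L -> lin_lim a L' -> L = L'.
Proof.
  intros H H'. apply Ceq_minus, Cmod_eq_0. apply Rle_antisym; [|apply Cmod_ge_0].
  apply Rnot_lt_le. intros Hp. set (e := Cmod (L - L')) in *.
  destruct (H (e / 4)) as [N HN]; [lra|]. destruct (H' (e / 4)) as [N' HN']; [lra|].
  set (n := S (max N N')). specialize (HN n ltac:(lia)). specialize (HN' n ltac:(lia)).
  assert (Hn : 0 < INR n) by (apply lt_0_INR; lia).
  assert (E : Cmod (RtoC (INR n) * (L - L'))%C <= e / 4 * INR n + e / 4 * INR n).
  { replace (RtoC (INR n) * (L - L'))%C with ((a n - RtoC (INR n) * L') + - (a n - RtoC (INR n) * L))%C by ring.
    apply Cmod_plus_le; auto. now rewrite Cmod_opp. }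
  rewrite Cmod_mult, Cmod_R, Rabs_right in E by lra. fold e in E. nra.
Qed.

(** * Prefixes of word expansions *)

Lemma wprefix_S W n : wprefix W (S n) = (wprefix W n ++ W n)%list.
Proof. unfold wprefix. rewrite seq_S, map_app, concat_app. simpl. now rewrite app_nil_r. Qed.

Lemma Nat_Even_double n : Nat.Even n -> n = (2 * Nat.div2 n)%nat.
Proof. intros [m ->]. now rewrite Nat.div2_double. Qed.

Lemma wprefix_even W n : (forall i, even_word (W i)) -> even_word (wprefix W n).
Proof.
  intros H. induction n as [|n IH].
  - exists O. reflexivity.
  - rewrite wprefix_S. destruct IH as [a Ha]. destruct (H n) as [b Hb]. exists (a + b)%nat. rewrite length_app. lia.
Qed.

Lemma expansion_data x W : irrational x -> is_word_expansion x W -> finitely_many_words W ->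
  (forall n, wprefix W n = cflist x (2 * wnorm (wprefix W n))) /\
  (exists Bd, forall n, (wnorm (wprefix W n) <= wnorm (wprefix W (S n)) <= wnorm (wprefix W n) + Bd)%nat) /\
  (forall m, exists n, (m <= wnorm (wprefix W n))%nat).
Proof.
  intros Hx [HE (k & [HC HU] & Hk)] [ws Hws].
  assert (EL : forall n, length (wprefix W n) = (2 * wnorm (wprefix W n))%nat).
  { intros n. apply Nat_Even_double, wprefix_even, HE. }
  split; [|split].
  - intros n. rewrite <- EL. rewrite (HC n) at 1. unfold cflist. apply map_ext. intros i.
    now apply is_cf_unique.
  (* A crude common bound for the lengths of the words that occur. *)
  - exists (list_sum (map (@length Z) ws)). intros n.
    pose proof (EL n). pose proof (EL (S n)) as E2. rewrite wprefix_S, length_app in E2.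
    rewrite wprefix_S. assert (length (W n) <= list_sum (map (@length Z) ws))%nat; [|lia].
    specialize (Hws n). revert Hws. generalize (W n). clear. intros w. induction ws as [|a ws IH]; simpl; [easy|].
    intros [->|Hi]; [lia|]. specialize (IH Hi). lia.
  - intros m. destruct (HU (2 * m)%nat) as [n Hn]. exists n. rewrite EL in Hn. lia.
Qed.

Lemma Clim_RtoC (u : nat -> R) (l : R) : Clim (fun n => RtoC (u n)) (RtoC l) <-> is_lim_seq u l.
Proof.
  split; intros H.
  - apply Clim_Re in H. exact H.
  - apply Clim_pair; [exact H|]. apply is_lim_seq_const.
Qed.

Lemma Clim_perturb (u u' : nat -> C) (t : nat -> R) K L :
  (forall M, exists N, forall n, (N <= n)%nat -> M <= t n) ->
  (exists N, forall n, (N <= n)%nat -> Cmod (u' n - u n)%C <= K) ->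
  Clim (fun n => (u n / RtoC (t n))%C) L -> Clim (fun n => (u' n / RtoC (t n))%C) L.
Proof.
  intros Ht [N0 H0]. rewrite !Clim_eps. intros H eps He.
  destruct (H (eps / 2)) as [N1 H1]; [lra|].
  destruct (Ht (1 + 4 * Rabs K / eps)) as [N2 H2].
  exists (max N0 (max N1 N2)). intros n Hn.
  specialize (H0 n ltac:(lia)). specialize (H1 n ltac:(lia)). specialize (H2 n ltac:(lia)).
  assert (HK : 0 <= 4 * Rabs K / eps).
  { apply Rmult_le_pos; [pose proof (Rabs_pos K); lra|apply Rlt_le, Rinv_0_lt_compat, He]. }
  assert (Nt : RtoC (t n) <> 0) by (apply RtoC_neq; lra).
  replace (u' n / RtoC (t n) - L)%C with ((u n / RtoC (t n) - L) + (u' n - u n) / RtoC (t n))%C by (field; auto).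
  apply Rle_lt_trans with (Cmod (u n / RtoC (t n) - L)%C + eps / 4); [|lra].
  eapply Rle_trans; [apply Cmod_triangle|]. apply Rplus_le_compat_l.
  rewrite Cmod_div, Cmod_R, Rabs_right by (auto; lra).
  apply Rmult_le_reg_r with (t n); [lra|]. unfold Rdiv at 1. rewrite Rmult_assoc, Rinv_l, Rmult_1_r by lra.
  apply Rle_trans with (eps / 4 * (4 * Rabs K / eps)).
  - eapply Rle_trans; [apply H0|]. eapply Rle_trans; [apply Rle_abs|]. right; field; lra.
  - apply Rmult_le_compat_l; lra.
Qed.

(** This convention settles the boundedness statements where the denominator vanishes: prefixes made
    of empty words, and distance 0 on the geodesic. *)
Lemma Cdiv_0_r z : (z / RtoC 0)%C = 0.
Proof. unfold Cdiv, Cinv. simpl. unfold Rdiv. rewrite Ropp_0, !Rmult_0_l. apply Ceq_parts; simpl; ring. Qed.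

Section Words.
Variables (x B : R) (W : nat -> word).
Hypothesis hB : cf_bound x B.
Hypothesis hW : is_word_expansion x W.
Hypothesis hfin : finitely_many_words W.

Notation t n := (wnorm (wprefix W n)).

Lemma total_norm_large M : exists N, forall n, (N <= n)%nat -> M <= INR (t n).
Proof.
  pose proof hB as (Hx & _). destruct (expansion_data x W Hx hW hfin) as (_ & [Bd H1] & H2).
  destruct (INR_large M) as [m Hm]. destruct (H2 m) as [N HN]. exists N. intros n Hn.
  apply Hm. eapply Nat.le_trans; [exact HN|]. apply (seq_mono (fun n => t n)); auto. apply H1.
Qed.

Lemma gamma_prefix_cfmat n : gamma_prefix W n = cfmat x (2 * t n).
Proof.
  pose proof hB as (Hx & _). destruct (expansion_data x W Hx hW hfin) as (H & _).
  unfold gamma_prefix, cfmat. now rewrite <- H.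
Qed.

Section Func.
Variable g : C -> C.
Hypothesis hg : holo g.
Hypothesis ginv : forall A z, SL2Z A -> upper_half z -> g (moebius A z) = g z.

(** [aseq] is indexed by single partial quotients and [t n] counts pairs, whence the index [2 * t n]
    and the rate [v / 2]. The gaps of [t] are bounded because only finitely many words occur, so
    [lin_lim_subseq] applies. *)
Lemma words_lim_gen (u : nat -> C) K v : (forall n, Cmod (u n - aseq g x (2 * t n))%C <= K) ->
  (Clim (fun n => (u n / RtoC (INR (t n)))%C) v <-> lin_lim (aseq g x) (v / 2)%C).
Proof.
  intros Hu. pose proof hB as (Hx & _). destruct (expansion_data x W Hx hW hfin) as (_ & [Bd H1] & H2).
  destruct (aseq_step g hg ginv x B hB) as [K1 [HK1 P1]].
  assert (HK : 0 <= K) by (eapply Rle_trans; [apply Cmod_ge_0|apply (Hu O)]).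
  rewrite <- (lin_lim_subseq (aseq g x) u (fun n => (2 * t n)%nat) (2 * Bd) K K1 (v / 2)%C); auto.
  2: { intros n. specialize (H1 n). lia. }
  2: { intros m. destruct (H2 m) as [n Hn]. exists n. lia. }
  destruct (total_norm_large 1) as [N HN].
  assert (E : forall n, (N <= n)%nat -> (u n / RtoC (INR (2 * t n)) = RtoC (/ 2) * (u n / RtoC (INR (t n))))%C).
  { intros n Hn. specialize (HN n Hn). rewrite mult_INR, RtoC_mult. change (INR 2) with 2.
    rewrite RtoC_inv by lra. assert (RtoC (INR (t n)) <> 0) by (apply RtoC_neq; lra). field. auto. }
  split; intros H.
  - replace (v / 2)%C with (RtoC (/ 2) * v)%C by (rewrite RtoC_inv by lra; field).
    apply Clim_ext_loc with (fun n => (RtoC (/ 2) * (u n / RtoC (INR (t n))))%C); [|now apply Clim_scal].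
    exists N. intros n Hn. symmetry. auto.
  - replace v with (2 * (v / 2))%C by field.
    apply Clim_ext_loc with (fun n => (2 * (u n / RtoC (INR (2 * t n))))%C); [|now apply Clim_scal].
    exists N. intros n Hn. rewrite E by auto. rewrite RtoC_inv by lra. field.
    specialize (HN n Hn). apply RtoC_neq; lra.
Qed.

Definition wint x' z0 n := path_integral (ge g x' (Some x)) z0 (moebius (gamma_prefix W n) z0).

Lemma wint_aseq x' z0 : x' <> Some x -> upper_half z0 ->
  exists K, 0 <= K /\ forall n, Cmod (wint x' z0 n - aseq g x (2 * t n))%C <= K.
Proof.
  intros Hx' Hz0. destruct (aseq_gamma g hg ginv x B hB z0 x' Hz0 Hx') as [K [HK P]].
  exists K. split; auto. intros n. unfold wint. rewrite gamma_prefix_cfmat. apply P.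
Qed.

Lemma words_lim x' z0 v : x' <> Some x -> upper_half z0 ->
  (Clim (fun n => (wint x' z0 n / RtoC (INR (t n)))%C) v <-> lin_lim (aseq g x) (v / 2)%C).
Proof.
  intros Hx' Hz0. destruct (wint_aseq x' z0 Hx' Hz0) as [K [HK P]]. now apply words_lim_gen with K.
Qed.

Lemma aseq_growth : exists K, 0 <= K /\ forall n, Cmod (aseq g x n) <= K * (1 + INR n).
Proof.
  destruct (aseq_step g hg ginv x B hB) as [K1 [HK1 P1]].
  exists (Cmod (aseq g x 0) + K1). pose proof (Cmod_ge_0 (aseq g x 0)). split; [lra|].
  induction n as [|n IH].
  - change (INR 0) with 0. lra.
  - rewrite S_INR. replace (aseq g x (S n)) with (aseq g x n + (aseq g x (S n) - aseq g x n))%C by ring.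
    eapply Rle_trans; [apply Cmod_plus_le; [apply IH|apply P1]|]. pose proof (pos_INR n). nra.
Qed.

Lemma words_bounded x' z0 : x' <> Some x -> upper_half z0 ->
  exists M, forall n, Cmod (wint x' z0 n / RtoC (INR (t n)))%C <= M.
Proof.
  intros Hx' Hz0. destruct (wint_aseq x' z0 Hx' Hz0) as [K [HK P]].
  destruct aseq_growth as [K2 [HK2 P2]].
  exists (K + 3 * K2). intros n. destruct (Nat.eq_dec (t n) 0) as [E|E].
  - rewrite E. change (INR 0) with 0. rewrite Cdiv_0_r, Cmod_0. lra.
  - assert (1 <= INR (t n)) by (apply (le_INR 1); lia).
    rewrite Cmod_div, Cmod_R, Rabs_right by (try (apply RtoC_neq); lra).
    apply Rmult_le_reg_r with (INR (t n)); [lra|]. unfold Rdiv. rewrite Rmult_assoc, Rinv_l, Rmult_1_r by lra.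
    specialize (P n). specialize (P2 (2 * t n)%nat). rewrite mult_INR in P2. change (INR 2) with 2 in P2.
    replace (wint x' z0 n) with ((wint x' z0 n - aseq g x (2 * t n)) + aseq g x (2 * t n))%C by ring.
    eapply Rle_trans; [apply Cmod_plus_le; eassumption|]. nra.
Qed.

(** The condition [Re (A (w + i)) = Re (A xi)] for a point [w + i] seen from the complete quotient [xi]
    amounts to [p^2 + c^2 = p D] with [p = c w + d] and [D = c xi + d]. *)
Lemma vertical_height (n : nat) (w : R) : (1 <= n)%nat ->
  SL2Z (cfmat x n) -> Re (moebius (cfmat x n) (RtoC w + Ci)%C) = x ->
  let p := moebius (cfmat x n) (RtoC w + Ci)%C in
  / Dprod x n ^ 2 <= (B + 1) ^ 2 * Im p /\ Im p <= (B + 1) ^ 2 * / Dprod x n ^ 2.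
Proof.
  intros Hn HA HR. pose proof hB as (Hx & HB1 & _). pose proof HA as HA'. unfold SL2Z in HA'.
  apply (f_equal IZR) in HA'. rewrite minus_IZR, !mult_IZR in HA'.
  destruct (gamma_action x n Hx) as [Ea Ec]. destruct (gamma_bottom x n Hx Hn) as [Hb1 Hb2].
  fold (cfmat x n) in *. set (A := cfmat x n) in *.
  assert (Hz : upper_half (RtoC w + Ci)%C) by (unfold upper_half; simpl; lra).
  pose proof (moebius_im A _ HA Hz) as HI.
  assert (Hc : 1 <= IZR (m21 A)) by (apply IZR_le in Hb2; exact Hb2).
  assert (Hd : 0 <= IZR (m22 A) <= IZR (m21 A)) by (split; apply IZR_le; lia).
  set (a := IZR (m11 A)) in *. set (b := IZR (m12 A)) in *. set (c := IZR (m21 A)) in *. set (d := IZR (m22 A)) in *.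
  set (xi := cq x n) in *. set (D := Dprod x n) in *.
  assert (HD : 1 <= D) by (apply Dprod_ge_1, Hx).
  assert (Hxi : xi <= B).
  { destruct n as [|n']; [lia|]. apply (cf_bound_S x B n' hB). }
  set (q := c * w + d).
  assert (EM : Cmod (RtoC c * (RtoC w + Ci) + RtoC d)%C ^ 2 = q ^ 2 + c ^ 2).
  { rewrite Cmod2_alt. unfold q. simpl. ring. }
  fold c d in HI. rewrite EM in HI.
  assert (Im1 : Im (RtoC w + Ci)%C = 1) by (simpl; ring). rewrite Im1 in HI.
  assert (Q0 : 0 < q ^ 2 + c ^ 2) by (pose proof (pow2_ge_0 q); nra).
  assert (ER : Re (moebius A (RtoC w + Ci)%C) = ((a * w + b) * q + a * c) / (q ^ 2 + c ^ 2)).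
  { unfold moebius. fold a b c d. unfold Cdiv, Cinv, q. simpl. field. unfold q in Q0. nra. }
  rewrite HR in ER.
  assert (E1 : x * (q ^ 2 + c ^ 2) = (a * w + b) * q + a * c) by (rewrite ER; field; lra).
  assert (E2 : q * (D - q) = c ^ 2).
  (* Inserting [x = (a xi + b) / (c xi + d)] into [E1] gives a product with the determinant as one
     factor; the other factor yields [q (xi - w) = c]. *)
  { assert (T : D * (x * (q ^ 2 + c ^ 2)) = D * ((a * w + b) * q + a * c)) by now rewrite E1.
    assert (T2 : (a * xi + b) * (q ^ 2 + c ^ 2) = (c * xi + d) * ((a * w + b) * q + a * c)).
    { rewrite Ea, Ec. rewrite <- T. ring. }
    assert (T3 : (a * d - b * c) * (q * (xi - w) - c) = 0).
    { assert (Z : (a * xi + b) * (q ^ 2 + c ^ 2) - (c * xi + d) * ((a * w + b) * q + a * c) = 0) by lra.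
      rewrite <- Z. unfold q. ring. }
    rewrite HA' in T3. assert (D - q = c * (xi - w)) by (unfold q; rewrite <- Ec; ring). rewrite H. nra. }
  intros p. fold p in HI. rewrite HI.
  assert (EqD : q ^ 2 + c ^ 2 = q * D) by nra. rewrite EqD.
  assert (Hq0 : 0 < q) by (rewrite EqD in Q0; nra).
  assert (HqD : q <= D) by nra.
  assert (HcD : D <= (B + 1) * c) by (rewrite <- Ec; nra).
  (* By [c^2 = q (D - q) <= q D] and [D <= (B + 1) c], the height [1 / (q D)] is at most
     [(B + 1)^2 / D^2]. *)
  assert (HqD2 : D ^ 2 <= (B + 1) ^ 2 * (q * D)).
  { assert (D ^ 2 <= ((B + 1) * c) ^ 2) by (apply pow_incr; lra). rewrite Rpow_mult_distr in H.
    eapply Rle_trans; [exact H|]. apply Rmult_le_compat_l; [apply pow2_ge_0|]. rewrite <- E2. nra. }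
  assert (HqDp : 0 < q * D) by nra. assert (HDp : 0 < D ^ 2) by nra.
  assert (HB2 : 1 <= (B + 1) ^ 2) by nra.
  split.
  - apply Rmult_le_reg_r with (D ^ 2 * (q * D)); [nra|].
    replace (/ D ^ 2 * (D ^ 2 * (q * D))) with (q * D) by (field; lra).
    replace ((B + 1) ^ 2 * (1 / (q * D)) * (D ^ 2 * (q * D))) with ((B + 1) ^ 2 * D ^ 2) by (field; lra). nra.
  - apply Rmult_le_reg_r with (D ^ 2 * (q * D)); [nra|].
    replace ((B + 1) ^ 2 * / D ^ 2 * (D ^ 2 * (q * D))) with ((B + 1) ^ 2 * (q * D)) by (field; lra).
    replace (1 / (q * D) * (D ^ 2 * (q * D))) with (D ^ 2) by (field; lra). exact HqD2.
Qed.

Lemma words_lim_points x' x1' z0 (zs : nat -> C) (xs : nat -> R) v :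
  x' <> Some x -> x1' <> Some x -> upper_half z0 ->
  (forall n, zs n = moebius (gamma_prefix W n) (RtoC (xs n) + Ci)%C) ->
  (forall n, (1 <= n)%nat -> Re (zs n) = x) ->
  Clim (fun n => (wint x' z0 n / RtoC (INR (t n)))%C) v ->
  Clim (fun n => (path_integral (ge g x1' (Some x)) z0 (zs n) / RtoC (INR (t n)))%C) v.
Proof.
  intros Hx' Hx1' Hz0 Ez Hz Hv.
  destruct (wint_aseq x' z0 Hx' Hz0) as [K [HK P]].
  pose proof hB as (Hx & HB1 & _).
  destruct (aseq_points g hg ginv x B hB z0 x1' ((B + 1) ^ 2) Hz0 Hx1' ltac:(nra)) as [K1 [HK1 P1]].
  apply Clim_perturb with (wint x' z0) (K1 + K); auto; [apply total_norm_large|].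
  destruct (total_norm_large 1) as [N HN].
  exists (S N). intros n Hn. specialize (HN n ltac:(lia)). specialize (Hz n ltac:(lia)). specialize (P n).
  assert (Ht : (1 <= 2 * t n)%nat).
  { destruct (t n); [simpl in HN; lra|lia]. }
  rewrite Ez, gamma_prefix_cfmat in Hz |- *.
  destruct (vertical_height _ (xs n) Ht (cfmat_even x (t n)) Hz) as [V1 V2].
  specialize (P1 (2 * t n)%nat _ Hz V1 V2).
  match goal with |- Cmod (?p - ?q)%C <= _ =>
    replace (p - q)%C with ((p - aseq g x (2 * t n)) + - (q - aseq g x (2 * t n)))%C by ring end.
  apply Cmod_plus_le; auto. now rewrite Cmod_opp.
Qed.
End Func.
End Words.

(** [D_n] is at least [golden^(n-2)] by [gamma_bottom_golden], and for [g = 1] the sequence [aseq]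
    is real. *)
Lemma lin_lim_one_lower x l : irrational x -> lin_lim (aseq (fun _ => 1) x) l -> Im l = 0 /\ 2 * ln golden <= Re l.
Proof.
  intros Hx H. pose proof golden_gt_1 as Hg.
  assert (HL : forall n, (1 <= n)%nat -> 2 * (INR n * ln golden - 2 * ln golden) <= 2 * ln (Dprod x n)).
  { intros n Hn. apply Rmult_le_compat_l; [lra|].
    pose proof (gamma_bottom_golden x n Hx Hn) as P. fold (cfmat x n) in P.
    pose proof (cfmat_bottom_le x n Hx) as P2. pose proof (Dprod_ge_1 x n Hx).
    assert (E : golden ^ n <= golden ^ 2 * Dprod x n).
    { eapply Rle_trans; [exact P|]. apply Rmult_le_compat_l; [nra|lra]. }
    apply ln_le in E; [|apply pow_lt; lra].
    rewrite ln_mult, !ln_pow in E by (try lra; nra). simpl (INR 2) in E. lra. }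
  assert (G : forall n e, (1 <= n)%nat -> Cmod (aseq (fun _ => 1) x n - RtoC (INR n) * l)%C <= e * INR n ->
    Rabs (Im l) <= e /\ 2 * ln (Dprod x n) <= INR n * (Re l + e)).
  { intros n e Hn Hc. rewrite aseq_one in Hc by auto.
    assert (Hp : 1 <= INR n) by (apply (le_INR 1); lia).
    pose proof (Rle_trans _ _ _ (im_le_Cmod _) Hc) as Q1. pose proof (Rle_trans _ _ _ (re_le_Cmod _) Hc) as Q2.
    replace (Im (RtoC (2 * ln (Dprod x n)) - RtoC (INR n) * l)%C) with (- (INR n * Im l)) in Q1 by (destruct l; simpl; ring).
    replace (Re (RtoC (2 * ln (Dprod x n)) - RtoC (INR n) * l)%C) with (2 * ln (Dprod x n) - INR n * Re l) in Q2 by (destruct l; simpl; ring).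
    rewrite Rabs_Ropp, Rabs_mult, Rabs_right in Q1 by lra. apply Rabs_le_between in Q2.
    split; [|lra]. apply Rmult_le_reg_l with (INR n); lra. }
  split.
  - apply Rabs_eq_0. apply Rle_antisym; [|apply Rabs_pos]. apply Rnot_lt_le. intros Hp.
    destruct (H (Rabs (Im l) / 2)) as [N HN]; [lra|].
    specialize (HN (S N) ltac:(lia)). apply G in HN; [|lia]. lra.
  - apply Rnot_lt_le. intros Hp. set (e := (2 * ln golden - Re l) / 4).
    destruct (H e) as [N HN]; [unfold e; lra|].
    destruct (INR_large (4 * ln golden / e)) as [N2 HN2].
    set (n := S (max N N2)). specialize (HN n ltac:(lia)). specialize (HN2 n ltac:(lia)).
    apply G in HN; [|lia]. destruct HN as [_ HN]. specialize (HL n ltac:(lia)).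
    assert (Hn : 1 <= INR n) by (apply (le_INR 1); lia).
    assert (He : 0 < e) by (unfold e; lra).
    assert (4 * ln golden <= e * INR n).
    { apply Rle_trans with (e * (4 * ln golden / e)); [right; field; lra|]. apply Rmult_le_compat_l; lra. }
    assert (INR n * (Re l + e) = INR n * (2 * ln golden) - 3 * (e * INR n)) by (unfold e; field).
    assert (0 < e * INR n) by (apply Rmult_lt_0_compat; lra). lra.
Qed.

Lemma exp_2_ln_golden : exp (2 * ln golden) = (3 + sqrt 5) / 2.
Proof.
  pose proof golden_gt_1. replace (2 * ln golden) with (ln golden + ln golden) by ring.
  rewrite exp_plus, !exp_ln by lra.
  pose proof golden_sq as E. simpl in E. unfold golden in *. lra.
Qed.

(** Every small [y] equals [D_n^-2] up to a factor [B^4] for some even [n], so [hint g x y] and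
    [- ln y] are the values of [aseq] for [g] and for 1 up to bounded errors. This passes from the
    heights [D_n^-2] to all heights. *)
Lemma lin_lim_vlim g x B p q : holo g -> (forall A z, SL2Z A -> upper_half z -> g (moebius A z) = g z) ->
  cf_bound x B -> 0 < q -> lin_lim (aseq g x) p -> lin_lim (aseq (fun _ => 1) x) (RtoC q) -> vlim g x (p / RtoC q)%C.
Proof.
  intros hg ginv hB Hq Hp H1 eps He. pose proof hB as (Hx & HB & _).
  set (v := (p / RtoC q)%C). pose proof (Cmod_ge_0 v) as Hv.
  assert (Nq : RtoC q <> 0) by (apply RtoC_neq; lra).
  (* The bound [q / 2] makes [2 ln D_n] at least [n q / 2]; the second bound absorbs the factor
     [1 + |v|]. *)
  set (e := Rmin (q / 2) (eps * q / (8 * (1 + Cmod v)))).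
  assert (He1 : 0 < eps * q / (8 * (1 + Cmod v))) by (apply Rdiv_lt_0_compat; [nra|lra]).
  assert (He0 : 0 < e) by (apply Rmin_pos; lra).
  assert (Eq : e <= q / 2) by apply Rmin_l.
  assert (Ee : e * (1 + Cmod v) <= eps * q / 8).
  { apply Rle_trans with (eps * q / (8 * (1 + Cmod v)) * (1 + Cmod v)); [|right; field; lra].
    apply Rmult_le_compat_r; [lra|apply Rmin_r]. }
  destruct (Hp e He0) as [N1 P1]. destruct (H1 e He0) as [N2 P2].
  assert (HB4 : 1 <= B ^ 4) by (apply pow_R1_Rle; lra).
  destruct (hint_ratio_both g hg ginv x B hB (B ^ 4) 1 HB4 ltac:(lra)) as [K [HK P3]].
  set (N := max N1 N2). pose proof (Dprod_ge_1 x N Hx) as HDN.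
  destruct (minus_ln_large (K * (2 + 4 * (1 + Cmod v) / eps))) as [d2 [Hd2 Q2]].
  (* Below [d1] the index of the window that contains [y] is at least [N]. *)
  set (d1 := / (B ^ 4 * Dprod x N ^ 2)).
  assert (HDN2 : 1 <= Dprod x N ^ 2) by nra.
  assert (Hd1 : 0 < d1) by (apply Rinv_0_lt_compat; nra).
  exists (Rmin d1 (Rmin d2 (1 / 2))). split.
  { split; [repeat apply Rmin_pos; lra|]. eapply Rle_lt_trans; [eapply Rle_trans; [apply Rmin_r|apply Rmin_r]|lra]. }
  intros y Hy.
  assert (Y1 : y < d1) by (eapply Rlt_le_trans; [apply Hy|apply Rmin_l]).
  assert (Y2 : y < d2) by (eapply Rlt_le_trans; [apply Hy|eapply Rle_trans; [apply Rmin_r|apply Rmin_l]]).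
  assert (Y3 : y < 1 / 2) by (eapply Rlt_le_trans; [apply Hy|eapply Rle_trans; [apply Rmin_r|apply Rmin_r]]).
  specialize (Q2 y ltac:(lra)).
  destruct (window_cover x B 1 y hB ltac:(lra) ltac:(lra)) as [r [R1 R2]].
  set (n := (2 * r)%nat) in *.
  pose proof (Dprod_ge_1 x n Hx) as HDn. assert (HDn2 : 1 <= Dprod x n ^ 2) by nra.
  assert (Hn : (N <= n)%nat).
  { destruct (Nat.le_gt_cases N n) as [l|l]; auto. exfalso.
    assert (Dprod x n <= Dprod x N).
    { clear - l Hx. assert (n <= N)%nat by lia. induction H; [lra|].
      destruct (Nat.eq_dec n m) as [->|]; [apply Dprod_mono, Hx|]. pose proof (Dprod_mono x m Hx). specialize (IHle ltac:(lia)). lra. }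
    assert (d1 <= 1 / B ^ 4 / Dprod x n ^ 2); [|lra].
    unfold d1. rewrite Rinv_mult. unfold Rdiv. rewrite Rmult_1_l. apply Rmult_le_compat_l; [apply Rlt_le, Rinv_0_lt_compat; lra|].
    apply Rinv_le_contravar; nra. }
  specialize (P1 n ltac:(lia)). specialize (P2 n ltac:(lia)).
  assert (HI : / Dprod x n ^ 2 <= 1) by (rewrite <- Rinv_1; apply Rinv_le_contravar; lra).
  assert (HI0 : 0 < / Dprod x n ^ 2) by (apply Rinv_0_lt_compat; lra).
  destruct (P3 (/ Dprod x n ^ 2) y) as [F1 F2]; try lra.
  { unfold Rdiv in R1. rewrite Rmult_1_l in R1.
    apply Rle_trans with (B ^ 4 * (/ B ^ 4 * / Dprod x n ^ 2)); [right; field; lra|]. apply Rmult_le_compat_l; lra. }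
  { unfold Rdiv in R2. rewrite Rmult_1_l in R2. nra. }
  fold (aseq g x n) in F1.
  assert (EA : RtoC (- ln (/ Dprod x n ^ 2)) = aseq (fun _ => 1) x n).
  { unfold aseq. rewrite hint_one; auto. }
  set (Y := - ln y) in *.
  rewrite aseq_one in EA by auto. rewrite aseq_one in P2 by auto.
  apply RtoC_inj in EA. rewrite EA in F2. set (A := 2 * ln (Dprod x n)) in *.
  apply Rabs_le_between in F2.
  assert (HA0 : Rabs (A - INR n * q) <= e * INR n).
  { rewrite <- RtoC_mult, <- RtoC_minus, Cmod_R in P2. exact P2. }
  pose proof (pos_INR n) as Hn0.
  assert (HnA : INR n * (q / 2) <= A).
  { apply Rabs_le_between in HA0. assert (e * INR n <= q / 2 * INR n) by (apply Rmult_le_compat_r; lra). lra. }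
  assert (HKe : 0 <= K * (2 + 4 * (1 + Cmod v) / eps)).
  { apply Rmult_le_pos; auto. assert (0 < 4 * (1 + Cmod v) / eps) by (apply Rdiv_lt_0_compat; lra). lra. }
  assert (HK1 : K <= Y).
  { eapply Rle_trans; [|exact Q2]. rewrite <- (Rmult_1_r K) at 1. apply Rmult_le_compat_l; auto.
    assert (0 < 4 * (1 + Cmod v) / eps) by (apply Rdiv_lt_0_compat; lra). lra. }
  assert (HK2 : K * (1 + Cmod v) <= eps / 4 * Y).
  { apply Rle_trans with (eps / 4 * (K * (4 * (1 + Cmod v) / eps))); [right; field; lra|].
    apply Rmult_le_compat_l; [lra|]. eapply Rle_trans; [|exact Q2]. apply Rmult_le_compat_l; lra. }
  replace (hint g x y - v * RtoC Y)%C with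
    ((hint g x y - aseq g x n) + (aseq g x n - RtoC (INR n) * p) + v * RtoC (INR n * q - A) + v * RtoC (A - Y))%C.
  2: { unfold v. rewrite !RtoC_minus, RtoC_mult. field. auto. }
  eapply Rle_trans; [apply Cmod_plus_le; [apply Cmod_plus_le; [apply Cmod_plus_le; [exact F1|exact P1]|]|]|].
  - rewrite Cmod_mult, Cmod_R, <- Rabs_Ropp, Ropp_minus_distr. apply Rmult_le_compat_l; [auto|exact HA0].
  - rewrite Cmod_mult, Cmod_R. apply Rmult_le_compat_l with (r2 := K); [auto|]. apply Rabs_le. lra.
  - assert (HH : e * INR n * (1 + Cmod v) <= eps / 4 * (Y + K)).
    { replace (e * INR n * (1 + Cmod v)) with (INR n * (e * (1 + Cmod v))) by ring.
      apply Rle_trans with (INR n * (eps * q / 8)); [apply Rmult_le_compat_l; lra|].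
      replace (INR n * (eps * q / 8)) with (eps / 4 * (INR n * (q / 2))) by field. apply Rmult_le_compat_l; lra. }
    assert (eps / 4 * K <= eps / 4 * Y) by (apply Rmult_le_compat_l; lra).
    assert (0 <= eps * Y) by (apply Rmult_le_pos; lra). lra.
Qed.

(** * Growth of the denominators *)

Section Epsilon.
Variables (x B : R) (W : nat -> word) (L : R).
Hypothesis hB : cf_bound x B.
Hypothesis hW : is_word_expansion x W.
Hypothesis hfin : finitely_many_words W.
Hypothesis hmean : mean_norm W L.
Hypothesis hL : 0 < L.

Notation t n := (wnorm (wprefix W n)).
Notation c n := (IZR (Zpos (cf_den (wprefix W n)))).

Lemma cf_den_Dprod n : 0 <= ln (c n) <= ln (Dprod x (2 * t n)) /\ ln (Dprod x (2 * t n)) <= ln (c n) + ln (B + 1).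
Proof.
  pose proof hB as (Hx & HB & _). destruct (expansion_data x W Hx hW hfin) as (HE & _).
  set (m := (2 * t n)%nat). pose proof (Dprod_ge_1 x m Hx) as HD.
  assert (H : 1 <= c n <= Dprod x m /\ Dprod x m <= c n * (B + 1)).
  { rewrite (HE n). fold m. destruct (Nat.eq_dec m 0) as [E|E].
    - rewrite E. change (cf_den (cflist x 0)) with 1%positive. simpl. lra.
    - assert (Hm : (1 <= m)%nat) by lia. rewrite cf_den_cflist by auto. fold (cfmat x m).
      destruct (gamma_bottom x m Hx Hm) as [Hb1 Hb2]. destruct (gamma_action x m Hx) as [_ Ec].
      fold (cfmat x m) in *. pose proof (cfmat_bottom_le x m Hx).
      assert (1 <= IZR (m21 (cfmat x m))) by (apply (IZR_le 1); lia).
      assert (IZR (m22 (cfmat x m)) <= IZR (m21 (cfmat x m))) by (apply IZR_le; lia).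
      assert (cq x m <= B) by (destruct m; [lia|]; apply (cf_bound_S x B m hB)).
      split; [lra|]. rewrite <- Ec. nra. }
  destruct H as [[H1 H2] H3]. split; [split|].
  - rewrite <- ln_1. apply ln_le; lra.
  - apply ln_le; lra.
  - rewrite <- ln_mult by lra. apply ln_le; lra.
Qed.

Lemma heps_seq_exp n : heps_seq W L n = exp (ln (c n) / (L * INR n)).
Proof. unfold heps_seq, Rpower. f_equal. unfold Rdiv. ring. Qed.

(** [L n] may be replaced by [t n] because their ratio tends to 1, and [2 ln c_n] differs from
    [aseq] for [g = 1] at [2 * t n] by a bounded amount. *)
Lemma heps_exponent_lim l : is_lim_seq (fun n => ln (c n) / (L * INR n)) (Finite l) <->
  lin_lim (aseq (fun _ => 1) x) (RtoC l).
Proof.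
  pose proof hB as (Hx & HB & _).
  assert (H : Clim (fun n => (RtoC (2 * ln (c n)) / RtoC (INR (t n)))%C) (2 * RtoC l)%C <-> lin_lim (aseq (fun _ => 1) x) (RtoC l)).
  { rewrite (words_lim_gen x B W hB hW hfin _ (holo_const 1) one_inv (fun n => RtoC (2 * ln (c n))) (2 * ln (B + 1))).
    - replace (2 * RtoC l / 2)%C with (RtoC l) by field. easy.
    - intros n. rewrite aseq_one by auto. rewrite <- RtoC_minus, Cmod_R. pose proof (cf_den_Dprod n). apply Rabs_le. lra. }
  rewrite <- H. destruct (total_norm_large x B W hB hW hfin 1) as [N HN].
  assert (H2 : Clim (fun n => (RtoC (2 * ln (c n)) / RtoC (INR (t n)))%C) (2 * RtoC l)%C <-> is_lim_seq (fun n => 2 * ln (c n) / INR (t n)) (2 * l)).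
  { rewrite <- Clim_RtoC, <- RtoC_mult. split; intros HH; eapply Clim_ext_loc; try exact HH; exists N; intros n Hn;
      specialize (HN n Hn); cbv beta; now rewrite RtoC_div by lra. }
  rewrite H2. unfold mean_norm in hmean.
  set (T := fun n => total_norm W n / INR n) in *.
  assert (ET : forall n, (S N <= n)%nat -> 0 < INR n /\ 1 <= INR (t n) /\ T n = INR (t n) / INR n).
  { intros n Hn. split; [apply lt_0_INR; lia|]. split; [apply HN; lia|]. reflexivity. }
  split; intros HH.
  - apply is_lim_seq_ext_loc with (fun n => 2 * L * (ln (c n) / (L * INR n)) / T n).
    + exists (S N). intros n Hn. destruct (ET n Hn) as (E1 & E2 & ->). field. lra.
    + replace (2 * l) with (2 * L * l / L) by (field; lra).
      apply is_lim_seq_div'; [|exact hmean|lra].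
      apply is_lim_seq_mult'; [apply is_lim_seq_const|exact HH].
  - apply is_lim_seq_ext_loc with (fun n => / (2 * L) * (2 * ln (c n) / INR (t n) * T n)).
    + exists (S N). intros n Hn. destruct (ET n Hn) as (E1 & E2 & ->). field. lra.
    + replace l with (/ (2 * L) * (2 * l * L)) by (field; lra).
      apply is_lim_seq_mult'; [apply is_lim_seq_const|].
      apply is_lim_seq_mult'; [exact HH|exact hmean].
Qed.

Lemma heps_exponent_pos n : 0 <= ln (c n) / (L * INR n).
Proof.
  pose proof (cf_den_Dprod n) as [[H _] _]. destruct n as [|n].
  - change (INR 0) with 0. rewrite Rmult_0_r. unfold Rdiv. rewrite Rinv_0. lra.
  - apply Rmult_le_pos; auto. apply Rlt_le, Rinv_0_lt_compat, Rmult_lt_0_compat; auto. apply lt_0_INR; lia.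
Qed.

Lemma heps_lim_iff e : heps_lim W L e <-> 0 < e /\ lin_lim (aseq (fun _ => 1) x) (RtoC (ln e)).
Proof.
  rewrite <- heps_exponent_lim. unfold heps_lim. split.
  (* The terms are at least 1, so the limit is positive and the logarithm is continuous there. *)
  - intros H. assert (He : 1 <= e).
    { apply (is_lim_seq_le (fun _ => 1) (heps_seq W L) 1 e); auto; [|apply is_lim_seq_const].
      intros n. rewrite heps_seq_exp. pose proof (exp_ineq1_le (ln (c n) / (L * INR n))). pose proof (heps_exponent_pos n). lra. }
    split; [lra|]. apply is_lim_seq_ext with (fun n => ln (heps_seq W L n)).
    + intros n. now rewrite heps_seq_exp, ln_exp.
    + apply is_lim_seq_continuous; auto. apply derivable_continuous_pt.
      exists (/ e). apply derivable_pt_lim_ln. lra.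
  - intros [He H]. apply is_lim_seq_ext with (fun n => exp (ln (c n) / (L * INR n))).
    + intros n. symmetry. apply heps_seq_exp.
    + rewrite <- (exp_ln e) by auto. apply is_lim_seq_continuous; auto.
      apply derivable_continuous_pt, derivable_pt_exp.
Qed.

Lemma heps_bounded : exists M, forall n, Rabs (heps_seq W L n) <= M.
Proof.
  pose proof hB as (Hx & HB & _). destruct (expansion_data x W Hx hW hfin) as (_ & [Bd H1] & _).
  destruct (aseq_growth x B hB _ (holo_const 1) one_inv) as [K [HK P]].
  assert (Ht : forall n, (t n <= n * Bd)%nat).
  { induction n as [|n IH]; [reflexivity|]. specialize (H1 n). simpl (S n * Bd)%nat. lia. }
  exists (exp (K * (1 + 2 * INR Bd) / L)). intros n. rewrite heps_seq_exp, Rabs_right by (apply Rle_ge, Rlt_le, exp_pos).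
  assert (0 <= K * (1 + 2 * INR Bd) / L).
  { apply Rmult_le_pos; [pose proof (pos_INR Bd); nra|apply Rlt_le, Rinv_0_lt_compat, hL]. }
  assert (ln (c n) / (L * INR n) <= K * (1 + 2 * INR Bd) / L); [|destruct (Req_dec (ln (c n) / (L * INR n)) (K * (1 + 2 * INR Bd) / L)) as [->|]; [lra|apply Rlt_le, exp_increasing; lra]].
  destruct n as [|n].
  - change (INR 0) with 0. rewrite Rmult_0_r. unfold Rdiv at 1. rewrite Rinv_0. lra.
  - assert (Hn : 1 <= INR (S n)) by (apply (le_INR 1); lia). set (m := S n) in *.
    pose proof (cf_den_Dprod m) as [[C1 C2] _]. specialize (P (2 * t m)%nat).
    rewrite aseq_one, Cmod_R in P by auto. rewrite mult_INR in P. change (INR 2) with 2 in P.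
    specialize (Ht m). apply le_INR in Ht. rewrite mult_INR in Ht.
    pose proof (Rle_abs (2 * ln (Dprod x (2 * t m)))).
    apply Rmult_le_reg_r with (L * INR m); [nra|].
    replace (ln (c m) / (L * INR m) * (L * INR m)) with (ln (c m)) by (field; lra).
    replace (K * (1 + 2 * INR Bd) / L * (L * INR m)) with (K * (INR m + 2 * (INR m * INR Bd))) by (field; lra).
    apply Rle_trans with (K * (1 + 2 * INR (t m))); [lra|]. apply Rmult_le_compat_l; lra.
Qed.
End Epsilon.

(** * Real quadratic numbers *)

Lemma mat_mul_assoc A B D : mat_mul A (mat_mul B D) = mat_mul (mat_mul A B) D.
Proof. unfold mat_mul; simpl. f_equal; ring. Qed.

Lemma mat_mul_1_l A : mat_mul mat_one A = A.
Proof. destruct A as [a b c d]. unfold mat_mul, mat_one. cbn [m11 m12 m21 m22]. f_equal; ring. Qed.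

Lemma mat_mul_1_r A : mat_mul A mat_one = A.
Proof. destruct A as [a b c d]. unfold mat_mul, mat_one. cbn [m11 m12 m21 m22]. f_equal; ring. Qed.

Lemma mat_mul_adj_r A : SL2Z A -> mat_mul A (mat_adj A) = mat_one.
Proof.
  destruct A as [a b c d]. unfold SL2Z, mat_mul, mat_adj, mat_one. cbn [m11 m12 m21 m22]. intros H.
  f_equal; lia.
Qed.

Lemma mat_mul_adj_l A : SL2Z A -> mat_mul (mat_adj A) A = mat_one.
Proof.
  destruct A as [a b c d]. unfold SL2Z, mat_mul, mat_adj, mat_one. cbn [m11 m12 m21 m22]. intros H.
  f_equal; lia.
Qed.

Lemma mat_adj_adj A : mat_adj (mat_adj A) = A.
Proof. destruct A as [a b c d]. unfold mat_adj. cbn [m11 m12 m21 m22]. f_equal; ring. Qed.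

Lemma mat_adj_mul A B : mat_adj (mat_mul A B) = mat_mul (mat_adj B) (mat_adj A).
Proof. destruct A as [a b c d], B as [a' b' c' d']. unfold mat_adj, mat_mul. cbn [m11 m12 m21 m22]. f_equal; ring. Qed.

Lemma mat_opp_opp A : mat_opp (mat_opp A) = A.
Proof. destruct A as [a b c d]. unfold mat_opp. cbn [m11 m12 m21 m22]. f_equal; ring. Qed.

Lemma SL2Z_mul A B : SL2Z A -> SL2Z B -> SL2Z (mat_mul A B).
Proof.
  destruct A as [a b c d], B as [a' b' c' d']. unfold SL2Z, mat_mul. cbn [m11 m12 m21 m22]. intros H1 H2.
  replace (_ - _)%Z with ((a * d - b * c) * (a' * d' - b' * c'))%Z by ring. now rewrite H1, H2.
Qed.

Lemma SL2Z_adj A : SL2Z A -> SL2Z (mat_adj A).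
Proof. destruct A as [a b c d]. unfold SL2Z, mat_adj. cbn [m11 m12 m21 m22]. lia. Qed.

Lemma SL2Z_opp A : SL2Z A -> SL2Z (mat_opp A).
Proof. destruct A as [a b c d]. unfold SL2Z, mat_opp. cbn [m11 m12 m21 m22]. lia. Qed.

Lemma mdenR_nz A x : irrational x -> SL2Z A -> mdenR A x <> 0.
Proof. intros Hx HA. apply mdenR_neq_0; auto. now apply SL2Z_bottom. Qed.

Lemma mdenR_mul A B x : mdenR B x <> 0 -> mdenR (mat_mul A B) x = mdenR A (moebiusR B x) * mdenR B x.
Proof.
  intros H. unfold moebiusR. fold (mdenR B x). unfold mdenR at 1 2. unfold mat_mul. cbn [m21 m22].
  rewrite !plus_IZR, !mult_IZR.
  transitivity (IZR (m21 A) * (IZR (m11 B) * x + IZR (m12 B)) + IZR (m22 A) * mdenR B x); [unfold mdenR; ring|].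
  field. exact H.
Qed.

Lemma moebiusR_mul A B x : irrational x -> SL2Z A -> SL2Z B ->
  moebiusR (mat_mul A B) x = moebiusR A (moebiusR B x).
Proof.
  intros Hx HA HB. pose proof (mdenR_nz B x Hx HB) as N1.
  pose proof (mdenR_nz A _ (proj1 (moebiusR_equiv B x Hx HB)) HA) as N2.
  unfold moebiusR at 1. fold (mdenR (mat_mul A B) x). rewrite mdenR_mul by auto.
  unfold moebiusR at 2. fold (mdenR A (moebiusR B x)).
  set (D := mdenR A (moebiusR B x)) in *. unfold mat_mul. cbn [m11 m12]. rewrite !plus_IZR, !mult_IZR.
  unfold moebiusR. fold (mdenR B x).
  transitivity ((IZR (m11 A) * (IZR (m11 B) * x + IZR (m12 B)) + IZR (m12 A) * mdenR B x) / (D * mdenR B x));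
    [unfold mdenR; f_equal; ring|]. field. auto.
Qed.

Lemma moebiusR_one x : moebiusR mat_one x = x.
Proof. unfold moebiusR, mat_one. cbn [m11 m12 m21 m22]. field. Qed.

Lemma moebiusR_opp A x : irrational x -> SL2Z A -> moebiusR (mat_opp A) x = moebiusR A x.
Proof.
  intros Hx HA. pose proof (mdenR_nz A x Hx HA) as N. unfold mdenR in N.
  unfold moebiusR, mat_opp. cbn [m11 m12 m21 m22]. rewrite !opp_IZR. field. split; auto.
  intros E. apply N. lra.
Qed.

Lemma moebius_mul A B z : SL2Z A -> SL2Z B -> upper_half z ->
  moebius (mat_mul A B) z = moebius A (moebius B z).
Proof.
  intros HA HB Hz. pose proof (mden_nz B z HB Hz) as N1.
  pose proof (mden_nz A _ HA (moebius_upper B z HB Hz)) as N2.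
  assert (E : mden (mat_mul A B) z = (mden A (moebius B z) * mden B z)%C).
  { unfold moebius. fold (mden B z). unfold mden at 1 2. unfold mat_mul. cbn [m21 m22].
    rewrite !plus_IZR, !mult_IZR, !RtoC_plus, !RtoC_mult.
    transitivity (RtoC (IZR (m21 A)) * (RtoC (IZR (m11 B)) * z + RtoC (IZR (m12 B))) + RtoC (IZR (m22 A)) * mden B z)%C; [unfold mden; ring|].
    field. exact N1. }
  unfold moebius at 1. fold (mden (mat_mul A B) z). rewrite E.
  unfold moebius at 2. fold (mden A (moebius B z)).
  set (D := mden A (moebius B z)) in *. unfold mat_mul. cbn [m11 m12].
  rewrite !plus_IZR, !mult_IZR, !RtoC_plus, !RtoC_mult.
  unfold moebius. fold (mden B z).
  transitivity ((RtoC (IZR (m11 A)) * (RtoC (IZR (m11 B)) * z + RtoC (IZR (m12 B))) + RtoC (IZR (m12 A)) * mden B z) / (D * mden B z))%C;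
    [unfold mden; f_equal; ring|]. field. auto.
Qed.

Lemma gamma_app l1 l2 : gamma (l1 ++ l2) = mat_mul (gamma l1) (gamma l2).
Proof.
  induction l1 as [|k l1 IH].
  - unfold gamma at 2. simpl. now rewrite mat_mul_1_l.
  - simpl app. unfold gamma in *. simpl. now rewrite IH, mat_mul_assoc.
Qed.

(** Powers with a natural exponent, suited to induction; [mat_pow] iterates over binary positive
    numbers. *)
Definition npow (A : mat2) (n : nat) : mat2 := Nat.iter n (mat_mul A) mat_one.

Lemma npow_S A n : npow A (S n) = mat_mul A (npow A n).
Proof. reflexivity. Qed.

Lemma SL2Z_npow A n : SL2Z A -> SL2Z (npow A n).
Proof. intros H. induction n; [reflexivity|]. now apply SL2Z_mul. Qed.

Lemma npow_add A n m : npow A (n + m) = mat_mul (npow A n) (npow A m).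
Proof.
  induction n as [|n IH]; [now rewrite mat_mul_1_l|]. simpl Nat.add. now rewrite !npow_S, IH, mat_mul_assoc.
Qed.

Lemma npow_adj A n : mat_adj (npow A n) = npow (mat_adj A) n.
Proof.
  induction n as [|n IH]; [reflexivity|]. rewrite <- Nat.add_1_r at 1. rewrite npow_add, mat_adj_mul, IH.
  unfold npow at 1. simpl. now rewrite mat_mul_1_r.
Qed.

Lemma npow_conj V A n : SL2Z V ->
  npow (mat_mul (mat_mul V A) (mat_adj V)) n = mat_mul (mat_mul V (npow A n)) (mat_adj V).
Proof.
  intros HV. induction n as [|n IH].
  - unfold npow; simpl. now rewrite mat_mul_1_r, mat_mul_adj_r.
  - rewrite !npow_S, IH, !mat_mul_assoc.
    rewrite <- (mat_mul_assoc (mat_mul V A) (mat_adj V) V), mat_mul_adj_l, mat_mul_1_r by auto. reflexivity.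
Qed.

Lemma mat_pow_cases A n : mat_pow A n = npow A (Z.to_nat n) \/ mat_pow A n = npow (mat_adj A) (Z.to_nat (- n)).
Proof.
  destruct n as [|p|p]; [now left| |].
  - left. unfold mat_pow. now rewrite Pos2Nat.inj_iter.
  - right. unfold mat_pow. now rewrite Pos2Nat.inj_iter.
Qed.

Lemma mat_pow_of_nat A n : mat_pow A (Z.of_nat n) = npow A n.
Proof.
  destruct n as [|n]; [reflexivity|]. cbn [Z.of_nat mat_pow].
  rewrite Pos2Nat.inj_iter, SuccNat2Pos.id_succ. reflexivity.
Qed.

Lemma mat_pow_opp_nat A n : mat_pow A (- Z.of_nat n) = npow (mat_adj A) n.
Proof.
  destruct n as [|n]; [reflexivity|]. cbn [Z.of_nat Z.opp mat_pow].
  rewrite Pos2Nat.inj_iter, SuccNat2Pos.id_succ. reflexivity.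
Qed.

(** * Matrices fixing an irrational number *)

Definition fixes (A : mat2) (x : R) : Prop := SL2Z A /\ moebiusR A x = x.

Section Fixers.
Variable x : R.
Hypothesis Hx : irrational x.

Lemma fixes_iff A : SL2Z A ->
  (moebiusR A x = x <-> IZR (m21 A) * x ^ 2 + (IZR (m22 A) - IZR (m11 A)) * x - IZR (m12 A) = 0).
Proof.
  intros HA. pose proof (mdenR_nz A x Hx HA) as N. unfold moebiusR. fold (mdenR A x). split; intros H.
  - assert (E : IZR (m11 A) * x + IZR (m12 A) = x * mdenR A x) by (rewrite <- H at 2; field; auto).
    unfold mdenR in E. lra.
  - apply Rmult_eq_reg_r with (mdenR A x); auto. unfold Rdiv. rewrite Rmult_assoc, Rinv_l by auto. unfold mdenR. lra.
Qed.

Lemma fixes_mul A B : fixes A x -> fixes B x ->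
  fixes (mat_mul A B) x /\ mdenR (mat_mul A B) x = mdenR A x * mdenR B x.
Proof.
  intros [HA EA] [HB EB]. split; [split; [now apply SL2Z_mul|]|].
  - now rewrite moebiusR_mul, EB, EA.
  - rewrite mdenR_mul, EB; auto. now apply mdenR_nz.
Qed.

Lemma fixes_one : fixes mat_one x /\ mdenR mat_one x = 1.
Proof. split; [split; [reflexivity|apply moebiusR_one]|]. unfold mdenR, mat_one; simpl. ring. Qed.

Lemma fixes_adj A : fixes A x -> fixes (mat_adj A) x /\ mdenR (mat_adj A) x * mdenR A x = 1.
Proof.
  intros [HA EA].
  assert (F : fixes (mat_adj A) x).
  { split; [now apply SL2Z_adj|]. rewrite <- EA at 1. rewrite <- moebiusR_mul, mat_mul_adj_l, moebiusR_one; auto. now apply SL2Z_adj. }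
  split; auto. rewrite <- (proj2 (fixes_mul _ _ F (conj HA EA))), mat_mul_adj_l by auto. apply fixes_one.
Qed.

Lemma fixes_opp A : fixes A x -> fixes (mat_opp A) x /\ mdenR (mat_opp A) x = - mdenR A x.
Proof.
  intros [HA EA]. split; [split; [now apply SL2Z_opp|now rewrite moebiusR_opp]|].
  unfold mdenR, mat_opp; cbn [m21 m22]. rewrite !opp_IZR. ring.
Qed.

Lemma fixes_npow A n : fixes A x -> fixes (npow A n) x /\ mdenR (npow A n) x = mdenR A x ^ n.
Proof.
  intros HA. induction n as [|n [IH1 IH2]]; [apply fixes_one|].
  rewrite npow_S. destruct (fixes_mul A (npow A n) HA IH1) as [H1 H2]. split; auto. rewrite H2, IH2. reflexivity.
Qed.

(** If [c] were not 0, then [x = (1 - d) / c] would be rational; with [c = 0] and [d = 1] there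
    remains a translation fixing [x]. *)
Lemma fixes_mden_1 A : fixes A x -> mdenR A x = 1 -> A = mat_one.
Proof.
  intros [HA EA] E. assert (Hc : m21 A = 0%Z).
  { destruct (Z.eq_dec (m21 A) 0) as [|n]; auto. exfalso. apply (Hx (1 - m22 A)%Z (m21 A) n).
    unfold mdenR in E. rewrite minus_IZR. assert (IZR (m21 A) <> 0) by now apply not_0_IZR.
    apply Rmult_eq_reg_r with (IZR (m21 A)); auto. unfold Rdiv. rewrite Rmult_assoc, Rinv_l by auto. lra. }
  apply fixes_iff in EA; auto. unfold SL2Z in HA. unfold mdenR in E. rewrite Hc in *.
  assert (Hd : m22 A = 1%Z) by (apply eq_IZR; lra).
  assert (Ha : m11 A = 1%Z) by lia. rewrite Hd, Ha in EA.
  assert (Hb : m12 A = 0%Z) by (apply eq_IZR; lra).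
  destruct A as [a b c d]; simpl in *; subst; reflexivity.
Qed.
End Fixers.

Lemma cfk_inj x y : irrational x -> irrational y -> (forall n, cfk x n = cfk y n) -> x = y.
Proof.
  intros Hx Hy H. destruct (is_cf_cfk x Hx) as [_ L1]. destruct (is_cf_cfk y Hy) as [_ L2].
  assert (E : Finite x = Finite y); [|now injection E].
  rewrite <- (is_lim_seq_unique _ _ L1), <- (is_lim_seq_unique _ _ L2). apply Lim_seq_ext.
  intros n. do 2 f_equal. apply map_ext. auto.
Qed.

(** * Periodic continued fractions and words *)

Lemma cfk_add x n m : cfk (cq x n) m = cfk x (n + m).
Proof. unfold cfk. now rewrite cq_add. Qed.

Lemma nth_cflist x n i : (i < n)%nat -> nth i (cflist x n) 0%Z = cfk x i.
Proof.
  intros H. unfold cflist. rewrite nth_indep with (d' := cfk x 0) by now rewrite length_map, length_seq.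
  rewrite map_nth, seq_nth by auto. reflexivity.
Qed.

Lemma wpow_S U n : wpow U (S n) = U ++ wpow U n.
Proof. reflexivity. Qed.

Lemma length_wpow U n : length (wpow U n) = (n * length U)%nat.
Proof. induction n as [|n IH]; [reflexivity|]. rewrite wpow_S, length_app, IH. simpl. lia. Qed.

Lemma wpow_snoc U n : wpow U (S n) = wpow U n ++ U.
Proof.
  induction n as [|n IH].
  - unfold wpow; simpl. now rewrite app_nil_r.
  - rewrite wpow_S, IH at 1. rewrite wpow_S. now rewrite app_assoc.
Qed.

Lemma nth_wpow U n i : (i < n * length U)%nat -> nth i (wpow U n) 0%Z = nth (i mod length U) U 0%Z.
Proof.
  revert i. induction n as [|n IH]; intros i H; [simpl in H; lia|].
  rewrite wpow_S. destruct (Nat.lt_ge_cases i (length U)) as [l|l].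
  - rewrite app_nth1, Nat.mod_small by auto. reflexivity.
  - rewrite app_nth2 by auto. simpl in H. rewrite IH by lia. f_equal.
    replace i with ((i - length U) + 1 * length U)%nat at 2 by lia. rewrite Nat.Div0.mod_add. reflexivity.
Qed.

Lemma cq_period_mult y p k : cq y p = y -> cq y (p * k) = y.
Proof.
  intros H. induction k as [|k IH]; [now rewrite Nat.mul_0_r|].
  rewrite Nat.mul_succ_r, cq_add, IH. exact H.
Qed.

Lemma cflist_period y p k : cq y p = y -> cflist y (p * k) = wpow (cflist y p) k.
Proof.
  intros H. induction k as [|k IH]; [now rewrite Nat.mul_0_r|].
  rewrite Nat.mul_succ_r, cflist_add, IH, wpow_snoc, cq_period_mult by auto. reflexivity.
Qed.

Lemma Dprod_period y p k : cq y p = y -> Dprod y (p * k) = Dprod y p ^ k.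
Proof.
  intros H. induction k as [|k IH]; [now rewrite Nat.mul_0_r|].
  rewrite Nat.mul_succ_r, Dprod_add, IH, cq_period_mult by auto. simpl. ring.
Qed.

Lemma gamma_wpow U k : gamma (wpow U k) = npow (gamma U) k.
Proof. induction k as [|k IH]; [reflexivity|]. now rewrite wpow_S, gamma_app, IH, npow_S. Qed.

Lemma cf_period_of_coeffs y p : irrational y -> (forall i, cfk y (p + i) = cfk y i) -> cq y p = y.
Proof. intros Hy H. apply cfk_inj; auto; [now apply irrational_cq|]. intros n. now rewrite cfk_add. Qed.

Lemma cf_period_of_wpow y W : irrational y -> (0 < length W)%nat ->
  (forall i, exists n, (i <= n)%nat /\ cflist y (length W * n) = wpow W n) -> cq y (length W) = y.
Proof.
  intros Hy HW H. apply cf_period_of_coeffs; auto.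
  assert (E : forall i, cfk y i = nth (i mod length W) W 0%Z).
  { intros i. destruct (H (S i)) as (n & Hn & E). assert (Hi : (i < n * length W)%nat) by nia.
    rewrite <- (nth_cflist y (length W * n)) by lia. rewrite E. now apply nth_wpow. }
  intros i. rewrite !E. f_equal. replace (length W + i)%nat with (i + 1 * length W)%nat by lia.
  now rewrite Nat.Div0.mod_add.
Qed.

(** Prepending [k :: l] to [y]: positivity of [l] and [y > 1] keep all intermediate values above 1,
    so the prepended entries are integer parts. *)
Lemma cf_construct k l y : List.Forall (fun k => (0 < k)%Z) l -> irrational y -> 1 < y ->
  exists x, irrational x /\ IZR k < x /\ cflist x (S (length l)) = k :: l /\ cq x (S (length l)) = y.
Proof.
  intros Hl Hy Hy1. revert k. induction Hl as [|k' l Hk' Hl IH]; intros k.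
  - exists (/ y + IZR k). assert (0 < / y) by (apply Rinv_0_lt_compat; lra).
    assert (/ y < 1) by (rewrite <- Rinv_1; apply Rinv_lt_contravar; lra).
    assert (E : Int_part (/ y + IZR k) = k) by (apply Int_part_unique; lra).
    split; [now apply irrational_shift, irrational_inv|]. split; [lra|]. split.
    + unfold cflist, cfk. simpl. now rewrite E.
    + simpl. unfold gauss. rewrite E. replace (/ y + IZR k - IZR k) with (/ y) by ring. apply Rinv_inv.
  - destruct (IH k') as (x1 & Hx1 & H1 & E1 & E2). apply (IZR_lt 0) in Hk' as Hk2.
    assert (1 <= IZR k') by (apply (IZR_le 1); lia).
    exists (/ x1 + IZR k). assert (0 < / x1) by (apply Rinv_0_lt_compat; lra).
    assert (/ x1 < 1) by (rewrite <- Rinv_1; apply Rinv_lt_contravar; lra).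
    assert (E : Int_part (/ x1 + IZR k) = k) by (apply Int_part_unique; lra).
    assert (G : gauss (/ x1 + IZR k) = x1).
    { unfold gauss. rewrite E. replace (/ x1 + IZR k - IZR k) with (/ x1) by ring. apply Rinv_inv. }
    split; [now apply irrational_shift, irrational_inv|]. split; [lra|]. split.
    + rewrite cflist_S, G. simpl length. rewrite E1. unfold cfk. simpl cq. now rewrite E.
    + simpl length. change (cq (gauss (/ x1 + IZR k)) (S (length l)) = y). now rewrite G.
Qed.

Lemma gamma_action_moebius x n : irrational x -> moebiusR (gamma (cflist x n)) (cq x n) = x.
Proof.
  intros Hx. destruct (gamma_action x n Hx) as [E1 E2]. unfold moebiusR. rewrite E1, E2.
  pose proof (Dprod_ge_1 x n Hx). field. lra.
Qed.

Lemma gamma_mden x n : irrational x -> mdenR (gamma (cflist x n)) (cq x n) = Dprod x n.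
Proof. intros Hx. apply (gamma_action x n Hx). Qed.

Lemma gamma_single k : gamma [k] = Mat2 k 1 1 0.
Proof. unfold gamma. simpl fold_right. apply mat_mul_1_r. Qed.

(** Bottom rows with [c >= d] are stripped of factors [(k 1; 1 0)] on the right by the Euclidean algorithm;
    when the determinant is [-1] the remainder is taken in [1..d] instead of [0..d-1], so that the
    algorithm stops only at a matrix [(a 1; 1 0)] and the length of the word has the required parity. *)
Lemma gamma_decomp (N : nat) : forall a b c d : Z, (Z.to_nat d <= N)%nat -> (1 <= d <= c)%Z ->
  (a * d - b * c = 1)%Z ->
  exists k l, List.Forall (fun k => (0 < k)%Z) l /\ Nat.Even (length (k :: l)) /\ gamma (k :: l) = Mat2 a b c d.
Proof.
  induction N as [|N IH]; intros a b c d HN Hd HD; [lia|].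
  set (q := (c / d)%Z). set (r := (c mod d)%Z).
  assert (Eq : c = (d * q + r)%Z) by (apply Z.div_mod; lia).
  assert (Hr : (0 <= r < d)%Z) by (apply Z.mod_pos_bound; lia).
  clearbody q r. assert (Hq : (1 <= q)%Z) by nia.
  enough (HM : exists k l, List.Forall (fun k => (0 < k)%Z) l /\ Nat.Even (length l) /\ gamma (k :: l) = Mat2 b (a - b * q) d r).
  { destruct HM as (k & l & Hl & He & Hg). exists k, (l ++ [q]). split; [|split].
    - apply Forall_app. split; auto. constructor; [lia|constructor].
    - destruct He as [m Hm]. exists (S m). simpl. rewrite length_app, Hm. simpl. lia.
    - change (k :: l ++ [q]) with ((k :: l) ++ [q]). rewrite gamma_app, Hg, gamma_single.
      unfold mat_mul; cbn [m11 m12 m21 m22]. f_equal; lia. }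
  assert (HD2 : (b * r - (a - b * q) * d = -1)%Z) by nia.
  destruct (Z.eq_dec r 0) as [Hr0|Hr0].
  (* Here the determinant -1 forces [d = 1] and the upper right entry 1, so the remaining matrix is
     [(b 1; 1 0)]. *)
  - exists b, []. split; [constructor|]. split; [exists O; reflexivity|].
    rewrite Hr0 in HD2 |- *. rewrite gamma_single. revert HD2. generalize (a - b * q)%Z. intros X HX.
    assert (1 <= X)%Z by nia. assert (X = 1 /\ d = 1)%Z as [-> ->] by nia. reflexivity.
  - set (q2 := ((d - 1) / r)%Z). set (r2 := (d - r * q2)%Z).
    assert (E2 : (d - 1 = r * q2 + (d - 1) mod r)%Z) by (apply Z.div_mod; lia).
    assert (Hr2 : (0 <= (d - 1) mod r < r)%Z) by (apply Z.mod_pos_bound; lia).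
    revert E2 Hr2. generalize ((d - 1) mod r)%Z. intros s E2 Hr2. clearbody q2.
    assert (Hq2 : (1 <= q2)%Z) by nia.
    destruct (IH (a - b * q)%Z (b - (a - b * q) * q2)%Z r r2) as (k & l & Hl & He & Hg); try lia; try (unfold r2; lia).
    exists k, (l ++ [q2]). split; [|split].
    + apply Forall_app. split; auto. constructor; [lia|constructor].
    + destruct He as [m Hm]. exists m. rewrite length_app. simpl in *. lia.
    + change (k :: l ++ [q2]) with ((k :: l) ++ [q2]). rewrite gamma_app, Hg, gamma_single.
      unfold mat_mul; cbn [m11 m12 m21 m22]. unfold r2. f_equal; lia.
Qed.

(** Eliminating [x ^ 2] leaves a linear equation with integer coefficients, which an irrational
    number satisfies only trivially. *)
Lemma forms_proportional x (a b c a' b' c' : Z) : irrational x ->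
  IZR a * x ^ 2 + IZR b * x + IZR c = 0 -> IZR a' * x ^ 2 + IZR b' * x + IZR c' = 0 ->
  (a' * b = a * b')%Z /\ (a' * c = a * c')%Z.
Proof.
  intros Hx E E'.
  assert (EP : IZR (a' * b - a * b') * x = IZR (a * c' - a' * c)).
  { rewrite !minus_IZR, !mult_IZR.
    assert (IZR a' * (IZR a * x ^ 2 + IZR b * x + IZR c) = 0) by (rewrite E; ring).
    assert (IZR a * (IZR a' * x ^ 2 + IZR b' * x + IZR c') = 0) by (rewrite E'; ring). lra. }
  destruct (Z.eq_dec (a' * b - a * b') 0) as [HP|HP].
  - rewrite HP in EP. assert (a * c' - a' * c = 0)%Z by (apply eq_IZR; lra). lia.
  - exfalso. apply (Hx (a * c' - a' * c)%Z _ HP). rewrite <- EP. field. now apply not_0_IZR.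
Qed.

(** The fixed points of [U] and [B] satisfy proportional quadratic equations, so the signs at [0] and [-1] of the
    polynomial of [U] (the conjugate of [y] lies in between) decide those of [B]. *)
Lemma reduced_fixer y U B : irrational y -> 1 < y -> fixes U y -> fixes B y ->
  (1 <= m21 U)%Z -> (1 <= m12 U)%Z -> (1 <= m11 U - m12 U + m21 U - m22 U)%Z ->
  1 < mdenR B y -> (1 <= m22 B <= m21 B)%Z.
Proof.
  intros Hy Hy1 [HU EU] [HB EB] Hc0 Hb0 Hs0 He.
  apply fixes_iff in EU; auto. apply fixes_iff in EB; auto.
  unfold mdenR in He. unfold SL2Z in HU, HB.
  pose proof HB as HBR. apply (f_equal IZR) in HBR. rewrite minus_IZR, !mult_IZR in HBR.
  destruct B as [a b c d], U as [a0 b0 c0 d0]. cbn [m11 m12 m21 m22] in *.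
  rewrite <- minus_IZR in EU, EB. unfold Rminus in EU, EB. rewrite <- opp_IZR in EU, EB.
  pose proof (forms_proportional y _ _ _ _ _ _ Hy EU EB) as P1.
  rewrite minus_IZR, opp_IZR in EB.
  destruct P1 as [P1 P2].
  set (e := IZR c * y + IZR d) in *.
  assert (Ea : (IZR a - IZR c * y) * e = 1).
  { rewrite <- HBR. unfold e. nra. }
  assert (Ha1 : 0 < IZR a - IZR c * y < 1).
  { split; nra. }
  assert (Hc : (1 <= c)%Z).
  { destruct (Z.lt_trichotomy c 0) as [Hc|[Hc|Hc]]; [|subst c|lia].
    - exfalso. assert (b <= -1)%Z by nia.
      assert (IZR c <= -1) by (apply (IZR_le c (-1)); lia).
      assert (Ha : (a < 0)%Z) by (apply lt_IZR; nra). assert (Hd : (1 < d)%Z) by (apply lt_IZR; unfold e in He; nra). nia.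
    - exfalso. unfold e in He. assert (1 < IZR d) by lra. apply lt_IZR in H. nia. }
  assert (Hcr : 1 <= IZR c) by (apply (IZR_le 1); lia).
  assert (Hac : (c < a)%Z) by (apply lt_IZR; nra).
  assert (Hb : (1 <= b)%Z) by nia.
  assert (Hs : (1 <= a - b + c - d)%Z).
  { assert (c0 * (a - b + c - d) = c * (a0 - b0 + c0 - d0))%Z by lia. nia. }
  assert (Hd : (1 <= d)%Z) by nia.
  split; auto. apply Z.nlt_ge. intros Hlt. nia.
Qed.

(** These are the sign conditions for [reduced_fixer]: the polynomial [c X^2 + (d - a) X - b] of [U]
    is negative at 0 and positive at -1. *)
Lemma gamma_period_pos y p : irrational y -> 1 < y -> (1 <= p)%nat -> Nat.Even p -> cq y p = y ->
  let U := gamma (cflist y p) in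
  fixes U y /\ (1 <= m21 U)%Z /\ (1 <= m12 U)%Z /\ (1 <= m11 U - m12 U + m21 U - m22 U)%Z.
Proof.
  intros Hy Hy1 Hp He Hper U.
  assert (HU : SL2Z U) by (apply gamma_SL2Z; now rewrite cflist_length).
  assert (FU : moebiusR U y = y).
  { rewrite <- Hper at 1. now apply gamma_action_moebius. }
  split; [now split|].
  assert (HF : List.Forall (fun k => (0 < k)%Z) (cflist y p)).
  { rewrite <- Hper. unfold cflist. apply List.Forall_map, List.Forall_forall. intros i _. rewrite cfk_add. apply cfk_pos; auto; lia. }
  destruct (gamma_pos _ HF) as (G1 & G2 & G3 & G4 & G5). fold U in G1, G2, G3, G4, G5.
  destruct (gamma_bottom y p Hy Hp) as [_ G6]. fold U in G6.
  assert (G7 : (m22 U <= m21 U)%Z).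
  { apply G5. intros E. apply (f_equal (@length Z)) in E. rewrite cflist_length in E. simpl in E. lia. }
  pose proof (proj1 (fixes_iff y Hy U HU) FU) as EU.
  unfold SL2Z in HU. split; auto.
  assert (Hb : (1 <= m12 U)%Z).
  { destruct (Z.eq_dec (m12 U) 0) as [E|]; [|lia]. exfalso. rewrite E in *.
    destruct (Z.eq_mul_1_nonneg (m11 U) (m22 U)) as [H H0]; [lia|lia|]. rewrite H, H0 in EU.
    assert (1 <= IZR (m21 U)) by (apply (IZR_le 1); lia). nra. }
  split; auto. destruct (Z.eq_dec (m11 U) (m12 U)) as [E1|]; [|lia].
  destruct (Z.eq_dec (m21 U) (m22 U)) as [E2|]; [|lia]. exfalso. rewrite E1, E2 in HU. lia.
Qed.

(** [reduced_fixer] and [gamma_decomp] write [B] as the matrix of a word. The number whose expansion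
    is this word followed by [y] equals [B y = y], so the word begins the expansion of [y] and its
    length is a period. *)
Lemma fixer_word y p B : irrational y -> 1 < y -> (1 <= p)%nat -> Nat.Even p -> cq y p = y ->
  fixes B y -> 1 < mdenR B y ->
  exists s, (1 <= s)%nat /\ cq y (2 * s) = y /\ B = gamma (cflist y (2 * s)).
Proof.
  intros Hy Hy1 Hp He Hper HB Heps.
  destruct (gamma_period_pos y p Hy Hy1 Hp He Hper) as (F1 & F2 & F3 & F4).
  pose proof (reduced_fixer y _ B Hy Hy1 F1 HB F2 F3 F4 Heps) as HR.
  destruct HB as [HB EB]. destruct B as [a b c d]. unfold SL2Z in HB. cbn [m11 m12 m21 m22] in *.
  destruct (gamma_decomp (Z.to_nat d) a b c d) as (k & l & Hl & [s Hs] & Hg); auto.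
  destruct (cf_construct k l y Hl Hy Hy1) as (x & Hx & _ & Ex & Ey).
  change (S (length l)) with (length (k :: l)) in *. rewrite Hs in Ex, Ey.
  assert (E : x = y).
  { rewrite <- (gamma_action_moebius x (2 * s) Hx), Ex, Ey, Hg. exact EB. }
  subst x. exists s. split; [simpl in Hs; lia|]. split; auto. now rewrite Ex.
Qed.

Lemma pigeonhole {T : Type} (f : nat -> T) (l : list T) : (forall n, In (f n) l) ->
  exists i j, (i < j)%nat /\ f i = f j.
Proof.
  intros H. apply NNPP. intros N.
  assert (ND : NoDup (map f (seq 0 (S (length l))))).
  { apply (NoDup_nth _ (f O)). rewrite length_map, length_seq. intros i j Hi Hj E.
    rewrite !map_nth, !seq_nth in E by auto. simpl in E.
    destruct (Nat.lt_trichotomy i j) as [h|[h|h]]; auto; exfalso; apply N; eauto. }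
  pose proof (NoDup_incl_length ND (l' := l)) as HL. rewrite length_map, length_seq in HL.
  assert (S (length l) <= length l)%nat; [|lia]. apply HL. intros z Hz. apply in_map_iff in Hz.
  destruct Hz as (n & <- & _). apply H.
Qed.

Lemma nat_least (P : nat -> Prop) : (exists n, P n) -> exists n, P n /\ forall m, P m -> (n <= m)%nat.
Proof.
  intros [n Hn]. revert Hn. induction n as [n IH] using lt_wf_ind. intros Hn.
  destruct (classic (exists m, (m < n)%nat /\ P m)) as [(m & Hm & Pm)|N]; [eauto|].
  exists n. split; auto. intros m Pm. apply Nat.nlt_ge. intros Hm. apply N. eauto.
Qed.

(** * Lagrange's theorem *)

Definition zrange (m : nat) : list Z := map (fun i => (Z.of_nat i - Z.of_nat m)%Z) (seq 0 (2 * m + 1)).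

Lemma in_zrange m z : Rabs (IZR z) <= INR m -> In z (zrange m).
Proof.
  intros H. rewrite INR_IZR_INZ in H. apply Rabs_le_between in H. rewrite <- opp_IZR in H. destruct H as [H1 H2].
  apply le_IZR in H1. apply le_IZR in H2. apply in_map_iff. exists (Z.to_nat (z + Z.of_nat m)).
  split; [lia|]. apply in_seq. lia.
Qed.

(** The transforms [(an, bn, cn)] of the quadratic form by the convergent matrices are bounded, because
    [p - x q] and [p' - x q'] are [O(1/D)]; a root of such a form is determined by the form and the sign of [2 an xi + bn]. *)
Lemma lagrange x B : cf_bound x B -> real_quadratic x ->
  exists m r, (1 <= r)%nat /\ cq (cq x (2 * m)) (2 * r) = cq x (2 * m).
Proof.
  intros hB [Hx (a & b & c & Ha & Hroot)]. pose proof hB as (_ & HB & _). unfold quad_root in Hroot.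
  assert (HaR : IZR a <> 0) by now apply not_0_IZR.
  set (E := Rabs (2 * IZR a * x + IZR b)). set (M := (E + Rabs (IZR a)) * (2 * (B + 1) ^ 2)).
  destruct (INR_large M) as [m0 Hm0]. specialize (Hm0 m0 (le_n _)).
  set (p1 n := m11 (cfmat x n)). set (p2 n := m12 (cfmat x n)). set (q1 n := m21 (cfmat x n)). set (q2 n := m22 (cfmat x n)).
  set (fa n := (a * p1 n * p1 n + b * p1 n * q1 n + c * q1 n * q1 n)%Z).
  set (fb n := (2 * a * p1 n * p2 n + b * (p1 n * q2 n + p2 n * q1 n) + 2 * c * q1 n * q2 n)%Z).
  set (fc n := (a * p2 n * p2 n + b * p2 n * q2 n + c * q2 n * q2 n)%Z).
  assert (F : forall n, (1 <= n)%nat -> Rabs (IZR (fa n)) <= M /\ Rabs (IZR (fb n)) <= M /\ Rabs (IZR (fc n)) <= M /\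
    IZR (fa n) <> 0 /\ IZR (fa n) * cq x n ^ 2 + IZR (fb n) * cq x n + IZR (fc n) = 0).
  { intros n Hn. destruct (gamma_action x n Hx) as [A1 A2]. destruct (gamma_bottom x n Hx Hn) as [G1 G2].
    pose proof (gamma_det (cflist x n)) as Gd. fold (cfmat x n) in *.
    assert (Hxi : 1 < cq x n <= B) by (destruct n; [lia|]; apply (cf_bound_S x B n hB)).
    pose proof (Dprod_ge_1 x n Hx) as HD.
    unfold fa, fb, fc. fold (p1 n) (p2 n) (q1 n) (q2 n) in *.
    rewrite !plus_IZR, !mult_IZR, !plus_IZR, !mult_IZR.
    assert (Q1 : 1 <= IZR (q1 n)) by (apply (IZR_le 1); lia).
    assert (Q2 : 0 <= IZR (q2 n)) by (apply (IZR_le 0); lia).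
    assert (Gs : exists s, Rabs s = 1 /\ IZR (p1 n) * IZR (q2 n) - IZR (p2 n) * IZR (q1 n) = s).
    { eexists. split; [|reflexivity]. rewrite <- !mult_IZR, <- minus_IZR, Gd.
      rewrite <- abs_IZR, Z.abs_pow. replace (Z.abs (-1)) with 1%Z by reflexivity. rewrite Z.pow_1_l by lia. reflexivity. }
    destruct Gs as (s & Hs & Es).
    (* This is [a (p - x' q)] for the conjugate [x' = - b / a - x]; its vanishing would make [x]
       rational. It shows that the leading coefficient of the transformed form is not 0. *)
    assert (Hnr : IZR a * IZR (p1 n) + IZR a * x * IZR (q1 n) + IZR b * IZR (q1 n) <> 0).
    { intros E0. apply (Hx (- (a * p1 n + b * q1 n))%Z (a * q1 n)%Z); [nia|].
      rewrite opp_IZR, plus_IZR, !mult_IZR. apply Rmult_eq_reg_r with (IZR a * IZR (q1 n)).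
      - unfold Rdiv. rewrite Rmult_assoc, Rinv_l; [lra|]. apply Rmult_integral_contrapositive. split; auto; lra.
      - apply Rmult_integral_contrapositive. split; auto; lra. }
    set (xi := cq x n) in *. set (D := Dprod x n) in *.
    set (P1 := IZR (p1 n)) in *. set (P2 := IZR (p2 n)) in *. set (R1 := IZR (q1 n)) in *. set (R2 := IZR (q2 n)) in *.
    set (ra := IZR a) in *. set (rb := IZR b) in *. set (rc := IZR c) in *.
    (* [gamma_action] gives [p' - x q' = - xi (p - x q)], and [(p - x q) D] is the determinant of
       the convergent matrix. *)
    set (de := P1 - x * R1). set (de' := P2 - x * R2).
    assert (HDR : R1 <= D /\ R2 <= D) by (rewrite <- A2; split; nra).
    assert (E1 : de' = - xi * de) by (unfold de, de'; nra).
    assert (E2 : de * D = s) by (rewrite <- Es, <- A2; unfold de, de' in *; nra).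
    assert (H1 : Rabs de * D = 1) by (rewrite <- Hs, <- E2, Rabs_mult, (Rabs_right D); lra).
    pose proof (Rabs_pos de) as H0.
    assert (H2 : Rabs de <= 1) by nra.
    assert (H3 : Rabs de' <= B * Rabs de).
    { rewrite E1, Rabs_mult, Rabs_Ropp, (Rabs_right xi) by lra. apply Rmult_le_compat_r; lra. }
    assert (EA : ra * P1 * P1 + rb * P1 * R1 + rc * R1 * R1 = (2 * ra * x + rb) * (R1 * de) + ra * (de * de)).
    { transitivity ((2 * ra * x + rb) * (R1 * de) + ra * (de * de) + (ra * x ^ 2 + rb * x + rc) * (R1 * R1)); [unfold de; ring|].
      rewrite Hroot. ring. }
    assert (EB : 2 * ra * P1 * P2 + rb * (P1 * R2 + P2 * R1) + 2 * rc * R1 * R2 = (2 * ra * x + rb) * (R1 * de' + R2 * de) + ra * (2 * (de * de'))).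
    { transitivity ((2 * ra * x + rb) * (R1 * de' + R2 * de) + ra * (2 * (de * de')) + (ra * x ^ 2 + rb * x + rc) * (2 * R1 * R2)); [unfold de, de'; ring|].
      rewrite Hroot. ring. }
    assert (EC : ra * P2 * P2 + rb * P2 * R2 + rc * R2 * R2 = (2 * ra * x + rb) * (R2 * de') + ra * (de' * de')).
    { transitivity ((2 * ra * x + rb) * (R2 * de') + ra * (de' * de') + (ra * x ^ 2 + rb * x + rc) * (R2 * R2)); [unfold de'; ring|].
      rewrite Hroot. ring. }
    assert (Bd : forall u v, Rabs u <= 2 * (B + 1) ^ 2 -> Rabs v <= 2 * (B + 1) ^ 2 ->
      Rabs ((2 * ra * x + rb) * u + ra * v) <= M).
    { intros u v Hu Hv. eapply Rle_trans; [apply Rabs_triang|]. rewrite !Rabs_mult. fold E. unfold M.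
      rewrite Rmult_plus_distr_r. apply Rplus_le_compat; apply Rmult_le_compat_l; auto; apply Rabs_pos. }
    pose proof (Rabs_pos de') as H4.
    assert (T1 : Rabs (R1 * de) <= 1) by (rewrite Rabs_mult, (Rabs_right R1) by lra; nra).
    assert (T2 : Rabs (R2 * de) <= 1) by (rewrite Rabs_mult, (Rabs_right R2) by lra; nra).
    assert (T3 : Rabs (R1 * de') <= B) by (rewrite Rabs_mult, (Rabs_right R1) by lra; nra).
    assert (T4 : Rabs (R2 * de') <= B) by (rewrite Rabs_mult, (Rabs_right R2) by lra; nra).
    assert (T5 : Rabs de' <= B) by nra.
    split; [|split; [|split; [|split]]].
    - rewrite EA. apply Bd; [nra|]. rewrite Rabs_mult. nra.
    - rewrite EB. apply Bd.
      + eapply Rle_trans; [apply Rabs_triang|]. nra.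
      + rewrite !Rabs_mult, (Rabs_right 2) by lra. assert (Rabs de * Rabs de' <= 1 * B) by (apply Rmult_le_compat; lra). nra.
    - rewrite EC. apply Bd; [nra|]. rewrite Rabs_mult. assert (Rabs de' * Rabs de' <= B * B) by (apply Rmult_le_compat; lra). nra.
    - rewrite EA. replace ((2 * ra * x + rb) * (R1 * de) + ra * (de * de)) with (de * (ra * P1 + ra * x * R1 + rb * R1)) by (unfold de; ring).
      apply Rmult_integral_contrapositive. split; auto. intros E0. rewrite E0, Rabs_R0 in H1. lra.
    - transitivity (ra * (P1 * xi + P2) ^ 2 + rb * (P1 * xi + P2) * (R1 * xi + R2) + rc * (R1 * xi + R2) ^ 2); [ring|].
      rewrite A1, A2. transitivity (D ^ 2 * (ra * x ^ 2 + rb * x + rc)); [ring|]. rewrite Hroot. ring. }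
  set (sg n := if Rle_dec 0 (2 * IZR (fa n) * cq x n + IZR (fb n)) then true else false).
  (* Only even indices are compared, in order to obtain an even period; [S i] keeps them positive,
     as [F] requires. *)
  destruct (pigeonhole (fun i => let n := (2 * S i)%nat in (fa n, fb n, fc n, sg n))
    (list_prod (list_prod (list_prod (zrange m0) (zrange m0)) (zrange m0)) [true; false])) as (i & j & Hij & HE).
  { intros i. cbv zeta. destruct (F (2 * S i)%nat ltac:(lia)) as (F1 & F2 & F3 & _).
    repeat apply in_prod; try (apply in_zrange; lra). destruct (sg (2 * S i)%nat); simpl; auto. }
  cbv zeta in HE.
  pose proof (f_equal (fun p => fst (fst (fst p))) HE) as Ea. pose proof (f_equal (fun p => snd (fst (fst p))) HE) as Eb.
  pose proof (f_equal (fun p => snd (fst p)) HE) as Ec. pose proof (f_equal (fun p => snd p) HE) as Es.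
  cbn [fst snd] in Ea, Eb, Ec, Es.
  destruct (F (2 * S i)%nat ltac:(lia)) as (_ & _ & _ & Na & Ri).
  destruct (F (2 * S j)%nat ltac:(lia)) as (_ & _ & _ & _ & Rj).
  rewrite <- Ea, <- Eb, <- Ec in Rj. unfold sg in Es. rewrite <- Ea, <- Eb in Es.
  set (n := (2 * S i)%nat) in *. set (n' := (2 * S j)%nat) in *.
  exists (S i), (j - i)%nat. split; [lia|]. fold n. rewrite <- cq_add.
  replace (n + 2 * (j - i))%nat with n' by (unfold n, n'; lia).
  set (A := IZR (fa n)) in *. set (Bn := IZR (fb n)) in *. set (Cn := IZR (fc n)) in *.
  set (X := cq x n) in *. set (Y := cq x n') in *. clearbody A Bn Cn X Y. clear - Na Ri Rj Es.
  assert (Sq : (2 * A * X + Bn) * (2 * A * X + Bn) = (2 * A * Y + Bn) * (2 * A * Y + Bn)).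
  { transitivity (Bn * Bn - 4 * A * Cn + 4 * A * (A * X ^ 2 + Bn * X + Cn)); [ring|]. rewrite Ri, <- Rj. ring. }
  assert (E : 2 * A * X + Bn = 2 * A * Y + Bn).
  { set (u := 2 * A * X + Bn) in *. set (v := 2 * A * Y + Bn) in *.
    destruct (Rle_dec 0 u), (Rle_dec 0 v); try discriminate; nra. }
  apply Rmult_eq_reg_l with (2 * A); [lra|lra].
Qed.

(** * Least even periods and exponents of words *)

Section Period.
Variables (y : R) (r : nat).
Hypothesis Hy : irrational y.

(** [r] counts pairs of coefficients: [2 * r] is the least even period. *)
Definition min_period : Prop := (1 <= r)%nat /\ cq y (2 * r) = y /\
  forall s, (1 <= s)%nat -> cq y (2 * s) = y -> (r <= s)%nat.

Hypothesis hr : min_period.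

Lemma period_gt_1 : 1 < y.
Proof. destruct hr as (H1 & H2 & _). rewrite <- H2. apply cq_gt_1; auto. lia. Qed.

Lemma period_div s : cq y (2 * s) = y -> exists q, s = (r * q)%nat.
Proof.
  intros H. destruct hr as (H1 & H2 & H3).
  pose proof (Nat.div_mod s r ltac:(lia)) as E. pose proof (Nat.mod_upper_bound s r ltac:(lia)) as Hm.
  exists (s / r)%nat. destruct (Nat.eq_dec (s mod r) 0) as [E0|E0]; [lia|]. exfalso.
  assert (r <= s mod r)%nat; [|lia]. apply H3; [lia|].
  rewrite E in H. replace (2 * (r * (s / r) + s mod r))%nat with (2 * r * (s / r) + 2 * (s mod r))%nat in H by lia.
  rewrite (cq_add y (2 * r * (s / r))), (cq_period_mult y (2 * r) (s / r) H2) in H. exact H.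
Qed.

(** If a period word is a power of an even word [U], the coefficients of [y] are read off
    arbitrarily high powers of [U], so the length of [U] is itself a period; minimality of [r] gives
    the bound. *)
Lemma word_power_le s n U : (1 <= s)%nat -> cq y (2 * s) = y -> even_word U -> cflist y (2 * s) = wpow U n ->
  (n * r <= s)%nat.
Proof.
  intros Hs H [u Hu] HW. destruct hr as (H1 & H2 & H3).
  pose proof (f_equal (@length Z) HW) as HL. rewrite cflist_length, length_wpow, Hu in HL.
  assert (Hn : (1 <= n)%nat) by nia. assert (Hu1 : (1 <= u)%nat) by nia.
  assert (r <= u)%nat; [|nia]. apply H3; auto. rewrite <- Hu. apply cf_period_of_wpow; auto; [lia|].
  intros i. exists (n * i)%nat. split; [nia|].
  replace (length U * (n * i))%nat with (2 * s * i)%nat by nia.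
  rewrite cflist_period, HW by auto. clear. unfold wpow. induction i as [|i IH].
  - now rewrite Nat.mul_0_r.
  - simpl. rewrite IH, <- concat_app, <- repeat_app. do 2 f_equal. lia.
Qed.

(** Every even period is a multiple of [2 * r], and its word is the corresponding power of the least
    period word; the exponent is thus [s / r]. *)
Lemma exponent_iff s N : (1 <= s)%nat -> cq y (2 * s) = y -> (is_exponent (cflist y (2 * s)) N <-> s = (r * N)%nat).
Proof.
  intros Hs H. destruct (period_div s H) as [q Eq]. destruct hr as (H1 & H2 & H3).
  assert (Hq : (0 < q)%nat) by nia.
  assert (Pq : exists U, even_word U /\ cflist y (2 * s) = wpow U q).
  { exists (cflist y (2 * r)). split; [exists r; apply cflist_length|].
    rewrite Eq, Nat.mul_assoc. now apply cflist_period. }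
  split.
  - intros [[HN (U & HU & HW)] Hmax]. specialize (Hmax q (conj Hq Pq)).
    pose proof (word_power_le s N U Hs H HU HW). nia.
  - intros E. assert (N = q) by nia. subst N. split; [now split|].
    intros n [Hn (U & HU & HW)]. pose proof (word_power_le s n U Hs H HU HW). nia.
Qed.
End Period.

Lemma min_period_exists y s : (1 <= s)%nat -> cq y (2 * s) = y -> exists r, min_period y r.
Proof.
  intros Hs H. destruct (nat_least (fun r => (1 <= r)%nat /\ cq y (2 * r) = y)) as (r & [H1 H2] & H3); [eauto|].
  exists r. split; [auto|]. split; auto.
Qed.

Lemma wprefix_periodic V W n : wprefix (periodic_words V W) (S n) = V ++ wpow W n.
Proof.
  induction n as [|n IH].
  - unfold wprefix, wpow; simpl. reflexivity.
  - rewrite wprefix_S, IH, wpow_snoc, app_assoc. reflexivity.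
Qed.

Lemma periodic_finite V W : finitely_many_words (periodic_words V W).
Proof. exists [V; W]. intros [|n]; simpl; auto. Qed.

(** Uniqueness of the coefficients turns an expansion [V W W ...] into an even index [2 * m] from
    which on the number is purely periodic. *)
Lemma quad_expansion_data x V W : irrational x -> quad_expansion x V W ->
  exists m s, (1 <= s)%nat /\ V = cflist x (2 * m) /\ W = cflist (cq x (2 * m)) (2 * s) /\
    cq (cq x (2 * m)) (2 * s) = cq x (2 * m).
Proof.
  intros Hx [HW HE]. destruct (expansion_data x _ Hx HE (periodic_finite V W)) as (H & _).
  destruct HE as [Hev _]. destruct (Hev 0%nat) as [m Hm]. destruct (Hev 1%nat) as [s Hs]. cbn [periodic_words] in Hm, Hs.
  assert (Hs1 : (1 <= s)%nat) by (destruct W; [easy|simpl in Hs; lia]).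
  assert (H' : forall n, V ++ wpow W n = cflist x (2 * m + length W * n)).
  { intros n. specialize (H (S n)). rewrite wprefix_periodic in H.
    pose proof (f_equal (@length Z) H) as HL. rewrite cflist_length, length_app, length_wpow in HL.
    rewrite H. f_equal. lia. }
  assert (HV : V = cflist x (2 * m)).
  { specialize (H' O). rewrite Nat.mul_0_r, Nat.add_0_r in H'. unfold wpow in H'. cbn [repeat concat] in H'. now rewrite app_nil_r in H'. }
  assert (H2 : forall n, cflist (cq x (2 * m)) (length W * n) = wpow W n).
  { intros n. specialize (H' n). rewrite (cflist_add x (2 * m)), <- HV in H'. now apply app_inv_head in H'. }
  exists m, s. split; auto. split; auto. rewrite <- Hs. split.
  - specialize (H2 1%nat). rewrite Nat.mul_1_r in H2. rewrite H2. unfold wpow; simpl. now rewrite app_nil_r.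
  - apply cf_period_of_wpow; [now apply irrational_cq|lia|]. intros i. exists i. auto.
Qed.

Lemma quad_expansion_of_period x m s : irrational x -> (1 <= s)%nat -> cq (cq x (2 * m)) (2 * s) = cq x (2 * m) ->
  quad_expansion x (cflist x (2 * m)) (cflist (cq x (2 * m)) (2 * s)).
Proof.
  intros Hx Hs H. split.
  { intros E. apply (f_equal (@length Z)) in E. rewrite cflist_length in E. simpl in E. lia. }
  assert (HP : forall n, wprefix (periodic_words (cflist x (2 * m)) (cflist (cq x (2 * m)) (2 * s))) (S n) = cflist x (2 * m + 2 * s * n)).
  { intros n. now rewrite wprefix_periodic, (cflist_add x (2 * m) (2 * s * n)), (cflist_period (cq x (2 * m)) (2 * s) n H). }
  split.
  - intros [|n]; [exists m|exists s]; apply cflist_length.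
  - exists (cfk x). split; [|now apply is_cf_cfk]. split.
    + intros [|n]; [reflexivity|]. rewrite HP, cflist_length. reflexivity.
    + intros k. exists (S k). rewrite HP, cflist_length. nia.
Qed.

Lemma fixes_conj V y A : irrational y -> SL2Z V -> fixes A (moebiusR V y) ->
  fixes (mat_mul (mat_mul (mat_adj V) A) V) y /\
  mdenR (mat_mul (mat_mul (mat_adj V) A) V) y = mdenR A (moebiusR V y).
Proof.
  intros Hy HV [HA EA]. pose proof (SL2Z_adj V HV) as HV'.
  pose proof (SL2Z_mul _ _ HV' HA) as HVA. pose proof (proj1 (moebiusR_equiv V y Hy HV)) as Hx.
  split; [split|].
  - now apply SL2Z_mul.
  - rewrite !moebiusR_mul, EA by auto. rewrite <- moebiusR_mul, mat_mul_adj_l by auto. apply moebiusR_one.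
  - rewrite mdenR_mul by (now apply mdenR_nz). rewrite mdenR_mul by (now apply mdenR_nz). rewrite EA.
    assert (E : mdenR (mat_adj V) (moebiusR V y) * mdenR V y = 1).
    { rewrite <- mdenR_mul by (now apply mdenR_nz). rewrite mat_mul_adj_l by auto. unfold mdenR, mat_one; simpl. ring. }
    transitivity (mdenR (mat_adj V) (moebiusR V y) * mdenR V y * mdenR A (moebiusR V y)); [ring|]. rewrite E. ring.
Qed.

(** The equation for the fixed points of [A] is proportional to the quadratic equation of [x], which
    [w'] shares; [w'] is irrational because [x + w'] is rational. *)
Lemma conjugate_fixed x w' A : irrational x -> galois_conjugate x w' -> fixes A x ->
  irrational w' /\ moebiusR A w' = w'.
Proof.
  intros Hx [Hne (a & b & c & Ha & E1 & E2)] [HA EA]. unfold quad_root in E1, E2.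
  assert (Hw : irrational w').
  { assert (HaR : IZR a <> 0) by now apply not_0_IZR.
    intros p q Hq E. apply (Hx (- (b * q + p * a))%Z (a * q)%Z); [nia|].
    assert (IZR q <> 0) by now apply not_0_IZR.
    assert (S : IZR a * (w' + x) + IZR b = 0).
    { apply Rmult_eq_reg_l with (w' - x); [|lra]. lra. }
    rewrite E in S. rewrite opp_IZR, plus_IZR, !mult_IZR.
    apply Rmult_eq_reg_l with (IZR a); auto.
    replace (IZR a * x) with (- IZR b - IZR a * (IZR p / IZR q)) by lra. field. auto. }
  split; auto. apply fixes_iff in EA; auto. apply fixes_iff; auto.
  rewrite <- minus_IZR in *. unfold Rminus in *. rewrite <- opp_IZR in *.
  destruct (forms_proportional x _ _ _ _ _ _ Hx E1 EA) as [P1 P2].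
  apply (f_equal IZR) in P1. apply (f_equal IZR) in P2. rewrite !mult_IZR in P1, P2.
  apply Rmult_eq_reg_l with (IZR a); [|now apply not_0_IZR].
  rewrite Rmult_0_r, !Rmult_plus_distr_l. rewrite <- Rmult_assoc, <- (Rmult_assoc (IZR a) _ w'), <- P1, <- P2.
  transitivity (IZR (m21 A) * (IZR a * w' ^ 2 + IZR b * w' + IZR c)); [ring|]. rewrite E2. ring.
Qed.

(** * The generator of the stabilizer *)

Section Generator.
Variables (x : R) (m r : nat).
Hypothesis Hx : irrational x.
Let y := cq x (2 * m).
Hypothesis hr : min_period y r.

Let V := cfmat x (2 * m).
Let U := gamma (cflist y (2 * r)).
(** [V] carries the purely periodic tail [y] to [x], so the matrix [U] of the least even period of
    [y] is conjugated by [V]. *)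
Definition stab_gen : mat2 := mat_mul (mat_mul V U) (mat_adj V).

Let Hy : irrational y. Proof. now apply irrational_cq. Qed.
Let HV : SL2Z V. Proof. apply cfmat_even. Qed.
Let EV : moebiusR V y = x. Proof. now apply gamma_action_moebius. Qed.

Lemma stab_gen_fixes : fixes stab_gen x /\ mdenR stab_gen x = Dprod y (2 * r) /\ 1 < mdenR stab_gen x.
Proof.
  destruct hr as (H1 & H2 & _).
  assert (FU : fixes U y).
  { split; [apply gamma_SL2Z; rewrite cflist_length; now exists r|]. rewrite <- H2 at 1. now apply gamma_action_moebius. }
  assert (EU : mdenR U y = Dprod y (2 * r)) by (rewrite <- H2 at 1; now apply gamma_mden).
  assert (E' : moebiusR (mat_adj V) x = y).
  { rewrite <- EV, <- moebiusR_mul, mat_mul_adj_l by (auto; now apply SL2Z_adj). apply moebiusR_one. }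
  rewrite <- E' in FU, EU.
  destruct (fixes_conj (mat_adj V) x U Hx (SL2Z_adj V HV) FU) as [G1 G2]. rewrite mat_adj_adj in G1, G2.
  fold stab_gen in G1, G2. rewrite EU, E' in G2. split; auto. split; auto. rewrite G2.
  pose proof (Dprod_lower y r Hy). assert (2 ^ 1 <= 2 ^ r) by (apply Rle_pow; [lra|auto]). lra.
Qed.

Lemma stab_gen_power k : npow stab_gen k = mat_mul (mat_mul V (npow U k)) (mat_adj V).
Proof. apply npow_conj, HV. Qed.

(** Conjugation to [y] turns [B] into the matrix of a period word by [fixer_word], and even periods
    are multiples of [2 * r]. *)
Lemma fixer_power B : fixes B x -> 1 < mdenR B x -> exists k, (1 <= k)%nat /\ B = npow stab_gen k.
Proof.
  intros HB He. rewrite <- EV in HB, He. destruct (fixes_conj V y B Hy HV HB) as [G1 G2]. rewrite <- G2 in He.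
  destruct hr as (H1 & H2 & _).
  destruct (fixer_word y (2 * r) _ Hy (period_gt_1 y r Hy hr) ltac:(lia) ltac:(now exists r) H2 G1 He) as (s & Hs & Es & EB).
  destruct (period_div y r hr s Es) as [q Eq]. exists q. split; [nia|].
  rewrite stab_gen_power. unfold U. rewrite <- gamma_wpow, <- cflist_period by auto.
  replace (2 * r * q)%nat with (2 * s)%nat by lia. rewrite <- EB.
  rewrite !mat_mul_assoc, mat_mul_adj_r, mat_mul_1_l by auto.
  rewrite <- mat_mul_assoc, mat_mul_adj_r, mat_mul_1_r by auto. reflexivity.
Qed.

Lemma stab_gen_generates : is_stab_generator x stab_gen.
Proof.
  destruct stab_gen_fixes as (G1 & _ & G2). split; [|split; [apply G1|exact G2]].
  (* The sign of [c x + d] decides between [B] and its negative; values below 1 are treated by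
     passing to the inverse. *)
  assert (Pos : forall B, fixes B x -> 0 < mdenR B x -> exists n, B = mat_pow stab_gen n).
  { intros B HB Hp. destruct (Rtotal_order (mdenR B x) 1) as [H|[H|H]].
    - destruct (fixes_adj x Hx B HB) as [F1 F2].
      destruct (fixer_power _ F1) as (k & _ & Ek).
      { apply Rmult_lt_reg_r with (mdenR B x); auto. lra. }
      exists (- Z.of_nat k)%Z. rewrite mat_pow_opp_nat, <- npow_adj, <- Ek. now rewrite mat_adj_adj.
    - exists 0%Z. now apply (fixes_mden_1 x).
    - destruct (fixer_power B HB H) as (k & _ & Ek). exists (Z.of_nat k). now rewrite mat_pow_of_nat. }
  intros B. split.
  - intros HB. change (fixes B x) in HB. destruct (Rtotal_order (mdenR B x) 0) as [H|[H|H]].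
    + destruct (fixes_opp x Hx B HB) as [F1 F2]. destruct (Pos _ F1 ltac:(lra)) as [n En].
      exists n. right. now rewrite <- En, mat_opp_opp.
    + exfalso. revert H. apply mdenR_nz; auto. apply HB.
    + destruct (Pos B HB H) as [n En]. exists n. now left.
  - intros [n Hn]. change (fixes B x).
    assert (F : fixes (mat_pow stab_gen n) x).
    { destruct (mat_pow_cases stab_gen n) as [-> | ->]; apply fixes_npow; auto. now apply fixes_adj. }
    destruct Hn as [-> | ->]; auto. now apply fixes_opp.
Qed.

(** [A] is the [k]-th power of [stab_gen], and the multiplier [c x + d] of [stab_gen] is a power [j]
    of that of [A]. Multipliers are multiplicative and these exceed 1, so [k j = 1]. *)
Lemma stab_generator_unique A : is_stab_generator x A -> A = stab_gen.
Proof.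
  intros (H & HA & He). change (1 < mdenR A x) in He.
  assert (FA : fixes A x).
  { apply H. exists 1%Z. left. change 1%Z with (Z.of_nat 1). rewrite mat_pow_of_nat. unfold npow; simpl. now rewrite mat_mul_1_r. }
  destruct (fixer_power A FA He) as (k & Hk & Ek). destruct stab_gen_fixes as (G1 & _ & G2).
  assert (Hpow : forall j, 1 <= mdenR A x ^ j) by (intros j; apply pow_R1_Rle; lra).
  assert (E : exists j, mdenR stab_gen x = mdenR A x ^ j).
  { destruct (fixes_adj x Hx A FA) as [F1 F2].
    assert (C : forall n, (exists j, mdenR (mat_pow A n) x = mdenR A x ^ j) \/ 0 < mdenR (mat_pow A n) x <= 1).
    { intros n. destruct (mat_pow_cases A n) as [-> | ->].
      - left. eexists. apply fixes_npow; auto.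
      - right. rewrite (proj2 (fixes_npow x Hx _ _ F1)).
        assert (E0 : mdenR (mat_adj A) x = / mdenR A x) by (apply Rmult_eq_reg_r with (mdenR A x); [rewrite F2; field|]; lra).
        rewrite E0, pow_inv. specialize (Hpow (Z.to_nat (- n))). split; [apply Rinv_0_lt_compat; lra|].
        rewrite <- Rinv_1. apply Rinv_le_contravar; lra. }
    destruct (proj1 (H stab_gen) G1) as [n [En|En]]; specialize (C n).
    - rewrite <- En in C. destruct C as [C|C]; [exact C|lra].
    - assert (Fn : fixes (mat_pow A n) x) by (apply H; exists n; now left).
      pose proof (proj2 (fixes_opp x Hx _ Fn)) as Eo. rewrite <- En in Eo.
      destruct C as [[j C]|C]; [specialize (Hpow j)|]; lra. }
  destruct E as [j Ej]. rewrite Ek, (proj2 (fixes_npow x Hx _ k G1)), <- pow_mult in Ej.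
  set (e := mdenR stab_gen x) in *.
  assert (k = 1)%nat as ->; [|rewrite Ek; unfold npow; simpl; apply mat_mul_1_r].
  destruct (Nat.eq_dec (k * j) 1) as [E1|E1]; [now apply Nat.eq_mul_1 in E1|exfalso].
  destruct (k * j)%nat as [|[|n]] eqn:En; [simpl in Ej; lra|lia|].
  assert (1 <= e ^ n) by (apply pow_R1_Rle; lra).
  assert (e ^ S (S n) = e * (e * e ^ n)) by reflexivity. nra.
Qed.

(** * Limits along a periodic expansion *)

Section QuadLimit.
Variables (B w' : R) (z : C) (s N : nat).
Hypothesis hB : cf_bound x B.
Hypothesis hs : (1 <= s)%nat.
Hypothesis hN : s = (r * N)%nat.
Let P := periodic_words (cflist x (2 * m)) (cflist y (2 * s)).

Let Hper : cq y (2 * s) = y.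
Proof. destruct hr as (_ & H2 & _). rewrite hN, Nat.mul_assoc. now apply cq_period_mult. Qed.

Let HP : is_word_expansion x P.
Proof. apply quad_expansion_of_period; auto. Qed.

Let Pt n : wnorm (wprefix P (S n)) = (m + s * n)%nat.
Proof.
  unfold P. rewrite wprefix_periodic. unfold wnorm. rewrite length_app, length_wpow, !cflist_length.
  replace (2 * m + n * (2 * s))%nat with (2 * (m + s * n))%nat by lia. apply Nat.div2_double.
Qed.

(** The prefix of index [n + 1] consists of [V] and [n] copies of [W], so its norm is [m + s n]; the
    quotient of two affine sequences tends to the quotient of their slopes. *)
Lemma affine_word_limit (u : nat -> C) (al be : C) : (forall n, u (S n) = RtoC (INR n) * be + al)%C ->
  Clim (fun n => (u n / RtoC (INR (wnorm (wprefix P n))))%C) (be / RtoC (INR s))%C.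
Proof.
  intros Hu. assert (Hs : 1 <= INR s) by (apply (le_INR 1); auto).
  assert (Ns : RtoC (INR s) <> 0) by (apply RtoC_neq; lra).
  pose proof (total_norm_large x B P hB HP (periodic_finite _ _)) as HL.
  apply Clim_perturb with (fun n => RtoC (INR (wnorm (wprefix P n))) * (be / RtoC (INR s)))%C
    (Cmod (al - RtoC (INR m) * (be / RtoC (INR s)))%C); auto.
  - exists 1%nat. intros [|n] Hn; [lia|]. rewrite Pt, Hu, plus_INR, mult_INR, RtoC_plus, RtoC_mult.
    right. f_equal. field. auto.
  - destruct (HL 1) as [n0 H0]. apply Clim_ext_loc with (fun _ => be / RtoC (INR s))%C; [|apply Clim_const].
    exists n0. intros n Hn. specialize (H0 n Hn). field. split; auto. apply RtoC_neq; lra.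
Qed.

(** [Dprod] is multiplicative over periods, so its logarithm is exactly affine in the number of
    periods. *)
Lemma quad_eps_lim : lin_lim (aseq (fun _ => 1) x) (RtoC (INR N / INR s * ln (mdenR stab_gen x))).
Proof.
  destruct stab_gen_fixes as (_ & G1 & G2). assert (Hs : 1 <= INR s) by (apply (le_INR 1); auto).
  assert (Ns : RtoC (INR s) <> 0) by (apply RtoC_neq; lra).
  set (be := RtoC (2 * (INR N * ln (mdenR stab_gen x)))).
  pose proof (words_lim_gen x B P hB HP (periodic_finite _ _) _ (holo_const 1) one_inv
    (fun n => aseq (fun _ => 1) x (2 * wnorm (wprefix P n))) 0 (be / RtoC (INR s))%C) as HW.
  replace (RtoC (INR N / INR s * ln (mdenR stab_gen x))) with (be / RtoC (INR s) / 2)%C.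
  2: { unfold be. replace (INR N / INR s * ln (mdenR stab_gen x)) with (2 * (INR N * ln (mdenR stab_gen x)) / INR s / 2) by (field; lra).
       rewrite !(RtoC_div _ _) by lra. reflexivity. }
  apply HW.
  { intros n. right. rewrite <- Cmod_0. f_equal. ring. }
  apply affine_word_limit with (RtoC (2 * ln (Dprod x (2 * m)))).
  intros n. rewrite Pt, aseq_one by auto. unfold be. rewrite <- RtoC_mult, <- RtoC_plus. f_equal.
  replace (2 * (m + s * n))%nat with (2 * m + 2 * r * (N * n))%nat by (rewrite hN; lia).
  rewrite (Dprod_add x (2 * m)). fold y.
  assert (H2 : cq y (2 * r) = y) by apply hr. rewrite (Dprod_period y (2 * r) (N * n) H2), <- G1.
  pose proof (Dprod_ge_1 x (2 * m) Hx). rewrite ln_mult, ln_pow, mult_INR; try lra. apply pow_lt. lra.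
Qed.

Hypothesis hw : galois_conjugate x w'.
Hypothesis hz : upper_half z.

Lemma quad_integral_lim g : holo g -> (forall A z, SL2Z A -> upper_half z -> g (moebius A z) = g z) ->
  lin_lim (aseq g x) (RtoC (INR N / INR s) * path_integral (ge g (Some w') (Some x)) z (moebius stab_gen z) / 2)%C.
Proof.
  intros hg ginv. destruct stab_gen_fixes as (G1 & _ & _).
  destruct (conjugate_fixed x w' _ Hx hw G1) as [Hw' Ew]. destruct G1 as [HA EA].
  assert (Hs : 1 <= INR s) by (apply (le_INR 1); auto).
  assert (Ns : RtoC (INR s) <> 0) by (apply RtoC_neq; lra).
  set (tau := path_integral _ z _).
  replace (RtoC (INR N / INR s) * tau)%C with (RtoC (INR N) * tau / RtoC (INR s))%C by (rewrite RtoC_div by lra; field; auto).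
  assert (Hne : Some w' <> Some x) by (intros E; injection E as E; now apply (proj1 hw)).
  apply (words_lim x B P hB HP (periodic_finite _ _) g hg ginv (Some w') z); auto.
  (* The prefix matrix [V U^(N n)] equals [stab_gen^(N n) V]: on [z] it acts like a power of the
     generator on the point [V z]. *)
  set (J k := path_integral (ge g (Some w') (Some x)) z (moebius (npow stab_gen k) (moebius V z))).
  assert (UV : upper_half (moebius V z)) by now apply moebius_upper.
  (* As [stab_gen] fixes both poles, [path_integral_transform] leaves the form unchanged, and each
     further power adds [tau]. *)
  assert (HJ : forall k, J k = (RtoC (INR k) * tau + J O)%C).
  { induction k as [|k IH]; [change (INR 0) with 0; ring|].
    rewrite S_INR, RtoC_plus. unfold J at 1. rewrite npow_S.
    pose proof (SL2Z_npow stab_gen k HA) as Hk.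
    rewrite moebius_mul by auto.
    set (p := moebius (npow stab_gen k) (moebius V z)). assert (Up : upper_half p) by now apply moebius_upper.
    rewrite <- (path_integral_chasles _ z (moebius stab_gen z)) by (auto using moebius_upper, holo_ge).
    pose proof (path_integral_transform g hg ginv stab_gen w' x z p HA hz Up (mdenR_nz _ _ Hw' HA) (mdenR_nz _ _ Hx HA)) as ET.
    rewrite Ew, EA in ET. rewrite ET. fold tau. change (path_integral (ge g (Some w') (Some x)) z p) with (J k). rewrite IH. ring. }
  apply affine_word_limit with (J O). intros n.
  transitivity (J (N * n)%nat); [|rewrite HJ, mult_INR, RtoC_mult; ring].
  unfold wint, J. f_equal. unfold gamma_prefix, P. rewrite wprefix_periodic, gamma_app, gamma_wpow.
  assert (EW : gamma (cflist y (2 * s)) = npow U N).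
  { assert (H2 : cq y (2 * r) = y) by apply hr. unfold U. rewrite <- gamma_wpow, <- cflist_period by auto. do 2 f_equal. lia. }
  fold (cfmat x (2 * m)). fold V. rewrite EW.
  assert (HU : SL2Z U) by (apply gamma_SL2Z; rewrite cflist_length; now exists r).
  assert (EN : npow (npow U N) n = npow U (N * n)).
  { clear. induction n as [|n IH]; [now rewrite Nat.mul_0_r|]. rewrite npow_S, IH, <- npow_add. f_equal. lia. }
  rewrite EN, <- moebius_mul by (auto; now apply SL2Z_npow). f_equal.
  rewrite stab_gen_power, <- mat_mul_assoc, mat_mul_adj_l, mat_mul_1_r by auto. reflexivity.
Qed.
End QuadLimit.
End Generator.

(** * The limit values *)

Lemma val_lim_vlim x B z0 v : cf_bound x B -> upper_half z0 -> (val_lim x z0 v <-> vlim jfun x v).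
Proof.
  intros hB Hz0. rewrite val_lim_iff. split.
  - apply (val_vlim jfun holo_jfun jfun_SL2Z x B hB z0 v Hz0).
  - apply (vlim_val jfun holo_jfun jfun_SL2Z x B hB z0 v Hz0).
Qed.

Lemma hval_lim_iff x B W x' z0 v : cf_bound x B -> is_word_expansion x W -> finitely_many_words W ->
  x' <> Some x -> upper_half z0 -> (hval_lim x W x' z0 v <-> lin_lim (aseq jfun x) (v / 2)%C).
Proof.
  intros hB hW hfin Hx' Hz0. unfold hval_lim. rewrite is_Clim_seq_iff.
  exact (words_lim x B W hB hW hfin jfun holo_jfun jfun_SL2Z x' z0 v Hx' Hz0).
Qed.

Lemma path_integral_eta x' x a b : upper_half a -> upper_half b ->
  path_integral (eta x' x) a b = path_integral (ge (fun _ => 1) x' x) a b.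
Proof. intros Ha Hb. apply path_integral_ext; auto. intros z _. unfold ge. ring. Qed.

Lemma hone_seq_eq x B W x' z0 n : cf_bound x B -> is_word_expansion x W -> finitely_many_words W -> upper_half z0 ->
  hone_seq x W x' z0 n = (wint x W (fun _ => 1) x' z0 n / RtoC (INR (wnorm (wprefix W n))))%C.
Proof.
  intros hB hW hfin Hz0. unfold hone_seq, wint. rewrite path_integral_eta; auto.
  apply moebius_upper; auto. rewrite (gamma_prefix_cfmat x B W hB hW hfin). apply cfmat_even.
Qed.

Lemma hone_lim_iff x B W x' z0 v : cf_bound x B -> is_word_expansion x W -> finitely_many_words W ->
  x' <> Some x -> upper_half z0 -> (hone_lim x W x' z0 v <-> lin_lim (aseq (fun _ => 1) x) (v / 2)%C).
Proof.
  intros hB hW hfin Hx' Hz0. unfold hone_lim. rewrite is_Clim_seq_iff.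
  rewrite <- (words_lim x B W hB hW hfin _ (holo_const 1) one_inv x' z0 v Hx' Hz0).
  pose proof (fun n => hone_seq_eq x B W x' z0 n hB hW hfin Hz0) as E.
  split; intros H; (eapply Clim_ext; [|exact H]); intros n; [|symmetry]; apply E.
Qed.

Lemma val_bounded_cf x B z0 : cf_bound x B -> upper_half z0 -> val_bounded x z0.
Proof.
  intros hB Hz0. destruct z0 as [x0 y0]. assert (Hy0 : 0 < y0) by exact Hz0.
  set (D := x - x0). pose proof (Rabs_pos D) as HD.
  assert (HC : 0 <= Rabs D / y0) by (apply Rmult_le_pos; [auto|apply Rlt_le, Rinv_0_lt_compat, Hy0]).
  destruct (cone_bounded jfun holo_jfun jfun_SL2Z x B hB (Rabs D / y0) (Rabs D + y0) HC ltac:(lra)) as [G [HG PG]].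
  exists G. intros z Hz. destruct (geodesic_param _ x z Hz0 Hz) as (s & Hs & ->).
  pose proof (geod_val_bound x0 y0 x s D Hy0 Hs eq_refl jfun G holo_jfun PG) as P.
  pose proof (geod_val_bound x0 y0 x s D Hy0 Hs eq_refl (fun _ => 1) 1 (holo_const 1)) as P1.
  set (z := geod_path _ _ s) in *. set (d := d_hyp (x0, y0) z) in *.
  assert (Hd : 0 <= d).
  { rewrite <- (Rmult_1_l d). eapply Rle_trans; [apply Cmod_ge_0|]. apply P1. intros p _. rewrite Cmod_1. lra. }
  unfold val_fun. fold d. destruct (Req_dec d 0) as [E|E].
  - rewrite E, Cdiv_0_r, Cmod_0. exact HG.
  - rewrite Cmod_div, Cmod_R, Rabs_right by (try (apply RtoC_neq); lra).
    apply Rmult_le_reg_r with d; [lra|]. unfold Rdiv. rewrite Rmult_assoc, Rinv_l, Rmult_1_r by lra. exact P.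
Qed.

Lemma lin_lim_SL2 g x B B' A L : holo g -> (forall A z, SL2Z A -> upper_half z -> g (moebius A z) = g z) ->
  cf_bound x B -> SL2Z A -> cf_bound (moebiusR A x) B' ->
  (lin_lim (aseq g x) L <-> lin_lim (aseq g (moebiusR A x)) L).
Proof.
  intros hg ginv hB hA hB'. destruct (aseq_tail g hg ginv x B B' A hB hA hB') as (m & n & K & HK & H).
  split.
  - now apply (lin_lim_shift _ _ L m n K HK).
  - apply (lin_lim_shift _ _ L n m K HK). intros l. rewrite Cmod_minus_sym. apply H.
Qed.

Lemma badly_approximable_SL2 x A : badly_approximable x -> SL2Z A -> badly_approximable (moebiusR A x).
Proof.
  intros Hx HA. apply badly_approximable_bounded in Hx. destruct Hx as [B HB].
  destruct (moebiusR_equiv A x (proj1 HB) HA) as [Hi He]. apply badly_approximable_bounded.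
  now apply (tail_equiv_bounded x _ B).
Qed.

(** The rate for [g = 1] is real and positive by the golden ratio bound, which permits the
    division. *)
Lemma val_lim_ratio x B z0 p q : cf_bound x B -> upper_half z0 ->
  lin_lim (aseq jfun x) p -> lin_lim (aseq (fun _ => 1) x) q -> val_lim x z0 (p / q)%C.
Proof.
  intros hB Hz0 Hp Hq. apply (val_lim_vlim x B); auto. pose proof hB as [Hx _].
  destruct (lin_lim_one_lower x q Hx Hq) as [H1 H2].
  assert (E : q = RtoC (Re q)) by (apply Ceq_parts; auto). rewrite E in Hq |- *.
  apply (lin_lim_vlim jfun x B); auto using holo_jfun, jfun_SL2Z.
  pose proof golden_gt_1 as Hg. apply ln_increasing in Hg; [|lra]. rewrite ln_1 in Hg. simpl in *. lra.
Qed.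

Lemma quadratic_data_exists x B : cf_bound x B -> real_quadratic x ->
  exists w' A V W N, galois_conjugate x w' /\ is_stab_generator x A /\ quad_expansion x V W /\ is_exponent W N.
Proof.
  intros hB Hq. pose proof Hq as [Hx (a & b & c & Ha & Hr)].
  destruct (lagrange x B hB Hq) as (m & s & Hs & Hp).
  destruct (min_period_exists _ s Hs Hp) as [r Hr'].
  destruct (period_div _ r Hr' s Hp) as [N HN].
  assert (HaR : IZR a <> 0) by now apply not_0_IZR.
  (* The first witness is the other root, by Vieta's formula. *)
  exists (- IZR b / IZR a - x), (stab_gen x m r), (cflist x (2 * m)), (cflist (cq x (2 * m)) (2 * s)), N.
  split; [|split; [|split]].
  - split.
    + intros E. apply (Hx (- b)%Z (2 * a)%Z); [lia|]. rewrite opp_IZR, mult_IZR.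
      apply Rmult_eq_reg_l with 2; [|lra]. replace (2 * x) with (x + x) by ring. rewrite <- E at 1. field. auto.
    + exists a, b, c. split; [auto|]. split; auto. unfold quad_root in *. rewrite <- Hr. field. auto.
  - now apply stab_gen_generates.
  - now apply quad_expansion_of_period.
  - apply (exponent_iff _ r (irrational_cq x (2 * m) Hx) Hr'); auto.
Qed.

(** Any admissible generator is [stab_gen] and any admissible exponent is [s / r], so all choices in
    the definitions of the quadratic values reduce to the least even period. *)
Lemma quadratic_limits x B w' A z V W N : cf_bound x B -> galois_conjugate x w' -> is_stab_generator x A ->
  upper_half z -> quad_expansion x V W -> is_exponent W N ->
  lin_lim (aseq jfun x) (RtoC (INR N / INR (wnorm W)) * tval x w' A z / 2)%C /\
  lin_lim (aseq (fun _ => 1) x) (RtoC (INR N / INR (wnorm W)) * tone x w' A z / 2)%C /\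
  lin_lim (aseq (fun _ => 1) x) (RtoC (INR N / INR (wnorm W) * ln (eps_of A x))) /\
  0 < INR N / INR (wnorm W) /\ 1 < eps_of A x.
Proof.
  intros hB Hw HA Hz HE HN. pose proof hB as [Hx _].
  destruct (quad_expansion_data x V W Hx HE) as (m & s & Hs & EV & EW & Hp).
  destruct (min_period_exists _ s Hs Hp) as [r Hr].
  rewrite EW in HN |- *. apply (exponent_iff _ r (irrational_cq x (2 * m) Hx) Hr s N Hs Hp) in HN.
  unfold wnorm. rewrite cflist_length, Nat.div2_double.
  pose proof (stab_generator_unique x m r Hx Hr A HA) as EA.
  pose proof (proj2 (proj2 (stab_gen_fixes x m r Hx Hr))) as Hep. change (1 < eps_of (stab_gen x m r) x) in Hep.
  subst A. split; [|split; [|split; [|split]]].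
  - exact (quad_integral_lim x m r Hx Hr B w' z s N hB Hs HN Hw Hz jfun holo_jfun jfun_SL2Z).
  - unfold tone. rewrite path_integral_eta; auto; [|apply moebius_upper; auto; apply HA].
    exact (quad_integral_lim x m r Hx Hr B w' z s N hB Hs HN Hw Hz _ (holo_const 1) one_inv).
  - exact (quad_eps_lim x m r Hx Hr B s N hB Hs HN).
  - apply Rdiv_lt_0_compat; apply lt_0_INR; nia.
  - exact Hep.
Qed.

Theorem theorem3p1
  (x : R) (W : nat -> word) (x' : P1R) (z0 : C)
  (hx : badly_approximable x)
  (hW : is_word_expansion x W) (hfin : finitely_many_words W)
  (hx' : x' <> Some x) (hz0 : upper_half z0) :
  (* (1) boundedness *)
  (val_bounded x z0 /\
   Cbounded_seq (hval_seq x W x' z0) /\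
   Cbounded_seq (hone_seq x W x' z0) /\
   (forall L : R, mean_norm W L -> 0 < L ->
      exists M : R, forall n, Rabs (heps_seq W L n) <= M)) /\
  (* (1) independence of the choices *)
  (forall (W1 : nat -> word) (x1' : P1R) (z1 : C),
     is_word_expansion x W1 -> finitely_many_words W1 ->
     x1' <> Some x -> upper_half z1 ->
     (forall v, val_lim x z0 v -> val_lim x z1 v) /\
     (forall v, hval_lim x W x' z0 v -> hval_lim x W1 x1' z1 v) /\
     (forall v, hone_lim x W x' z0 v -> hone_lim x W1 x1' z1 v) /\
     (forall L L1 e, mean_norm W L -> 0 < L -> mean_norm W1 L1 -> 0 < L1 ->
        heps_lim W L e -> heps_lim W1 L1 e)) /\
  (* (1) SL2(Z)-invariance *)
  (forall A : mat2, SL2Z A ->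
     let y := moebiusR A x in
     badly_approximable y /\
     forall (W1 : nat -> word) (x1' : P1R) (z1 : C),
       is_word_expansion y W1 -> finitely_many_words W1 ->
       x1' <> Some y -> upper_half z1 ->
       (forall v, val_lim x z0 v <-> val_lim y z1 v) /\
       (forall v, hval_lim x W x' z0 v <-> hval_lim y W1 x1' z1 v) /\
       (forall v, hone_lim x W x' z0 v <-> hone_lim y W1 x1' z1 v) /\
       (forall L L1 e, mean_norm W L -> 0 < L -> mean_norm W1 L1 -> 0 < L1 ->
          (heps_lim W L e <-> heps_lim W1 L1 e))) /\
  (* (2) real quadratic numbers *)
  (real_quadratic x ->
     ((exists v, is_val_quad x v) /\
      (forall v, is_val_quad x v -> val_lim x z0 v)) /\
     ((exists v, is_hval_quad x v) /\
      (forall v, is_hval_quad x v -> hval_lim x W x' z0 v)) /\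
     ((exists v, is_hone_quad x v) /\
      (forall v, is_hone_quad x v -> hone_lim x W x' z0 v)) /\
     ((exists e, is_heps_quad x e) /\
      (forall e, is_heps_quad x e ->
         forall L : R, mean_norm W L -> 0 < L -> heps_lim W L e))) /\
  (* (3) other endpoints of integration *)
  (forall v o : C, hval_lim x W x' z0 v -> hone_lim x W x' z0 o ->
     forall (x1' : P1R) (xs : nat -> R),
       x1' <> Some x ->
       let zs n := moebius (gamma_prefix W n) (RtoC (xs n) + Ci)%C in
       (forall n, (1 <= n)%nat -> geodesic None (Some (RtoC x)) (zs n)) ->
       is_Clim_seq zs (RtoC x) ->
       is_Clim_seq (fun n => (path_integral (j_eta x1' (Some x)) z0 (zs n)
                              / RtoC (total_norm W n))%C) v /\
       is_Clim_seq (fun n => (path_integral (eta x1' (Some x)) z0 (zs n)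
                              / RtoC (total_norm W n))%C) o) /\
  (* (4) *)
  (forall L : R, mean_norm W L -> 0 < L ->
     ((exists e, heps_lim W L e) <-> (exists o, hone_lim x W x' z0 o)) /\
     (forall e o, heps_lim W L e -> hone_lim x W x' z0 o ->
        o = RtoC (2 * ln e))) /\
  (* (5) *)
  ((forall L e : R, mean_norm W L -> 0 < L -> heps_lim W L e ->
      (3 + sqrt 5) / 2 <= e) /\
   (forall o, hone_lim x W x' z0 o -> Im o = 0 /\ 0 < Re o)) /\
  (* (6) *)
  (forall v o : C, hval_lim x W x' z0 v -> hone_lim x W x' z0 o ->
     val_lim x z0 (v / o)%C).
Proof.
  destruct (cf_bound_exists x hx) as [B hB]. pose proof hB as [Hx _].
  (* The right-hand sides of these four equivalences involve only [hint] and [aseq] at [x], which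
     makes the independence of [x'], [z0] and the words immediate. *)
  pose proof (fun z v => val_lim_vlim x B z v hB) as EV.
  pose proof (fun W x' z v => hval_lim_iff x B W x' z v hB) as EH.
  pose proof (fun W x' z v => hone_lim_iff x B W x' z v hB) as EO.
  pose proof (fun W L hW hf hL => heps_lim_iff x B W L hB hW hf hL) as EE.
  split; [|split; [|split; [|split; [|split; [|split; [|split]]]]]].
  - split; [now apply (val_bounded_cf x B)|]. split; [|split].
    + exact (words_bounded x B W hB hW hfin jfun holo_jfun jfun_SL2Z x' z0 hx' hz0).
    + destruct (words_bounded x B W hB hW hfin _ (holo_const 1) one_inv x' z0 hx' hz0) as [M HM].
      exists M. intros n. rewrite (hone_seq_eq x B); auto.
    + intros L _ HL. exact (heps_bounded x B W L hB hW hfin HL).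
  - intros W1 x1' z1 hW1 hf1 hx1 hz1. split; [|split; [|split]].
    + intros v. rewrite !EV by auto. easy.
    + intros v. rewrite !EH by auto. easy.
    + intros v. rewrite !EO by auto. easy.
    + intros L L1 e hm hL hm1 hL1. rewrite !EE by auto. easy.
  - intros A HA y. assert (Hy : badly_approximable y) by now apply badly_approximable_SL2.
    split; auto. destruct (cf_bound_exists y Hy) as [B' hB'].
    intros W1 x1' z1 hW1 hf1 hx1 hz1. split; [|split; [|split]].
    + intros v. rewrite EV, (val_lim_vlim y B') by auto. exact (vlim_SL2 jfun holo_jfun jfun_SL2Z x B B' A hB HA hB' v).
    + intros v. rewrite EH, (hval_lim_iff y B') by auto. exact (lin_lim_SL2 jfun x B B' A _ holo_jfun jfun_SL2Z hB HA hB').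
    + intros v. rewrite EO, (hone_lim_iff y B') by auto. exact (lin_lim_SL2 _ x B B' A _ (holo_const 1) one_inv hB HA hB').
    + intros L L1 e hm hL hm1 hL1. rewrite EE, (heps_lim_iff y B') by auto.
      rewrite (lin_lim_SL2 _ x B B' A _ (holo_const 1) one_inv hB HA hB'). easy.
  - intros Hq. destruct (quadratic_data_exists x B hB Hq) as (w0 & A0 & V0 & W0 & N0 & D1 & D2 & D3 & D4).
    split; [|split; [|split]]; (split; [unfold is_val_quad, is_hval_quad, is_hone_quad, is_heps_quad; eauto 15|]).
    (* [is_val_quad] mentions no word, so the period [V0], [W0], [N0] is brought in; its factor [c]
       cancels in the quotient. *)
    + intros v (w' & A & z & H1 & H2 & H3 & ->).
      destruct (quadratic_limits x B w' A z V0 W0 N0 hB H1 H2 H3 D3 D4) as (L1 & L2 & _ & Hc & _).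
      set (c := INR N0 / INR (wnorm W0)) in *.
      pose proof (val_lim_ratio x B z0 _ _ hB hz0 L1 L2) as HV.
      destruct (lin_lim_one_lower x _ Hx L2) as [_ Hpos].
      assert (Nc : RtoC c <> 0) by (apply RtoC_neq; lra).
      assert (Nt : tone x w' A z <> 0).
      { intros E. rewrite E in Hpos. replace (RtoC c * 0 / 2)%C with (RtoC 0) in Hpos by field.
        pose proof golden_gt_1 as Hg. apply ln_increasing in Hg; [|lra]. rewrite ln_1 in Hg. simpl in *. lra. }
      replace (tval x w' A z / tone x w' A z)%C with ((RtoC c * tval x w' A z / 2) / (RtoC c * tone x w' A z / 2))%C; auto.
      field. auto.
    + intros v (w' & A & z & V & W2 & N & H1 & H2 & H3 & H4 & H5 & ->). apply EH; auto.
      now apply (quadratic_limits x B w' A z V W2 N).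
    + intros v (w' & A & z & V & W2 & N & H1 & H2 & H3 & H4 & H5 & ->). apply EO; auto.
      now apply (quadratic_limits x B w' A z V W2 N).
    + intros e (A & V & W2 & N & H2 & H4 & H5 & ->) L hm hL. apply EE; auto.
      (* [is_heps_quad] involves no integral; [Ci] serves as an arbitrary base point for
         [quadratic_limits]. *)
      assert (Hi : upper_half Ci) by (unfold upper_half; simpl; lra).
      destruct (quadratic_limits x B w0 A Ci V W2 N hB D1 H2 Hi H4 H5) as (_ & _ & L3 & _ & He).
      split; [apply exp_pos|]. unfold Rpower. now rewrite ln_exp.
  - intros v o Hv Ho x1' xs hx1 zs Hz _. unfold hval_lim in Hv. unfold hone_lim in Ho.
    rewrite is_Clim_seq_iff in Hv, Ho. rewrite !is_Clim_seq_iff.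
    assert (Hre : forall n, (1 <= n)%nat -> Re (zs n) = x) by (intros n Hn; apply (Hz n Hn)).
    split.
    + exact (words_lim_points x B W hB hW hfin jfun holo_jfun jfun_SL2Z x' x1' z0 zs xs v hx' hx1 hz0 (fun n => eq_refl) Hre Hv).
    + assert (Ho' : Clim (fun n => (wint x W (fun _ => 1) x' z0 n / RtoC (INR (wnorm (wprefix W n))))%C) o).
      { eapply Clim_ext; [|exact Ho]. intros n. now apply (hone_seq_eq x B). }
      eapply Clim_ext; [|exact (words_lim_points x B W hB hW hfin _ (holo_const 1) one_inv x' x1' z0 zs xs o hx' hx1 hz0 (fun n => eq_refl) Hre Ho')].
      intros n. cbv beta. rewrite path_integral_eta; auto. unfold zs. apply moebius_upper.
      * rewrite (gamma_prefix_cfmat x B W hB hW hfin). apply cfmat_even.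
      * unfold upper_half; simpl; lra.
  - intros L hm hL. split; [split|].
    + intros [e He]. apply EE in He; auto. exists (RtoC (2 * ln e)). apply EO; auto.
      replace (RtoC (2 * ln e) / 2)%C with (RtoC (ln e)) by (rewrite RtoC_mult; field). apply He.
    (* [o / 2] is real, so its exponential is a candidate for the limit of [heps_seq]. *)
    + intros [o Ho]. apply EO in Ho; auto. destruct (lin_lim_one_lower x _ Hx Ho) as [H1 _].
      exists (exp (Re (o / 2)%C)). apply EE; auto. split; [apply exp_pos|]. rewrite ln_exp.
      replace (RtoC (Re (o / 2)%C)) with (o / 2)%C; auto. apply Ceq_parts; auto.
    + intros e o He Ho. apply EE in He; auto. apply EO in Ho; auto. destruct He as [_ He].
      pose proof (lin_lim_unique _ _ _ He Ho) as E. rewrite RtoC_mult, E. field.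
  - split.
    + intros L e hm hL He. apply EE in He; auto. destruct He as [He0 He].
      destruct (lin_lim_one_lower x _ Hx He) as [_ H2]. rewrite <- exp_2_ln_golden, <- (exp_ln e) by auto.
      simpl in H2. destruct H2 as [H2|H2]; [left; now apply exp_increasing|right; now rewrite H2].
    + intros o Ho. apply EO in Ho; auto. destruct (lin_lim_one_lower x _ Hx Ho) as [H1 H2].
      pose proof golden_gt_1 as Hg. apply ln_increasing in Hg; [|lra]. rewrite ln_1 in Hg.
      assert (E : o = (RtoC 2 * (o / 2))%C) by field. rewrite E. set (h := (o / 2)%C) in *.
      split.
      * replace (Im (RtoC 2 * h)%C) with (2 * Im h) by (simpl; ring). lra.
      * replace (Re (RtoC 2 * h)%C) with (2 * Re h) by (simpl; ring). lra.
  - intros v o Hv Ho. apply EH in Hv; auto. apply EO in Ho; auto.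
    pose proof (val_lim_ratio x B z0 _ _ hB hz0 Hv Ho) as H.
    destruct (lin_lim_one_lower x _ Hx Ho) as [H1 H2].
    assert (No : o <> 0).
    { intros E. rewrite E in H2. replace (0 / 2)%C with (RtoC 0) in H2 by field.
      pose proof golden_gt_1 as Hg. apply ln_increasing in Hg; [|lra]. rewrite ln_1 in Hg. simpl in *. lra. }
    replace (v / o)%C with ((v / 2) / (o / 2))%C; auto. field. auto.
Qed.
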